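(* Let $M$ be the Verma module over ${}_RU$ of highest weight $Tv^{-1}$, let $\Psi:(M_\pi)^{sT'_{-1}}\to M$ be an isomorphism of ${}_RU$-modules, let $m,n\ge 0$ be integers, and let $\beta:{}_R\mathcal F_m\otimes_R{}_R\mathcal F_n^{\rho_1}\to {}_RU$ be a homomorphism of the form $$\beta=\sum_{k}r_k\,\beta^{m,n}_{2k},\qquad r_k\in R,$$ the sum being over integers $k$ with $|m-n|\le 2k\le m+n$ and $2k\equiv m+n \pmod 2$. Put $s\beta=\sum_k s(r_k)\beta^{m,n}_{2k}$. If $\phi$ is an invariant form on $M$ satisfying $$s\circ\phi_\pi\circ L=\phi\circ(\Psi\otimes\Psi),$$ that is, $s\big(\sum_{j\ge0}(-1)^jv^{-j(j-1)/2}\{j\}\,\phi_\pi(F^{(j)}a,\rho_1(E^{(j)})b)\big)=\phi(\Psi(a),\Psi(b))$ for all $a,b\in M_\pi$, then $$\chi_{\beta,\phi}^{\sharp}=\chi_{s\beta,\phi},$$ where $\chi_{\beta,\phi}$ is the invariant pairing of $M\otimes\mathcal F_m$ and $M\otimes\mathcal F_n$ given by $\chi_{\beta,\phi}(x\otimes e,y\otimes f)=\phi\big(x,\rho_1(\beta(e\otimes f))y\big)$.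
   Context: **Algebras.** $k$ is a field of characteristic $0$, $v$ an indeterminate. $U$ is the $k(v)$-algebra generated by $E,F,K^{\pm1}$ with $[E,F]=\frac{K-K^{-1}}{v-v^{-1}}$, $KEK^{-1}=v^2E$, $KFK^{-1}=v^{-2}F$, $KK^{-1}=K^{-1}K=1$; coproduct $\Delta(E)=E\otimes1+K\otimes E$, $\Delta(F)=F\otimes K^{-1}+1\otimes F$, $\Delta(K)=K\otimes K$; antipode $S(E)=-K^{-1}E$, $S(F)=-FK$, $S(K)=K^{-1}$. $U$ and ${}_RU$ are modules over themselves under the adjoint action $\mathrm{ad}(x)y=\sum x_{(1)}yS(x_{(2)})$. $R=k(v)[[T-1]]$, $s$ is the (continuous) $k(v)$-algebra involution of $R$ with $s(T)=T^{-1}$, ${}_RU=R\otimes_{k(v)}U$; a left subscript $R$ denotes extension of scalars to $R$. Put $[n]=\frac{v^n-v^{-n}}{v-v^{-1}}$, $[n]!=[1]\cdots[n]$, $E^{(n)}=E^n/[n]!$, $F^{(n)}=F^n/[n]!$, $\{n\}=\prod_{a=1}^n(v^a-v^{-a})$, $\{0\}=1$, $[T;\lambda]=\frac{v^\lambda T-v^{-\lambda}T^{-1}}{v-v^{-1}}$. A vector has weight $Tv^\lambda$ if $K$ acts on it by $Tv^\lambda$. **(Anti)automorphisms.** $\rho_1$ is the automorphism of $U$ with $\rho_1(E)=-vF$, $\rho_1(F)=-v^{-1}E$, $\rho_1(K)=K^{-1}$; $\varrho$ is the anti-automorphism with $\varrho(E)=vKF$, $\varrho(F)=vK^{-1}E$,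 $\varrho(K)=K$; $T'_{-1}$ is the automorphism with $T'_{-1}(E)=-K^{-1}F$, $T'_{-1}(F)=-EK$, $T'_{-1}(K)=K^{-1}$. For a module $A$ and automorphism $\theta$ of $U$, $A^\theta$ is $A$ with $x$ acting by $\theta(x)$; $A^{s\theta}$ is $A$ with $r\otimes x$ ($r\in R$, $x\in U$) acting as $s(r)\otimes\theta(x)$. On a finite dimensional module, for $e$ with $Ke=v^ne$, $T''_1(e)=\sum_{-a+b-c=n}(-1)^bv^{-ac+b}E^{(a)}F^{(b)}E^{(c)}e$. **Invariant pairings and localization.** An invariant pairing of ${}_RU$-modules $A,B$ is an $R$-bilinear map $\chi:A\times B\to R$ with $\chi(xa,b)=\chi(a,\varrho(x)b)$ for $x\in U$; an invariant form on $A$ is the case $B=A$. If $F$ acts injectively on $A$, $A_F$ is the localization with respect to powers of $F$, $A\subset A_F$, $A_\pi=A_F/A$. For finite dimensional $\mathcal E$, $(M\otimes\mathcal E)_F=M_F\otimes\mathcal E$ and $(M\otimes\mathcal E)_\pi=M_\pi\otimes\mathcal E$. For $A=M\otimes\mathcal E$, $B=M\otimes\mathcal E'$ (with $\mathcal E,\mathcal E'$ finite dimensional, possibly trivial), an invariant pairing $\chi$ on $A\times B$ has a unique lift to an invariant pairing $\chi_F$ on $A_F\times B_F$ which vanishes on $A\times B_F$ and $A_F\times B$ and satisfies $\chi_F(F^{-1}a,F^{-1}b)=v^{\lambda}\frac{[T;0]}{[T;\lambda]}\chi(a,b)$ whenever $a\in A$, $b\in B$ have weight $Tv^{\lambda-1}$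 ($\lambda\in\mathbb Z$) and $Ea=0=Eb$. It induces a pairing $\chi_\pi$ on $A_\pi\times B_\pi$. **The operation $\sharp$.** For $\mathcal E$ finite dimensional define the bijection $\bar\Psi:M_\pi\otimes\mathcal E\to M\otimes\mathcal E$ by $\bar\Psi(rx\otimes e)=s(r)\sum_{j\ge0}v^{j(j-1)/2}\{j\}\,\Psi(F^{(j)}x)\otimes T''_1(E^{(j)}e)$ for $r\in R$, $x\in M_\pi$, $e\in\mathcal E$. For an invariant pairing $\chi$ of $M\otimes\mathcal E$ and $M\otimes\mathcal E'$, $\chi^\sharp$ is the invariant pairing of the same modules defined by $$\chi^\sharp(\bar\Psi(a),\bar\Psi(b))=s\Big(\sum_{j\ge0}(-1)^jv^{-j(j-1)/2}\{j\}\,\chi_\pi\big(F^{(j)}a,\rho_1(E^{(j)})b\big)\Big),\quad a\in M_\pi\otimes\mathcal E,\ b\in M_\pi\otimes\mathcal E'.$$ **The maps $\beta^{m,n}_{2r}$.** $\mathcal F_m$ is the irreducible $U$-module with highest weight vector $u^{(m)}$ of weight $v^m$, and $u^{(m)}_k=F^{(k)}u^{(m)}$, $0\le k\le m$. $\mathcal F_m\otimes\mathcal F_n^{\rho_1}$ is the direct sum of irreducible modules of highest weights $v^{m+n-2q}$, $0\le q\le\min\{m,n\}$, generated by the highest weight vectors $$u^{(m+n-2q)}=\sum_{k=0}^{q}(-1)^{n-q}\frac{[n-q+k]!\,[m-k]!}{[n-q]!\,[m]!}\,v^{(k-q)(2+m)+q^2-k^2+n}\,u_k^{(m)}\otimes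 u_{n-q+k}^{(n)}.$$ For $m+n$ even and an integer $r$ with $|m-n|\le2r\le m+n$, $\beta^{m,n}_{2r}:\mathcal F_m\otimes\mathcal F_n^{\rho_1}\to U$ is the $U$-module homomorphism (adjoint action on $U$) with $\beta^{m,n}_{2r}(u^{(m+n-2q)})=E^{(r)}K^{-r}$ if $2r=m+n-2q$ and $0$ otherwise. *)

(* Defs.v *)
From HB Require Import structures.
From mathcomp Require Import all_boot all_order all_algebra.
From mathcomp Require Import ring.
From mathcomp Require Import boolp classical_sets functions cardinality fsbigop.

Set Implicit Arguments.
Unset Strict Implicit.
Unset Printing Implicit Defensive.

Import GRing.Theory.
Local Open Scope ring_scope.

Record fps (F : Type) := FPS { fcoef : nat -> F }.

HB.instance Definition _ (F : Type) := gen_eqMixin (fps F).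
HB.instance Definition _ (F : Type) := gen_choiceMixin (fps F).

Section PowerSeries.
Variable F : fieldType.
Implicit Types f g h : fps F.

Lemma fpsP f g : (forall n, fcoef f n = fcoef g n) -> f = g.
Proof. by case: f g => [f] [g] /= /funext ->. Qed.

Definition fps_add f g := FPS (fun n => fcoef f n + fcoef g n).
Definition fps_opp f := FPS (fun n => - fcoef f n).
Definition fpsC (c : F) : fps F := FPS (fun n => if n is 0 then c else 0).
Definition fps_mul f g :=
  FPS (fun n => \sum_(i < n.+1) fcoef f i * fcoef g (n - i)).

Fact fps_addA : associative fps_add.
Proof. by move=> f g h; apply: fpsP => n /=; rewrite addrA. Qed.
Fact fps_addC : commutative fps_add.
Proof. by move=> f g; apply: fpsP => n /=; rewrite addrC. Qed.
Fact fps_add0 : left_id (fpsC 0) fps_add.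
Proof. by move=> f; apply: fpsP => -[|n] /=; rewrite add0r. Qed.
Fact fps_addN : left_inverse (fpsC 0) fps_opp fps_add.
Proof. by move=> f; apply: fpsP => -[|n] /=; rewrite addNr. Qed.

HB.instance Definition _ :=
  GRing.isZmodule.Build (fps F) fps_addA fps_addC fps_add0 fps_addN.

Let trunc N f : {poly F} := \poly_(i < N.+1) fcoef f i.

Let fps_mulE f g n : fcoef (fps_mul f g) n = (trunc n f * trunc n g)`_n.
Proof.
rewrite coefM; apply: eq_bigr => i _.
by rewrite !coef_poly ltn_ord ltnS leq_subr.
Qed.

Fact fps_mulC : commutative fps_mul.
Proof. by move=> f g; apply: fpsP => n; rewrite !fps_mulE mulrC. Qed.

Let truncM n f g i : (i <= n)%N ->
  (trunc n (fps_mul f g))`_i = (trunc n f * trunc n g)`_i.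
Proof.
move=> lein; rewrite coef_poly ltnS lein coefM; apply: eq_bigr => j _.
have leji : (j <= i)%N by rewrite -ltnS.
rewrite !coef_poly !ltnS (leq_trans leji lein).
by rewrite (leq_trans (leq_subr j i) lein).
Qed.

Fact fps_mulA : associative fps_mul.
Proof.
move=> f g h; apply: fpsP => n; rewrite !fps_mulE.
have -> : (trunc n f * trunc n (fps_mul g h))`_n =
          (trunc n f * (trunc n g * trunc n h))`_n.
  rewrite !coefM; apply: eq_bigr => i _.
  by rewrite truncM ?leq_subr.
rewrite mulrA [in RHS]coefM [in LHS]coefM; apply: eq_bigr => i _.
by rewrite truncM // -ltnS.
Qed.

Fact fps_mul1 : left_id (fpsC 1) fps_mul.
Proof.
move=> f; apply: fpsP => n /=; rewrite big_ord_recl /= mul1r subn0.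
by rewrite big1 ?addr0 // => i _; rewrite mul0r.
Qed.

Fact fps_mulDl : left_distributive fps_mul fps_add.
Proof.
move=> f g h; apply: fpsP => n /=; rewrite -big_split; apply: eq_bigr => i _.
by rewrite mulrDl.
Qed.

Fact fps_1neq0 : fpsC 1 != fpsC 0.
Proof. by apply/eqP => /(congr1 (fun f => fcoef f 0)) /eqP; rewrite oner_eq0. Qed.

HB.instance Definition _ := GRing.Zmodule_isComNzRing.Build (fps F)
  fps_mulA fps_mulC fps_mul1 fps_mulDl fps_1neq0.

Definition fps_unit : {pred fps F} := [pred f | `[< exists g, g * f = 1 >]].
Definition fps_inv f := xget f [set g | g * f = 1]%classic.

Fact fps_mulV : {in fps_unit, left_inverse 1 fps_inv *%R}.
Proof.
move=> f /asboolP [g gf]; rewrite /fps_inv; case: xgetP => [h _ //|].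
by move=> /(_ g).
Qed.
Fact fps_unitPl f g : g * f = 1 -> fps_unit f.
Proof. by move=> gf; apply/asboolP; exists g. Qed.
Fact fps_inv_out : {in [predC fps_unit], fps_inv =1 id}.
Proof.
move=> f; rewrite inE /= => /asboolP nf; rewrite /fps_inv.
by case: xgetP => // g _ gf; case: nf; exists g.
Qed.

HB.instance Definition _ := GRing.ComNzRing_hasMulInverse.Build (fps F)
  fps_mulV fps_unitPl fps_inv_out.

Fact fpsC_is_zmod_morphism : zmod_morphism fpsC.
Proof. by move=> a b; apply: fpsP => -[|n] //=; rewrite subr0. Qed.
Fact fpsC_is_monoid_morphism : monoid_morphism fpsC.
Proof.
split=> // a b; apply: fpsP => -[|n] /=; rewrite big_ord_recl /=.
  by rewrite big_ord0 addr0.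
by rewrite mulr0 add0r big1 // => i _; rewrite mul0r.
Qed.
HB.instance Definition _ :=
  GRing.isZmodMorphism.Build F (fps F) fpsC fpsC_is_zmod_morphism.
HB.instance Definition _ :=
  GRing.isMonoidMorphism.Build F (fps F) fpsC fpsC_is_monoid_morphism.

(* [fps F] is F[[T - 1]]: a series is the sequence of its coefficients on the
   powers of T - 1. *)
Definition fpsT : fps F := FPS (fun n => if (n <= 1)%N then 1 else 0).

Lemma fpsT_unit : fpsT \is a GRing.unit.
Proof.
apply/asboolP; exists (FPS (fun n => (-1) ^+ n)); apply: fpsP => -[|n].
  by rewrite /= big_ord_recl big_ord0 /= expr0 mulr1 addr0.
rewrite /= big_ord_recr big_ord_recr /= big1 => [|i _]; last first.
  by rewrite leqNgt ltn_subRL addn1 ltnS ltn_ord mulr0.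
by rewrite subnn subSn // subnn /= !mulr1 exprS mulN1r add0r addrN.
Qed.

(* The substitution of T^-1 for T, that is of T^-1 - 1 for T - 1; the sum is
   finite since (T^-1 - 1)^i is divisible by (T - 1)^i. *)
Definition fps_s f : fps F :=
  FPS (fun n => \sum_(i < n.+1) fcoef f i * fcoef ((fpsT^-1 - 1) ^+ i) n).

Lemma fps_sC c : fps_s (fpsC c) = fpsC c.
Proof.
apply: fpsP => n; rewrite /= big_ord_recl /= big1 => [|i _]; last first.
  by rewrite mul0r.
by case: n => [|n] /=; rewrite ?mulr1 ?mulr0 addr0.
Qed.

Lemma fps_sT : fps_s fpsT = fpsT^-1.
Proof.
have w0 : fcoef (fpsT^-1) 0 = 1.
  have := congr1 (fun f => fcoef f 0) (mulVr fpsT_unit).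
  by rewrite /= big_ord_recl big_ord0 /= mulr1 addr0.
apply: fpsP => -[|n] /=.
  by rewrite big_ord_recl big_ord0 /= mulr1 addr0.
rewrite big_ord_recl big_ord_recl big1 /= => [|i _]; last by rewrite mul0r.
by rewrite mulr0 mul1r add0r addr0 /= subr0.
Qed.

End PowerSeries.

(* The parameter v over a base ring S; S is k(v), or k(v)[[T - 1]]. *)
Record qparam (S : comUnitRingType) := QParam {
  qv :> S;
  qv_unit : qv \is a GRing.unit;
  qvB_unit : qv - qv^-1 \is a GRing.unit
}.

Inductive uterm (S : Type) :=
  UE | UF | UK | UKi | UC of S | UAdd of uterm S & uterm S
| UMul of uterm S & uterm S.
Arguments UE {S}. Arguments UF {S}. Arguments UK {S}. Arguments UKi {S}.

HB.instance Definition _ (S : Type) := gen_eqMixin (uterm S).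
HB.instance Definition _ (S : Type) := gen_choiceMixin (uterm S).

(* The congruence on noncommutative expressions in E, F, K, K^-1 generated by
   the axioms of S-algebras and the defining relations of U. *)
Inductive ueq (S : comUnitRingType) (v : S) : uterm S -> uterm S -> Prop :=
| ueq_refl x : ueq v x x
| ueq_sym x y : ueq v x y -> ueq v y x
| ueq_trans x y z : ueq v x y -> ueq v y z -> ueq v x z
| ueq_add x x' y y' : ueq v x x' -> ueq v y y' ->
    ueq v (UAdd x y) (UAdd x' y')
| ueq_mul x x' y y' : ueq v x x' -> ueq v y y' ->
    ueq v (UMul x y) (UMul x' y')
| ueq_addA x y z : ueq v (UAdd x (UAdd y z)) (UAdd (UAdd x y) z)
| ueq_addC x y : ueq v (UAdd x y) (UAdd y x)
| ueq_add0 x : ueq v (UAdd (UC 0) x) x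
| ueq_addN x : ueq v (UAdd (UMul (UC (-1)) x) x) (UC 0)
| ueq_mulA x y z : ueq v (UMul x (UMul y z)) (UMul (UMul x y) z)
| ueq_mul1 x : ueq v (UMul (UC 1) x) x
| ueq_mulDl x y z : ueq v (UMul (UAdd x y) z) (UAdd (UMul x z) (UMul y z))
| ueq_mulDr x y z : ueq v (UMul x (UAdd y z)) (UAdd (UMul x y) (UMul x z))
| ueq_CD a b : ueq v (UC (a + b)) (UAdd (UC a) (UC b))
| ueq_CM a b : ueq v (UC (a * b)) (UMul (UC a) (UC b))
| ueq_Cc a x : ueq v (UMul (UC a) x) (UMul x (UC a))
| ueq_KKi : ueq v (UMul UK UKi) (UC 1)
| ueq_KiK : ueq v (UMul UKi UK) (UC 1)
| ueq_KE : ueq v (UMul (UMul UK UE) UKi) (UMul (UC (v ^+ 2)) UE)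
| ueq_KF : ueq v (UMul (UMul UK UF) UKi) (UMul (UC (v ^- 2)) UF)
| ueq_EF : ueq v (UAdd (UMul UE UF) (UMul (UC (-1)) (UMul UF UE)))
    (UMul (UC (v - v^-1)^-1) (UAdd UK (UMul (UC (-1)) UKi))).

Section Ueval.
Variables (S : comUnitRingType) (v : S) (B : nzRingType).
Variables (c : S -> B) (e f k ki : B).

Fixpoint ueval (t : uterm S) : B :=
  match t with
  | UE => e | UF => f | UK => k | UKi => ki | UC a => c a
  | UAdd x y => ueval x + ueval y
  | UMul x y => ueval x * ueval y
  end.

Record urels : Prop := Urels {
  urC : zmod_morphism c;
  urCM : monoid_morphism c;
  urCc : forall a x, c a * x = x * c a;
  urKKi : k * ki = 1;
  urKiK : ki * k = 1;
  urKE : k * e * ki = c (v ^+ 2) * e;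
  urKF : k * f * ki = c (v ^- 2) * f;
  urEF : e * f - f * e = c (v - v^-1)^-1 * (k - ki)
}.

Lemma ueval_sound : urels -> forall x y, ueq v x y -> ueval x = ueval y.
Proof.
move=> [cB [c1 cM] cc kki kik ke kf ef].
have c0 : c 0 = 0 by rewrite -[0 in LHS](subrr 0) cB subrr.
have cN a : c (- a) = - c a by rewrite -[- a]sub0r cB c0 sub0r.
have cD a b : c (a + b) = c a + c b by rewrite -{1}[b]opprK cB cN opprK.
move=> x y; elim=> {x y} //=; try by move=> *; congruence.

- by move=> x y z; rewrite addrA.
- by move=> x y; rewrite addrC.
- by move=> x; rewrite c0 add0r.
- by move=> x; rewrite cN c1 mulN1r addNr c0.
- by move=> x y z; rewrite mulrA.
- by move=> x; rewrite c1 mul1r.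
- by move=> x y z; rewrite mulrDl.
- by move=> x y z; rewrite mulrDr.
- by rewrite cN c1 !mulN1r.
Qed.

End Ueval.

Section Uq.
Variables (S : comUnitRingType) (v : qparam S).

Let ueqb (x y : uterm S) : bool := `[< ueq v x y >].
Let ueqb_refl : reflexive ueqb.
Proof. by move=> x; apply/asboolP; exact: ueq_refl. Qed.
Let ueqb_sym : symmetric ueqb.
Proof.
by move=> x y; apply/asboolP/asboolP; exact: ueq_sym.
Qed.
Let ueqb_trans : transitive ueqb.
Proof.
move=> y x z /asboolP xy /asboolP yz; apply/asboolP.
exact: ueq_trans xy yz.
Qed.
Definition ueq_equiv : equiv_rel (uterm S) :=
  EquivRel ueqb ueqb_refl ueqb_sym ueqb_trans.

Definition Uq : Type := {eq_quot ueq_equiv}%qT.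
HB.instance Definition _ := Choice.on Uq.
HB.instance Definition _ : EqQuotient _ ueq_equiv Uq := EqQuotient.on Uq.

Local Notation pi := (\pi_Uq)%qT.

Lemma Uq_eqP x y : reflect (ueq v x y) (pi x == pi y).
Proof. by rewrite eqmodE; exact: asboolP. Qed.

Lemma Uq_eq x y : ueq v x y -> pi x = pi y.
Proof. by move/Uq_eqP/eqP. Qed.

Lemma Uq_repr x : ueq v (repr (pi x)) x.
Proof. by apply/Uq_eqP; rewrite reprK. Qed.

Lemma Uq_ind (P : Uq -> Prop) : (forall x, P (pi x)) -> forall x, P x.
Proof. by move=> Pp x; rewrite -[x]reprK. Qed.

Definition Uq_add (x y : Uq) : Uq := pi (UAdd (repr x) (repr y)).
Definition Uq_mul (x y : Uq) : Uq := pi (UMul (repr x) (repr y)).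
Definition UqC (a : S) : Uq := pi (UC a).
Definition Uq_opp (x : Uq) : Uq := Uq_mul (UqC (-1)) x.
Definition Uq_scale (a : S) (x : Uq) : Uq := Uq_mul (UqC a) x.

Lemma Uq_addE x y : Uq_add (pi x) (pi y) = pi (UAdd x y).
Proof. by apply: Uq_eq; apply: ueq_add; exact: Uq_repr. Qed.
Lemma Uq_mulE x y : Uq_mul (pi x) (pi y) = pi (UMul x y).
Proof. by apply: Uq_eq; apply: ueq_mul; exact: Uq_repr. Qed.

Fact Uq_addA : associative Uq_add.
Proof.
elim/Uq_ind=> x; elim/Uq_ind=> y; elim/Uq_ind=> z.
by rewrite !Uq_addE; apply: Uq_eq; exact: ueq_addA.
Qed.
Fact Uq_addC : commutative Uq_add.
Proof.
elim/Uq_ind=> x; elim/Uq_ind=> y.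
by rewrite !Uq_addE; apply: Uq_eq; exact: ueq_addC.
Qed.
Fact Uq_add0 : left_id (UqC 0) Uq_add.
Proof. elim/Uq_ind=> x; rewrite Uq_addE; apply: Uq_eq; exact: ueq_add0. Qed.
Fact Uq_addN : left_inverse (UqC 0) Uq_opp Uq_add.
Proof.
elim/Uq_ind=> x; rewrite /Uq_opp Uq_mulE Uq_addE.
by apply: Uq_eq; exact: ueq_addN.
Qed.
HB.instance Definition _ :=
  GRing.isZmodule.Build Uq Uq_addA Uq_addC Uq_add0 Uq_addN.

Fact Uq_mulA : associative Uq_mul.
Proof.
elim/Uq_ind=> x; elim/Uq_ind=> y; elim/Uq_ind=> z.
by rewrite !Uq_mulE; apply: Uq_eq; exact: ueq_mulA.
Qed.
Fact Uq_mul1l : left_id (UqC 1) Uq_mul.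
Proof. elim/Uq_ind=> x; rewrite Uq_mulE; apply: Uq_eq; exact: ueq_mul1. Qed.
Fact Uq_Cc a x : Uq_mul (UqC a) x = Uq_mul x (UqC a).
Proof.
by elim/Uq_ind: x => x; rewrite !Uq_mulE; apply: Uq_eq; exact: ueq_Cc.
Qed.
Fact Uq_mul1r : right_id (UqC 1) Uq_mul.
Proof. by move=> x; rewrite -Uq_Cc Uq_mul1l. Qed.
Fact Uq_mulDl : left_distributive Uq_mul +%R.
Proof.
elim/Uq_ind=> x; elim/Uq_ind=> y; elim/Uq_ind=> z.
by rewrite /+%R /= !(Uq_mulE, Uq_addE); apply: Uq_eq; exact: ueq_mulDl.
Qed.
Fact Uq_mulDr : right_distributive Uq_mul +%R.
Proof.
elim/Uq_ind=> x; elim/Uq_ind=> y; elim/Uq_ind=> z.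
by rewrite /+%R /= !(Uq_mulE, Uq_addE); apply: Uq_eq; exact: ueq_mulDr.
Qed.
Fact Uq_1neq0 : UqC 1 != 0.
Proof.
apply/negP => /Uq_eqP eq10; have/eqP := oner_neq0 S; apply.
suff rel : @urels S v S idfun 0 0 1 1 by exact: (ueval_sound rel eq10).
by split=> //; rewrite ?(mulr0, mulr1, mul0r, subrr)// => a x; rewrite mulrC.
Qed.
HB.instance Definition _ := GRing.Zmodule_isNzRing.Build Uq
  Uq_mulA Uq_mul1l Uq_mul1r Uq_mulDl Uq_mulDr Uq_1neq0.

Lemma UqCM a b : UqC (a * b) = UqC a * UqC b.
Proof. by rewrite /*%R /= Uq_mulE; apply: Uq_eq; exact: ueq_CM. Qed.
Lemma UqCD a b : UqC (a + b) = UqC a + UqC b.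
Proof. by rewrite [RHS]Uq_addE; apply: Uq_eq; exact: ueq_CD. Qed.

Fact Uq_scalerA a b x : Uq_scale a (Uq_scale b x) = Uq_scale (a * b) x.
Proof. by rewrite /Uq_scale UqCM; exact: mulrA. Qed.
Fact Uq_scale1r : left_id 1 Uq_scale.
Proof. exact: Uq_mul1l. Qed.
Fact Uq_scalerDr : right_distributive Uq_scale +%R.
Proof. by move=> a; exact: Uq_mulDr. Qed.
Fact Uq_scalerDl x : {morph Uq_scale^~ x : a b / a + b}.
Proof. by move=> a b; rewrite /Uq_scale UqCD; exact: mulrDl. Qed.
HB.instance Definition _ := GRing.Zmodule_isLmodule.Build S Uq
  Uq_scalerA Uq_scale1r Uq_scalerDr Uq_scalerDl.
Fact Uq_scalerAl (a : S) (x y : Uq) : a *: (x * y) = (a *: x) * y.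
Proof. exact: Uq_mulA. Qed.
HB.instance Definition _ := GRing.Lmodule_isLalgebra.Build S Uq Uq_scalerAl.
Fact Uq_scalerAr (a : S) (x y : Uq) : a *: (x * y) = x * (a *: y).
Proof.
rewrite [LHS]Uq_Cc [RHS](_ : _ = x * (y * UqC a)); last first.
  by congr (_ * _); exact: Uq_Cc.
by rewrite mulrA.
Qed.
HB.instance Definition _ := GRing.Lalgebra_isAlgebra.Build S Uq Uq_scalerAr.

Definition gE : Uq := pi UE.
Definition gF : Uq := pi UF.
Definition gK : Uq := pi UK.
Definition gKi : Uq := pi UKi.

Lemma UqCE a : UqC a = a%:A.
Proof. by rewrite -[LHS]mulr1. Qed.

Lemma UqC_scale a x : pi (UMul (UC a) x) = a *: pi x.
Proof. by rewrite -Uq_mulE. Qed.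

Lemma gKKi : gK * gKi = 1.
Proof. by rewrite [LHS]Uq_mulE; apply: Uq_eq; exact: ueq_KKi. Qed.
Lemma gKiK : gKi * gK = 1.
Proof. by rewrite [LHS]Uq_mulE; apply: Uq_eq; exact: ueq_KiK. Qed.
Lemma gKE : gK * gE * gKi = (qv v ^+ 2) *: gE.
Proof.
rewrite -[RHS]UqC_scale [gK * gE]Uq_mulE [LHS]Uq_mulE.
by apply: Uq_eq; exact: ueq_KE.
Qed.
Lemma gKF : gK * gF * gKi = (qv v ^- 2) *: gF.
Proof.
rewrite -[RHS]UqC_scale [gK * gF]Uq_mulE [LHS]Uq_mulE.
by apply: Uq_eq; exact: ueq_KF.
Qed.
Lemma gEF : gE * gF - gF * gE = (qv v - (qv v)^-1)^-1 *: (gK - gKi).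
Proof.
have UN x : - pi x = pi (UMul (UC (-1)) x) by rewrite -Uq_mulE.
rewrite [gE * gF]Uq_mulE [gF * gE]Uq_mulE !UN.
rewrite [LHS]Uq_addE [gK + _]Uq_addE -[RHS]UqC_scale.
by apply: Uq_eq; exact: ueq_EF.
Qed.

Section Hom.
Variables (B : nzRingType) (c : S -> B) (e f k ki : B).
Hypothesis rels : urels v c e f k ki.

Definition Uhom (x : Uq) : B := ueval c e f k ki (repr x).

Lemma Uhom_pi t : Uhom (pi t) = ueval c e f k ki t.
Proof. by apply: (ueval_sound rels); exact: Uq_repr. Qed.
Lemma UhomD : {morph Uhom : x y / x + y}.
Proof.
elim/Uq_ind=> x; elim/Uq_ind=> y.
by rewrite [_ + _]Uq_addE !Uhom_pi.
Qed.
Lemma UhomM : {morph Uhom : x y / x * y}.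
Proof.
elim/Uq_ind=> x; elim/Uq_ind=> y.
by rewrite [_ * _]Uq_mulE !Uhom_pi.
Qed.
Lemma UhomZ a x : Uhom (a *: x) = c a * Uhom x.
Proof. by elim/Uq_ind: x => x; rewrite -UqC_scale !Uhom_pi. Qed.
Lemma Uhom_gens : [/\ Uhom gE = e, Uhom gF = f, Uhom gK = k & Uhom gKi = ki].
Proof. by rewrite !Uhom_pi. Qed.
Lemma UhomC a : Uhom a%:A = c a.
Proof. by rewrite -UqCE Uhom_pi. Qed.

Lemma Uhom_zmod : zmod_morphism Uhom.
Proof.
move=> x y; apply/eqP; rewrite -(inj_eq (addIr (Uhom y))) subrK -UhomD.
by rewrite subrK.
Qed.
Lemma Uhom_monoid : monoid_morphism Uhom.
Proof.
split; last exact: UhomM.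
by rewrite -[1]scale1r UhomC; case: (urCM rels).
Qed.

End Hom.

End Uq.

Section Automorphisms.
Variables (S : comUnitRingType) (v : qparam S).
Local Notation U := (Uq v).
Local Notation q := (qv v).
Local Notation E := (gE v).
Local Notation F := (gF v).
Local Notation K := (gK v).
Local Notation Ki := (gKi v).

Let inU (a : S) : U := a%:A.

Let inUB : zmod_morphism inU.
Proof. by move=> a b; rewrite /inU scalerBl. Qed.
Let inUM : monoid_morphism inU.
Proof. by split=> [|a b]; rewrite /inU ?scale1r // -scalerAl mul1r scalerA. Qed.
Let inUC a x : inU a * x = x * inU a.
Proof. by rewrite /inU -scalerAl -scalerAr mul1r mulr1. Qed.
Let inUZ a x : inU a * x = a *: x.
Proof. by rewrite /inU -scalerAl mul1r. Qed.

Lemma gEKi : E * Ki = (q ^+ 2) *: (Ki * E).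
Proof.
by rewrite scalerAr -gKE !mulrA gKiK mul1r.
Qed.
Lemma gKE' : K * E = (q ^+ 2) *: (E * K).
Proof. by rewrite scalerAl -gKE -!mulrA gKiK mulr1. Qed.
Lemma gFKi : F * Ki = (q ^- 2) *: (Ki * F).
Proof. by rewrite scalerAr -gKF !mulrA gKiK mul1r. Qed.
Lemma gKF' : K * F = (q ^- 2) *: (F * K).
Proof. by rewrite scalerAl -gKF -!mulrA gKiK mulr1. Qed.
Lemma gKiEK : Ki * E * K = (q ^- 2) *: E.
Proof.
have := gKE'; move/(congr1 (fun x => q ^- 2 *: (Ki * x))).
rewrite mulrA gKiK mul1r => ->; rewrite -scalerAr scalerA mulVr ?scale1r ?mulrA //.
exact/unitrX/qv_unit.
Qed.
Lemma gKiFK : Ki * F * K = (q ^+ 2) *: F.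
Proof.
have := gKF'; move/(congr1 (fun x => q ^+ 2 *: (Ki * x))).
rewrite mulrA gKiK mul1r => ->.
rewrite -scalerAr scalerA mulrV ?scale1r ?mulrA //.
exact/unitrX/qv_unit.
Qed.

Definition rho1 : U -> U := Uhom inU (- q *: F) (- q^-1 *: E) Ki K.

Fact rho1_rels : urels q inU (- q *: F) (- q^-1 *: E) Ki K.
Proof.
have qu := qv_unit v.
split=> //; rewrite ?gKKi ?gKiK // ?inUZ.
- by rewrite -scalerAr -scalerAl gKiFK !scalerA mulrC.
- by rewrite -scalerAr -scalerAl gKiEK !scalerA mulrC.
- rewrite -!scalerAr -!scalerAl !scalerA !mulrNN mulVr // mulrV // !scale1r.
  by rewrite -opprB gEF -scalerN opprB.
Qed.

Fact rho1_is_zmod_morphism : zmod_morphism rho1.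
Proof. exact: Uhom_zmod rho1_rels. Qed.
Fact rho1_is_monoid_morphism : monoid_morphism rho1.
Proof. exact: Uhom_monoid rho1_rels. Qed.
Fact rho1_is_scalable : scalable rho1.
Proof. by move=> a x; rewrite /rho1 (UhomZ rho1_rels) inUZ. Qed.
HB.instance Definition _ :=
  GRing.isZmodMorphism.Build U U rho1 rho1_is_zmod_morphism.
HB.instance Definition _ :=
  GRing.isMonoidMorphism.Build U U rho1 rho1_is_monoid_morphism.
HB.instance Definition _ :=
  GRing.isScalable.Build S U U *:%R rho1 rho1_is_scalable.

Definition Tminus1 : U -> U := Uhom inU (- (Ki * F)) (- (E * K)) Ki K.

Fact Tminus1_rels : urels q inU (- (Ki * F)) (- (E * K)) Ki K.
Proof.
split=> //; rewrite ?gKKi ?gKiK // ?inUZ.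
- by rewrite mulrN mulNr -!mulrA (mulrA Ki F) gKiFK -scalerAr scalerN.
- by rewrite mulrN mulNr !mulrA gKiEK -scalerAl scalerN.
- have q2 : q ^+ 2 \is a GRing.unit by exact/unitrX/qv_unit.
  have -> : - (Ki * F) * - (E * K) = (Ki * F * K) * (Ki * E * K).
    by rewrite mulrNN !mulrA -(mulrA (Ki * F) K Ki) gKKi mulr1.
  have -> : - (E * K) * - (Ki * F) = E * F.
    by rewrite mulrNN -mulrA (mulrA K) gKKi mul1r.
  rewrite gKiFK gKiEK -scalerAl -scalerAr scalerA mulrV // scale1r.
  by rewrite -opprB gEF -scalerN opprB.
Qed.

Fact Tminus1_is_zmod_morphism : zmod_morphism Tminus1.
Proof. exact: Uhom_zmod Tminus1_rels. Qed.
Fact Tminus1_is_monoid_morphism : monoid_morphism Tminus1.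
Proof. exact: Uhom_monoid Tminus1_rels. Qed.
Fact Tminus1_is_scalable : scalable Tminus1.
Proof. by move=> a x; rewrite /Tminus1 (UhomZ Tminus1_rels) inUZ. Qed.
HB.instance Definition _ :=
  GRing.isZmodMorphism.Build U U Tminus1 Tminus1_is_zmod_morphism.
HB.instance Definition _ :=
  GRing.isMonoidMorphism.Build U U Tminus1 Tminus1_is_monoid_morphism.
HB.instance Definition _ :=
  GRing.isScalable.Build S U U *:%R Tminus1 Tminus1_is_scalable.

(* Anti-automorphisms of U are morphisms from U to the converse ring U^c. *)
Definition varrho : U -> U :=
  Uhom (inU : S -> U^c) (q *: (K * F) : U^c) (q *: (Ki * E) : U^c)
    (K : U^c) (Ki : U^c).

Fact varrho_rels : urels q (inU : S -> U^c)
  (q *: (K * F) : U^c) (q *: (Ki * E) : U^c) (K : U^c) (Ki : U^c).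
Proof.
have qu := qv_unit v; have qu2 : q ^+ 2 \is a GRing.unit by exact: unitrX.
split=> //.
- split=> [|a b]; first by case: inUM.
  by rewrite mulrC; case: inUM => _ ->.
- move=> a x; exact/esym/inUC.
- exact: (gKiK v).
- exact: (gKKi v).
- change (Ki * ((q *: (K * F)) * K) = q *: (K * F) * inU (q ^+ 2)).
  rewrite -inUC inUZ -scalerAl -scalerAr !mulrA gKiK mul1r gKF'.
  by rewrite !scalerA mulrAC mulrV // mul1r.
- change (Ki * ((q *: (Ki * E)) * K) = q *: (Ki * E) * inU (q ^- 2)).
  rewrite -inUC inUZ -scalerAl -scalerAr gKiEK -scalerAr !scalerA.
  by rewrite mulrC.
- change (q *: (Ki * E) * (q *: (K * F)) - q *: (K * F) * (q *: (Ki * E)) =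
    (K - Ki) * inU (q - q^-1)^-1).
  rewrite -inUC inUZ -gEF -!scalerAl -!scalerAr !scalerA -expr2 !mulrA.
  by rewrite gKF gKiEK -!scalerAl !scalerA mulrV // !scale1r.
Qed.

Lemma varrhoM x y : varrho (x * y) = varrho y * varrho x.
Proof. exact: (UhomM varrho_rels x y). Qed.

End Automorphisms.

(* A module over S (x) U: since U is presented by generators and relations,
   it is an S-module with S-linear operators satisfying the relations. *)
Record uaction (S : comUnitRingType) (v : qparam S) (A : lmodType S) :=
  UAction {
    opE : A -> A; opF : A -> A; opK : A -> A; opKi : A -> A;
    opE_lin : linear opE; opF_lin : linear opF;
    opK_lin : linear opK; opKi_lin : linear opKi;
    opKKi : forall x, opK (opKi x) = x;
    opKiK : forall x, opKi (opK x) = x;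
    opKE : forall x, opK (opE (opKi x)) = (qv v ^+ 2) *: opE x;
    opKF : forall x, opK (opF (opKi x)) = (qv v ^- 2) *: opF x;
    opEF : forall x, opE (opF x) - opF (opE x) =
             (qv v - (qv v)^-1)^-1 *: (opK x - opKi x)
  }.

Section LinearProp.
Variables (S : comUnitRingType) (A B : lmodType S) (f : A -> B).
Hypothesis lf : linear f.
Lemma lin0 : f 0 = 0.
Proof. by have := lf (-1) 0 0; rewrite scaler0 addr0 scaleN1r addNr. Qed.
Lemma linD x y : f (x + y) = f x + f y.
Proof. by have := lf 1 x y; rewrite !scale1r. Qed.
Lemma linZ a x : f (a *: x) = a *: f x.
Proof. by have := lf a x 0; rewrite !addr0 lin0 addr0. Qed.
Lemma linN x : f (- x) = - f x.
Proof. by rewrite -scaleN1r linZ scaleN1r. Qed.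
Lemma linB x y : f (x - y) = f x - f y.
Proof. by rewrite linD linN. Qed.
Lemma lin_sum (I : Type) (r : seq I) (P : pred I) (g : I -> A) :
  f (\sum_(i <- r | P i) g i) = \sum_(i <- r | P i) f (g i).
Proof. by apply: (big_morph f linD lin0). Qed.
End LinearProp.

Section Action.
Variables (S : comUnitRingType) (v : qparam S) (A : lmodType S).
Variable a : uaction v A.

Fixpoint uact (t : uterm S) : A -> A :=
  match t with
  | UE => opE a | UF => opF a | UK => opK a | UKi => opKi a
  | UC c => fun x => c *: x
  | UAdd t1 t2 => fun x => uact t1 x + uact t2 x
  | UMul t1 t2 => fun x => uact t1 (uact t2 x)
  end.

Definition act (y : Uq v) : A -> A := uact (repr y).

Lemma uact_lin t : linear (uact t).
Proof.
elim: t => [||||c|t IHt u IHu|t IHt u IHu] b x y /=.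
- exact: opE_lin.
- exact: opF_lin.
- exact: opK_lin.
- exact: opKi_lin.
- by rewrite scalerDr !scalerA mulrC.
- by rewrite IHt IHu scalerDr addrACA.
- by rewrite IHu IHt.
Qed.

Lemma uact_sound t u : ueq v t u -> uact t =1 uact u.
Proof.
elim=> {t u} /=.
- by [].
- by move=> x y _ h z; rewrite h.
- by move=> x y z _ h1 _ h2 w; rewrite h1 h2.
- by move=> x x' y y' _ h1 _ h2 w; rewrite h1 h2.
- by move=> x x' y y' _ h1 _ h2 w; rewrite h1 h2.
- by move=> x y z w; rewrite addrA.
- by move=> x y w; rewrite addrC.
- by move=> x w; rewrite scale0r add0r.
- by move=> x w; rewrite scaleN1r addNr scale0r.
- by [].
- by move=> x w; rewrite scale1r.
- by [].
- by move=> x y z w; rewrite (linD (uact_lin x)).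
- by move=> b c w; rewrite scalerDl.
- by move=> b c w; rewrite scalerA.
- by move=> b x w; rewrite (linZ (uact_lin x)).
- by move=> w; rewrite opKKi scale1r.
- by move=> w; rewrite opKiK scale1r.
- exact: opKE.
- exact: opKF.
- by move=> w; rewrite !scaleN1r opEF.
Qed.

Lemma act_pi t : act (\pi_(Uq v)%qT t) =1 uact t.
Proof. exact/uact_sound/Uq_repr. Qed.

Lemma act_lin y : linear (act y).
Proof. exact: uact_lin. Qed.
Lemma actE : act (gE v) =1 opE a. Proof. exact: act_pi. Qed.
Lemma actF : act (gF v) =1 opF a. Proof. exact: act_pi. Qed.
Lemma actK : act (gK v) =1 opK a. Proof. exact: act_pi. Qed.
Lemma actKi : act (gKi v) =1 opKi a. Proof. exact: act_pi. Qed.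
Lemma actM y z x : act (y * z) x = act y (act z x).
Proof.
by elim/Uq_ind: y => y; elim/Uq_ind: z => z; rewrite [y in act y]Uq_mulE !act_pi.
Qed.
Lemma actD y z x : act (y + z) x = act y x + act z x.
Proof.
by elim/Uq_ind: y => y; elim/Uq_ind: z => z; rewrite [y in act y]Uq_addE !act_pi.
Qed.
Lemma actZ c y x : act (c *: y) x = c *: act y x.
Proof. by elim/Uq_ind: y => y; rewrite -UqC_scale !act_pi. Qed.
Lemma act1 x : act 1 x = x.
Proof. by rewrite act_pi /= scale1r. Qed.
Lemma actN y x : act (- y) x = - act y x.
Proof. by rewrite -scaleN1r actZ scaleN1r. Qed.

End Action.

Definition uhom (S : comUnitRingType) (v : qparam S) (A B : lmodType S)
    (a : uaction v A) (b : uaction v B) (f : A -> B) : Prop :=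
  linear f /\ forall (y : Uq v) x, f (act a y x) = act b y (f x).

Section Twist.
Variables (S : comUnitRingType) (v : qparam S) (A : lmodType S).
Variables (theta : {lrmorphism Uq v -> Uq v}) (a : uaction v A).

Fact twist_KKi x : act a (theta (gK v)) (act a (theta (gKi v)) x) = x.
Proof. by rewrite -actM -rmorphM gKKi rmorph1 act1. Qed.
Fact twist_KiK x : act a (theta (gKi v)) (act a (theta (gK v)) x) = x.
Proof. by rewrite -actM -rmorphM gKiK rmorph1 act1. Qed.
Fact twist_KE x :
  act a (theta (gK v)) (act a (theta (gE v)) (act a (theta (gKi v)) x)) =
  (qv v ^+ 2) *: act a (theta (gE v)) x.
Proof. rewrite -!actM -!rmorphM gKE -actZ; congr (act a _ x).
exact: (linearZ_LR theta). Qed.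
Fact twist_KF x :
  act a (theta (gK v)) (act a (theta (gF v)) (act a (theta (gKi v)) x)) =
  (qv v ^- 2) *: act a (theta (gF v)) x.
Proof. rewrite -!actM -!rmorphM gKF -actZ; congr (act a _ x).
exact: (linearZ_LR theta). Qed.
Fact twist_EF x :
  act a (theta (gE v)) (act a (theta (gF v)) x) -
  act a (theta (gF v)) (act a (theta (gE v)) x) =
  (qv v - (qv v)^-1)^-1 *: (act a (theta (gK v)) x - act a (theta (gKi v)) x).
Proof.
rewrite -!actM -!rmorphM -!actN -!actD -!rmorphB gEF -actZ.
congr (act a _ x); exact: (linearZ_LR theta).
Qed.

Definition twist : uaction v A :=
  UAction (act_lin a (theta (gE v))) (act_lin a (theta (gF v)))
    (act_lin a (theta (gK v))) (act_lin a (theta (gKi v)))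
    twist_KKi twist_KiK twist_KE twist_KF twist_EF.

End Twist.

Section Adjoint.
Variables (S : comUnitRingType) (v : qparam S).
Local Notation E := (gE v).
Local Notation F := (gF v).
Local Notation K := (gK v).
Local Notation Ki := (gKi v).
Implicit Types y : Uq v.

(* ad(x) y = \sum x_(1) y S(x_(2)), for x = E, F, K, K^-1. *)
Definition adE y := E * y + K * y * (- (Ki * E)).
Definition adF y := F * y * K + y * (- (F * K)).
Definition adK y := K * y * Ki.
Definition adKi y := Ki * y * K.

Fact adE_lin : linear adE.
Proof.
move=> c y z; rewrite /adE !mulrN !mulrDr mulrDl.
rewrite -(scalerAr c E) -(scalerAr c K) -(scalerAl c (K * y)) scalerDr scalerN.
by rewrite opprD addrACA.
Qed.
Fact adF_lin : linear adF.
Proof.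
move=> c y z; rewrite /adF !mulrN mulrDr !mulrDl.
rewrite -(scalerAr c F) -(scalerAl c (F * y)) -(scalerAl c y) scalerDr scalerN.
by rewrite opprD addrACA.
Qed.
Fact adK_lin : linear adK.
Proof. by move=> c y z; rewrite /adK mulrDr mulrDl -(scalerAr c K) -scalerAl. Qed.
Fact adKi_lin : linear adKi.
Proof. by move=> c y z; rewrite /adKi mulrDr mulrDl -(scalerAr c Ki) -scalerAl. Qed.

Fact adKKi y : adK (adKi y) = y.
Proof.
by rewrite /adK /adKi !mulrA gKKi mul1r -mulrA gKKi mulr1.
Qed.
Fact adKiK y : adKi (adK y) = y.
Proof. by rewrite /adK /adKi !mulrA gKiK mul1r -mulrA gKiK mulr1. Qed.
Fact adKE y : adK (adE (adKi y)) = (qv v ^+ 2) *: adE y.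
Proof.
rewrite /adK /adE /adKi mulrDr mulrDl scalerDr; congr (_ + _).
  by rewrite scalerAl -gKE !mulrA -[LHS]mulrA gKKi mulr1.
rewrite !mulrN !mulNr scalerN; congr (- _).
rewrite scalerAr -gEKi !mulrA -(mulrA K K Ki) gKKi mulr1.
by rewrite -(mulrA (K * y) K Ki) gKKi mulr1.
Qed.
Fact adKF y : adK (adF (adKi y)) = (qv v ^- 2) *: adF y.
Proof.
rewrite /adK /adF /adKi mulrDr mulrDl scalerDr; congr (_ + _).
  by rewrite scalerAl scalerAl -gKF !mulrA -[LHS]mulrA gKKi mulr1.
rewrite !mulrN !mulNr scalerN; congr (- _).
rewrite scalerAr -gKF' !mulrA gKKi mul1r.
by rewrite -[LHS]mulrA gKKi mulr1 -!mulrA.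
Qed.
Fact adEF y : adE (adF y) - adF (adE y) =
  (qv v - (qv v)^-1)^-1 *: (adK y - adKi y).
Proof.
have cK x : x * K * Ki = x by rewrite -mulrA gKKi mulr1.
have KEFK : Ki * (E * F) * K = E * F.
  have -> : Ki * (E * F) * K = (Ki * E * K) * (Ki * F * K).
    by rewrite !mulrA cK.
  rewrite gKiEK gKiFK -scalerAl -scalerAr scalerA mulVr ?scale1r //.
  exact/unitrX/qv_unit.
have FKEK x : F * K * x * (Ki * E * K) = K * F * x * E.
  rewrite gKiEK gKF' -scalerAr -!scalerAl; congr (_ *: _).
have sub4 (V : zmodType) (x1 x2 x3 x4 x5 x6 : V) :
    x1 - x2 + (x3 - x4) - (x5 - x4 - (x2 - x6)) = (x1 - x5) - (x6 - x3).
  rewrite !opprB addrA addrC addrACA [RHS]addrACA.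
  rewrite (addrCA x4 (x1 - x2)) (addrC x4) subrK addrAC (addrCA (- x5)).
  by rewrite -[x1 - x2 + _]addrA addKr addrAC.
have -> : adE (adF y) = E * F * y * K - E * y * (F * K) +
    (K * y * (F * E) - K * F * y * E).
  rewrite /adE /adF !mulrN !mulrBr mulrBl opprB !mulrA.
  by rewrite !cK.
have -> : adF (adE y) = F * E * y * K - K * F * y * E -
    (E * y * (F * K) - K * y * (E * F)).
  rewrite /adE /adF !mulrN mulrBr !mulrBl -FKEK; congr (_ - _ - (_ - _)).
  - by rewrite !mulrA.
  - by rewrite !mulrA.
  - by rewrite -[in RHS]KEFK !mulrA.
rewrite sub4 /adK /adKi.
rewrite -[F * E * y * K]mulrA -[E * F * y * K]mulrA -mulrBl -mulrBr gEF.
rewrite -scalerAl -scalerAr -scalerBr mulrBl mulrBr; congr (_ *: _).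
by rewrite !mulrA opprB addrC addrA subrK.
Qed.
Definition adjoint : uaction v (Uq v) :=
  UAction adE_lin adF_lin adK_lin adKi_lin adKKi adKiK adKE adKF adEF.

End Adjoint.

(* A (x) S^d is represented by families: x stands for \sum_j x_j (x) e_j, with
   (e_j) the canonical basis of S^d. *)
Section TensorMap.
Variables (S : comUnitRingType) (d : nat).
Local Notation V := 'cV[S]_d.

Definition tpure (A : lmodType S) (x : A) (e : V) : {ffun 'I_d -> A} :=
  [ffun i => e i 0 *: x].

Definition tmap (A B : lmodType S) (h : A -> B) (g : V -> V)
    (x : {ffun 'I_d -> A}) : {ffun 'I_d -> B} :=
  \sum_(j < d) tpure (h (x j)) (g (delta_mx j 0)).

Section Theory.
Variable A : lmodType S.
Implicit Types (h : A -> A) (g : V -> V) (x : {ffun 'I_d -> A}).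

Lemma tmapE h g x i :
  tmap h g x i = \sum_(j < d) g (delta_mx j 0) i 0 *: h (x j).
Proof. by rewrite /tmap sum_ffunE; apply: eq_bigr => j _; rewrite ffunE. Qed.

Lemma tmap_lin h g : linear h -> linear (tmap h g).
Proof.
move=> lh c x y; apply/ffunP=> i; rewrite !ffunE !tmapE scaler_sumr -big_split.
apply: eq_bigr => j _ /=; rewrite !ffunE lh scalerDr !scalerA.
by rewrite [_ * c]mulrC.
Qed.

Lemma cV_sum (u : V) : u = \sum_(j < d) u j 0 *: delta_mx j 0.
Proof.
apply/colP => i; rewrite summxE (bigD1 i) //= big1 => [|j /negPf ji].
  by rewrite !mxE !eqxx mulr1 addr0.
by rewrite !mxE eq_sym ji mulr0.
Qed.

Lemma tmap_pure h g (y : A) (e : V) : linear h -> linear g ->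
  tmap h g (tpure y e) = tpure (h y) (g e).
Proof.
move=> lh lg; apply/ffunP => i; rewrite tmapE ffunE [in RHS](cV_sum e).
rewrite (lin_sum lg) summxE scaler_suml; apply: eq_bigr => j _.
by rewrite ffunE (linZ lh) (linZ lg) !mxE scalerA mulrC.
Qed.

Lemma tpure_sum x : x = \sum_(j < d) tpure (x j) (delta_mx j 0).
Proof.
apply/ffunP => i; rewrite sum_ffunE (bigD1 i) //= big1 => [|j /negPf ji].
  by rewrite ffunE !mxE !eqxx scale1r addr0.
by rewrite ffunE !mxE eq_sym ji scale0r.
Qed.

Lemma tmap_comp h h' g g' x : linear h -> linear g ->
  tmap h g (tmap h' g' x) = tmap (fun y => h (h' y)) (fun u => g (g' u)) x.
Proof.
move=> lh lg; rewrite [tmap h' g' x]/tmap (lin_sum (tmap_lin _ lh)).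
by apply: eq_bigr => j _; rewrite tmap_pure.
Qed.

Lemma eq_tmap h h' g g' : h =1 h' -> g =1 g' -> tmap h g =1 tmap h' g'.
Proof.
by move=> eh eg x; apply: eq_bigr => j _; rewrite eh eg.
Qed.

Lemma tmap_id x : tmap id id x = x.
Proof. by rewrite [RHS]tpure_sum. Qed.

Lemma tmapDl h h' g x : tmap (fun y => h y + h' y) g x = tmap h g x + tmap h' g x.
Proof.
apply/ffunP => i; rewrite !ffunE !tmapE -big_split.
by apply: eq_bigr => j _ /=; rewrite scalerDr.
Qed.
Lemma tmapZl c h g x : tmap (fun y => c *: h y) g x = c *: tmap h g x.
Proof.
apply/ffunP => i; rewrite !ffunE !tmapE scaler_sumr.
by apply: eq_bigr => j _ /=; rewrite !scalerA mulrC.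
Qed.
Lemma tmapDr h g g' x : tmap h (fun y => g y + g' y) x = tmap h g x + tmap h g' x.
Proof.
apply/ffunP => i; rewrite !ffunE !tmapE -big_split.
by apply: eq_bigr => j _ /=; rewrite !mxE scalerDl.
Qed.
Lemma tmapZr c h g x : tmap h (fun y => c *: g y) x = c *: tmap h g x.
Proof.
apply/ffunP => i; rewrite !ffunE !tmapE scaler_sumr.
by apply: eq_bigr => j _ /=; rewrite !mxE !scalerA.
Qed.

End Theory.
End TensorMap.

Section Tensor.
Variables (S : comUnitRingType) (v : qparam S) (A : lmodType S) (d : nat).
Variables (a : uaction v A) (e : uaction v 'cV[S]_d).
Local Notation q := (qv v).
Implicit Types x : {ffun 'I_d -> A}.

(* The coproducts of E, F, K, K^-1. *)
Definition tensE x := tmap (opE a) id x + tmap (opK a) (opE e) x.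
Definition tensF x := tmap (opF a) (opKi e) x + tmap id (opF e) x.
Definition tensK x := tmap (opK a) (opK e) x.
Definition tensKi x := tmap (opKi a) (opKi e) x.

Let lid (B : lmodType S) : linear (id : B -> B).
Proof. by []. Qed.
Let lin2 (B C : lmodType S) (f g : B -> C) : linear f -> linear g ->
  linear (fun y => f y + g y).
Proof. by move=> lf lg c y z; rewrite lf lg scalerDr addrACA. Qed.
Let lE := opE_lin a. Let lF := opF_lin a.
Let lK := opK_lin a. Let lKi := opKi_lin a.
Let lE' := opE_lin e. Let lF' := opF_lin e.
Let lK' := opK_lin e. Let lKi' := opKi_lin e.

Fact tensE_lin : linear tensE.
Proof. by apply: lin2; apply: tmap_lin. Qed.
Fact tensF_lin : linear tensF.
Proof. by apply: lin2; apply: tmap_lin. Qed.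
Fact tensK_lin : linear tensK.
Proof. exact: tmap_lin. Qed.
Fact tensKi_lin : linear tensKi.
Proof. exact: tmap_lin. Qed.

Fact tensKKi x : tensK (tensKi x) = x.
Proof.
rewrite /tensK /tensKi tmap_comp // -[RHS]tmap_id.
by apply: eq_tmap => y; rewrite opKKi.
Qed.
Fact tensKiK x : tensKi (tensK x) = x.
Proof.
rewrite /tensK /tensKi tmap_comp // -[RHS]tmap_id.
by apply: eq_tmap => y; rewrite opKiK.
Qed.
Fact tensKE x : tensK (tensE (tensKi x)) = (q ^+ 2) *: tensE x.
Proof.
rewrite /tensE (linD tensK_lin) /tensK /tensKi !tmap_comp //.
all: try by move=> c y z; rewrite !(opE_lin, opF_lin, opK_lin, opKi_lin).
rewrite scalerDr.
congr (_ + _).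
  by rewrite -tmapZl; apply: eq_tmap => y; rewrite ?opKE ?opKKi.
by rewrite -tmapZr; apply: eq_tmap => y; rewrite ?opKE ?opKKi.
Qed.
Fact tensKF x : tensK (tensF (tensKi x)) = (q ^- 2) *: tensF x.
Proof.
rewrite /tensF (linD tensK_lin) /tensK /tensKi !tmap_comp //.
all: try by move=> c y z; rewrite !(opE_lin, opF_lin, opK_lin, opKi_lin).
rewrite scalerDr.
congr (_ + _).
  by rewrite -tmapZl; apply: eq_tmap => y; rewrite ?opKF ?opKKi.
by rewrite -tmapZr; apply: eq_tmap => y; rewrite ?opKF ?opKKi.
Qed.

Let opKF' (B : lmodType S) (b : uaction v B) y :
  opK b (opF b y) = q ^- 2 *: opF b (opK b y).
Proof. by rewrite -opKF opKiK. Qed.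
Let opEKi' (B : lmodType S) (b : uaction v B) y :
  opE b (opKi b y) = q ^+ 2 *: opKi b (opE b y).
Proof. by rewrite -[LHS](opKiK b) opKE (linZ (opKi_lin b)). Qed.
Let opEF' (B : lmodType S) (b : uaction v B) y :
  opE b (opF b y) =
  opF b (opE b y) + (q - q^-1)^-1 *: (opK b y + (- 1) *: opKi b y).
Proof. by rewrite scaleN1r -opEF addrC subrK. Qed.

Fact tensEF x : tensE (tensF x) - tensF (tensE x) =
  (q - q^-1)^-1 *: (tensK x - tensKi x).
Proof.
rewrite /tensE /tensF (linD (tmap_lin _ lE)) (linD (tmap_lin _ lK)).
rewrite (linD (tmap_lin _ lF)) (linD (tmap_lin _ (@lid A))) !tmap_comp //.
rewrite (eq_tmap (h' := fun y => opF a (opE a y) +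
  (q - q^-1)^-1 *: (opK a y + (- 1) *: opKi a y))
  (g' := opKi e) (opEF' a) (fun=> erefl)).
rewrite (eq_tmap (h := fun y => opK a (id y)) (h' := opK a)
  (fun=> erefl) (opEF' e)).
rewrite (eq_tmap (h := fun y => opK a (opF a y)) (opKF' a) (opEKi' e)).
rewrite !(tmapDl, tmapDr, tmapZl, tmapZr) scalerA mulVr ?scale1r; last first.
  exact/unitrX/qv_unit.
rewrite /tensK /tensKi !scaleN1r.
set x1 := tmap _ _ x; set x2 := tmap _ _ x; set x3 := tmap _ _ x.
set x4 := tmap _ _ x; set x5 := tmap _ _ x; set x6 := tmap _ _ x.
set x7 := tmap _ _ x.
have z6 (V : zmodType) (a1 a2 a3 a4 b1 b2 : V) :
    a1 + b1 + a2 + (a3 + (a4 + b2)) - (a1 + a3 + (a2 + a4)) = b1 + b2.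
  by rewrite [X in X - _](AC (3*(1*2)) ((2*6)*(1*4*(3*5)))) addrK.
rewrite [LHS]z6 -scalerDr; congr (_ *: _).
by rewrite addrC addrA subrK.
Qed.

(* x (x) e |-> \sum x_(1) x (x) x_(2) e on A (x) S^d. *)
Definition tens : uaction v {ffun 'I_d -> A} :=
  UAction tensE_lin tensF_lin tensK_lin tensKi_lin
    tensKKi tensKiK tensKE tensKF tensEF.

End Tensor.

Section QuantumIntegers.
Variables (S : comUnitRingType) (v : qparam S).
Local Notation q := (qv v).

Definition qint (n : nat) : S := (q ^+ n - q ^- n) / (q - q^-1).
Definition qfact (n : nat) : S := \prod_(1 <= i < n.+1) qint i.
Definition qbrace (n : nat) : S := \prod_(1 <= i < n.+1) (q ^+ i - q ^- i).

Definition dE (n : nat) : Uq v := (qfact n)^-1 *: gE v ^+ n.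
Definition dF (n : nat) : Uq v := (qfact n)^-1 *: gF v ^+ n.

Lemma qint0 : qint 0 = 0.
Proof. by rewrite /qint expr0 invr1 subrr mul0r. Qed.

Lemma qint_comm (k l : nat) :
  qint k.+1 * qint l - qint l.+1 * qint k =
  (q - q^-1)^-1 * (q ^+ l * q ^- k - q ^+ k * q ^- l).
Proof.
have hu := qvB_unit v; have qu := qv_unit v.
rewrite /qint !exprS !invrM ?unitrX //.
move: (mulVr hu); set h := (_ - _)^-1; move: h => h.
move: (q ^- k) (q ^- l) => x' y'; move: (q ^+ k) (q ^+ l) => x y.
move: (q^-1) => a'; move: (qv v) => a e.
transitivity (h * (h * (a - a')) * (y * x' - x * y')); first by ring.
by rewrite e mulr1.
Qed.

End QuantumIntegers.

(* The basis u_0, ..., u_m of F_m, extended by u_k = 0 for k > m. *)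
Definition ubas (S : comUnitRingType) (m k : nat) : 'cV[S]_m.+1 :=
  if (k <= m)%N then delta_mx (inord k) 0 else 0.
Arguments ubas {S} m k.

Definition linext (S : comUnitRingType) (m : nat) (g : nat -> 'cV[S]_m.+1)
    (u : 'cV[S]_m.+1) : 'cV[S]_m.+1 := \sum_(k < m.+1) u k 0 *: g k.

Section Fmod.
Variables (S : comUnitRingType) (v : qparam S) (m : nat).
Local Notation q := (qv v).
Local Notation u := (@ubas S m).

Lemma linext_lin (g : nat -> 'cV[S]_m.+1) : linear (linext g).
Proof.
move=> c x y; rewrite /linext scaler_sumr -big_split; apply: eq_bigr => k _ /=.
by rewrite !mxE scalerDl scalerA.
Qed.

Lemma linextE g k : linext g (u k) = if (k <= m)%N then g k else 0.
Proof.
rewrite /linext /ubas; case: leqP => [lekm|_]; last first.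
  by rewrite big1 // => i _; rewrite mxE scale0r.
rewrite (bigD1 (inord k)) //= big1 => [|i /negPf ik].
  by rewrite !mxE !eqxx scale1r addr0 inordK.
by rewrite !mxE ik scale0r.
Qed.

Lemma ubas_ext (f g : 'cV[S]_m.+1 -> 'cV[S]_m.+1) : linear f -> linear g ->
  (forall k, (k <= m)%N -> f (u k) = g (u k)) -> f =1 g.
Proof.
move=> lf lg fg x; rewrite (cV_sum x) (lin_sum lf) (lin_sum lg).
apply: eq_bigr => j _; rewrite (linZ lf) (linZ lg); congr (_ *: _).
have lejm : (j <= m)%N by rewrite -ltnS.
by have := fg j lejm; rewrite /ubas lejm inord_val.
Qed.

Definition FmE :=
  linext (fun k => if k is k'.+1 then qint v (m - k') *: u k' else 0).
Definition FmF := linext (fun k => qint v k.+1 *: u k.+1).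
Definition FmK := linext (fun k => q ^ (m%:Z - (2 * k)%:Z) *: u k).
Definition FmKi := linext (fun k => q ^ ((2 * k)%:Z - m%:Z) *: u k).

Let lE : linear FmE := @linext_lin _.
Let lF : linear FmF := @linext_lin _.
Let lK : linear FmK := @linext_lin _.
Let lKi : linear FmKi := @linext_lin _.

Lemma FmE0 : FmE (u 0) = 0. Proof. exact: linextE. Qed.
Lemma FmES k : (k < m)%N -> FmE (u k.+1) = qint v (m - k) *: u k.
Proof. by move=> km; rewrite [LHS]linextE km. Qed.
Lemma FmFE k : FmF (u k) = qint v k.+1 *: u k.+1.
Proof.
rewrite [LHS]linextE; case: leqP => // mk; rewrite /ubas ifN ?scaler0 //.
by rewrite -ltnNge ltnW.
Qed.
Lemma FmKE k : FmK (u k) = q ^ (m%:Z - (2 * k)%:Z) *: u k.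
Proof.
rewrite [LHS]linextE; case: leqP => // mk; rewrite /ubas ifN ?scaler0 //.
by rewrite -ltnNge.
Qed.
Lemma FmKiE k : FmKi (u k) = q ^ ((2 * k)%:Z - m%:Z) *: u k.
Proof.
rewrite [LHS]linextE; case: leqP => // mk; rewrite /ubas ifN ?scaler0 //.
by rewrite -ltnNge.
Qed.

Let qu := qv_unit v.
Let lid : linear (id : 'cV[S]_m.+1 -> 'cV[S]_m.+1). Proof. by []. Qed.
Let lc (A B C : lmodType S) (f : B -> C) (g : A -> B) :
  linear f -> linear g -> linear (fun x => f (g x)).
Proof. by move=> lf lg c x y; rewrite lg lf. Qed.
Let ls (A B : lmodType S) c (f : A -> B) :
  linear f -> linear (fun x => c *: f x).
Proof.
by move=> lf b x y; rewrite lf scalerDr !scalerA [c * b]mulrC.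
Qed.
Let lB (A B : lmodType S) (f g : A -> B) :
  linear f -> linear g -> linear (fun x => f x - g x).
Proof.
by move=> lf lg c x y; rewrite lf lg opprD scalerBr addrACA.
Qed.

Fact FmKKi x : FmK (FmKi x) = x.
Proof.
move: x; apply: (ubas_ext (lc lK lKi) lid) => k km.
rewrite FmKiE (linZ lK) FmKE scalerA -exprzDr // addrA subrK.
by rewrite subrr scale1r.
Qed.
Fact FmKiK x : FmKi (FmK x) = x.
Proof.
move: x; apply: (ubas_ext (lc lKi lK) lid) => k km.
rewrite FmKE (linZ lKi) FmKiE scalerA -exprzDr // addrA subrK.
by rewrite subrr scale1r.
Qed.
Fact FmKE2 x : FmK (FmE (FmKi x)) = (q ^+ 2) *: FmE x.
Proof.
move: x; apply: (ubas_ext (lc lK (lc lE lKi)) (ls _ lE)) => -[|k] km.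
  by rewrite FmKiE (linZ lE) FmE0 !scaler0 (lin0 lK).
rewrite FmKiE (linZ lE) FmES // !(linZ lK) FmKE !scalerA mulrAC -exprzDr //.
congr (_ * _ *: _); rewrite -[q ^+ 2]/(q ^ 2%:Z); congr (q ^ _).
by rewrite mulnS PoszD; ring.
Qed.
Fact FmKF2 x : FmK (FmF (FmKi x)) = (q ^- 2) *: FmF x.
Proof.
move: x; apply: (ubas_ext (lc lK (lc lF lKi)) (ls _ lF)) => k km.
rewrite FmKiE (linZ lF) FmFE !(linZ lK) FmKE !scalerA mulrAC -exprzDr //.
congr (_ * _ *: _); rewrite -[q ^- 2]/(q ^ (- 2%:Z)); congr (q ^ _).
by rewrite mulnS PoszD; ring.
Qed.
Fact FmEF x : FmE (FmF x) - FmF (FmE x) =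
  (q - q^-1)^-1 *: (FmK x - FmKi x).
Proof.
move: x; apply: (ubas_ext (lB (lc lE lF) (lc lF lE)) (ls _ (lB lK lKi))).
move=> k km.
have -> : FmE (FmF (u k)) = (qint v k.+1 * qint v (m - k)) *: u k.
  rewrite FmFE (linZ lE); move: km; rewrite leq_eqVlt => /orP[/eqP->|km].
    by rewrite subnn qint0 mulr0 scale0r /ubas ltnn (lin0 lE) scaler0.
  by rewrite FmES // scalerA.
have -> : FmF (FmE (u k)) = (qint v (m - k).+1 * qint v k) *: u k.
  case: k km => [_|k km]; first by rewrite FmE0 (lin0 lF) qint0 mulr0 scale0r.
  by rewrite FmES // (linZ lF) FmFE scalerA subnSK.
rewrite -scalerBl qint_comm FmKE FmKiE -scalerBl scalerA; congr (_ * _ *: _).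
have e : m%:Z = (m - k)%:Z + k%:Z by rewrite -PoszD subnK.
have -> : m%:Z - (2 * k)%:Z = (m - k)%:Z + - k%:Z.
  by rewrite e mul2n -addnn PoszD; ring.
have -> : (2 * k)%:Z - m%:Z = k%:Z + - (m - k)%:Z.
  by rewrite e mul2n -addnn PoszD; ring.
by rewrite !exprzDr // -!exprnN.
Qed.

(* The irreducible module of highest weight v^m, in the basis
   u_k = F^(k) u_0. *)
Definition Fmod : uaction v 'cV[S]_m.+1 :=
  UAction lE lF lK lKi FmKKi FmKiK FmKE2 FmKF2 FmEF.

End Fmod.

Section BetaT.
Variables (S : comUnitRingType) (v : qparam S).
Local Notation q := (qv v).

(* T''_1 on a vector of weight v^n; the sum over t = (a, b, c) is finite when E
   and F are nilpotent. *)
Definition T1wt (A : lmodType S) (a : uaction v A) (n : int) (x : A) : A :=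
  \sum_(t \in [set t : nat * nat * nat |
                 - t.1.1%:Z + t.1.2%:Z - t.2%:Z = n]%classic)
    ((-1) ^+ t.1.2 * q ^ (- (t.1.1 * t.2)%:Z + t.1.2%:Z)) *:
      act a (dE v t.1.1) (act a (dF v t.1.2) (act a (dE v t.2) x)).

Definition T1 (m : nat) : 'cV[S]_m.+1 -> 'cV[S]_m.+1 :=
  linext (fun k => T1wt (Fmod v m) (m%:Z - (2 * k)%:Z) (ubas m k)).

Definition FFmod (m n : nat) : uaction v {ffun 'I_n.+1 -> 'cV[S]_m.+1} :=
  tens (Fmod v m) (twist (@rho1 S v) (Fmod v n)).

Definition ubas2 (m n i j : nat) : {ffun 'I_n.+1 -> 'cV[S]_m.+1} :=
  tpure (ubas m i) (ubas n j).

(* The highest weight vector u^(m + n - 2p), for p <= min(m, n). *)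
Definition uhw (m n p : nat) : {ffun 'I_n.+1 -> 'cV[S]_m.+1} :=
  \sum_(k < p.+1)
    ((-1) ^+ (n - p) *
     (qfact v (n - p + k) * qfact v (m - k) / (qfact v (n - p) * qfact v m)) *
     q ^ ((k%:Z - p%:Z) * (2 + m%:Z) + p%:Z ^+ 2 - k%:Z ^+ 2 + n%:Z)) *:
    ubas2 m n k (n - p + k).

Definition brange (m n r : nat) : bool :=
  [&& 2 * r == m + n %[mod 2], `|m%:Z - n%:Z| <= 2 * r & 2 * r <= m + n]%N.

Definition is_beta (m n r : nat) (b : {ffun 'I_n.+1 -> 'cV[S]_m.+1} -> Uq v) :=
  uhom (FFmod m n) (adjoint v) b /\
  forall p, (p <= minn m n)%N -> b (uhw m n p) =
    if (2 * r == m + n - 2 * p)%N then dE v r * gKi v ^+ r else 0.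

(* The universal property of the module induced from the character of the Borel
   subalgebra given by E |-> 0, K |-> lam. *)
Definition verma (A : lmodType S) (a : uaction v A) (lam : S) : Prop :=
  exists x0 : A, [/\ opE a x0 = 0, opK a x0 = lam *: x0 &
    forall (B : lmodType S) (b : uaction v B) (y0 : B),
      opE b y0 = 0 -> opK b y0 = lam *: y0 ->
      exists! f : A -> B, uhom a b f /\ f x0 = y0].

End BetaT.
Arguments is_beta {S} v m n r b.

Section BaseChange.
Variables (F : fieldType) (v : qparam F).

Fact fpsCq_unit : fpsC (qv v) \is a GRing.unit.
Proof. exact: (rmorph_unit (@fpsC F) (qv_unit v)). Qed.
Fact fpsCqB_unit : fpsC (qv v) - (fpsC (qv v))^-1 \is a GRing.unit.
Proof.
rewrite -(rmorphV (@fpsC F) (qv_unit v)) -(rmorphB (@fpsC F)).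
exact: (rmorph_unit (@fpsC F) (qvB_unit v)).
Qed.
Definition qparamR : qparam (fps F) := QParam fpsCq_unit fpsCqB_unit.

(* The map x |-> 1 (x) x from U to R (x) U; the latter is the R-algebra with
   the same generators and relations as U. *)
Definition bc : Uq v -> Uq qparamR :=
  Uhom (fun a : F => (fpsC a)%:A : Uq qparamR)
    (gE qparamR) (gF qparamR) (gK qparamR) (gKi qparamR).

Fact bc_rels : urels (qv v) (fun a : F => (fpsC a)%:A : Uq qparamR)
    (gE qparamR) (gF qparamR) (gK qparamR) (gKi qparamR).
Proof.
have qu := qv_unit v.
split; rewrite ?gKKi ?gKiK //.
- by move=> a b; rewrite rmorphB scalerBl.
- split; first by rewrite rmorph1 scale1r.
  by move=> a b; rewrite rmorphM -scalerAl mul1r scalerA.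
- by move=> a x; rewrite -scalerAl -scalerAr mul1r mulr1.
- by rewrite gKE -scalerAl mul1r rmorphXn.
- by rewrite gKF -scalerAl mul1r rmorphV ?unitrX // rmorphXn.
- by rewrite gEF -scalerAl mul1r rmorphV ?qvB_unit // rmorphB rmorphV.
Qed.

(* The R-linear extension of a map from F_m (x) F_n^rho1 to U. *)
Definition extR (m n : nat) (b : {ffun 'I_n.+1 -> 'cV[F]_m.+1} -> Uq v)
    (w : {ffun 'I_n.+1 -> 'cV[fps F]_m.+1}) : Uq qparamR :=
  \sum_(i < m.+1) \sum_(j < n.+1) w j i 0 *: bc (b (ubas2 F m n i j)).

Definition betaR (m n : nat)
    (b : nat -> {ffun 'I_n.+1 -> 'cV[F]_m.+1} -> Uq v) (r : nat -> fps F)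
    (w : {ffun 'I_n.+1 -> 'cV[fps F]_m.+1}) : Uq qparamR :=
  \sum_(k < (m + n).+1 | brange m n k) r k *: extR (b k) w.

End BaseChange.

Section Pairings.
Variables (F : fieldType) (v : qparam F).
Local Notation R := (fps F).
Local Notation vR := (qparamR v).
Local Notation q := (qv vR).
Local Notation T := (fpsT F).

Definition qT (l : int) : R := (q ^ l * T - q ^ (- l) * T^-1) / (q - q^-1).

Definition invariant_pairing (A B : lmodType R) (a : uaction vR A)
    (b : uaction vR B) (chi : A -> B -> R) : Prop :=
  [/\ forall c x x' y, chi (c *: x + x') y = c * chi x y + chi x' y,
      forall c x y y', chi x (c *: y + y') = c * chi x y + chi x y' &
      forall (u : Uq vR) x y, chi (act a u x) y = chi x (act b (varrho u) y)].

(* Modules A -> A_F -> A_pi, with their actions. *)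
Record locdata := LocData {
  lbase : lmodType R; lloc : lmodType R; lquo : lmodType R;
  abase : uaction vR lbase; aloc : uaction vR lloc; aquo : uaction vR lquo;
  linj : lbase -> lloc; lproj : lloc -> lquo
}.

(* A_F is the localization of A, on which F acts injectively, and
   A_pi = A_F / A. *)
Definition is_localization (X : locdata) : Prop :=
  [/\ uhom (abase X) (aloc X) (@linj X) /\ injective (@linj X),
      bijective (opF (aloc X)),
      forall y, exists n x, iter n (opF (aloc X)) y = linj x,
      uhom (aloc X) (aquo X) (@lproj X) /\
        (forall z, exists y, lproj y = z :> lquo X) &
      forall y : lloc X, lproj y = 0 <-> exists x, y = linj x].

(* (A (x) F_m)_F = A_F (x) F_m and (A (x) F_m)_pi = A_pi (x) F_m. *)
Definition tens_loc (X : locdata) (m : nat) : locdata :=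
  LocData (tens (abase X) (Fmod vR m)) (tens (aloc X) (Fmod vR m))
    (tens (aquo X) (Fmod vR m))
    (fun x : {ffun 'I_m.+1 -> lbase X} => [ffun i => linj (x i)])
    (fun x : {ffun 'I_m.+1 -> lloc X} => [ffun i => lproj (x i)]).

Section Lift.
Variables X Y : locdata.

(* The normalization is stated without denominators: R is an integral domain
   and [T; l] <> 0. *)
Definition is_lift (chi : lbase X -> lbase Y -> R)
    (chiF : lloc X -> lloc Y -> R) : Prop :=
  [/\ invariant_pairing (aloc X) (aloc Y) chiF,
      forall x y, chiF (linj x) y = 0,
      forall x y, chiF x (linj y) = 0 &
      forall (l : int) x y x' y',
        opK (abase X) x = (T * q ^ (l - 1)) *: x ->
        opK (abase Y) y = (T * q ^ (l - 1)) *: y ->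
        opE (abase X) x = 0 -> opE (abase Y) y = 0 ->
        opF (aloc X) x' = linj x -> opF (aloc Y) y' = linj y ->
        qT l * chiF x' y' = q ^ l * qT 0 * chi x y].

(* The lift exists and is unique for the pairings of M (x) E and M (x) E'. *)
Definition lift (chi : lbase X -> lbase Y -> R) : lloc X -> lloc Y -> R :=
  xget (fun _ _ => 0) [set chiF | is_lift chi chiF]%classic.

Definition chi_pi (chi : lbase X -> lbase Y -> R) (x : lquo X) (y : lquo Y) :=
  xget 0 [set r : R | exists x' y',
            [/\ lproj x' = x, lproj y' = y & r = lift chi x' y']]%classic.

(* s o chi_pi o L. *)
Definition sL (chi : lbase X -> lbase Y -> R) (x : lquo X) (y : lquo Y) : R :=
  fps_s (\sum_(j \in [set: nat]%classic)
    (-1) ^+ j * q ^- (j * j.-1)./2 * qbrace vR j *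
    chi_pi chi (act (aquo X) (dF vR j) x) (act (aquo Y) (rho1 (dE vR j)) y)).

End Lift.

Section Sharp.
Variables (M : locdata) (Psi : lquo M -> lbase M).

(* Psi is an isomorphism of R (x) U-modules from (M_pi)^(s T'_{-1}) to M. *)
Definition twisted_iso : Prop :=
  [/\ bijective Psi, {morph Psi : x y / x + y},
      forall c x, Psi (fps_s c *: x) = c *: Psi x &
      forall (u : Uq v) x,
        Psi (act (aquo M) (bc (Tminus1 u)) x) = act (abase M) (bc u) (Psi x)].

(* Written on x = \sum_i x_i (x) u_i; the factor s(r) comes from the
   s-semilinearity of Psi. *)
Definition Psibar (m : nat) (x : {ffun 'I_m.+1 -> lquo M}) :
    {ffun 'I_m.+1 -> lbase M} :=
  \sum_(i < m.+1) \sum_(j \in [set: nat]%classic)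
    (q ^+ (j * j.-1)./2 * qbrace vR j) *:
      tpure (Psi (act (aquo M) (dF vR j) (x i)))
        (T1 vR (act (Fmod vR m) (dE vR j) (ubas m i))).

(* Psibar is bijective. *)
Definition Psibar_inv (m : nat) (y : {ffun 'I_m.+1 -> lbase M}) :
    {ffun 'I_m.+1 -> lquo M} := xget 0 [set x | Psibar x = y]%classic.

Definition sharp (m n : nat)
    (chi : {ffun 'I_m.+1 -> lbase M} -> {ffun 'I_n.+1 -> lbase M} -> R) :
    {ffun 'I_m.+1 -> lbase M} -> {ffun 'I_n.+1 -> lbase M} -> R :=
  fun x y => sL (X := tens_loc M m) (Y := tens_loc M n) chi
    (Psibar_inv x) (Psibar_inv y).

End Sharp.

(* chi_{beta, phi} (x (x) e, y (x) f) = phi (x, rho1 (beta (e (x) f)) y), for x =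
   \sum_i x_i (x) u_i and y = \sum_j y_j (x) u_j. *)
Definition chi_beta (m n : nat) (A : lmodType R) (a : uaction vR A)
    (beta : {ffun 'I_n.+1 -> 'cV[R]_m.+1} -> Uq vR) (phi : A -> A -> R)
    (x : {ffun 'I_m.+1 -> A}) (y : {ffun 'I_n.+1 -> A}) : R :=
  \sum_(i < m.+1) \sum_(j < n.+1)
    phi (x i) (act a (rho1 (beta (ubas2 R m n i j))) (y j)).

End Pairings.

Section Indeterminate.
Variable k : fieldType.
Local Notation "x %:F" := (@FracField.tofrac {poly k} x).

Fact indet_unit : ('X%:F : {fraction {poly k}}) \is a GRing.unit.
Proof. by rewrite unitfE tofrac_eq0 polyX_eq0. Qed.
Fact indetB_unit :
  ('X%:F : {fraction {poly k}}) - ('X%:F)^-1 \is a GRing.unit.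
Proof.
have x0 : ('X%:F : {fraction {poly k}}) != 0 by rewrite tofrac_eq0 polyX_eq0.
rewrite unitfE subr_eq0; apply/eqP => e.
have /eqP : ('X ^+ 2 : {poly k})%:F = 1%:F.
  by rewrite tofracXn tofrac1 expr2 {2}e mulfV.
rewrite tofrac_eq => /eqP /(congr1 (fun p : {poly k} => size p)).
by rewrite size_polyXn size_poly1.
Qed.
Definition vq : qparam {fraction {poly k}} := QParam indet_unit indetB_unit.

End Indeterminate.

(* Main.v *)
Require Import Defs.
From mathcomp Require Import all_boot all_order all_algebra.
From mathcomp Require Import ring zify.
From mathcomp Require Import boolp classical_sets functions cardinality fsbigop.
Set Implicit Arguments.
Unset Strict Implicit.
Unset Printing Implicit Defensive.
Import GRing.Theory.
Local Open Scope ring_scope.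


(** Let [x0] be the highest weight vector of M and z the class of F^-1 x0 in M_pi; F kills z, and E
    generates M_pi from z. In coordinates Psibar is Psi applied to J x, where J = Sum_j [cJ_j] F^(j)
    (x) T''_1 E^(j) ([PsibarE]), and the sharp operation transports s o L(chi_pi) through Psibar,
    with L as in [pairL]. The theorem thus reduces to an identity about M_pi, L(chi_{beta,phi_pi})
    (x, y) = chi_{beta, L(phi_pi)} (J x, J y), where on the right U acts on M_pi through T'_-1
    ([pairL_beta]). The compatibility of phi with Psi turns s o L(phi_pi) into phi, and the
    s-semilinearity of Psi turns beta into s beta ([betaR_Psi]). Three ingredients give the
    identity.

    First, the left side involves (chi_{beta,phi})_pi, which has to be chi_{beta,phi_pi}
    ([chi_pi_beta]). A lift is unique ([lift_uniq]), so it is enough that chi_{beta,phi_F} has the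
    prescribed values on F^-1 of singular vectors ([beta_lift]). These values come out of the
    invariance of a pairing between M_F and a non-split extension of M by M_pi.

    Second, both sides are invariant pairings of the T'_-1-twists of M_pi (x) F_m and M_pi (x) F_n
    ([pairL_pairing], [braid_opE], [braid_opF], [braid_opK], [pair_beta_pairing]). Such pairings are
    determined by their values on the vectors z (x) u_k and z (x) u_l ([low_pairing_eq]).

    Third, on these vectors one compares two functionals on W = F_m (x) F_n^rho1, namely f(w) =
    phi_pi(z, rho1(beta w) z) and g(w) = phi_pi(z, T'_-1(rho1(beta w)) z). Both only see the zero
    weight space. W carries an operator Q ([braidW]) with the relations of T''_1; on the zero weight
    vector of the summand of highest weight v^(2r) it is the scalar (-1)^r v^(r(r+1)) ([Q_wzE]), and
    this is also the ratio of f to g at ad(F^(r)) (E^(r) K^-r) ([low_rho_ad]). Hence f = g o Q.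
    Since [cL] and [cJ] are the coefficients of inverse series, Q sends Sum_j [cL_j] F^(j) u_k (x)
    F^(j) u_l to T''_1 u_k (x) T''_1 u_l ([braidW_Lu2]), and f = g o Q at this vector is the
    equality wanted ([low_is_beta]). *)

(** * The ring R = k(v)[[T - 1]]: units, absence of zero divisors, the involution s *)

Section PowerSeriesTheory.
Variable F : fieldType.
Implicit Types f g h w : fps F.

Lemma fcoefD f g n : fcoef (f + g) n = fcoef f n + fcoef g n. Proof. by []. Qed.
Lemma fcoefN f n : fcoef (- f) n = - fcoef f n. Proof. by []. Qed.
Lemma fcoef0 n : fcoef (0 : fps F) n = 0. Proof. by case: n. Qed.
Lemma fcoefM f g n :
  fcoef (f * g) n = \sum_(i < n.+1) fcoef f i * fcoef g (n - i).
Proof. by []. Qed.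
Lemma fcoef_sum I (r : seq I) (P : pred I) (f : I -> fps F) n :
  fcoef (\sum_(i <- r | P i) f i) n = \sum_(i <- r | P i) fcoef (f i) n.
Proof. by apply: (big_morph (fun f => fcoef f n)) => //; exact: fcoef0. Qed.
Lemma fcoefCM a g n : fcoef (fpsC a * g) n = a * fcoef g n.
Proof.
rewrite fcoefM big_ord_recl /= subn0 big1 ?addr0 // => i _.
by rewrite mul0r.
Qed.

Lemma fcoefM_val f g a b n :
  (forall i, (i < a)%N -> fcoef f i = 0) ->
  (forall i, (i < b)%N -> fcoef g i = 0) ->
  (n < a + b)%N -> fcoef (f * g) n = 0.
Proof.
move=> fa gb nab; rewrite fcoefM big1 // => i _.
have [ia|ai] := ltnP i a; first by rewrite fa ?mul0r.
rewrite gb ?mulr0 //; have := ltn_ord i; lia.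
Qed.

Lemma fcoefX_val w i n : fcoef w 0 = 0 -> (n < i)%N -> fcoef (w ^+ i) n = 0.
Proof.
move=> w0; elim: i n => // i IH n ni; rewrite exprS.
by apply: (@fcoefM_val _ _ 1 i) => // -[].
Qed.

(** Divided by its constant term, [f] is [1 - h] with [h] divisible by [T - 1], so the inverse is
    the geometric series in [h]. *)
Lemma fps_unit0 f : fcoef f 0 != 0 -> f \is a GRing.unit.
Proof.
move=> f0; set c := fcoef f 0 in f0.
pose h := 1 - fpsC c^-1 * f.
have h0 : fcoef h 0 = 0 by rewrite fcoefD fcoefN fcoefCM mulVf ?subrr.
(* The coefficient of index [n] of the infinite sum only needs the powers of [h] up to [n]. *)
pose g := FPS (fun n => fcoef (\sum_(i < n.+1) h ^+ i) n).
have gE N n : (n <= N)%N -> fcoef g n = fcoef (\sum_(i < N.+1) h ^+ i) n.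
  move=> nN; rewrite /g /= -(subnKC nN) -addSn big_split_ord fcoefD /=.
  rewrite [X in _ + X]fcoef_sum [X in _ + X]big1 ?addr0 // => i _.
  by rewrite fcoefX_val // leq_addr.
have e : (1 - h) * g = 1.
  apply: fpsP => n.
  have -> : fcoef ((1 - h) * g) n = fcoef ((1 - h) * \sum_(i < n.+1) h ^+ i) n.
    rewrite !fcoefM; apply: eq_bigr => i _; congr (_ * _).
    by rewrite (@gE n) // leq_subr.
  rewrite -opprB mulNr -subrX1 opprB fcoefD fcoefN.
  by rewrite fcoefX_val // subr0.
apply/asboolP; exists (fpsC c^-1 * g).
by rewrite mulrAC -e /h subKr.
Qed.

(** With [a] the order of [f], the coefficient of index [a + n] of [f * g] is
    [fcoef f a * fcoef g n] as soon as the earlier coefficients of [g] vanish. *)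
Lemma fps_mulf_eq0 f g : f * g = 0 -> f != 0 -> g = 0.
Proof.
move=> fg0 f0.
have /boolp.existsNP [i fi] : ~ (forall i, fcoef f i = 0).
  by move=> f00; move/eqP: f0; apply; apply: fpsP => n; rewrite f00 fcoef0.
have [a fa amin] : exists2 a, fcoef f a != 0 & forall i, (i < a)%N -> fcoef f i = 0.
  have ex : exists i, fcoef f i != 0 by exists i; apply/eqP.
  exists (ex_minn ex); first by case: ex_minnP.
  case: ex_minnP => a _ amin j ja; apply/eqP; apply: contraLR ja => /amin.
  by rewrite -leqNgt.
apply: fpsP => n; rewrite fcoef0; elim/ltn_ind: n => n IH.
have : fcoef (f * g) (a + n) = 0 by rewrite fg0 fcoef0.
rewrite fcoefM (bigD1 (inord a)) //= inordK ?ltnS ?leq_addr //.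
rewrite big1 => [|j ja]; last first.
  have [ja'|aj] := ltnP j a; first by rewrite amin ?mul0r.
  rewrite IH ?mulr0 //.
  have : nat_of_ord j != a.
    apply: contraNN ja => /eqP ja; apply/eqP/val_inj.
    by rewrite /= inordK // ltnS leq_addr.
  have := ltn_ord j; lia.
rewrite addr0 addKn => /eqP; rewrite mulf_eq0 => /orP[/eqP fa0|/eqP //].
by rewrite fa0 eqxx in fa.
Qed.

Let w0 : fcoef ((fpsT F)^-1 - 1) 0 = 0.
Proof.
have e : fcoef ((fpsT F)^-1) 0 = 1.
  have := congr1 (fun f => fcoef f 0) (mulVr (fpsT_unit F)).
  by rewrite /= big_ord_recl big_ord0 /= mulr1 addr0.
by rewrite fcoefD e fcoefN subrr.
Qed.
Local Notation w := ((fpsT F)^-1 - 1).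
Let wV i n : (n < i)%N -> fcoef (w ^+ i) n = 0.
Proof. exact: fcoefX_val w0. Qed.

Let fps_sE N f n : (n <= N)%N ->
  fcoef (fps_s f) n = \sum_(i < N.+1) fcoef f i * fcoef (w ^+ i) n.
Proof.
move=> nN; rewrite -(subnKC nN) -addSn big_split_ord /=.
rewrite [X in _ = _ + X]big1 ?addr0 // => i _.
by rewrite wV ?mulr0 // leq_addr.
Qed.

Lemma fps_sD : {morph @fps_s F : f g / f + g}.
Proof.
move=> f g; apply: fpsP => n; rewrite fcoefD /= -big_split.
by apply: eq_bigr => i _; rewrite /= mulrDl.
Qed.

Lemma fps_s0 : fps_s (0 : fps F) = 0.
Proof. exact: (fps_sC (0 : F)). Qed.

Lemma fps_sN f : fps_s (- f) = - fps_s f.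
Proof. by apply/eqP; rewrite -subr_eq0 opprK -fps_sD addNr fps_s0. Qed.

(** Up to index [n], [fps_s] is the evaluation of a truncated polynomial at [w = T^-1 - 1], because
    [w ^+ i] has order at least [i]; evaluation is multiplicative. *)
Lemma fps_sM : {morph @fps_s F : f g / f * g}.
Proof.
move=> f g; apply: fpsP => n.
pose P h : {poly F} := \poly_(i < n.+1) fcoef h i.
have ev h : forall j, (j <= n)%N ->
    fcoef (fps_s h) j = fcoef (map_poly (@fpsC F) (P h)).[w] j.
  move=> j jn; rewrite (fps_sE _ jn) (@horner_coef_wide _ n.+1); last first.
    by rewrite (leq_trans (size_poly _ _)) // size_poly.
  rewrite fcoef_sum; apply: eq_bigr => i _.
  by rewrite coef_map fcoefCM coef_poly ltn_ord.
rewrite (ev (f * g)) //.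
have -> : fcoef (fps_s f * fps_s g) n =
    fcoef ((map_poly (@fpsC F) (P f)).[w] * (map_poly (@fpsC F) (P g)).[w]) n.
  rewrite !fcoefM; apply: eq_bigr => i _.
  by rewrite !ev ?leq_subr // -ltnS.
rewrite -hornerM -rmorphM.
have sz : (size (P f * P g)%R <= n.+1 + n.+1)%N.
  apply: leq_trans (size_polyMleq _ _) _.
  apply: leq_trans (leq_pred _) _.
  by apply: leq_add; exact: size_poly.
rewrite (@horner_coef_wide _ n.+1); last first.
  by rewrite (leq_trans (size_poly _ _)) // size_poly.
rewrite (@horner_coef_wide _ (n.+1 + n.+1)); last first.
  exact: leq_trans (size_poly _ _) sz.
rewrite big_split_ord fcoefD !fcoef_sum [X in _ = _ + X]big1 ?addr0.
  apply: eq_bigr => i _; rewrite !coef_map !fcoefCM; congr (_ * _).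
  rewrite coef_poly ltn_ord coefM; apply: eq_bigr => j _.
  by rewrite !coef_poly !ifT //; move: (ltn_ord i) (ltn_ord j) => /=; lia.
move=> i _; rewrite coef_map fcoefCM wV ?mulr0 //=; lia.
Qed.

Lemma fps_s1 : fps_s (1 : fps F) = 1.
Proof. exact: (fps_sC (1 : F)). Qed.

Lemma fps_sX f n : fps_s (f ^+ n) = fps_s f ^+ n.
Proof. by elim: n => [|n IH]; rewrite ?fps_s1 // !exprS fps_sM IH. Qed.

Lemma fps_sV f : f \is a GRing.unit -> fps_s f^-1 = (fps_s f)^-1.
Proof.
move=> fu; have e : fps_s f * fps_s f^-1 = 1 by rewrite -fps_sM mulrV // fps_s1.
have su : fps_s f \is a GRing.unit by apply/unitrP; exists (fps_s f^-1); rewrite mulrC.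
by rewrite -[LHS](mulKr su) e mulr1.
Qed.

Lemma fps_s_unit f : f \is a GRing.unit -> fps_s f \is a GRing.unit.
Proof.
move=> fu; apply/unitrP; exists (fps_s f^-1).
by rewrite -!fps_sM mulVr // mulrV // fps_s1.
Qed.

Lemma fps_s_sum I (r : seq I) (P : pred I) (f : I -> fps F) :
  fps_s (\sum_(i <- r | P i) f i) = \sum_(i <- r | P i) fps_s (f i).
Proof. by apply: (big_morph _ fps_sD fps_s0). Qed.

Lemma fps_sK : involutive (@fps_s F).
Proof.
move=> f; apply: fpsP => n.
pose X := fpsT F - 1.
have X0 : fcoef X 0 = 0 by rewrite fcoefD /= subrr.
have XE i j : fcoef (X ^+ i) j = (i == j)%:R.
  have X1 : forall j, fcoef X j = (j == 1%N)%:R.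
    by move=> [|[|l]]; rewrite fcoefD //= ?subrr ?subr0 ?addr0 ?oppr0.
  elim: i j => [|i IH] j; first by case: j.
  rewrite exprS fcoefM; case: j => [|j].
    by rewrite big_ord_recl big_ord0 X0 mul0r addr0.
  rewrite 2!big_ord_recl big1 ?addr0 => [|l _]; last by rewrite X1 mul0r.
  by rewrite !X1 mul0r add0r mul1r IH /= subSS subn0.
have sw : fps_s w = X.
  by rewrite fps_sD fps_sN fps_s1 fps_sV ?fpsT_unit // fps_sT invrK.
(* Up to index [n], [fps_s f] only depends on the truncation [g] of [f], a polynomial in
   [X = T - 1], and [s] exchanges [X] and [w]. *)
pose g := \sum_(i < n.+1) fpsC (fcoef f i) * X ^+ i.
have sX : fps_s X = w by rewrite fps_sD fps_sN fps_s1 fps_sT.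
have gf j : (j <= n)%N -> fcoef (fps_s g) j = fcoef (fps_s f) j.
  move=> jn; rewrite (fps_sE f jn) fps_s_sum fcoef_sum.
  by apply: eq_bigr => i _; rewrite fps_sM fps_sC fps_sX sX fcoefCM.
have -> : fcoef (fps_s (fps_s f)) n = fcoef (fps_s (fps_s g)) n.
  rewrite !(@fps_sE n) //; apply: eq_bigr => i _.
  by rewrite gf // -ltnS.
rewrite !fps_s_sum fcoef_sum (bigD1 ord_max) // big1 => [|i ni].
  rewrite [LHS]addr0 !fps_sM !fps_sC !fps_sX sX sw fcoefCM XE eqxx mulr1 //.
rewrite !fps_sM !fps_sC !fps_sX sX sw fcoefCM XE.
rewrite (negPf (_ : nat_of_ord i != n)) ?mulr0 //.
Qed.

End PowerSeriesTheory.

(** * Quantum integers, and commutation of divided powers with E, F, K *)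

Section UqModules.
Variables (S : comUnitRingType) (v : qparam S).
Local Notation q := (qv v).
Local Notation h := ((q - q^-1)^-1).
Local Notation U := (Uq v).

Let qu := qv_unit v.

Lemma qD (a b : int) : q ^ a * q ^ b = q ^ (a + b).
Proof. by rewrite exprzDr. Qed.
Lemma qX_unit (a : int) : q ^ a \is a GRing.unit.
Proof. exact: unitrXz. Qed.
Lemma qNK (a : int) : q ^ a * q ^ (- a) = 1.
Proof. by rewrite qD subrr. Qed.
Lemma qKN (a : int) : q ^ (- a) * q ^ a = 1.
Proof. by rewrite qD addNr. Qed.
Lemma qX n : q ^+ n = q ^ n%:Z. Proof. by []. Qed.
Lemma qXN n : q ^- n = q ^ (- n%:Z). Proof. by rewrite -exprnN. Qed.
Lemma q1 : q = q ^ 1. Proof. by []. Qed.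
Lemma qV : q^-1 = q ^ (- 1). Proof. by []. Qed.
Lemma h_unit : h \is a GRing.unit. Proof. by rewrite unitrV qvB_unit. Qed.
Lemma hB : h * (q - q^-1) = 1. Proof. by rewrite mulVr ?qvB_unit. Qed.

(* [z] for an arbitrary integer z *)
Definition qi (z : int) : S := h * (q ^ z - q ^ (- z)).
Lemma qintE n : qint v n = qi n%:Z.
Proof. by rewrite /qint qXN mulrC. Qed.
Lemma qi0 : qi 0 = 0. Proof. by rewrite /qi oppr0 subrr mulr0. Qed.
Lemma qiN z : qi (- z) = - qi z.
Proof. by rewrite /qi opprK -mulrN opprB. Qed.
Lemma qi1 : qi 1 = 1. Proof. exact: hB. Qed.
Lemma qiD a b : qi (a + b) = q ^ b * qi a + q ^ (- a) * qi b.
Proof.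
rewrite /qi ![_ * (h * _)]mulrCA -mulrDr; congr (_ * _).
rewrite !mulrBr !qD addrA (addrC b a) (addrC (- a) b) subrK -opprD.
by [].
Qed.
Lemma qiD' a b : qi (a + b) = q ^ (- b) * qi a + q ^ a * qi b.
Proof. by rewrite addrC qiD addrC. Qed.

Lemma qintS n : qint v n.+1 = q ^ 1 * qint v n + q ^ (- n%:Z).
Proof. by rewrite !qintE -addn1 PoszD qiD qi1 mulr1. Qed.
Lemma qintS' n : qint v n.+1 = q ^ (- 1) * qint v n + q ^ n%:Z.
Proof. by rewrite !qintE -addn1 PoszD qiD' qi1 mulr1. Qed.
Lemma qint1 : qint v 1 = 1.
Proof. by rewrite qintE qi1. Qed.

Lemma gen_ind (P : U -> Prop) :
  P (gE v) -> P (gF v) -> P (gK v) -> P (gKi v) -> (forall c, P c%:A) ->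
  (forall x y, P x -> P y -> P (x + y)) ->
  (forall x y, P x -> P y -> P (x * y)) -> forall x, P x.
Proof.
move=> PE PF PK PKi PC PD PM; elim/Uq_ind; elim=> //.
- by move=> c; rewrite -[X in P X]/(UqC v c) UqCE.
- by move=> x Px y Py; rewrite -(Uq_addE v); exact: PD.
- by move=> x Px y Py; rewrite -(Uq_mulE v); exact: PM.
Qed.

Lemma actC (A : lmodType S) (a : uaction v A) c x : act a c%:A x = c *: x.
Proof. by rewrite actZ act1. Qed.

Lemma uhom_gen (A B : lmodType S) (a : uaction v A) (b : uaction v B)
    (f : A -> B) : linear f ->
  (forall x, f (opE a x) = opE b (f x)) ->
  (forall x, f (opF a x) = opF b (f x)) ->
  (forall x, f (opK a x) = opK b (f x)) -> uhom a b f.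
Proof.
move=> lf fE fF fK; split=> //; elim/gen_ind.
- by move=> x; rewrite !actE.
- by move=> x; rewrite !actF.
- by move=> x; rewrite !actK.
- by move=> x; rewrite !actKi -{2}[x](opKKi a) fK opKiK.
- by move=> c x; rewrite !actC (linZ lf).
- by move=> y z fy fz x; rewrite !actD (linD lf) fy fz.
- by move=> y z fy fz x; rewrite !actM fy fz.
Qed.

Section OneModule.
Variables (A : lmodType S) (a : uaction v A).
Local Notation E := (opE a).
Local Notation F := (opF a).
Local Notation K := (opK a).
Local Notation Ki := (opKi a).

Lemma K_F x : K (F x) = q ^ (- 2) *: F (K x).
Proof. by rewrite -[RHS]/(q ^- 2 *: _) -opKF opKiK. Qed.
Lemma K_E x : K (E x) = q ^ 2 *: E (K x).
Proof. by rewrite -[RHS]/(q ^+ 2 *: _) -opKE opKiK. Qed.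
Lemma Ki_F x : Ki (F x) = q ^ 2 *: F (Ki x).
Proof.
have := K_F (Ki x); rewrite opKKi => e.
have := congr1 Ki e; rewrite opKiK (linZ (opKi_lin a)) => ->.
by rewrite scalerA qD scale1r.
Qed.
Lemma Ki_E x : Ki (E x) = q ^ (- 2) *: E (Ki x).
Proof.
have := K_E (Ki x); rewrite opKKi => e.
have := congr1 Ki e; rewrite opKiK (linZ (opKi_lin a)) => ->.
by rewrite scalerA qD scale1r.
Qed.
Lemma E_F x : E (F x) = F (E x) + h *: (K x - Ki x).
Proof. by rewrite -opEF addrC subrK. Qed.

Lemma wt_Ki c x : c \is a GRing.unit -> K x = c *: x -> Ki x = c^-1 *: x.
Proof.
move=> cu e; rewrite -[in RHS](opKiK a x) e (linZ (opKi_lin a)) scalerA.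
by rewrite mulVr // scale1r.
Qed.
Lemma wt_F c x : K x = c *: x -> K (F x) = (q ^ (- 2) * c) *: F x.
Proof. by move=> e; rewrite K_F e (linZ (opF_lin a)) scalerA. Qed.
Lemma wt_E c x : K x = c *: x -> K (E x) = (q ^ 2 * c) *: E x.
Proof. by move=> e; rewrite K_E e (linZ (opE_lin a)) scalerA. Qed.

Hypothesis qn : forall n, qint v n.+1 \is a GRing.unit.
Local Notation dEa n := (act a (dE v n)).
Local Notation dFa n := (act a (dF v n)).

Lemma qfactS n : qfact v n.+1 = qfact v n * qint v n.+1.
Proof. by rewrite /qfact big_nat_recr. Qed.
Lemma qfact0 : qfact v 0 = 1.
Proof. by rewrite /qfact big_nil. Qed.
Lemma qfact_unit n : qfact v n \is a GRing.unit.
Proof. by elim: n => [|n IH]; rewrite ?qfact0 ?unitr1 // qfactS unitrM IH qn. Qed.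

Lemma dFS n : gF v * dF v n = qint v n.+1 *: dF v n.+1.
Proof.
rewrite /dF qfactS -scalerAr -exprS scalerA invrM ?qfact_unit //.
by rewrite mulrA mulrV // mul1r.
Qed.
Lemma dFSr n : dF v n * gF v = qint v n.+1 *: dF v n.+1.
Proof. by rewrite -dFS /dF -scalerAl -scalerAr -exprS -exprSr. Qed.
Lemma dES n : gE v * dE v n = qint v n.+1 *: dE v n.+1.
Proof.
rewrite /dE qfactS -scalerAr -exprS scalerA invrM ?qfact_unit //.
by rewrite mulrA mulrV // mul1r.
Qed.
Lemma dESr n : dE v n * gE v = qint v n.+1 *: dE v n.+1.
Proof. by rewrite -dES /dE -scalerAl -scalerAr -exprS -exprSr. Qed.
Lemma dF0 : dF v 0 = 1.
Proof. by rewrite /dF qfact0 invr1 scale1r expr0. Qed.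
Lemma dE0 : dE v 0 = 1.
Proof. by rewrite /dE qfact0 invr1 scale1r expr0. Qed.

Lemma F_dF n x : F (dFa n x) = qint v n.+1 *: dFa n.+1 x.
Proof. by rewrite -actF -actM dFS actZ. Qed.
Lemma dF_F n x : dFa n (F x) = qint v n.+1 *: dFa n.+1 x.
Proof. by rewrite -actF -actM dFSr actZ. Qed.
Lemma E_dE n x : E (dEa n x) = qint v n.+1 *: dEa n.+1 x.
Proof. by rewrite -actE -actM dES actZ. Qed.
Lemma dE_E n x : dEa n (E x) = qint v n.+1 *: dEa n.+1 x.
Proof. by rewrite -actE -actM dESr actZ. Qed.
Lemma dFa0 x : dFa 0 x = x. Proof. by rewrite dF0 act1. Qed.
Lemma dEa0 x : dEa 0 x = x. Proof. by rewrite dE0 act1. Qed.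

Lemma scalerI_unit (B : lmodType S) c (x y : B) :
  c \is a GRing.unit -> c *: x = c *: y -> x = y.
Proof. by move=> cu /(congr1 ( *:%R c^-1)); rewrite !scalerA mulVr // !scale1r. Qed.

Lemma scalerC (B : lmodType S) c d (x : B) : c *: (d *: x) = d *: (c *: x).
Proof. by rewrite !scalerA mulrC. Qed.

Lemma K_dF n x : K (dFa n x) = q ^ (- (2 * n)%:Z) *: dFa n (K x).
Proof.
elim: n => [|n IH]; first by rewrite !dFa0 scale1r.
apply: (scalerI_unit (qn n)); rewrite -(linZ (opK_lin a)) -F_dF K_F IH.
rewrite (linZ (opF_lin a)) F_dF !scalerA qD mulrC; congr (_ * _ ^ _ *: _); lia.
Qed.
Lemma Ki_dF n x : Ki (dFa n x) = q ^ (2 * n)%:Z *: dFa n (Ki x).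
Proof.
elim: n => [|n IH]; first by rewrite !dFa0 scale1r.
apply: (scalerI_unit (qn n)); rewrite -(linZ (opKi_lin a)) -F_dF Ki_F IH.
rewrite (linZ (opF_lin a)) F_dF !scalerA qD mulrC; congr (_ * _ ^ _ *: _); lia.
Qed.
Lemma K_dE n x : K (dEa n x) = q ^ (2 * n)%:Z *: dEa n (K x).
Proof.
elim: n => [|n IH]; first by rewrite !dEa0 scale1r.
apply: (scalerI_unit (qn n)); rewrite -(linZ (opK_lin a)) -E_dE K_E IH.
rewrite (linZ (opE_lin a)) E_dE !scalerA qD mulrC; congr (_ * _ ^ _ *: _); lia.
Qed.
Lemma Ki_dE n x : Ki (dEa n x) = q ^ (- (2 * n)%:Z) *: dEa n (Ki x).
Proof.
elim: n => [|n IH]; first by rewrite !dEa0 scale1r.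
apply: (scalerI_unit (qn n)); rewrite -(linZ (opKi_lin a)) -E_dE Ki_E IH.
rewrite (linZ (opE_lin a)) E_dE !scalerA qD mulrC; congr (_ * _ ^ _ *: _); lia.
Qed.

(** Induction through F F^(n+1) = [n+2] F^(n+2); the two recursions [qintS] and [qintS'] take care
    of the coefficients of K and of K^-1 respectively. *)
Lemma E_dF n x : E (dFa n.+1 x) = dFa n.+1 (E x) +
  h *: dFa n (q ^ (- n%:Z) *: K x - q ^ n%:Z *: Ki x).
Proof.
have lF i := act_lin a (dF v i).
elim: n x => [|n IH] x.
  apply: (scalerI_unit (qn 0)); rewrite scalerDr -(linZ (opE_lin a)) -F_dF.
  by rewrite -dF_F !dFa0 qintE qi1 !scale1r E_F.
apply: (scalerI_unit (qn n.+1)); rewrite scalerDr -(linZ (opE_lin a)) -F_dF.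
rewrite E_F IH (linD (opF_lin a)) F_dF -addrA; congr (_ + _).
rewrite (linZ (opF_lin a)) F_dF K_dF Ki_dF -scalerDr.
rewrite [RHS]scalerC; congr (_ *: _); rewrite !(linB (lF _)) !(linZ (lF _)).
rewrite !scalerBr !scalerA addrACA -scalerDl -opprD -scalerDl.
congr (_ *: _ - _ *: _).
  rewrite [in RHS]qintS; move: (qint v n.+1) => u; rewrite mulrDl mulrAC !qD mulrC.
  by congr (q ^ _ * _ + q ^ _); lia.
rewrite [in RHS]qintS'; move: (qint v n.+1) => u; rewrite mulrDl mulrAC !qD mulrC.
by congr (q ^ _ * _ + q ^ _); lia.
Qed.

Lemma dE_F n x : dEa n.+1 (F x) = F (dEa n.+1 x) +
  h *: dEa n (q ^ n%:Z *: K x - q ^ (- n%:Z) *: Ki x).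
Proof.
have lE i := act_lin a (dE v i).
elim: n x => [|n IH] x.
  apply: (scalerI_unit (qn 0)); rewrite scalerDr -(linZ (opF_lin a)) -dE_E.
  by rewrite -E_dE !dEa0 qintE qi1 !scale1r E_F.
apply: (scalerI_unit (qn n.+1)); rewrite scalerDr -(linZ (opF_lin a)) -!dE_E.
rewrite E_F (linD (lE _)) IH -addrA; congr (_ + _).
rewrite (linZ (lE _)) -scalerDr [RHS]scalerC; congr (_ *: _).
rewrite K_E Ki_E !(linB (lE _)) !(linZ (lE _)) !dE_E !scalerA.
rewrite !scalerBr !scalerA addrACA -{2}[dEa _ (K x)]scale1r.
rewrite -{2}[dEa _ (Ki x)]scale1r -scalerDl -opprD -scalerDl.
congr (_ *: _ - _ *: _).
  rewrite [in RHS]qintS; move: (qint v n.+1) => u; rewrite mulrDl [in RHS]mulrAC !qD addNr.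
  by congr (q ^ _ * _ + _); lia.
rewrite [in RHS]qintS'; move: (qint v n.+1) => u; rewrite mulrDl [in RHS]mulrAC !qD subrr.
by congr (q ^ _ * _ + _); lia.
Qed.

End OneModule.
End UqModules.

(* Decides equalities of monomials in powers of q: the powers are moved to the
   right and merged. *)
Lemma q_cancel (S : comUnitRingType) (v : qparam S) (x y : S) :
  x * qv v ^ 0 = y * qv v ^ 0 -> x = y.
Proof. by rewrite expr0z !mulr1. Qed.
Ltac q_collect :=
  repeat match goal with
  | |- context [@GRing.mul _ ?x (@GRing.mul _ ?y ?z)] => rewrite (mulrA x y z)
  end;
  repeat match goal with
  | |- context [@GRing.mul _ (@GRing.mul _ ?x (@exprz ?R ?u ?a)) ?y] =>
    lazymatch y with
    | (@exprz _ _ ?b) =>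
      rewrite -(mulrA x (@exprz R u a) (@exprz R u b)) -(exprzDr (qv_unit _) a b)
    | _ => rewrite (mulrAC x (@exprz R u a) y)
    end
  | |- context [@GRing.mul _ (@exprz ?R ?u ?a) ?y] =>
    lazymatch y with
    | (@exprz _ _ ?b) => rewrite -(exprzDr (qv_unit _) a b)
    | _ => rewrite (mulrC (@exprz R u a) y)
    end
  end.
Ltac qmono :=
  match goal with |- context [qv ?v] =>
    apply: (q_cancel (v := v)); q_collect
  end;
  first [ congr (_ * _ ^ _); first [by ring | lia]
        | congr (_ ^ _); lia ].

Lemma fsum_nat (V : zmodType) (f : nat -> V) N :
  (forall j, (N <= j)%N -> f j = 0) ->
  \sum_(j \in [set: nat]%classic) f j = \sum_(j < N) f j.
Proof.
move=> fN; rewrite (fsbigE (index_iota 0 N)) ?iota_uniq //; last first.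
  by move=> j _; rewrite mem_index_iota -leqNgt => /fN.
rewrite -(big_mkord xpredT); apply: eq_bigl => j.
by rewrite mem_set.
Qed.

(** Serves where two series cancel after a shift of the index by one; the conditions on [g 0] and
    [f N] are the boundary terms. *)
Lemma sum_shift (V : zmodType) (f g : nat -> V) N :
  g 0%N = 0 -> f N = 0 -> (forall j, (j < N)%N -> g j.+1 = f j) ->
  \sum_(j < N.+1) f j = \sum_(j < N.+1) g j.
Proof.
move=> g0 fN gf; rewrite big_ord_recr [RHS]big_ord_recl /= g0 fN addr0 add0r.
by apply: eq_bigr => j _; rewrite /= gf.
Qed.

(** * Invariant pairings, and the operation L on them *)

Section Pairings.
Variables (S : comUnitRingType) (v : qparam S).
Local Notation q := (qv v).
Local Notation h := ((q - q^-1)^-1).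
Local Notation U := (Uq v).

(** Invariance on the generators only, with [varrho] expanded, in a form that can be checked by
    computation. [pair_act] recovers invariance under all of U, and [invariant_is_pairing] is the
    converse over R. *)
Record pairing (A B : lmodType S) (a : uaction v A) (b : uaction v B)
    (chi : A -> B -> S) : Prop := Pairing {
  pair_linl : forall y c x x', chi (c *: x + x') y = c * chi x y + chi x' y;
  pair_linr : forall x c y y', chi x (c *: y + y') = c * chi x y + chi x y';
  pairE : forall x y, chi (opE a x) y = q * chi x (opK b (opF b y));
  pairF : forall x y, chi (opF a x) y = q * chi x (opKi b (opE b y));
  pairK : forall x y, chi (opK a x) y = chi x (opK b y)
}.

Section Basics.
Variables (A B : lmodType S) (a : uaction v A) (b : uaction v B).
Variable chi : A -> B -> S.
Hypothesis pc : pairing a b chi.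

Lemma pairlL y : linear (chi^~ y : A -> S^o).
Proof. by move=> c x x'; exact: (pair_linl pc). Qed.
Lemma pairlR x : linear (chi x : B -> S^o).
Proof. by move=> c y y'; exact: (pair_linr pc). Qed.
Lemma pair0l y : chi 0 y = 0. Proof. exact: (lin0 (pairlL y)). Qed.
Lemma pair0r x : chi x 0 = 0. Proof. exact: (lin0 (pairlR x)). Qed.
Lemma pairDl x x' y : chi (x + x') y = chi x y + chi x' y.
Proof. exact: (linD (pairlL y)). Qed.
Lemma pairDr x y y' : chi x (y + y') = chi x y + chi x y'.
Proof. exact: (linD (pairlR x)). Qed.
Lemma pairZl c x y : chi (c *: x) y = c * chi x y.
Proof. exact: (linZ (pairlL y)). Qed.
Lemma pairZr c x y : chi x (c *: y) = c * chi x y.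
Proof. exact: (linZ (pairlR x)). Qed.
Lemma pairNl x y : chi (- x) y = - chi x y.
Proof. exact: (linN (pairlL y)). Qed.
Lemma pairNr x y : chi x (- y) = - chi x y.
Proof. exact: (linN (pairlR x)). Qed.
Lemma pairBr x y y' : chi x (y - y') = chi x y - chi x y'.
Proof. exact: (linB (pairlR x)). Qed.
Lemma pairBl x x' y : chi (x - x') y = chi x y - chi x' y.
Proof. exact: (linB (pairlL y)). Qed.
Lemma pair_sumr (I : Type) (r : seq I) (P : pred I) (g : I -> B) x :
  chi x (\sum_(i <- r | P i) g i) = \sum_(i <- r | P i) chi x (g i).
Proof. exact: (lin_sum (pairlR x)). Qed.
Lemma pair_suml (I : Type) (r : seq I) (P : pred I) (g : I -> A) y :
  chi (\sum_(i <- r | P i) g i) y = \sum_(i <- r | P i) chi (g i) y.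
Proof. exact: (lin_sum (pairlL y)). Qed.

Lemma pairKi x y : chi (opKi a x) y = chi x (opKi b y).
Proof. by rewrite -{1}[y](opKKi b) -(pairK pc) opKKi. Qed.

Lemma pairFr x y : chi x (opF b y) = q ^ (- 1) * chi (opE a (opKi a x)) y.
Proof.
by rewrite (pairE pc) pairKi opKiK mulrA mulVr ?qv_unit // mul1r.
Qed.
Lemma pairEr x y : chi x (opE b y) = q ^ (- 1) * chi (opF a (opK a x)) y.
Proof.
by rewrite (pairF pc) (pairK pc) opKKi mulrA mulVr ?qv_unit // mul1r.
Qed.

Lemma varrhoD : {morph @varrho S v : x y / x + y}.
Proof. exact: (UhomD (varrho_rels v)). Qed.
Lemma varrhoC c : varrho (c%:A : U) = c%:A.
Proof. exact: (UhomC (varrho_rels v)). Qed.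
Lemma varrho_gens :
  [/\ varrho (gE v) = q *: (gK v * gF v), varrho (gF v) = q *: (gKi v * gE v),
      varrho (gK v) = gK v & varrho (gKi v) = gKi v].
Proof. exact: (Uhom_gens (varrho_rels v)). Qed.

Lemma pair_act u x y : chi (act a u x) y = chi x (act b (varrho u) y).
Proof.
have [vE vF vK vKi] := varrho_gens.
elim/gen_ind: u x y.
- by move=> x y; rewrite actE vE actZ actM actK actF pairZr (pairE pc).
- by move=> x y; rewrite actF vF actZ actM actKi actE pairZr (pairF pc).
- by move=> x y; rewrite actK vK actK (pairK pc).
- by move=> x y; rewrite actKi vKi actKi pairKi.
- by move=> c x y; rewrite varrhoC !actC pairZl pairZr.
- by move=> u w IHu IHw x y; rewrite varrhoD !actD pairDl pairDr IHu IHw.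
- by move=> u w IHu IHw x y; rewrite varrhoM !actM IHu IHw.
Qed.

End Basics.

Lemma rho1_gens : [/\ rho1 (gE v) = - q *: gF v, rho1 (gF v) = - q^-1 *: gE v,
    rho1 (gK v) = gKi v & rho1 (gKi v) = gK v].
Proof. exact: (Uhom_gens (rho1_rels v)). Qed.
Lemma Tminus1_gens : [/\ Tminus1 (gE v) = - (gKi v * gF v),
    Tminus1 (gF v) = - (gE v * gK v),
    Tminus1 (gK v) = gKi v & Tminus1 (gKi v) = gK v].
Proof. exact: (Uhom_gens (Tminus1_rels v)). Qed.

Lemma rho1_dE j : rho1 (dE v j) = (- q) ^+ j *: dF v j.
Proof.
have [rE _ _ _] := rho1_gens.
rewrite /dE /dF linearZ /= rmorphXn /= rE scalerA mulrC -scalerA; congr (_ *: _).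
by rewrite exprZn.
Qed.

(** As [rho1] sends E^(j) to (-q)^j F^(j), the sum defining L can be written with F^(j) in both
    arguments; [cL] is its coefficient, in which the signs have cancelled. [cJ] is the coefficient
    of Psibar. *)
Definition cL j := q ^- (j * j.-1)./2 * q ^+ j * qbrace v j.
Definition cJ j := q ^+ (j * j.-1)./2 * qbrace v j.

Lemma qbraceS n : qbrace v n.+1 = qbrace v n * (q ^+ n.+1 - q ^- n.+1).
Proof. by rewrite /qbrace big_nat_recr. Qed.
Lemma qbrace0 : qbrace v 0 = 1.
Proof. by rewrite /qbrace big_nil. Qed.
Lemma tri_half j : ((j.+1 * j)./2 = (j * j.-1)./2 + j)%N.
Proof.
rewrite (_ : (j.+1 * j = j * j.-1 + j.*2)%N); first by rewrite halfD odd_double andbF doubleK.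
by case: j => //= j; lia.
Qed.

Lemma qB_qint n : q ^+ n - q ^- n = (q - q^-1) * qint v n.
Proof. by rewrite /qint mulrC divrK ?qvB_unit. Qed.

Lemma cLS j : cL j.+1 = cL j * (q ^ (1 - j%:Z) * (q - q^-1) * qint v j.+1).
Proof.
rewrite /cL qbraceS qB_qint tri_half exprD invrM ?unitrX ?qv_unit // exprS.
have -> : q ^ (1 - j%:Z) = q * q ^- j by rewrite exprzDr ?qv_unit // -exprnN.
move: (qint v j.+1) (qbrace v j) (q ^+ _) (q ^- _) (q ^- _) => *; ring.
Qed.
Lemma cJS j : cJ j.+1 = cJ j * (q ^ j%:Z * (q - q^-1) * qint v j.+1).
Proof.
rewrite /cJ qbraceS qB_qint tri_half exprD -[q ^ j%:Z]/(q ^+ j).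
move: (q ^+ _) (q ^+ _) (qbrace v j) (qint v j.+1) => *; ring.
Qed.
Lemma cL0 : cL 0 = 1.
Proof. by rewrite /cL qbrace0 !mulr1 expr0 invr1. Qed.
Lemma cJ0 : cJ 0 = 1.
Proof. by rewrite /cJ qbrace0 !mulr1. Qed.

Hypothesis qn : forall n, qint v n.+1 \is a GRing.unit.

(* The sum is finite when F is locally nilpotent on A. *)
Definition pairL (A B : lmodType S) (a : uaction v A) (b : uaction v B)
    (chi : A -> B -> S) (x : A) (y : B) : S :=
  \sum_(j \in [set: nat]%classic)
    (-1) ^+ j * q ^- (j * j.-1)./2 * qbrace v j *
    chi (act a (dF v j) x) (act b (rho1 (dE v j)) y).

Definition Fnil (A : lmodType S) (a : uaction v A) :=
  forall x, exists N, forall j, (N <= j)%N -> act a (dF v j) x = 0.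

Section PairL.
Variables (A B : lmodType S) (a : uaction v A) (b : uaction v B).
Variable chi : A -> B -> S.
Hypothesis pc : pairing a b chi.

Lemma pairLE N x y : (forall j, (N <= j)%N -> act a (dF v j) x = 0) ->
  pairL a b chi x y =
  \sum_(j < N) cL j * chi (act a (dF v j) x) (act b (dF v j) y).
Proof.
move=> xN; rewrite /pairL (fsum_nat (N := N)) => [|j /xN ->]; last first.
  by rewrite (pair0l pc) mulr0.
apply: eq_bigr => j _.
have -> : act b (rho1 (dE v j)) y = (- q) ^+ j *: act b (dF v j) y.
  by rewrite rho1_dE actZ.
rewrite (pairZr pc) mulrA; congr (_ * _).
rewrite -[- q]mulN1r exprMn /cL.
move: (qbrace v j) (q ^+ _) (q ^- _) => x3 x2 x1.
transitivity ((-1) ^+ j * (-1) ^+ j * (x1 * x2 * x3)); first by ring.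
by rewrite -exprD addnn -mul2n exprM sqrrN !expr1n mul1r.
Qed.

Hypothesis nA : Fnil a.
Local Notation chiL := (pairL a b chi).

Let dFl n x y c : act a (dF v n) (c *: x + y) = c *: act a (dF v n) x + act a (dF v n) y.
Proof. exact: act_lin. Qed.

Let nbound (xs : seq A) :
  exists N, forall x, x \in xs -> forall j, (N <= j)%N -> act a (dF v j) x = 0.
Proof.
elim: xs => [|x xs [N NP]]; first by exists 0%N.
have [N' NP'] := nA x; exists (maxn N N') => y; rewrite inE => /orP[/eqP->|yx] j.
  by rewrite geq_max => /andP[_]; exact: NP'.
by rewrite geq_max => /andP[jN _]; exact: NP.
Qed.

Let nb1 N x : (forall j, (N <= j)%N -> act a (dF v j) x = 0) ->
  forall j, (N.+1 <= j)%N -> act a (dF v j) x = 0.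
Proof. by move=> xN j /ltnW; exact: xN. Qed.

(** Moving a generator through the F^(j) of either argument leaves terms from the commutator of E
    with F^(j). By the recursion [cLS], those arising at consecutive indices cancel, and what
    remains is invariance with the roles of E and F exchanged by T'_-1. *)
Lemma pairL_pairing :
  pairing (twist (@Tminus1 S v) a) (twist (@Tminus1 S v) b) chiL.
Proof.
have dK n x : act a (dF v n) (opK a x) = q ^ (2 * n)%:Z *: opK a (act a (dF v n) x).
  by rewrite (K_dF _ qn) scalerA qNK scale1r.
have dK' n x : act b (dF v n) (opK b x) = q ^ (2 * n)%:Z *: opK b (act b (dF v n) x).
  by rewrite (K_dF _ qn) scalerA qNK scale1r.
have dKi n x : act a (dF v n) (opKi a x) = q ^ (- (2 * n)%:Z) *: opKi a (act a (dF v n) x).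
  by rewrite (Ki_dF _ qn) scalerA qKN scale1r.
have dKi' n x : act b (dF v n) (opKi b x) = q ^ (- (2 * n)%:Z) *: opKi b (act b (dF v n) x).
  by rewrite (Ki_dF _ qn) scalerA qKN scale1r.
have cLh j : cL j.+1 * h = cL j * q ^ (1 - j%:Z) * qint v j.+1.
  rewrite cLS; have := hB v; move: (q - q^-1) h (q ^ _) (qint _ _) (cL j).
  move=> d h' x u c e; transitivity (c * x * u * (h' * d)); first by ring.
  by rewrite e mulr1.
have LF x y : chiL (opKi a (opF a x)) y = q ^ (- 1) * chiL x (opE b y).
  have [N NP] := nbound [:: x; opKi a (opF a x)].
  have xN : forall j, (N <= j)%N -> act a (dF v j) x = 0.
    by apply: NP; rewrite inE eqxx.
  have x'N : forall j, (N <= j)%N -> act a (dF v j) (opKi a (opF a x)) = 0.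
    by apply: NP; rewrite !inE eqxx orbT.
  rewrite !(pairLE (N := N.+1)) ?mulr_sumr; [|exact: nb1..].
  (* [l] is the left-hand summand and [l + f - g] the right-hand one; [f] and [g] agree after a
     shift of the index, hence have the same sum. *)
  pose al j := chi (act a (dF v j.+1) (opK a x)) (act b (dF v j) y).
  pose be j := chi (act a (dF v j.+1) (opKi a x)) (act b (dF v j) y).
  pose l j := cL j * (q ^ 2 * qint v j.+1) * be j.
  pose f j := cL j * (q ^ (- 2 - (2 * j)%:Z) * qint v j.+1) * al j - l j.
  pose g j := if j is j'.+1 then q ^ (- 1) * (cL j * h) *
    (q ^ (- j'%:Z - 2) * al j' - q ^ (j'%:Z + 2) * be j') else 0.
  have fg : \sum_(j < N.+1) f j = \sum_(j < N.+1) g j.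
    apply: sum_shift => // [|j _].
      rewrite /f /l /al /be dK dKi !xN ?leqW // (lin0 (opK_lin a)).
      by rewrite (lin0 (opKi_lin a)) !scaler0 (pair0l pc) !mulr0 subrr.
    rewrite /g cLh /f /l; move: (al j) (be j) (cL j) (qint v j.+1) => x1 x2 c u.
    by rewrite mulrBr; congr (_ - _); qmono.
  transitivity (\sum_(j < N.+1) (l j + f j - g j)).
    rewrite sumrB big_split /= fg addrK; apply: eq_bigr => j _.
    rewrite /l /be dKi (dF_F _ qn) !(linZ (opKi_lin a)) scalerA Ki_dF //.
    rewrite scalerA !(pairZl pc); move: (chi _ _) (cL j) (qint v j.+1) => *.
    by qmono.
  apply: eq_bigr => -[j jN] _ /=; rewrite /f /l /g /al /be {f g l al be fg}.
  rewrite [X in X - _]addrC subrK.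
  have FK i : chi (act a (dF v i) x) (opE b (act b (dF v i) y)) =
      q ^ (- 1 - (2 * i)%:Z) * qint v i.+1 *
      chi (act a (dF v i.+1) (opK a x)) (act b (dF v i) y).
    rewrite (pairEr pc) (K_dF _ qn) (linZ (opF_lin a)) (F_dF _ qn) scalerA.
    by rewrite (pairZl pc) !mulrA qD.
  case: j jN => [|j] jN.
    rewrite subr0; have := FK 0%N; rewrite !dFa0 => ->.
    by move: (qint v 1) (chi _ _) (cL 0) => *; qmono.
  have -> : act b (dF v j.+1) (opE b y) = opE b (act b (dF v j.+1) y) -
      h *: act b (dF v j) (q ^ (- j%:Z) *: opK b y - q ^ j%:Z *: opKi b y).
    by rewrite (E_dF _ qn) addrK.
  rewrite (pairBr pc) FK !mulrBr; congr (_ - _).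
    by move: (cL j.+1) (qint v j.+2) (chi _ _) => *; qmono.
  rewrite (pairZr pc) (linB (act_lin b _)) !(linZ (act_lin b _)) dK' dKi'.
  rewrite (pairBr pc) !(pairZr pc) -(pairK pc) -(pairKi pc).
  rewrite (K_dF _ qn) (Ki_dF _ qn) !(pairZl pc).
  move: (chi _ _) (chi _ _) => x1 x2; rewrite !mulrBr; congr (_ - _).
    by move: (cL j.+1) h => *; qmono.
  by move: (cL j.+1) h => *; qmono.
have LE x y : chiL (opE a (opK a x)) y = q ^ 1 * chiL x (opF b y).
  have [N NP] := nbound [:: x; opE a (opK a x)].
  have xN : forall j, (N <= j)%N -> act a (dF v j) x = 0.
    by apply: NP; rewrite inE eqxx.
  have x'N : forall j, (N <= j)%N -> act a (dF v j) (opE a (opK a x)) = 0.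
    by apply: NP; rewrite !inE eqxx orbT.
  rewrite !(pairLE (N := N.+1)) ?mulr_sumr; [|exact: nb1..].
  pose al j := chi (act a (dF v j) (opK a (opK a x))) (act b (dF v j.+1) y).
  pose be j := chi (act a (dF v j) x) (act b (dF v j.+1) y).
  pose l j := cL j * (q ^ 1 * qint v j.+1) * be j.
  pose f j := cL j * (q ^ (1 - (2 * j)%:Z) * qint v j.+1) * al j - l j.
  pose g j := if j is j'.+1 then cL j * h *
    (q ^ (- j'%:Z) * al j' - q ^ j'%:Z * be j') else 0.
  have fg : \sum_(j < N.+1) f j = \sum_(j < N.+1) g j.
    apply: sum_shift => // [|j _].
      rewrite /f /l /al /be !dK !xN // !(lin0 (opK_lin a)).
      by rewrite !scaler0 (lin0 (opK_lin a)) scaler0 (pair0l pc) !mulr0 subrr.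
    rewrite /g cLh /f /l; move: (al j) (be j) (cL j) (qint v j.+1) => x1 x2 c u.
    by rewrite mulrBr; congr (_ - _); qmono.
  transitivity (\sum_(j < N.+1) (l j + f j - g j)); last first.
    rewrite sumrB big_split /= fg addrK; apply: eq_bigr => j _.
    rewrite /l /be (dF_F _ qn) (pairZr pc).
    by move: (chi _ _) (cL j) (qint v j.+1) => *; qmono.
  apply: eq_bigr => -[j jN] _ /=; rewrite /f /l /g /al /be {f g l al be fg}.
  rewrite [X in X - _]addrC subrK.
  have FK i : chi (opE a (act a (dF v i) (opK a x))) (act b (dF v i) y) =
      q ^ (1 - (2 * i)%:Z) * qint v i.+1 *
      chi (act a (dF v i) (opK a (opK a x))) (act b (dF v i.+1) y).
    rewrite (pairE pc) -(pairK pc) (K_dF _ qn) (F_dF _ qn) (pairZr pc) (pairZl pc).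
    rewrite [q in LHS](q1 v); move: (chi _ _) (qint v i.+1) => *; qmono.
  case: j jN => [|j] jN.
    rewrite subr0; have := FK 0%N; rewrite !dFa0 => ->.
    by move: (qint v 1) (chi _ _) (cL 0) => *; qmono.
  have -> : act a (dF v j.+1) (opE a (opK a x)) = opE a (act a (dF v j.+1) (opK a x)) -
      h *: act a (dF v j) (q ^ (- j%:Z) *: opK a (opK a x) - q ^ j%:Z *: x).
    by rewrite (E_dF _ qn) opKiK addrK.
  rewrite (pairBl pc) FK !mulrBr; congr (_ - _).
    by move: (cL j.+1) (qint v j.+2) (chi _ _) => *; qmono.
  rewrite (pairZl pc) (linB (act_lin a _)) !(linZ (act_lin a _)).
  rewrite (pairBl pc) !(pairZl pc).
  move: (chi _ _) (chi _ _) => x1 x2; rewrite !mulrBr; congr (_ - _).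
    by move: (cL j.+1) h => *; qmono.
  by move: (cL j.+1) h => *; qmono.
have LK x y : chiL (opKi a x) y = chiL x (opKi b y).
  have [N NP] := nbound [:: x; opKi a x].
  rewrite !(pairLE (N := N)); [|by apply: NP; rewrite !inE ?eqxx ?orbT..].
  apply: eq_bigr => j _; congr (_ * _).
  by rewrite dKi dKi' (pairZl pc) (pairZr pc) (pairKi pc).
have [tE tF tK tKi] := Tminus1_gens.
have Ll y c x x' : chiL (c *: x + x') y = c * chiL x y + chiL x' y.
  have [N NP] := nbound [:: x; x'; c *: x + x'].
  rewrite !(pairLE (N := N)); [|by apply: NP; rewrite !inE ?eqxx ?orbT..].
  rewrite mulr_sumr -big_split; apply: eq_bigr => j _ /=.
  by rewrite dFl (pair_linl pc) mulrDr mulrCA.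
have Lr x c y y' : chiL x (c *: y + y') = c * chiL x y + chiL x y'.
  have [N NP] := nA x.
  rewrite !(pairLE (N := N)) // mulr_sumr -big_split; apply: eq_bigr => j _ /=.
  by rewrite act_lin (pair_linr pc) mulrDr mulrCA.
have LlN x y : chiL (- x) y = - chiL x y.
  exact: (linN (Ll y : linear (chiL^~ y : A -> S^o))).
have LrN x y : chiL x (- y) = - chiL x y.
  exact: (linN (Lr x : linear (chiL x : B -> S^o))).
have LrZ x c y : chiL x (c *: y) = c * chiL x y.
  exact: (linZ (Lr x : linear (chiL x : B -> S^o))).
split=> // x y /=.
- rewrite tE tF tK !actN !actM !actKi !actF !actE !actK LlN (linN (opKi_lin b)) LrN.
  rewrite LF mulrN Ki_E opKiK LrZ [q in RHS]q1; congr (- _).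
  by move: (chiL _ _) => *; qmono.
- rewrite tE tF tKi !actN !actM !actKi !actF !actE !actK LlN (linN (opK_lin b)) LrN.
  by rewrite LE opKKi mulrN.
- by rewrite !tK !actKi.
Qed.
End PairL.
End Pairings.

Arguments opE : simpl never.
Arguments opF : simpl never.
Arguments opK : simpl never.
Arguments opKi : simpl never.

(** * Twisted modules and tensor products on pure tensors *)

Section TwistOps.
Variables (S : comUnitRingType) (v : qparam S) (A : lmodType S).
Variable a : uaction v A.
Local Notation aT := (twist (@Tminus1 S v) a).
Local Notation aR := (twist (@rho1 S v) a).
Implicit Type x : A.

Lemma twistTE x : opE aT x = - opKi a (opF a x).
Proof.
have [rE _ _ _] := Tminus1_gens v.
by rewrite -[LHS]/(act a (Tminus1 (gE v)) x) rE actN actM actKi actF.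
Qed.
Lemma twistTF x : opF aT x = - opE a (opK a x).
Proof.
have [_ rF _ _] := Tminus1_gens v.
by rewrite -[LHS]/(act a (Tminus1 (gF v)) x) rF actN actM actE actK.
Qed.
Lemma twistTK x : opK aT x = opKi a x.
Proof.
have [_ _ rK _] := Tminus1_gens v.
by rewrite -[LHS]/(act a (Tminus1 (gK v)) x) rK actKi.
Qed.
Lemma twistTKi x : opKi aT x = opK a x.
Proof.
have [_ _ _ rK] := Tminus1_gens v.
by rewrite -[LHS]/(act a (Tminus1 (gKi v)) x) rK actK.
Qed.
Lemma twistRE x : opE aR x = - qv v *: opF a x.
Proof.
have [rE _ _ _] := rho1_gens v.
by rewrite -[LHS]/(act a (rho1 (gE v)) x) rE actZ actF.
Qed.
Lemma twistRF x : opF aR x = - (qv v)^-1 *: opE a x.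
Proof.
have [_ rF _ _] := rho1_gens v.
by rewrite -[LHS]/(act a (rho1 (gF v)) x) rF actZ actE.
Qed.
Lemma twistRK x : opK aR x = opKi a x.
Proof.
have [_ _ rK _] := rho1_gens v.
by rewrite -[LHS]/(act a (rho1 (gK v)) x) rK actKi.
Qed.
Lemma twistRKi x : opKi aR x = opK a x.
Proof.
have [_ _ _ rK] := rho1_gens v.
by rewrite -[LHS]/(act a (rho1 (gKi v)) x) rK actK.
Qed.
End TwistOps.

Section TensorPure.
Variables (S : comUnitRingType) (d : nat).
Local Notation V := 'cV[S]_d.
Variable A : lmodType S.
Implicit Types (x y : A) (e f : V).

Lemma tpure_linl e : linear ((@tpure S d A)^~ e).
Proof. by move=> c x y; apply/ffunP=> i; rewrite !ffunE scalerDr !scalerA mulrC. Qed.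
Lemma tpure_linr x : linear (@tpure S d A x).
Proof. by move=> c e f; apply/ffunP=> i; rewrite !ffunE !mxE scalerDl scalerA. Qed.
Lemma tpureDl x y e : tpure (x + y) e = tpure x e + tpure y e.
Proof. exact: (linD (tpure_linl e)). Qed.
Lemma tpureZl c x e : tpure (c *: x) e = c *: tpure x e.
Proof. exact: (linZ (tpure_linl e)). Qed.
Lemma tpureNl x e : tpure (- x) e = - tpure x e.
Proof. exact: (linN (tpure_linl e)). Qed.
Lemma tpureBl x y e : tpure (x - y) e = tpure x e - tpure y e.
Proof. exact: (linB (tpure_linl e)). Qed.
Lemma tpure0l e : tpure (0 : A) e = 0.
Proof. exact: (lin0 (tpure_linl e)). Qed.
Lemma tpureDr x e f : tpure x (e + f) = tpure x e + tpure x f.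
Proof. exact: (linD (tpure_linr x)). Qed.
Lemma tpureZr c x e : tpure x (c *: e) = c *: tpure x e.
Proof. exact: (linZ (tpure_linr x)). Qed.
Lemma tpureNr x e : tpure x (- e) = - tpure x e.
Proof. exact: (linN (tpure_linr x)). Qed.
Lemma tpureBr x e f : tpure x (e - f) = tpure x e - tpure x f.
Proof. exact: (linB (tpure_linr x)). Qed.
Lemma tpure0r x : tpure x (0 : V) = 0.
Proof. exact: (lin0 (tpure_linr x)). Qed.

Lemma tens_ind (P : {ffun 'I_d -> A} -> Prop) :
  (forall u w, P u -> P w -> P (u + w)) -> P 0 ->
  (forall x e, P (tpure x e)) -> forall w, P w.
Proof.
move=> PD P0 Pp w; rewrite [w]tpure_sum.
by elim/big_ind: _ => // i _; exact: Pp.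
Qed.

Lemma tens_ext (B : lmodType S) (f g : {ffun 'I_d -> A} -> B) :
  linear f -> linear g -> (forall x e, f (tpure x e) = g (tpure x e)) -> f =1 g.
Proof.
move=> lf lg fg; apply: tens_ind => //; last by rewrite (lin0 lf) (lin0 lg).
by move=> x y ex ey; rewrite (linD lf) (linD lg) ex ey.
Qed.
End TensorPure.

Section TensPure.
Variables (S : comUnitRingType) (v : qparam S) (d : nat) (A : lmodType S).
Variables (a : uaction v A) (e : uaction v 'cV[S]_d).
Implicit Types (x : A) (y : 'cV[S]_d).

Lemma tensE_pure x y : opE (tens a e) (tpure x y) =
  tpure (opE a x) y + tpure (opK a x) (opE e y).
Proof.
by rewrite /opE /= /tensE !tmap_pure //; do ?[exact: opE_lin|exact: opK_lin].
Qed.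
Lemma tensF_pure x y : opF (tens a e) (tpure x y) =
  tpure (opF a x) (opKi e y) + tpure x (opF e y).
Proof.
by rewrite /opF /= /tensF !tmap_pure //; do ?[exact: opF_lin|exact: opKi_lin].
Qed.
Lemma tensK_pure x y : opK (tens a e) (tpure x y) = tpure (opK a x) (opK e y).
Proof. by rewrite /opK /= /tensK tmap_pure //; exact: opK_lin. Qed.
Lemma tensKi_pure x y : opKi (tens a e) (tpure x y) = tpure (opKi a x) (opKi e y).
Proof. by rewrite /opKi /= /tensKi tmap_pure //; exact: opKi_lin. Qed.
End TensPure.

Lemma lin_comp (S : comUnitRingType) (A B C : lmodType S) (f : B -> C) (g : A -> B) :
  linear f -> linear g -> linear (fun x => f (g x)).
Proof. by move=> lf lg c x y; rewrite lg lf. Qed.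
Lemma lin_opp (S : comUnitRingType) (A B : lmodType S) (f : A -> B) :
  linear f -> linear (fun x => - f x).
Proof. by move=> lf c x y; rewrite lf opprD scalerN. Qed.
Lemma lin_add (S : comUnitRingType) (A B : lmodType S) (f g : A -> B) :
  linear f -> linear g -> linear (fun x => f x + g x).
Proof. by move=> lf lg c x y; rewrite lf lg scalerDr addrACA. Qed.
Lemma lin_scale (S : comUnitRingType) (A B : lmodType S) (c : S) (f : A -> B) :
  linear f -> linear (fun x => c *: f x).
Proof. by move=> lf k x y; rewrite lf scalerDr !scalerA [c * k]mulrC. Qed.
Lemma lin_bigsum (S : comUnitRingType) (A B : lmodType S) (I : Type) (r : seq I)
    (f : I -> A -> B) :
  (forall i, linear (f i)) -> linear (fun x => \sum_(i <- r) f i x).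
Proof.
move=> lf c x y; rewrite scaler_sumr -big_split; apply: eq_bigr => i _.
exact: lf.
Qed.

(** * The operator J behind Psibar, on an arbitrary tensor product *)

Section BraidTensor.
Variables (S : comUnitRingType) (v : qparam S) (d : nat) (A : lmodType S).
Variables (a : uaction v A) (e : uaction v 'cV[S]_d).
Local Notation q := (qv v).
Local Notation h := ((q - q^-1)^-1).
Local Notation V := 'cV[S]_d.
Hypothesis qn : forall n, qint v n.+1 \is a GRing.unit.
Variable t : V -> V.
Hypothesis lt : linear t.
Hypothesis tE : forall y, t (opE e y) = - opF e (opK e (t y)).
Hypothesis tF : forall y, t (opF e y) = - opKi e (opE e (t y)).
Hypothesis tK : forall y, t (opK e y) = opKi e (t y).
Variable N : nat.
Hypothesis eN : forall j y, (N <= j)%N -> act e (dE v j) y = 0.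

(** The series of Psibar without Psi, for any [t] having the relations of T''_1 with E, F, K. The
    index runs up to [N] although the term at [N] is zero: this provides the vanishing boundary term
    of the index shifts. *)
Definition braid (w : {ffun 'I_d -> A}) : {ffun 'I_d -> A} :=
  \sum_(j < N.+1) cJ v j *: tmap (act a (dF v j)) (fun y => t (act e (dE v j) y)) w.

Lemma braid_lin : linear braid.
Proof.
apply: lin_bigsum => j; apply: lin_scale; apply: tmap_lin; exact: act_lin.
Qed.

Lemma braid_pure x y : braid (tpure x y) =
  \sum_(j < N.+1) cJ v j *: tpure (act a (dF v j) x) (t (act e (dE v j) y)).
Proof.
apply: eq_bigr => j _; rewrite tmap_pure //; first exact: act_lin.
exact: (lin_comp lt (@act_lin _ _ _ e _)).
Qed.

Let tKi y : t (opKi e y) = opK e (t y).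
Proof. by rewrite -[y in RHS](opKKi e) tK opKKi. Qed.
Let Et y : opE e (t y) = - t (opKi e (opF e y)).
Proof. by rewrite tKi tF (linN (opK_lin e)) opKKi opprK. Qed.
Let Ft y : opF e (t y) = - t (opE e (opK e y)).
Proof. by rewrite tE tK opKKi opprK. Qed.

Let cJh j : cJ v j.+1 * h = cJ v j * q ^ j%:Z * qint v j.+1.
Proof.
rewrite cJS; have := hB v; move: (q - q^-1) h (q ^ _) (qint _ _) (cJ _ j).
move=> d' h' x u c E; transitivity (c * x * u * (h' * d')); first by ring.
by rewrite E mulr1.
Qed.

Local Notation T := (tens a e).
Local Notation T' := (tens (twist (@Tminus1 S v) a) e).

Let pureE' x y : opE T' (tpure x y) =
  - tpure (opKi a (opF a x)) y + tpure (opKi a x) (opE e y).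
Proof.
by rewrite tensE_pure twistTE twistTK tpureNl.
Qed.
Let pureF' x y : opF T' (tpure x y) =
  - tpure (opE a (opK a x)) (opKi e y) + tpure x (opF e y).
Proof.
by rewrite tensF_pure twistTF tpureNl.
Qed.

Let dKi n x : act a (dF v n) (opKi a x) = q ^ (- (2 * n)%:Z) *: opKi a (act a (dF v n) x).
Proof. by rewrite (Ki_dF _ qn) scalerA qKN scale1r. Qed.
Let dK n x : act a (dF v n) (opK a x) = q ^ (2 * n)%:Z *: opK a (act a (dF v n) x).
Proof. by rewrite (K_dF _ qn) scalerA qNK scale1r. Qed.
Let eKi n x : act e (dE v n) (opKi e x) = q ^ (2 * n)%:Z *: opKi e (act e (dE v n) x).
Proof. by rewrite (Ki_dE _ qn) scalerA qNK scale1r. Qed.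
Let eK n x : act e (dE v n) (opK e x) = q ^ (- (2 * n)%:Z) *: opK e (act e (dE v n) x).
Proof. by rewrite (K_dE _ qn) scalerA qKN scale1r. Qed.

Lemma braid_opK w : braid (opKi T w) = opK T' (braid w).
Proof.
move: w; apply: tens_ext.
- exact: lin_comp braid_lin (opKi_lin _).
- exact: lin_comp (opK_lin _) braid_lin.
move=> x y; rewrite tensKi_pure !braid_pure (lin_sum (opK_lin T')).
apply: eq_bigr => j _; rewrite (linZ (opK_lin T')) tensK_pure twistTK.
congr (_ *: _); rewrite dKi eKi (linZ lt) tKi tpureZl tpureZr scalerA qKN.
by rewrite scale1r.
Qed.

(** Together with [braid_opK] and [braid_opE], this makes [braid] a homomorphism from the
    T'_-1-twist of the tensor product to the tensor product in which only the first factor is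
    twisted. The commutators with divided powers cancel after an index shift, by the recursion
    [cJS]. *)
Lemma braid_opF w : braid (opKi T (opF T w)) = - opE T' (braid w).
Proof.
move: w; apply: tens_ext.
- exact: lin_comp braid_lin (lin_comp (opKi_lin _) (opF_lin _)).
- exact: lin_opp (lin_comp (opE_lin _) braid_lin).
move=> x y; rewrite tensF_pure (linD (opKi_lin T)) !tensKi_pure (linD braid_lin).
rewrite !braid_pure -big_split (lin_sum (opE_lin T')) -sumrN.
(* [r] and [l] are common to both sides; the commutator terms [g] of the left side have the same sum
   as the surplus [f] of the right side. *)
pose al j := tpure (opKi a (act a (dF v j.+1) x)) (t (act e (dE v j) y)).
pose be j := tpure (opKi a (act a (dF v j.+1) x))
  (t (act e (dE v j) (opKi e (opKi e y)))).
pose l j := (cJ v j * q ^ (- (2 * j)%:Z) * qint v j.+1) *: be j.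
pose f j := (cJ v j * qint v j.+1) *: al j - l j.
pose g j := if j is j'.+1 then (cJ v j * h) *:
  (q ^ (- j'%:Z) *: al j' - q ^ (- (3 * j')%:Z) *: be j') else 0.
pose r j := cJ v j *: tpure (opKi a (act a (dF v j) x))
   (t (opKi e (opF e (act e (dE v j) y)))).
have fg : \sum_(j < N.+1) f j = \sum_(j < N.+1) g j.
  apply: sum_shift => // [|j _].
    by rewrite /f /l /al /be !eN // (lin0 lt) !tpure0r !scaler0 subrr.
  rewrite /g cJh /f /l; move: (al j) (be j) (cJ v j) (qint v j.+1) => x1 x2 c u.
  by rewrite scalerBr !scalerA; congr (_ *: _ - _ *: _); qmono.
transitivity (\sum_(j < N.+1) (r j + l j + g j)); last first.
  rewrite big_split -fg -big_split; apply: eq_bigr => j _ /=.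
  rewrite (linZ (opE_lin T')) pureE' Et tpureNr -scalerN opprD !opprK scalerDr.
  rewrite /r /f /al (F_dF _ qn) (linZ (opKi_lin a)) tpureZl scalerA.
  by rewrite -addrA [l j + _]addrC subrK addrC.
apply: eq_bigr => -[j jN] _ /=; rewrite [r j + _]addrC -addrA; congr (_ + _).
  rewrite /l /be dKi (dF_F _ qn) (linZ (opKi_lin a)) !tpureZl !scalerA.
  by congr (_ *: _); move: (cJ v j) (qint v j.+1) => *; qmono.
rewrite dKi eKi (linZ lt) tpureZl tpureZr !scalerA -mulrA qKN mulr1.
case: j jN => [|j] jN; first by rewrite /r /= !dEa0 addr0.
rewrite (dE_F _ qn) (linD (opKi_lin e)) (linD lt) tpureDr scalerDr; congr (_ + _).
rewrite /g (linZ (opKi_lin e)) (linZ lt) tpureZr scalerA; congr (_ *: _).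
rewrite (linB (@act_lin _ _ _ e _)) !(linZ (@act_lin _ _ _ e _)) eK.
rewrite (linB (opKi_lin e)) !(linZ (opKi_lin e)) opKiK scalerA.
rewrite (linB lt) !(linZ lt) tpureBr !tpureZr /al /be.
rewrite [in RHS]eKi (linZ lt) tpureZr !scalerA !qD; congr (_ ^ _ *: _ - _ ^ _ *: _); lia.
Qed.

Lemma braid_opE w : braid (opE T (opK T w)) = - opF T' (braid w).
Proof.
move: w; apply: tens_ext.
- exact: lin_comp braid_lin (lin_comp (opE_lin _) (opK_lin _)).
- exact: lin_opp (lin_comp (opF_lin _) braid_lin).
move=> x y; rewrite tensK_pure tensE_pure (linD braid_lin).
rewrite !braid_pure -big_split (lin_sum (opF_lin T')) -sumrN.
pose al j := tpure (act a (dF v j) x) (t (act e (dE v j.+1) (opK e y))).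
pose be j := tpure (act a (dF v j) (opK a (opK a x)))
  (t (act e (dE v j.+1) (opK e y))).
pose l j := (cJ v j * qint v j.+1) *: be j.
pose f j := (cJ v j * q ^ (2 * j)%:Z * qint v j.+1) *: al j - l j.
pose g j := if j is j'.+1 then (cJ v j * h) *:
  (q ^ j'%:Z *: al j' - q ^ (- j'%:Z) *: be j') else 0.
pose r j := cJ v j *: tpure (opE a (act a (dF v j) (opK a x)))
   (t (act e (dE v j) (opK e y))).
have fg : \sum_(j < N.+1) f j = \sum_(j < N.+1) g j.
  apply: sum_shift => // [|j _].
    by rewrite /f /l /al /be !eN // (lin0 lt) !tpure0r !scaler0 subrr.
  rewrite /g cJh /f /l; move: (al j) (be j) (cJ v j) (qint v j.+1) => x1 x2 c u.
  by rewrite scalerBr !scalerA; congr (_ *: _ - _ *: _); qmono.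
transitivity (\sum_(j < N.+1) (r j + l j + g j)); last first.
  rewrite big_split -fg -big_split; apply: eq_bigr => j _ /=.
  rewrite -addrA [l j + _]addrC subrK (linZ (opF_lin T')) pureF' Ft tpureNr -scalerN.
  rewrite opprD !opprK scalerDr; congr (_ + _).
    rewrite /r; congr (_ *: _); rewrite dK eK (linZ (opE_lin a)) tpureZl (linZ lt).
    by rewrite tpureZr scalerA qNK scale1r tK.
  rewrite /al (K_dE _ qn) (linZ (opE_lin e)) (E_dE _ qn) scalerA (linZ lt) tpureZr.
  by rewrite scalerA mulrA.
apply: eq_bigr => -[j jN] _ /=.
have -> : l j = cJ v j *: tpure (act a (dF v j) (opK a (opK a x)))
    (t (act e (dE v j) (opE e (opK e y)))).
  by rewrite (dE_E _ qn) (linZ lt) tpureZr scalerA.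
rewrite addrAC; congr (_ + _); rewrite {}/r.
case: j jN => [|j] jN; first by rewrite /g /= !dFa0 addr0.
rewrite (E_dF _ qn) tpureDl scalerDr -[LHS]addr0 -addrA; congr (_ + _).
rewrite opKiK (linB (@act_lin _ _ _ a _)) !(linZ (@act_lin _ _ _ a _)).
rewrite tpureZl tpureBl !tpureZl /g /al /be scalerA -scalerDr addrA subrK subrr.
by rewrite scaler0.
Qed.
End BraidTensor.

(** * Invariance of chi_{beta,phi} *)

Section BetaPairing.
Variables (S : comUnitRingType) (v : qparam S) (A B : lmodType S).
Variables (a : uaction v A) (b : uaction v B) (phi : A -> B -> S).
Hypothesis pp : pairing a b phi.
Variables m n : nat.
Local Notation q := (qv v).
Local Notation Em := (Fmod v m).
Local Notation En := (Fmod v n).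
Variable beta : {ffun 'I_n.+1 -> 'cV[S]_m.+1} -> Uq v.
Hypothesis hb : uhom (FFmod v m n) (adjoint v) beta.
Let lb : linear beta. Proof. by case: hb. Qed.

(** [chi_beta] for two different modules: besides M, M_F and M_pi, it is applied to the pairing of
    M_F with an extension of M by M_pi. *)
Definition pair_beta (x : {ffun 'I_m.+1 -> A}) (y : {ffun 'I_n.+1 -> B}) : S :=
  \sum_(i < m.+1) \sum_(j < n.+1)
    phi (x i) (act b (rho1 (beta (ubas2 S m n i j))) (y j)).

Lemma ubas_delta k (i : 'I_k.+1) : ubas k i = delta_mx i 0 :> 'cV[S]_k.+1.
Proof. by rewrite /ubas -ltnS ltn_ord inord_val. Qed.

Lemma beta_pure e f : beta (tpure e f) =
  \sum_(i < m.+1) \sum_(j < n.+1) (e i 0 * f j 0) *: beta (ubas2 S m n i j).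
Proof.
rewrite {1}(cV_sum e) (lin_sum (tpure_linl f)) (lin_sum lb).
apply: eq_bigr => i _; rewrite tpureZl (linZ lb) {1}(cV_sum f).
rewrite (lin_sum (tpure_linr _)) (lin_sum lb) scaler_sumr.
apply: eq_bigr => j _; rewrite tpureZr (linZ lb) scalerA /ubas2.
by rewrite !ubas_delta.
Qed.

Lemma pair_beta_pure x e y f :
  pair_beta (tpure x e) (tpure y f) = phi x (act b (rho1 (beta (tpure e f))) y).
Proof.
rewrite beta_pure linear_sum /= /pair_beta.
rewrite (big_morph (fun u => act b u y) (fun u w => actD b u w y)
  (_ : act b 0 y = 0)); last by rewrite -(scale0r 1) actC scale0r.
rewrite (pair_sumr pp); apply: eq_bigr => i _; rewrite linear_sum /=.
rewrite (big_morph (fun u => act b u y) (fun u w => actD b u w y)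
  (_ : act b 0 y = 0)); last by rewrite -(scale0r 1) actC scale0r.
rewrite (pair_sumr pp); apply: eq_bigr => j _.
rewrite linearZ /= actZ (pairZr pp) !ffunE (pairZl pp) (linZ (act_lin b _)).
by rewrite (pairZr pp) mulrA.
Qed.

Lemma pair_beta_linl y : linear (pair_beta^~ y : _ -> S^o).
Proof.
move=> c x x'; rewrite /pair_beta scaler_sumr -big_split; apply: eq_bigr => i _.
rewrite scaler_sumr -big_split; apply: eq_bigr => j _ /=.
by rewrite !ffunE (pair_linl pp).
Qed.
Lemma pair_beta_linr x : linear (pair_beta x : _ -> S^o).
Proof.
move=> c y y'; rewrite /pair_beta scaler_sumr -big_split; apply: eq_bigr => i _.
rewrite scaler_sumr -big_split; apply: eq_bigr => j _ /=.
by rewrite !ffunE act_lin (pair_linr pp).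
Qed.

Lemma betaE e f : beta (tpure (opE Em e) f) =
  q *: beta (tpure (opK Em e) (opF En f)) +
  (gE v * beta (tpure e f) - gK v * beta (tpure e f) * gKi v * gE v).
Proof.
have := (hb.2 (gE v) (tpure e f)); rewrite !actE tensE_pure twistRE.
rewrite scaleNr tpureNr tpureZr (linB lb) (linZ lb) => /eqP.
rewrite subr_eq => /eqP->; rewrite addrC; congr (_ + _).
by rewrite /opE /= /adE mulrN !mulrA.
Qed.
Lemma betaF e f : beta (tpure (opF Em e) (opK En f)) =
  q^-1 *: beta (tpure e (opE En f)) +
  (gF v * beta (tpure e f) - beta (tpure e f) * gF v) * gK v.
Proof.
have := (hb.2 (gF v) (tpure e f)); rewrite !actF tensF_pure twistRF twistRKi.
rewrite scaleNr tpureNr tpureZr (linB lb) (linZ lb) => /eqP.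
rewrite subr_eq => /eqP->; rewrite addrC; congr (_ + _).
by rewrite /opF /= /adF mulrN mulrBl !mulrA.
Qed.
Lemma betaK e f : beta (tpure (opK Em e) (opKi En f)) =
  gK v * beta (tpure e f) * gKi v.
Proof.
have := (hb.2 (gK v) (tpure e f)); rewrite !actK tensK_pure twistRK => ->.
by rewrite /opK.
Qed.
Lemma betaKi e f : beta (tpure (opKi Em e) (opK En f)) =
  gKi v * beta (tpure e f) * gK v.
Proof.
have := (hb.2 (gKi v) (tpure e f)); rewrite !actKi tensKi_pure twistRKi => ->.
by rewrite /opKi.
Qed.

Let pure_ext (f g : {ffun 'I_m.+1 -> A} -> {ffun 'I_n.+1 -> B} -> S) :
  (forall y, linear (f^~ y : _ -> S^o)) -> (forall x, linear (f x : _ -> S^o)) ->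
  (forall y, linear (g^~ y : _ -> S^o)) -> (forall x, linear (g x : _ -> S^o)) ->
  (forall x e y k, f (tpure x e) (tpure y k) = g (tpure x e) (tpure y k)) ->
  forall x y, f x y = g x y.
Proof.
move=> fl fr gl gr fg x y; move: x; apply: (tens_ext (fl y) (gl y)) => x e.
by move: y; apply: (tens_ext (fr _) (gr _)) => y k.
Qed.

Let act_phi u x y : phi (act a u x) y = phi x (act b (varrho u) y).
Proof. exact: pair_act pp u x y. Qed.

(** On pure tensors, equivariance of [beta] for the adjoint action ([betaE], [betaF], [betaK],
    [betaKi]) trades the action on [e] for the action on [f] and multiplications in U, which [rho1]
    and the invariance of [phi] turn into the action on [x] and [y]. *)
Lemma pair_beta_pairing : pairing (tens a Em) (tens b En) pair_beta.
Proof.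
have ll (f : {ffun 'I_m.+1 -> A} -> {ffun 'I_m.+1 -> A}) y :
    linear f -> linear (fun x => pair_beta (f x) y : S^o).
  by move=> lf; exact: (lin_comp (pair_beta_linl y) lf).
have lr (f : {ffun 'I_n.+1 -> B} -> {ffun 'I_n.+1 -> B}) x :
    linear f -> linear (fun y => pair_beta x (f y) : S^o).
  by move=> lf; exact: (lin_comp (pair_beta_linr x) lf).
have rD u w x y : phi x (act b (rho1 (u + w)) y) =
    phi x (act b (rho1 u) y) + phi x (act b (rho1 w) y).
  by rewrite rmorphD actD (pairDr pp).
have rZ c u x y : phi x (act b (rho1 (c *: u)) y) = c * phi x (act b (rho1 u) y).
  by rewrite linearZ actZ (pairZr pp).
have rN u x y : phi x (act b (rho1 (- u)) y) = - phi x (act b (rho1 u) y).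
  by rewrite rmorphN actN (pairNr pp).
have [rE rF rK rKi] := rho1_gens v.
have qq : q^-1 * q = 1 by rewrite mulVr ?qv_unit.
have aE u y : act b (rho1 u) (opE b y) = - q *: act b (rho1 (u * gF v)) y.
  rewrite rmorphM /= rF actM actZ actE (linZ (act_lin b _)) scalerA mulrNN.
  by rewrite mulrV ?qv_unit // scale1r.
have aF u y : act b (rho1 u) (opF b y) = - q^-1 *: act b (rho1 (u * gE v)) y.
  rewrite rmorphM /= rE actM actZ actF (linZ (act_lin b _)) scalerA mulrNN.
  by rewrite qq scale1r.
have aK u y : act b (rho1 u) (opK b y) = act b (rho1 (u * gKi v)) y.
  by rewrite rmorphM /= rKi actM actK.
have aKi u y : act b (rho1 u) (opKi b y) = act b (rho1 (u * gK v)) y.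
  by rewrite rmorphM /= rK actM actKi.
have Ea u y : opE b (act b (rho1 u) y) = - q *: act b (rho1 (gF v * u)) y.
  by rewrite rmorphM /= rF actM actZ actE scalerA mulrNN mulrV ?qv_unit // scale1r.
have Fa u y : opF b (act b (rho1 u) y) = - q^-1 *: act b (rho1 (gE v * u)) y.
  by rewrite rmorphM /= rE actM actZ actF scalerA mulrNN qq scale1r.
have Ka u y : opK b (act b (rho1 u) y) = act b (rho1 (gKi v * u)) y.
  by rewrite rmorphM /= rKi actM actK.
have Kia u y : opKi b (act b (rho1 u) y) = act b (rho1 (gK v * u)) y.
  by rewrite rmorphM /= rK actM actKi.
split.
- by move=> y c x x'; exact: pair_beta_linl.
- by move=> x c y y'; exact: pair_beta_linr.
- apply: pure_ext.
  + by move=> y; exact/ll/opE_lin.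
  + by move=> x; exact: pair_beta_linr.
  + move=> y c x x' /=; rewrite (pair_beta_linl _ c x x') mulrDr mulrCA //.
  + by move=> x; apply: (lin_scale q (lr _ x (lin_comp (opK_lin _) (opF_lin _)))).
  move=> x e y f; rewrite tensE_pure (linD (pair_beta_linl _)) !pair_beta_pure.
  rewrite tensF_pure (linD (opK_lin (tens b En))) !tensK_pure opKKi.
  rewrite (linD (pair_beta_linr _)) !pair_beta_pure.
  rewrite (pairE pp) (pairK pp) Fa (linZ (opK_lin b)) !Ka !aK aF !(pairZr pp).
  have := betaKi (opK Em e) (opF En f); rewrite opKiK => ->.
  rewrite -!mulrA gKKi mulr1 betaE mulrDr mulrBr -scalerAr !mulrA gKiK mul1r.
  rewrite rD rZ rD rN mulrDr !mulrA !mulrN mulrV ?qv_unit // !mulN1r.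
  by move: (phi _ _) (phi _ _) (phi _ _) => *; ring.
- apply: pure_ext.
  + by move=> y; exact/ll/opF_lin.
  + by move=> x; exact: pair_beta_linr.
  + move=> y c x x' /=; rewrite (pair_beta_linl _ c x x') mulrDr mulrCA //.
  + by move=> x; apply: (lin_scale q (lr _ x (lin_comp (opKi_lin _) (opE_lin _)))).
  move=> x e y f; rewrite tensF_pure (linD (pair_beta_linl _)) !pair_beta_pure.
  rewrite tensE_pure (linD (opKi_lin (tens b En))) !tensKi_pure opKiK.
  rewrite (linD (pair_beta_linr _)) !pair_beta_pure.
  rewrite (pairF pp) Ea (linZ (opKi_lin b)) !Kia !aKi aE -!mulrA !(pairZr pp).
  have := betaF e (opKi En f); rewrite opKKi => ->.
  set X := beta (tpure e (opKi En f)).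
  have -> : gK v * (gF v * beta (tpure (opKi Em e) f)) = q ^- 2 *: (gF v * X * gK v).
    have := betaK (opKi Em e) f; rewrite opKKi -/X => ->.
    rewrite mulrA gKF' -scalerAl; congr (_ *: _).
    by rewrite -!mulrA gKiK mulr1.
  have -> : X * (gK v * gF v) = q ^- 2 *: (X * gF v * gK v).
    by rewrite gKF' -scalerAr !mulrA.
  have -> : beta (tpure e (opKi En (opE En f))) = q ^- 2 *: beta (tpure e (opE En (opKi En f))).
    by rewrite Ki_E tpureZr (linZ lb).
  rewrite mulrBl !(rD, rZ, rN) mulrDr; move: (phi _ _) (phi _ _) (phi _ _) => x1 x2 x3.
  have e1 : q * q ^- 2 = q^-1 by rewrite expr2 invrM ?qv_unit // mulVKr ?qv_unit.
  have -> : q * (q ^- 2 * x2) = q^-1 * x2 by rewrite mulrA e1.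
  have e2 z : q * (- q * (q ^- 2 * z)) = - z.
    by rewrite mulNr mulrN [q * (q ^- 2 * z)]mulrA e1 mulVKr ?qv_unit.
  rewrite !e2; ring.
- apply: pure_ext.
  + by move=> y; exact/ll/opK_lin.
  + by move=> x; exact: pair_beta_linr.
  + by move=> y; exact: pair_beta_linl.
  + by move=> x; exact/lr/opK_lin.
  move=> x e y f; rewrite !tensK_pure !pair_beta_pure (pairK pp) Ka aK.
  have := betaK e (opK En f); rewrite opKiK => ->.
  by rewrite !mulrA gKiK mul1r.
Qed.
End BetaPairing.

(** * q-binomial sums, and the closed form of T''_1 on F_m *)

Section QBinomials.
Variables (S : comUnitRingType) (v : qparam S).
Local Notation q := (qv v).
Hypothesis qn : forall n, qint v n.+1 \is a GRing.unit.

Definition qbin (n k : nat) : S :=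
  if (k <= n)%N then qfact v n / (qfact v k * qfact v (n - k)) else 0.

Let fu n : qfact v n \is a GRing.unit. Proof. exact: qfact_unit. Qed.

Lemma qbin_gt n k : (n < k)%N -> qbin n k = 0.
Proof. by rewrite /qbin ltnNge => /negPf->. Qed.
Lemma qbin0 n : qbin n 0 = 1.
Proof. by rewrite /qbin subn0 qfact0 mul1r mulrV. Qed.
Lemma qbinn n : qbin n n = 1.
Proof. by rewrite /qbin leqnn subnn qfact0 mulr1 mulrV. Qed.
Lemma qbin_sub n k : (k <= n)%N -> qbin n (n - k) = qbin n k.
Proof. by move=> kn; rewrite /qbin leq_subr kn subKn // [X in _ / X]mulrC. Qed.
Lemma qbinM n k : (k <= n)%N -> qbin n k * (qfact v k * qfact v (n - k)) = qfact v n.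
Proof. by move=> kn; rewrite /qbin kn divrK // unitrM !fu. Qed.

Lemma qbinS n k :
  qbin n.+1 k.+1 = q ^ (- k.+1%:Z) * qbin n k.+1 + q ^ (n%:Z - k%:Z) * qbin n k.
Proof.
have [kn|nk|<-] := ltngtP k n; last first.
- by rewrite !qbinn qbin_gt // mulr0 add0r subrr mul1r.
- by rewrite !qbin_gt ?mulr0 ?addr0 // ltnW.
have du : qfact v k.+1 * qfact v (n - k) \is a GRing.unit by rewrite unitrM !fu.
apply: (mulIr du) => /=; have -> : qbin n.+1 k.+1 * (qfact v k.+1 * qfact v (n - k)) =
    qfact v n.+1 by rewrite -(qbinM (ltnW kn : k.+1 <= n.+1)%N) subSS.
rewrite mulrDl.
have -> : q ^ (- k.+1%:Z) * qbin n k.+1 * (qfact v k.+1 * qfact v (n - k)) =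
    q ^ (- k.+1%:Z) * qint v (n - k) * qfact v n.
  have e1 : qfact v (n - k) = qfact v (n - k.+1) * qint v (n - k).
    by rewrite -(subnSK kn) qfactS.
  rewrite -(qbinM kn) e1.
  by move: (qbin _ _) (qint v _) (qfact v _) (qfact v _) => *; ring.
have -> : q ^ (n%:Z - k%:Z) * qbin n k * (qfact v k.+1 * qfact v (n - k)) =
    q ^ (n%:Z - k%:Z) * qint v k.+1 * qfact v n.
  rewrite -[in RHS](qbinM (ltnW kn)) qfactS.
  by move: (qbin _ _) (qint v _) (qfact v _) (qfact v _) => *; ring.
rewrite -mulrDl qfactS mulrC; congr (_ * _); rewrite !qintE.
have -> : n.+1%:Z = k.+1%:Z + (n - k)%:Z by lia.
rewrite qiD addrC; congr (_ * _ + q ^ _ * _); lia.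
Qed.

(** With [p = m - k], the inner sum over the exponent [c] in T''_1 of [u_k], for a fixed exponent
    [a] of the left power of E. *)
Definition fsum p a k := \sum_(c < k.+1)
  (-1) ^+ c * q ^ (c%:Z * (1 - a%:Z)) * qbin (p + c) c * qbin (p + a) (k - c).

Lemma fsumS p a k : fsum p a.+1 k.+1 =
  q ^ (- k.+1%:Z) * fsum p a k.+1 + q ^ (p%:Z + a%:Z - k%:Z) * fsum p a k.
Proof.
rewrite /fsum !mulr_sumr big_ord_recr [in RHS]big_ord_recr /= addrAC; congr (_ + _).
  rewrite -big_split; apply: eq_bigr => -[c ck] _ /=.
  rewrite subSn // addnS qbinS.
  move: (qbin _ _) (qbin _ _) (qbin _ _) ((-1) ^+ c) => x y z e.
  rewrite mulrDr; congr (_ + _); qmono.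
rewrite subnn !qbin0; move: (qbin _ _) ((-1) ^+ _) => x e; qmono.
Qed.

Lemma fsum_0 p k : fsum p 0 k = (-1) ^+ k * q ^ (k%:Z * (p%:Z + 1)).
Proof.
elim: p k => [|p IHp] k.
  rewrite /fsum big_ord_recr big1 => [|[c ck] _] /=; last first.
    by rewrite (@qbin_gt 0) ?mulr0 // subn_gt0.
  by rewrite [LHS]add0r subnn qbin0 add0n qbinn !mulr1.
have f1 j : fsum p 1 j.+1 = 0.
  rewrite fsumS !IHp exprS mulN1r mulNr mulrN addrC; apply/eqP.
  rewrite subr_eq0; apply/eqP; move: ((-1) ^+ j) => *; qmono.
elim: k => [|k IHk].
  by rewrite /fsum big_ord1 /= !qbin0 !mulr1.
(* Pascal's rule on [qbin (p.+1 + c) c] splits the sum into [fsum p 1], which vanishes by induction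
   on [p], and a shifted copy of the sum itself. *)
transitivity (fsum p 1 k.+1 - q ^ (p%:Z + 2) * fsum p.+1 0 k); last first.
  rewrite f1 IHk sub0r exprS mulN1r mulNr; congr (- _).
  by move: ((-1) ^+ _) => *; qmono.
rewrite /fsum big_ord_recl [in RHS]big_ord_recl -addrA; congr (_ + _).
  by rewrite /= addn1 !addn0 !qbin0.
rewrite mulr_sumr -sumrB; apply: eq_bigr => -[c ck] _ /=.
rewrite /bump /= !add1n !addn0 !addn1 subSS (addSnnS p c) addSn qbinS exprS.
move: (qbin _ _) (qbin _ _) (qbin _ _) ((-1) ^+ c) => x y z e.
rewrite mulN1r !mulNr mulrDr mulrDl opprD; congr (- _ - _); qmono.
Qed.

(** Pascal's rule lowers [a]; at the bottom the closed form [fsum_0] makes two terms cancel. Hence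
    the terms of T''_1 with a left power of E contribute nothing. *)
Lemma fsum_eq0 p a k : (a < k)%N -> fsum p a.+1 k = 0.
Proof.
elim: a k => [|a IHa] [|k] // ak; rewrite fsumS.
  rewrite !fsum_0 exprS mulN1r mulNr mulrN addrC; apply/eqP.
  by rewrite subr_eq0; apply/eqP; move: ((-1) ^+ k) => *; qmono.
by rewrite !IHa ?mulr0 ?addr0 // ltnW.
Qed.
End QBinomials.

Section BraidFmod.
Variables (S : comUnitRingType) (v : qparam S).
Local Notation q := (qv v).
Hypothesis qn : forall n, qint v n.+1 \is a GRing.unit.
Variable m : nat.
Local Notation Fm := (Fmod v m).
Local Notation u k := (@ubas S m k).

Lemma ubas_gt k : (m < k)%N -> u k = 0.
Proof. by rewrite /ubas ltnNge => /negPf->. Qed.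
Lemma opE0 : opE Fm (u 0) = 0. Proof. exact: FmE0. Qed.
Lemma opES k : (k < m)%N -> opE Fm (u k.+1) = qint v (m - k) *: u k.
Proof. exact: FmES. Qed.
Lemma opFu k : opF Fm (u k) = qint v k.+1 *: u k.+1.
Proof. exact: FmFE. Qed.
Lemma opKu k : opK Fm (u k) = q ^ (m%:Z - (2 * k)%:Z) *: u k.
Proof. exact: FmKE. Qed.
Lemma opKiu k : opKi Fm (u k) = q ^ ((2 * k)%:Z - m%:Z) *: u k.
Proof. exact: FmKiE. Qed.

Lemma qfact_neq k : qfact v k \is a GRing.unit. Proof. exact: qfact_unit. Qed.

Lemma act_dF_u j k : act Fm (dF v j) (u k) = qbin v (k + j) j *: u (k + j)%N.
Proof.
elim: j => [|j IH]; first by rewrite dFa0 addn0 qbin0 // scale1r.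
apply: (scalerI_unit (qn j)); rewrite -F_dF // IH (linZ (opF_lin Fm)) opFu.
rewrite !scalerA addnS; congr (_ *: _).
have fu := qfact_unit qn; apply: (mulIr (fu j)); apply: (mulIr (fu k)).
have e1 := qbinM qn (leq_addl k j); have e2 := qbinM qn (leq_addl k j.+1).
rewrite addnK in e1; rewrite addnK in e2.
rewrite qfactS addnS qfactS -e1 in e2.
transitivity (qbin v (k + j) j * (qfact v j * qfact v k) * qint v (k + j).+1).
  by ring.
by rewrite -e2; ring.
Qed.

Lemma act_dE_u j k : (j <= k)%N -> (k <= m)%N ->
  act Fm (dE v j) (u k) = qbin v (m - k + j) j *: u (k - j)%N.
Proof.
elim: j => [|j IH] jk km; first by rewrite dEa0 subn0 qbin0 // scale1r.
apply: (scalerI_unit (qn j)); rewrite -E_dE // IH ?(ltnW jk) //.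
rewrite (linZ (opE_lin Fm)) -(subnSK jk) opES; last by lia.
rewrite !scalerA; congr (_ *: _).
have -> : (m - (k - j.+1) = m - k + j.+1)%N by lia.
have fu := qfact_unit qn; apply: (mulIr (fu j)); apply: (mulIr (fu (m - k)%N)).
have e1 := qbinM qn (leq_addl (m - k) j).
have e2 := qbinM qn (leq_addl (m - k) j.+1).
rewrite addnK in e1; rewrite addnK in e2.
rewrite qfactS addnS qfactS -e1 in e2; rewrite addnS.
transitivity (qbin v (m - k + j) j * (qfact v j * qfact v (m - k)) *
  qint v (m - k + j).+1); first by ring.
by rewrite -e2; ring.
Qed.

Lemma act_dE_u0 j k : (k < j)%N -> act Fm (dE v j) (u k) = 0.
Proof.
have [km|mk] := leqP k m; last first.
  by rewrite ubas_gt // (lin0 (act_lin Fm _)).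
elim: j => // j IH; rewrite ltnS leq_eqVlt => /orP[/eqP<-|kj].
  apply: (scalerI_unit (qn k)); rewrite -E_dE // act_dE_u // subnn.
  by rewrite (linZ (opE_lin Fm)) opE0 !scaler0.
by apply: (scalerI_unit (qn j)); rewrite -E_dE // IH // (lin0 (opE_lin Fm)) scaler0.
Qed.

Lemma cV_ind (P : 'cV[S]_m.+1 -> Prop) :
  (forall x y, P x -> P y -> P (x + y)) -> P 0 ->
  (forall c k, (k <= m)%N -> P (c *: u k)) -> forall x, P x.
Proof.
move=> PD P0 Pu x; rewrite (cV_sum x); elim/big_ind: _ => // i _.
by rewrite -ubas_delta; apply: Pu; rewrite -ltnS.
Qed.

Lemma Fmod_dE0 j x : (m < j)%N -> act Fm (dE v j) x = 0.
Proof.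
move=> mj; elim/cV_ind: x => [x y ex ey||c k km].
- by rewrite (linD (act_lin Fm _)) ex ey addr0.
- exact: lin0 (act_lin Fm _).
by rewrite (linZ (act_lin Fm _)) act_dE_u0 ?scaler0 // (leq_ltn_trans km).
Qed.

Definition tau (k : nat) : S :=
  (-1) ^+ (m - k) * q ^ ((m%:Z - k%:Z) * (k%:Z + 1)).

(** The closed form of T''_1 on F_m, by [T1wt_u]; its relations with E, F, K can be read on the
    basis. *)
Definition braidFm : 'cV[S]_m.+1 -> 'cV[S]_m.+1 :=
  linext (fun k => tau k *: u (m - k)%N).

Lemma braidFm_lin : linear braidFm. Proof. exact: linext_lin. Qed.
Lemma braidFm_u k : (k <= m)%N -> braidFm (u k) = tau k *: u (m - k)%N.
Proof. by move=> km; rewrite /braidFm linextE km. Qed.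

Lemma tauS k : (k < m)%N -> tau k = - q ^ ((2 * k)%:Z + 2 - m%:Z) * tau k.+1.
Proof.
move=> km; rewrite /tau -(subnSK km) exprS mulN1r !mulNr; congr (- _).
by move: ((-1) ^+ _) => *; qmono.
Qed.

Lemma braidFm_E y : braidFm (opE Fm y) = - opF Fm (opK Fm (braidFm y)).
Proof.
have lt := braidFm_lin; move: y; apply: ubas_ext.
- exact: lin_comp lt (opE_lin _).
- exact: lin_opp (lin_comp (opF_lin _) (lin_comp (opK_lin _) lt)).
case=> [|k] km.
  rewrite opE0 (lin0 lt) braidFm_u // subn0 (linZ (opK_lin _)) opKu.
  by rewrite !(linZ (opF_lin _)) opFu (@ubas_gt m.+1) // !scaler0 oppr0.
rewrite opES // (linZ lt) braidFm_u ?(ltnW km) // braidFm_u //.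
rewrite (linZ (opK_lin _)) opKu !(linZ (opF_lin _)) opFu subnSK //.
rewrite !scalerA -scaleNr; congr (_ *: _); rewrite tauS //.
by move: (tau _) (qint v _) => *; rewrite !mulNr mulrN; congr (- _); qmono.
Qed.

Lemma braidFm_F y : braidFm (opF Fm y) = - opKi Fm (opE Fm (braidFm y)).
Proof.
have lt := braidFm_lin; move: y; apply: ubas_ext.
- exact: lin_comp lt (opF_lin _).
- exact: lin_opp (lin_comp (opKi_lin _) (lin_comp (opE_lin _) lt)).
move=> k; rewrite leq_eqVlt => /orP[/eqP->|km].
  rewrite opFu (linZ lt) ubas_gt // (lin0 lt) braidFm_u // subnn.
  by rewrite (linZ (opE_lin _)) opE0 !scaler0 (lin0 (opKi_lin _)) oppr0.
rewrite opFu (linZ lt) !braidFm_u ?(ltnW km) // (linZ (opE_lin _)).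
rewrite -(subnSK km) opES; last by lia.
rewrite !(linZ (opKi_lin _)) opKiu !scalerA -scaleNr; congr (_ *: _).
rewrite (tauS km) (_ : m - (m - k.+1) = k.+1)%N; last by lia.
by move: (tau _) (qint v _) => *; rewrite !mulNr opprK; qmono.
Qed.

Lemma braidFm_K y : braidFm (opK Fm y) = opKi Fm (braidFm y).
Proof.
have lt := braidFm_lin; move: y; apply: ubas_ext.
- exact: lin_comp lt (opK_lin _).
- exact: lin_comp (opKi_lin _) lt.
move=> k km; rewrite opKu (linZ lt) braidFm_u // (linZ (opKi_lin _)) opKiu.
by rewrite !scalerA mulrC; congr (_ * q ^ _ *: _); lia.
Qed.

Lemma braidFm_Ki y : braidFm (opKi Fm y) = opK Fm (braidFm y).
Proof. by rewrite -[y in RHS](opKKi Fm) braidFm_K opKKi. Qed.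

(** The weight condition fixes the exponent of F, so the sum runs over the exponents of the two
    powers of E. For a fixed left exponent it is an [fsum], and only the left exponent 0
    survives. *)
Lemma T1wt_u k : (k <= m)%N ->
  T1wt Fm (m%:Z - (2 * k)%:Z) (u k) = tau k *: u (m - k)%N.
Proof.
move=> km; pose p := (m - k)%N; have pk : (p + k = m)%N by rewrite subnK.
pose f (t : nat * nat * nat) := ((-1) ^+ t.1.2 *
  q ^ (- (t.1.1 * t.2)%:Z + t.1.2%:Z)) *:
  act Fm (dE v t.1.1) (act Fm (dF v t.1.2) (act Fm (dE v t.2) (u k))).
(* The exponent of F is forced by the weight; the truncated subtraction is exact under the filter in
   [r]. *)
pose g (s : nat * nat) := (s.1, p + s.1 + s.2 - k, s.2)%N.
pose r0 := [seq (x, y) | x <- iota 0 m.+1, y <- iota 0 k.+1].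
pose r := [seq g s | s <- r0 & (k <= p + s.1 + s.2)%N].
have memr0 s : (s \in r0) = (s.1 <= m)%N && (s.2 <= k)%N.
  apply/allpairsP/andP => [[[x y] []]|[xm yk]].
    by rewrite !mem_iota /= => ? ? ->; split=> /=; lia.
  by exists s; rewrite !mem_iota !add0n !ltnS !leq0n xm yk; case: s {xm yk}.
have Dg s : (k <= p + s.1 + s.2)%N -> - (g s).1.1%:Z + (g s).1.2%:Z - (g s).2%:Z =
    m%:Z - (2 * k)%:Z by rewrite /g /=; lia.
have -> : T1wt Fm (m%:Z - (2 * k)%:Z) (u k) = \sum_(t <- r) f t.
  rewrite /T1wt (fsbigE r) /=; last first.
  - move=> [[x y] z] /= e; apply: contraNeq => nz.
    have zk : (z <= k)%N.
      rewrite leqNgt; apply: contra nz => kz; apply/eqP.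
      by rewrite act_dE_u0 // !(lin0 (act_lin Fm _)) scaler0.
    have xm : (x <= m)%N.
      by rewrite leqNgt; apply: contra nz => mx; apply/eqP; rewrite Fmod_dE0 // scaler0.
    apply/mapP; exists (x, z); last by rewrite /g /=; congr (_, _, _); lia.
    by rewrite mem_filter memr0 /= xm zk andbT; lia.
  - move=> t /= /mapP[s]; rewrite mem_filter => /andP[sk _] ->; exact: Dg.
  - rewrite map_inj_in_uniq.
      by apply/filter_uniq/allpairs_uniq; rewrite ?iota_uniq // => -[? ?] [? ?].
    by move=> [x y] [x' y'] _ _ [-> _ ->].
  rewrite -[in LHS]big_filter; congr (\sum_(t <- _) _); apply/all_filterP/allP => t.
  move=> /mapP[s]; rewrite mem_filter => /andP[sk _] ->.
  by rewrite mem_set //=; exact: Dg.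
rewrite big_map big_filter big_mkcond big_allpairs.
have fk (x y : nat) : (y <= k)%N -> (if (k <= p + x + y)%N then f (g (x, y)) else 0) =
    ((-1) ^+ (p + k + x) * q ^ (p%:Z + x%:Z - k%:Z) * qbin v k x *
     ((-1) ^+ y * q ^ (y%:Z * (1 - x%:Z)) * qbin v (p + y) y * qbin v (p + x) (k - y)))
    *: (if (x <= k)%N then u p else 0).
  move=> yk; case: ifP => kxy; last first.
    by rewrite (@qbin_gt _ _ (p + x)) ?mulr0 ?scale0r //; lia.
  rewrite /f /g /= act_dE_u // (linZ (act_lin Fm _)) act_dF_u !(linZ (act_lin Fm _)).
  have -> : (k - y + (p + x + y - k) = p + x)%N by lia.
  have [xk|kx] := leqP x k; last first.
    by rewrite ubas_gt ?(lin0 (act_lin Fm _)) ?scaler0 //; lia.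
  rewrite act_dE_u ?addnK; [|lia|lia]; rewrite !scalerA; congr (_ *: _).
  have -> : (m - (p + x) + x = k)%N by lia.
  have -> : qbin v (p + x) (p + x + y - k) = qbin v (p + x) (k - y).
    by rewrite -[RHS]qbin_sub; [congr (qbin _ _ _); lia|lia].
  rewrite -/p; have -> : (-1) ^+ (p + x + y - k) = (-1) ^+ (p + k + x) * (-1) ^+ y :> S.
    rewrite -exprD -[LHS]signr_odd -[RHS]signr_odd; congr (_ ^+ nat_of_bool _).
    by rewrite oddB // !oddD; case: (odd p) (odd k) (odd x) (odd y) => [] [] [] [].
  move: ((-1) ^+ _) ((-1) ^+ _) (qbin _ _ _) (qbin _ _ _) (qbin _ _ _) => *.
  by qmono.
transitivity (\sum_(x <- iota 0 m.+1) ((-1) ^+ (p + k + x) *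
    q ^ (p%:Z + x%:Z - k%:Z) * qbin v k x * fsum v p x k) *:
    (if (x <= k)%N then u p else 0)).
  apply: eq_bigr => x _; rewrite -[iota 0 k.+1]/(index_iota 0 k.+1) big_mkord.
  rewrite /fsum mulr_sumr scaler_suml; apply: eq_bigr => y _.
  exact: (fk x y (ltn_ord y : y <= k)%N).
(* Only [x = 0] contributes: for [0 < x <= k] the inner sum vanishes, and for [x > k] the vector is
   0. *)
rewrite big_cons big1_seq => [|x]; last first.
  move=> /andP[_]; rewrite mem_iota => /andP[x0 _]; case: ifP => xk; last by rewrite scaler0.
  by rewrite -(prednK x0) fsum_eq0 ?mulr0 ?scale0r //; lia.
rewrite addr0 leq0n addn0 qbin0 // fsum_0 // /tau -/p; congr (_ *: _).
rewrite mulr1 exprD; have -> : (-1) ^+ k = (-1) ^+ k :> S by [].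
have ss : (-1) ^+ k * (-1) ^+ k = 1 :> S by rewrite -exprD addnn -mul2n exprM sqrrN !expr1n.
transitivity ((-1) ^+ p * ((-1) ^+ k * (-1) ^+ k) * (q ^ (p%:Z - k%:Z) * q ^ (k%:Z * (p%:Z + 1)))).
  by rewrite addr0; ring.
by rewrite ss mulr1 qD; congr (_ * q ^ _); lia.
Qed.

End BraidFmod.

(** * Strings of highest weight vectors and independence of eigenvectors *)

Section HighestWeight.
Variables (S : comUnitRingType) (v : qparam S) (A : lmodType S) (a : uaction v A).
Local Notation q := (qv v).
Hypothesis qn : forall n, qint v n.+1 \is a GRing.unit.

Lemma act_twist (theta : {lrmorphism Uq v -> Uq v}) u x :
  act (twist theta a) u x = act a (theta u) x.
Proof.
elim/gen_ind: u x.
- by move=> x; rewrite actE.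
- by move=> x; rewrite actF.
- by move=> x; rewrite actK.
- by move=> x; rewrite actKi.
- by move=> c x; rewrite actC linearZ /= rmorph1 actC.
- by move=> u w IHu IHw x; rewrite actD IHu IHw rmorphD actD.
- by move=> u w IHu IHw x; rewrite actM IHu IHw rmorphM actM.
Qed.

Lemma act_twist_dE j x :
  act (twist (@rho1 S v) a) (dE v j) x = (- q) ^+ j *: act a (dF v j) x.
Proof. by rewrite act_twist /= rho1_dE; exact: actZ. Qed.

Lemma E_dF_hw N x i : opE a x = 0 -> opK a x = q ^ N *: x ->
  opE a (act a (dF v i.+1) x) = qi v (N - i%:Z) *: act a (dF v i) x.
Proof.
move=> Ex Kx; rewrite E_dF // Ex (lin0 (act_lin a _)) add0r.
have Kix : opKi a x = q ^ (- N) *: x.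
  by rewrite (wt_Ki (qX_unit v N) Kx) invr_expz.
rewrite Kx Kix !scalerA !qD -scalerBl (linZ (act_lin a _)) scalerA; congr (_ *: _).
by rewrite /qi; congr (_ * (q ^ _ - q ^ _)); lia.
Qed.

Lemma eigen_indep (T : A -> A) N (w : nat -> A) (lam c : nat -> S) :
  linear T -> (forall i, (i < N)%N -> T (w i) = lam i *: w i) ->
  (forall i j, (i < j)%N -> (j < N)%N -> lam i - lam j \is a GRing.unit) ->
  \sum_(i < N) c i *: w i = 0 -> forall i, (i < N)%N -> c i *: w i = 0.
Proof.
move=> lT; elim: N c => [//|N IH] c Tw du s0.
have s1 : \sum_(i < N) ((lam i - lam N) * c i) *: w i = 0.
  have := congr1 (fun x => T x - lam N *: x) s0; rewrite (lin0 lT) scaler0 subr0.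
  move=> e; rewrite -[RHS]e (lin_sum lT) scaler_sumr -sumrB [in RHS]big_ord_recr /=.
  rewrite (linZ lT) Tw // scalerC subrr addr0; apply: eq_bigr => i _.
  by rewrite (linZ lT) Tw ?(ltn_trans (ltn_ord i)) // scalerC -scalerBl scalerA.
have z i : (i < N)%N -> c i *: w i = 0.
  move=> iN; apply: (scalerI_unit (du i N iN (ltnSn N))); rewrite scaler0 scalerA.
  apply: (IH (fun i => (lam i - lam N) * c i)) iN => // [j jN|j k jk kN].
    by rewrite Tw // ltnW.
  by rewrite du // ltnW.
move=> i; rewrite ltnS leq_eqVlt => /orP[/eqP->|]; last exact: z.
by move: s0; rewrite big_ord_recr big1 /= ?add0r // => j _; exact: z.
Qed.

(** The left side is a difference of eigenvalues of FE on zero weight vectors; the factored form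
    shows when it is nonzero. *)
Lemma qi_quad x y :
  qi v x * qi v (x + 1) - qi v y * qi v (y + 1) = qi v (x - y) * qi v (x + y + 1).
Proof.
have e z z' : qi v z * qi v z' = (q - q^-1)^-1 * (q - q^-1)^-1 *
    (q ^ (z + z') - q ^ (z - z') - (q ^ (- z + z') - q ^ (- z - z'))).
  by rewrite /qi mulrACA mulrBl !mulrBr !qD.
rewrite !e -mulrBr; congr (_ * _).
have <- : x + (x + 1) = x - y + (x + y + 1) by lia.
have <- : - x - (x + 1) = - (x - y) - (x + y + 1) by lia.
have <- : - y - (y + 1) = x - y - (x + y + 1) by lia.
have <- : y + (y + 1) = - (x - y) + (x + y + 1) by lia.
have -> : x - (x + 1) = -1 by lia.
have -> : y - (y + 1) = -1 by lia.
have -> : - x + (x + 1) = 1 by lia.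
have -> : - y + (y + 1) = 1 by lia.
move: (q ^ _) (q ^ _) (q ^ _) (q ^ _) (q ^ _) (q ^ _) => *; ring.
Qed.
End HighestWeight.

(** * The operator Q on F_m (x) F_n^rho1, and coordinates there *)

Section TensorRho.
Variables (F : fieldType) (v : qparam F).
Local Notation q := (qv v).
Hypothesis qn : forall n, qint v n.+1 \is a GRing.unit.
Variables m n : nat.
Local Notation Fm := (Fmod v m).
Local Notation Fn := (Fmod v n).
Local Notation Fn1 := (twist (@rho1 F v) Fn).
Local Notation W := {ffun 'I_n.+1 -> 'cV[F]_m.+1}.
Local Notation aW := (FFmod v m n).
Local Notation u2 i j := (ubas2 F m n i j).
Local Notation t := (@braidFm F v m).
Local Notation t' := (@braidFm F v n).

Lemma rho_braidE y : t' (opE Fn1 y) = - opF Fn1 (opK Fn1 (t' y)).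
Proof.
rewrite !(twistRE, twistRF, twistRK) (linZ (@braidFm_lin _ v n)) braidFm_F //.
rewrite Ki_E !scalerN !scaleNr !opprK scalerA; congr (_ *: _).
by rewrite [X in X * _]q1 qV; qmono.
Qed.
Lemma rho_braidF y : t' (opF Fn1 y) = - opKi Fn1 (opE Fn1 (t' y)).
Proof.
rewrite !(twistRE, twistRF, twistRKi) (linZ (@braidFm_lin _ v n)) braidFm_E //.
rewrite (linZ (opK_lin Fn)) K_F scalerN !scaleNr !opprK scalerA; congr (_ *: _).
by rewrite [X in X * _]q1 qV; qmono.
Qed.
Lemma rho_braidK y : t' (opK Fn1 y) = opKi Fn1 (t' y).
Proof.
by rewrite twistRK twistRKi braidFm_Ki.
Qed.
Lemma rho_nil j y : (n.+1 <= j)%N -> act Fn1 (dE v j) y = 0.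
Proof.
move=> nj; rewrite act_twist_dE.
suff -> : act Fn (dF v j) y = 0 by rewrite scaler0.
elim/cV_ind: y => [x y ex ey||c k kn].
- by rewrite (linD (act_lin Fn _)) ex ey addr0.
- exact: lin0 (act_lin Fn _).
by rewrite (linZ (act_lin Fn _)) act_dF_u // ubas_gt ?scaler0 // (leq_trans nj) ?leq_addl.
Qed.

(** An operator with the relations of T''_1 on the whole module: [braid] leaves a twist by T'_-1 on
    the first factor, which [t] removes. See [braidWE], [braidWF], [braidWK]. *)
Definition braidW (w : W) : W := tmap t id (braid Fm Fn1 t' n.+1 w).

Let lt : linear t := @braidFm_lin _ v m.
Let lt' : linear t' := @braidFm_lin _ v n.
Let lid : linear (id : 'cV[F]_n.+1 -> 'cV[F]_n.+1). Proof. by []. Qed.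
Let ltm : linear (tmap t id : W -> W). Proof. exact: tmap_lin lt. Qed.

Lemma braidW_lin : linear braidW.
Proof. exact: lin_comp ltm (braid_lin _ _ _ _). Qed.

Local Notation T' := (tens (twist (@Tminus1 F v) Fm) Fn1).

Let tmE w : tmap t id (opE T' w) = opE aW (tmap t id w).
Proof.
move: w; apply: tens_ext.
- exact: lin_comp ltm (opE_lin _).
- exact: lin_comp (opE_lin _) ltm.
move=> x e; rewrite tensE_pure (linD ltm) !tmap_pure // tensE_pure.
rewrite twistTE twistTK (linN lt) braidFm_Ki braidFm_F //.
rewrite (linN (opK_lin Fm)) opKKi opprK.
by rewrite braidFm_Ki.
Qed.
Let tmF w : tmap t id (opF T' w) = opF aW (tmap t id w).
Proof.
move: w; apply: tens_ext.
- exact: lin_comp ltm (opF_lin _).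
- exact: lin_comp (opF_lin _) ltm.
move=> x e; rewrite tensF_pure (linD ltm) !tmap_pure // tensF_pure.
by rewrite twistTF (linN lt) braidFm_E // opprK braidFm_K // opKKi.
Qed.
Let tmK w : tmap t id (opK T' w) = opK aW (tmap t id w).
Proof.
move: w; apply: tens_ext.
- exact: lin_comp ltm (opK_lin _).
- exact: lin_comp (opK_lin _) ltm.
move=> x e; rewrite tensK_pure !tmap_pure // tensK_pure twistTK.
by rewrite braidFm_Ki.
Qed.

Lemma braidWF w : braidW (opKi aW (opF aW w)) = - opE aW (braidW w).
Proof.
rewrite /braidW (braid_opF _ qn lt' rho_braidF rho_braidK rho_nil).
by rewrite (linN ltm) tmE.
Qed.
Lemma braidWE w : braidW (opE aW (opK aW w)) = - opF aW (braidW w).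
Proof.
rewrite /braidW (braid_opE _ qn lt' rho_braidE rho_braidK rho_nil).
by rewrite (linN ltm) tmF.
Qed.
Lemma braidWK w : braidW (opKi aW w) = opK aW (braidW w).
Proof.
rewrite /braidW (braid_opK _ qn lt' rho_braidK).
by rewrite tmK.
Qed.

Definition co (i j : nat) (w : W) : F := w (inord j) (inord i) 0.

Lemma co_lin i j : linear (co i j : W -> F^o).
Proof. by move=> c x y; rewrite /co !ffunE !mxE. Qed.
Lemma co0 i j : co i j 0 = 0. Proof. by rewrite /co !ffunE !mxE. Qed.
Lemma coZ i j c w : co i j (c *: w) = c * co i j w.
Proof. by rewrite /co !ffunE !mxE. Qed.
Lemma coD i j w w' : co i j (w + w') = co i j w + co i j w'.
Proof. by rewrite /co !ffunE !mxE. Qed.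
Lemma coB i j w w' : co i j (w - w') = co i j w - co i j w'.
Proof. by rewrite /co !ffunE !mxE. Qed.
Lemma co_sum (I : Type) (r : seq I) (P : pred I) (f : I -> W) i j :
  co i j (\sum_(k <- r | P k) f k) = \sum_(k <- r | P k) co i j (f k).
Proof. by apply: (big_morph _ (@coD i j) (@co0 i j)). Qed.
Lemma co_u2 i j k l : (i <= m)%N -> (j <= n)%N -> (k <= m)%N -> (l <= n)%N ->
  co i j (u2 k l) = ((i == k) && (j == l))%:R.
Proof.
move=> im jn km ln; rewrite /co /ubas2 !ffunE /ubas km ln !mxE !eqxx !andbT.
rewrite -!val_eqE /= !inordK //.
by case: (i == k); case: (j == l); rewrite ?mulr1 ?mulr0.
Qed.

Lemma W_expand w : w = \sum_(i < m.+1) \sum_(j < n.+1) co i j w *: u2 i j.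
Proof.
rewrite exchange_big {1}[w]tpure_sum; apply: eq_bigr => j _.
rewrite [in LHS](cV_sum (w j)) (lin_sum (tpure_linl _)).
apply: eq_bigr => i _; rewrite tpureZl /co !inord_val /ubas2.
by rewrite !ubas_delta.
Qed.

Lemma W_ind (P : W -> Prop) :
  (forall x y, P x -> P y -> P (x + y)) -> P 0 ->
  (forall c i j, (i <= m)%N -> (j <= n)%N -> P (c *: u2 i j)) -> forall w, P w.
Proof.
move=> PD P0 Pu w; rewrite [w]W_expand; elim/big_ind: _ => // i _.
by elim/big_ind: _ => // j _; apply: Pu; rewrite -ltnS.
Qed.

Lemma W_ext (B : lmodType F) (f g : W -> B) : linear f -> linear g ->
  (forall i j, (i <= m)%N -> (j <= n)%N -> f (u2 i j) = g (u2 i j)) -> f =1 g.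
Proof.
move=> lf lg fg; elim/W_ind=> [x y ex ey||c i j im jn].
- by rewrite (linD lf) (linD lg) ex ey.
- by rewrite (lin0 lf) (lin0 lg).
by rewrite (linZ lf) (linZ lg) fg.
Qed.

Lemma W_eq w w' : (forall i j, (i <= m)%N -> (j <= n)%N -> co i j w = co i j w') ->
  w = w'.
Proof.
move=> e; rewrite [w]W_expand [w']W_expand; apply: eq_bigr => i _.
by apply: eq_bigr => j _; rewrite e // -ltnS.
Qed.

Lemma K_u2 i j : opK aW (u2 i j) =
  q ^ ((m%:Z - (2 * i)%:Z) - (n%:Z - (2 * j)%:Z)) *: u2 i j.
Proof.
rewrite tensK_pure twistRK opKu opKiu tpureZl tpureZr scalerA qD.
by congr (q ^ _ *: _); lia.
Qed.
Lemma E_u2 i j : opE aW (u2 i j) = tpure (opE Fm (ubas m i)) (ubas n j) -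
  (q ^ (m%:Z - (2 * i)%:Z + 1) * qint v j.+1) *: u2 i j.+1.
Proof.
rewrite tensE_pure twistRE opFu opKu scalerA tpureZl tpureZr scalerA; congr (_ + _).
rewrite -scaleNr mulNr mulrN; congr (- _ *: _).
by rewrite [X in _ * (X * _)]q1; qmono.
Qed.
Lemma F_u2 i j : opF aW (u2 i j) =
  (qint v i.+1 * q ^ (n%:Z - (2 * j)%:Z)) *: u2 i.+1 j -
  q ^ (- 1) *: tpure (ubas m i) (opE Fn (ubas n j)).
Proof.
rewrite tensF_pure twistRF twistRKi opFu opKu tpureZl tpureZr scalerA.
by rewrite tpureZr scaleNr.
Qed.

End TensorRho.

Section TensorRhoBasis.
Variables (F : fieldType) (v : qparam F).
Local Notation q := (qv v).
Hypothesis qn : forall n, qint v n.+1 \is a GRing.unit.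
Variables m n : nat.
Local Notation Fm := (Fmod v m).
Local Notation Fn := (Fmod v n).
Local Notation Fn1 := (twist (@rho1 F v) Fn).
Local Notation W := {ffun 'I_n.+1 -> 'cV[F]_m.+1}.
Local Notation aW := (FFmod v m n).
Local Notation u2 i j := (ubas2 F m n i j).
Local Notation t := (@braidFm F v m).
Local Notation t' := (@braidFm F v n).
Local Notation co := (@co F m n).
Local Notation Q := (@braidW F v m n).
Local Notation fu := (qfact_unit qn).

Lemma u2_gtl i j : (m < i)%N -> u2 i j = 0.
Proof. by move=> mi; rewrite /ubas2 ubas_gt // tpure0l. Qed.
Lemma u2_gtr i j : (n < j)%N -> u2 i j = 0.
Proof. by move=> nj; rewrite /ubas2 (@ubas_gt _ n) // tpure0r. Qed.

Lemma coE i j k l : (i <= m)%N -> (j <= n)%N ->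
  co i j (u2 k l) = ((i == k) && (j == l))%:R.
Proof.
move=> im jn; have [km|mk] := leqP k m; last first.
  by rewrite u2_gtl // co0 (_ : i == k = false) //; lia.
have [ln|nl] := leqP l n; last first.
  by rewrite u2_gtr // co0 (_ : j == l = false) ?andbF //; lia.
exact: co_u2.
Qed.

Definition hwc p k : F := (-1) ^+ (n - p) *
     (qfact v (n - p + k) * qfact v (m - k) / (qfact v (n - p) * qfact v m)) *
     q ^ ((k%:Z - p%:Z) * (2 + m%:Z) + p%:Z ^+ 2 - k%:Z ^+ 2 + n%:Z).

Lemma uhwE p : uhw v m n p = \sum_(k < p.+1) hwc p k *: u2 k (n - p + k).
Proof. by []. Qed.

Lemma hwcS p k : (k < m)%N -> hwc p k.+1 * qint v (m - k) =
  hwc p k * q ^ (m%:Z - (2 * k)%:Z + 1) * qint v (n - p + k).+1.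
Proof.
move=> km; rewrite /hwc addnS qfactS.
have -> : qfact v (m - k) = qfact v (m - k.+1) * qint v (m - k).
  by rewrite -(subnSK km) qfactS.
move: (qint v _) (qint v _) (_^-1) (qfact v _) (qfact v _) ((-1) ^+ _) => x y z f g e.
by qmono.
Qed.

Lemma uhw_E p : (p <= minn m n)%N -> opE aW (uhw v m n p) = 0.
Proof.
rewrite leq_min => /andP[pm pn]; rewrite uhwE (lin_sum (opE_lin aW)).
pose g k := hwc p k *: tpure (opE Fm (ubas m k)) (ubas n (n - p + k)).
pose f k := (hwc p k * (q ^ (m%:Z - (2 * k)%:Z + 1) * qint v (n - p + k).+1)) *:
  u2 k (n - p + k).+1.
transitivity (\sum_(k < p.+1) (g k - f k)).
  apply: eq_bigr => k _; rewrite (linZ (opE_lin aW)) E_u2 scalerBr; congr (_ - _).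
  by rewrite scalerA.
rewrite sumrB; apply/eqP; rewrite subr_eq0; apply/eqP/esym; apply: sum_shift.
- by rewrite /g opE0 tpure0l scaler0.
- by rewrite /f subnK // u2_gtr // scaler0.
move=> k kp; have km := leq_trans kp pm.
by rewrite /g /f opES // tpureZl scalerA hwcS // -mulrA addnS.
Qed.

Lemma uhw_K p : (p <= minn m n)%N ->
  opK aW (uhw v m n p) = q ^ (m + n - 2 * p)%:Z *: uhw v m n p.
Proof.
rewrite leq_min => /andP[pm pn]; rewrite uhwE (lin_sum (opK_lin aW)) scaler_sumr.
apply: eq_bigr => k _; rewrite (linZ (opK_lin aW)) K_u2 scalerC; congr (q ^ _ *: _).
lia.
Qed.

Lemma co_uhw0 p : (p <= minn m n)%N -> co 0 (n - p) (uhw v m n p) = hwc p 0.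
Proof.
rewrite leq_min => /andP[pm pn]; rewrite uhwE co_sum.
rewrite big_ord_recl /= big1 => [|i _].
  rewrite coZ coE ?leq_subr // addn0 !eqxx.
  by rewrite addr0; exact: mulr1.
by rewrite coZ coE ?leq_subr // mulr0.
Qed.
Lemma co_uhwp p : (p <= minn m n)%N -> co p n (uhw v m n p) = hwc p p.
Proof.
rewrite leq_min => /andP[pm pn]; rewrite uhwE co_sum.
rewrite big_ord_recr /= big1 => [|i _].
  rewrite coZ coE // subnK // !eqxx.
  by rewrite add0r; exact: mulr1.
rewrite coZ coE // (_ : p == i = false) ?mulr0 //.
by have := ltn_ord i; lia.
Qed.

(** On the edge where the first index is 0, only the lowering of the second index by F contributes,
    so coordinates can be followed along powers of F. [co_Fn] treats the edge where the second index
    is [n]. *)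
Lemma co_F0 l w : (l < n)%N -> co 0 l (opF aW w) = - q ^ (-1) * qint v (n - l) * co 0 l.+1 w.
Proof.
move=> ln; move: w; apply: (W_ext (B := F^o)).
- by move=> c x y; rewrite (opF_lin aW) coD coZ.
- by move=> c x y; rewrite coD coZ mulrDr mulrCA.
move=> i j im jn; rewrite F_u2 coB.
rewrite !coZ coE ?(ltnW ln) // mulr0 sub0r.
rewrite coE //; case: j jn => [|j] jn.
  by rewrite opE0 tpure0r co0 andbF !mulr0 oppr0.
rewrite opES // tpureZr coZ coE ?(ltnW ln) //.
rewrite eqSS !mulNr -mulrA; congr (- (_ * _)).
have [->|_] := eqVneq l j; first by [].
by rewrite andbF !mulr0.
Qed.

Lemma co_Fn k w : (k < m)%N -> co k.+1 n (opF aW w) = q ^ (- n%:Z) * qint v k.+1 * co k n w.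
Proof.
move=> km; move: w; apply: (W_ext (B := F^o)).
- by move=> c x y; rewrite (opF_lin aW) coD coZ.
- by move=> c x y; rewrite coD coZ mulrDr mulrCA.
move=> i j im jn; rewrite F_u2 coB.
rewrite !coZ coE //.
have -> : co k.+1 n (tpure (ubas m i) (opE Fn (ubas n j))) = 0.
  case: j jn => [|j] jn; first by rewrite opE0 tpure0r co0.
  rewrite opES // tpureZr coZ coE // (_ : n == j = false).
    by rewrite andbF mulr0.
  by rewrite eqn_leq leqNgt jn.
rewrite mulr0 subr0 coE ?(ltnW km) // eqSS.
have [->|] := eqVneq k i; have [<-|] := eqVneq n j; rewrite ?andbF ?mulr0 //.
by rewrite /= !mulr1 mulrC; congr (q ^ _ * _); lia.
Qed.

Lemma qbin_rec k l : qint v k.+1 * qbin v k l = qint v l.+1 * qbin v k.+1 l.+1.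
Proof.
have [lk|kl] := leqP l k; last by rewrite !qbin_gt ?mulr0.
have du : qfact v l * qfact v (k - l) \is a GRing.unit by rewrite unitrM !fu.
apply: (mulIr du); rewrite -mulrA qbinM // mulrC -qfactS.
rewrite -(qbinM qn (lk : l.+1 <= k.+1)%N) subSS qfactS.
move: (qbin _ _ _) (qint v _) (qfact v _) (qfact v _) => *; ring.
Qed.

Lemma co_dF0 j l w : (l + j <= n)%N -> co 0 l (act aW (dF v j) w) =
  (- q ^ (-1)) ^+ j * qbin v (n - l) j * co 0 (l + j) w.
Proof.
elim: j l => [|j IH] l lj; first by rewrite dFa0 qbin0 // addn0 !mul1r.
apply: (mulrI (qn j)); rewrite -coZ -(F_dF _ qn) co_F0; last by lia.
rewrite IH; last by lia.
have -> : (n - l = (n - l.+1).+1)%N by lia.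
rewrite addSnnS exprS.
transitivity (- q ^ (-1) * (- q ^ (-1)) ^+ j *
  (qint v (n - l.+1).+1 * qbin v (n - l.+1) j) * co 0 (l + j.+1) w); first by ring.
by rewrite qbin_rec; ring.
Qed.

Lemma co_dFn j k w : (j <= k)%N -> (k <= m)%N -> co k n (act aW (dF v j) w) =
  q ^ (- (n * j)%:Z) * qbin v k j * co (k - j) n w.
Proof.
elim: j k => [|j IH] k jk km; first by rewrite dFa0 qbin0 // muln0 subn0 !mul1r.
apply: (mulrI (qn j)); case: k jk km => // k jk km.
rewrite -coZ -(F_dF _ qn) co_Fn // IH //; last by lia.
rewrite subSS.
transitivity (q ^ (- n%:Z) * q ^ (- (n * j)%:Z) *
  (qint v k.+1 * qbin v k j) * co (k - j) n w); first by ring.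
rewrite qbin_rec; move: (qint v _) (qbin _ _ _) (co _ _ _) => *; qmono.
Qed.

(** Each term of [braid] raises both indices by the same amount and [t], [t'] reverse them, so
    [u_m (x) u_n] is reached only from [u_0 (x) u_0], by the term of index 0. This coordinate pins
    down the scalars by which Q acts. *)
Lemma co_Q w : co m n (Q w) = tau v m 0 * tau v n 0 * co 0 0 w.
Proof.
move: w; apply: (W_ext (B := F^o)).
- by move=> c x y; rewrite (@braidW_lin _ v m n) coD coZ.
- by move=> c x y; rewrite coD coZ mulrDr mulrCA.
move=> i j im jn; have lt := @braidFm_lin _ v m; have lt' := @braidFm_lin _ v n.
have ltm : linear (tmap t id : W -> W) by exact: tmap_lin lt.
rewrite /braidW braid_pure // (lin_sum ltm) co_sum.
pose f a := cJ v a * (qbin v (i + a) a * ((- q) ^+ a * qbin v (j + a) a)) *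
  (tau v m (i + a) * tau v n (j + a)) * ((i + a == 0) && (j + a == 0))%N%:R.
transitivity (\sum_(a < n.+2) f a).
  apply: eq_bigr => a _.
  rewrite (linZ ltm) tmap_pure // act_twist_dE !act_dF_u //.
  have [ia|mi] := leqP (i + a) m; last first.
    rewrite ubas_gt // scaler0 (lin0 lt) tpure0l scaler0 co0.
    by rewrite /f (_ : (i + a == 0) = false)%N ?mulr0 //; lia.
  have [ja|nj] := leqP (j + a) n; last first.
    rewrite (@ubas_gt _ n) // !scaler0 (lin0 lt') tpure0r scaler0 co0.
    by rewrite /f (_ : (j + a == 0) = false)%N ?andbF ?mulr0 //; lia.
  rewrite scalerA (linZ lt) (linZ lt') !braidFm_u // !tpureZl !tpureZr !scalerA.
  rewrite coZ coE // /f.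
  have -> : (m == m - (i + a) = (i + a == 0))%N by lia.
  have -> : (n == n - (j + a) = (j + a == 0))%N by lia.
  by move: ((_ && _)%:R) => *; ring.
rewrite big_ord_recl /= big1 => [|a _]; last first.
  by rewrite /f /bump /= (_ : (i + _ == 0) = false)%N ?mulr0 // addnS.
rewrite /f /= !addn0 cJ0 !qbin0 // addr0 coE // !mul1r.
rewrite (eq_sym 0%N i) (eq_sym 0%N j) {f}.
by case: i im => [|i] im; case: j jn => [|j] jn; rewrite ?mulr0.
Qed.
End TensorRhoBasis.

(** * Eigenvalues of Q on the zero weight space *)

Section ZeroWeight.
Variables (F : fieldType) (v : qparam F).
Local Notation q := (qv v).
Hypothesis qn : forall n, qint v n.+1 \is a GRing.unit.
Variables m n s : nat.
Hypothesis mns : (m + n = 2 * s)%N.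
Local Notation W := {ffun 'I_n.+1 -> 'cV[F]_m.+1}.
Local Notation aW := (FFmod v m n).
Local Notation u2 i j := (ubas2 F m n i j).
Local Notation co := (@co F m n).
Local Notation Q := (@braidW F v m n).
Local Notation d := (minn m n).

Lemma qi_neq0 z : z != 0 -> qi v z != 0.
Proof.
case: z => [[|k]|k] // _; first by rewrite -qintE -unitfE.
by rewrite NegzE qiN oppr_eq0 -qintE -unitfE.
Qed.
Lemma qX_neq1 z : z != 0 -> q ^ z != 1.
Proof.
move=> z0; apply: contraNneq (qi_neq0 z0) => e.
by rewrite /qi -invr_expz e invr1 subrr mulr0.
Qed.

Local Opaque braidW act uhw.

Definition chain p i : W := act aW (dF v i) (uhw v m n p).

Lemma ledd p : (p <= d)%N -> (p <= s)%N. Proof. lia. Qed.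

Lemma chain_E p i : (p <= d)%N ->
  opE aW (chain p i.+1) = qi v ((2 * (s - p))%:Z - i%:Z) *: chain p i.
Proof.
move=> pd; rewrite /chain (E_dF_hw qn (N := (2 * (s - p))%N)) ?uhw_E //.
by rewrite uhw_K //; congr (q ^ _ *: _); lia.
Qed.
Lemma chain_F p i : opF aW (chain p i) = qint v i.+1 *: chain p i.+1.
Proof. exact: F_dF. Qed.
Lemma chain_K p i : (p <= d)%N ->
  opK aW (chain p i) = q ^ ((2 * (s - p))%:Z - (2 * i)%:Z) *: chain p i.
Proof.
move=> pd; rewrite /chain (K_dF _ qn) uhw_K // (linZ (act_lin aW _)) scalerA qD.
by congr (q ^ _ *: _); lia.
Qed.
Lemma chain_Ki p i : (p <= d)%N ->
  opKi aW (chain p i) = q ^ ((2 * i)%:Z - (2 * (s - p))%:Z) *: chain p i.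
Proof.
move=> pd; rewrite (wt_Ki (qX_unit v _) (chain_K i pd)) invr_expz.
by congr (q ^ _ *: _); lia.
Qed.

Let fu := qfact_unit qn.

Lemma hwc_unit p k : hwc v m n p k != 0.
Proof.
rewrite /hwc -!unitfE !unitrM !fu qX_unit unitrX ?unitrN1 ?unitrV ?unitrM ?fu //.
Qed.

Lemma chain_neq0 p i : (p <= d)%N -> (i <= 2 * (s - p))%N -> chain p i != 0.
Proof.
move=> pd; elim: i => [_|i IH iN].
  rewrite /chain dFa0; apply: contraTneq (hwc_unit p 0) => e.
  by rewrite -(co_uhw0 v pd) e co0 eqxx.
have : qi v ((2 * (s - p))%:Z - i%:Z) *: chain p i != 0.
  rewrite scaler_eq0 negb_or; apply/andP; split; first by apply: qi_neq0; lia.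
  exact: IH (ltnW iN).
by apply: contraNneq => e; rewrite -chain_E // e (lin0 (opE_lin aW)).
Qed.

Definition wz p := chain p (s - p).

Lemma wz_K p : (p <= d)%N -> opK aW (wz p) = wz p.
Proof. by move=> pd; rewrite chain_K // (_ : _ - _ = 0) ?scale1r //; lia. Qed.

Lemma wz_FE p : (p <= d)%N -> opF aW (opE aW (wz p)) =
  (qi v (s - p)%:Z * qi v ((s - p)%:Z + 1)) *: wz p.
Proof.
move=> pd; rewrite /wz; case e: (s - p)%N => [|r].
  rewrite qi0 mul0r scale0r /chain dFa0 uhw_E // (lin0 (opF_lin aW)) //.
rewrite chain_E // (linZ (opF_lin aW)) chain_F scalerA mulrC; congr (_ * _ *: _).
  by rewrite qintE.
by rewrite e; congr (qi v _); lia.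
Qed.

(** The [wz p] are nonzero eigenvectors of FE for distinct eigenvalues. *)
Lemma wz_indep (c : nat -> F) : \sum_(p < d.+1) c p *: wz p = 0 ->
  forall p, (p <= d)%N -> c p = 0.
Proof.
move=> s0 p pd; apply/eqP.
have := eigen_indep (lin_comp (opF_lin aW) (opE_lin aW))
  (fun i (id' : (i < d.+1)%N) => wz_FE id') _ s0 pd.
move=> /(_ _)/eqP; rewrite scaler_eq0 (negPf (chain_neq0 pd _)); last by lia.
rewrite orbF; apply=> i j ij jd; rewrite qi_quad unitfE mulf_neq0 // qi_neq0 //; lia.
Qed.

Lemma co_K i j w : (i <= m)%N -> (j <= n)%N ->
  co i j (opK aW w) = q ^ ((m%:Z - (2 * i)%:Z) - (n%:Z - (2 * j)%:Z)) * co i j w.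
Proof.
move=> im jn; move: w; apply: (W_ext (B := F^o)).
- by move=> c x y; rewrite (opK_lin aW) coD coZ.
- by move=> c x y; rewrite coD coZ mulrDr mulrCA.
move=> k l km ln; rewrite K_u2 coZ coE //.
by have [->|] := eqVneq i k; have [->|] := eqVneq j l; rewrite ?mulr0.
Qed.

(** The zero weight basis vectors sit at the positions [(ga i, gb i)]; at least one of the two
    truncated halves is 0. *)
Let ga i := ((m - n)./2 + i)%N.
Let gb i := ((n - m)./2 + i)%N.

Lemma W0_eq w : opK aW w = w -> (forall i, (i <= d)%N -> co (ga i) (gb i) w = 0) ->
  w = 0.
Proof.
move=> Kw cw; apply: W_eq => i j im jn; rewrite co0.
have := co_K w im jn; rewrite Kw; set e := (_ - _ - _) => /eqP.
rewrite -subr_eq0 -{1}[co i j w]mul1r -mulrBl mulf_eq0 subr_eq0 eq_sym.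
have [e0 _|/qX_neq1/negPf-> /= /eqP //] := eqVneq e 0.
(* A zero weight position has the form [(ga l, gb l)] for [l] the smaller of its two indices. *)
have := cw (minn i j); rewrite /ga /gb.
have -> : ((m - n)./2 + minn i j = i)%N by rewrite /e in e0; lia.
have -> : ((n - m)./2 + minn i j = j)%N by rewrite /e in e0; lia.
by apply; lia.
Qed.

(** A zero weight vector is determined by [d + 1] coordinates ([W0_eq]), and the [wz p] are [d + 1]
    independent vectors, so the square matrix [P] of their coordinates is invertible. *)
Lemma W0_span w : opK aW w = w ->
  exists c : nat -> F, w = \sum_(p < d.+1) c p *: wz p.
Proof.
move=> Kw; pose P := \matrix_(p < d.+1, i < d.+1) co (ga i) (gb i) (wz p).
have KS c : opK aW (\sum_(p < d.+1) c p *: wz p) = \sum_(p < d.+1) c p *: wz p.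
  rewrite (lin_sum (opK_lin aW)); apply: eq_bigr => p _.
  by rewrite (linZ (opK_lin aW)) wz_K // -ltnS.
have coS c i : (i <= d)%N -> co (ga i) (gb i) (\sum_(p < d.+1) c p *: wz p) =
    ((\row_(p < d.+1) c p) *m P) 0 (inord i).
  move=> id'; rewrite co_sum mxE; apply: eq_bigr => p _.
  by rewrite coZ !mxE inordK.
have Pf : row_free P.
  apply: inj_row_free => x xP; apply/rowP => p; rewrite mxE.
  pose c k := x 0 (inord k).
  have xc : x = \row_(p < d.+1) c p by apply/rowP => k; rewrite mxE /c inord_val.
  have := @wz_indep c _ p; rewrite /c inord_val; apply; last by rewrite -ltnS.
  by apply: W0_eq (KS c) _ => i id'; rewrite coS // -xc xP mxE.
rewrite row_free_unit in Pf.
pose x := (\row_(i < d.+1) co (ga i) (gb i) w) *m invmx P.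
pose c k := x 0 (inord k); exists c.
have xc : x = \row_(p < d.+1) c p by apply/rowP => k; rewrite mxE /c inord_val.
apply/eqP; rewrite -subr_eq0; apply/eqP/W0_eq.
  by rewrite (linB (opK_lin aW)) Kw KS.
move=> i id'; rewrite coB coS // -xc mulmxKV // mxE inordK //.
by rewrite subrr.
Qed.

(** E and F commute on zero weight vectors, and Q exchanges them up to sign and K; so Q commutes
    with FE there and preserves its eigenlines. *)
Lemma Q_wz p : (p <= d)%N -> exists al, Q (wz p) = al *: wz p.
Proof.
move=> pd; have lQ := @braidW_lin _ v m n.
have KiW : opKi aW (wz p) = wz p by rewrite -{1}(wz_K pd) opKiK.
have KQ : opK aW (Q (wz p)) = Q (wz p) by rewrite -(braidWK qn) KiW.
have [c Qc] := W0_span KQ; exists (c p).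
pose lam i := qi v (s - i)%:Z * qi v ((s - i)%:Z + 1).
have EKF w : opK aW w = w -> opE aW (opF aW w) = opF aW (opE aW w).
  move=> Kw; rewrite E_F; have -> : opKi aW w = w by rewrite -{1}Kw opKiK.
  by rewrite Kw subrr scaler0 addr0.
have QFE : opF aW (opE aW (Q (wz p))) = lam p *: Q (wz p).
  rewrite -(linZ lQ) -(wz_FE pd).
  have -> : opE aW (Q (wz p)) = - Q (opKi aW (opF aW (wz p))) by rewrite braidWF ?opprK.
  have -> : opKi aW (opF aW (wz p)) = q ^ 2 *: opF aW (wz p) by rewrite Ki_F KiW.
  rewrite (linZ lQ) -scalerN (linZ (opF_lin aW)) (linN (opF_lin aW)).
  have <- : Q (opE aW (opK aW (opF aW (wz p)))) = - opF aW (Q (opF aW (wz p))).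
    exact: braidWE.
  rewrite K_F (wz_K pd) (linZ (opE_lin aW)) (linZ lQ) (EKF _ (wz_K pd)) scalerA qD.
  exact: scale1r.
have z : \sum_(i < d.+1) (c i * (lam i - lam p)) *: wz i = 0.
  have := QFE; rewrite Qc (lin_sum (lin_comp (opF_lin aW) (opE_lin aW))).
  move/eqP; rewrite -subr_eq0 scaler_sumr -sumrB => /eqP e; rewrite -[RHS]e.
  apply: eq_bigr => i _; rewrite (linZ (opE_lin aW)) (linZ (opF_lin aW)).
  rewrite wz_FE; last by rewrite -ltnS.
  by rewrite !scalerA -scalerBl mulrBr [lam p * _]mulrC.
rewrite {1}Qc (bigD1 (inord p)) //= big1 ?addr0 ?inordK // => i ip.
have /eqP := wz_indep (c := fun i => c i * (lam i - lam p)) z (ltn_ord i : i <= d)%N.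
rewrite mulf_eq0 => /orP[/eqP->|]; first by rewrite scale0r.
rewrite qi_quad mulf_eq0 => /orP[]; apply: contraTeq => _; apply: qi_neq0; last by lia.
have : nat_of_ord i != p.
  by apply: contraNneq ip => <-; rewrite inord_val.
have := ltn_ord i; lia.
Qed.

Let taup N i : F := (-1) ^+ (N - i) * q ^ ((N%:Z - i%:Z) * (i%:Z + 1)).

(** On the string generated by the highest weight vector, Q acts as T''_1 does on the irreducible
    module of dimension [N + 1], up to one factor [c]: the property [P] spreads from the zero weight
    vector to its neighbours through the relations of Q with E and F. One matrix coefficient then
    forces [c = 1]. *)
Lemma Q_wzE p : (p <= d)%N ->
  Q (wz p) = ((-1) ^+ (s - p) * q ^ ((s - p)%:Z * ((s - p)%:Z + 1))) *: wz p.
Proof.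
move=> pd; have [al Qw] := Q_wz pd; pose N := (2 * (s - p))%N.
have lQ := @braidW_lin _ v m n.
have tS i : (i < N)%N -> taup N i = - q ^ ((2 * i)%:Z + 2 - N%:Z) * taup N i.+1.
  move=> iN; rewrite /taup -(subnSK iN) exprS mulN1r !mulNr; congr (- _).
  by move: ((-1) ^+ _) => *; qmono.
have tr : taup N (s - p) = (-1) ^+ (s - p) * q ^ ((s - p)%:Z * ((s - p)%:Z + 1)).
  by rewrite /taup /N; congr (_ ^+ _ * q ^ _); lia.
have t0 i : taup N i != 0.
  by rewrite /taup mulf_neq0 // -unitfE ?qX_unit // unitrX // unitrN1.
pose c := al / taup N (s - p).
pose P i := Q (chain p i) = (c * taup N i) *: chain p (N - i).
have Pr : P (s - p)%N.
  rewrite /P -/(wz p) Qw /c divfK //; congr (_ *: chain _ _); lia.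
have up i : (i < N)%N -> P i -> P i.+1.
  move=> iN Pi; have := braidWF qn (chain p i).
  rewrite Pi chain_F (linZ (opKi_lin aW)) chain_Ki // !(linZ lQ).
  rewrite (linZ (opE_lin aW)) -(subnSK iN) chain_E // -/N.
  have -> : N%:Z - (N - i.+1)%:Z = i.+1%:Z by lia.
  rewrite -qintE tS // => e; rewrite /P.
  apply: (scalerI_unit (qn i)); apply: (scalerI_unit (qX_unit v ((2 * i.+1)%:Z - N%:Z))).
  rewrite [LHS]scalerC e !scalerA -scaleNr; congr (_ *: _).
  move: (taup _ _) (qint v _) => t u; rewrite mulNr mulrN mulNr opprK.
  by qmono.
have down i : (i < N)%N -> P i.+1 -> P i.
  move=> iN Pi; have := braidWE qn (chain p i.+1).
  rewrite Pi chain_K // (linZ (opE_lin aW)) chain_E // -/N !(linZ lQ).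
  rewrite (linZ (opF_lin aW)) chain_F subnSK // => e; rewrite /P.
  have e1 : qint v (N - i) = qi v (N%:Z - i%:Z) by rewrite qintE; congr (qi v _); lia.
  have iu : qi v (N%:Z - i%:Z) \is a GRing.unit.
    by rewrite unitfE; apply: qi_neq0; lia.
  apply: (scalerI_unit iu); apply: (scalerI_unit (qX_unit v (N%:Z - (2 * i.+1)%:Z))).
  rewrite [LHS]e e1 (tS i iN) !scalerA -scaleNr; congr (_ *: _).
  move: (taup _ _) (qi v _) => t u; rewrite !mulNr !mulrN mulrC; congr (- _).
  by qmono.
have Pall i : (i <= N)%N -> P i.
  move=> iN; have [le|le] := leqP i (s - p); last first.
    have : (s - p <= i)%N by apply: ltnW.
    elim: i iN {le} => [|i IH] iN; first by rewrite leqn0 => /eqP e; rewrite -e.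
    rewrite leq_eqVlt => /orP[/eqP<- //|le]; apply: up => //; apply: IH => //.
    exact: ltnW.
  have key k : (i + k <= N)%N -> P (i + k)%N -> P i.
    elim: k => [|k IH] kN; first by rewrite addn0.
    by rewrite addnS => /(down (i + k)%N) H; apply: (IH _ (H _)); lia.
  by apply: (key (s - p - i)%N); rewrite subnKC //; lia.
suff c1 : c = 1.
  by rewrite Qw -tr; congr (_ *: _); rewrite -[LHS](divfK (t0 (s - p)%N)) -/c c1 mul1r.
have pm : (p <= m)%N by move: pd; rewrite leq_min => /andP[].
have pn' : (p <= n)%N by move: pd; rewrite leq_min => /andP[].
(* At the index [n - p] the string has a component on [u_0 (x) u_0], and at the mirror index
   [N - (n - p) = m - p] one on [u_m (x) u_n]; [co_Q] relates the two. *)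
have pN : (n - p <= N)%N by lia.
have := congr1 (co m n) (Pall _ pN).
have Nn : (N - (n - p) = m - p)%N by lia.
rewrite coZ co_Q // /chain Nn co_dF0 ?add0n ?leq_subr // subn0 co_uhw0 //.
rewrite co_dFn ?leq_subr // subKn // co_uhwp //.
pose A := qbin v n (n - p) *
  (qfact v (n - p + 0) * qfact v (m - 0) / (qfact v (n - p) * qfact v m)).
have eA : A = qbin v m (m - p) *
    (qfact v (n - p + p) * qfact v (m - p) / (qfact v (n - p) * qfact v m)).
  have eU : qfact v (n - p) * qfact v m \is a GRing.unit by rewrite unitrM !fu.
  rewrite /A addn0 subn0 divrr // mulr1 subnK //; apply: (mulIr eU).
  rewrite -[RHS]mulrA (divrK eU).
  apply: (mulIr (fu p)).
  have := qbinM qn (leq_subr p m); have := qbinM qn (leq_subr p n).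
  rewrite !subKn //; move: (qbin v n _) (qbin v m _) => x y e1 e2.
  transitivity (x * (qfact v (n - p) * qfact v p) * qfact v m); first by ring.
  rewrite e1 -e2; ring.
have A0 : A != 0.
  rewrite /A mulf_neq0 //; last first.
    rewrite -unitfE unitrM unitrM !fu unitrV unitrM !fu //.
  apply: contraTneq (fu n) => e; rewrite -(qbinM qn (leq_subr p n)) e mul0r.
  by rewrite unitr0.
pose Y := (-1) ^+ (m - p) * (-1) ^+ (n - p) *
  q ^ (m%:Z + n%:Z - p%:Z - p%:Z * m%:Z + p%:Z ^+ 2) * A.
have Y0 : Y != 0.
  rewrite /Y mulf_neq0 // -unitfE !unitrM qX_unit !unitrX ?unitrN1 //.
have sg l : (p <= l)%N -> (-1) ^+ l = (-1) ^+ p * (-1) ^+ (l - p) :> F.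
  by move=> pl; rewrite -exprD subnKC.
have ss l : (-1) ^+ l * (-1) ^+ l = 1 :> F.
  by rewrite -exprD addnn -mul2n exprM sqrrN !expr1n.
have hq l : (- q ^ (-1)) ^+ l = (-1) ^+ l * q ^ (- l%:Z).
  by rewrite -[- q ^ _]mulN1r exprMn [(q ^ _) ^+ _]exprnP exprz_exp mulN1r.
have -> : tau v m 0 * tau v n 0 * ((- q ^ (-1)) ^+ (n - p) * qbin v n (n - p) *
    hwc v m n p 0) = Y.
  rewrite /tau /hwc !subn0 (sg m pm) (sg n pn') hq.
  transitivity (((-1) ^+ p * (-1) ^+ p) * ((-1) ^+ (n - p) * (-1) ^+ (n - p)) *
   ((-1) ^+ (m - p) * (-1) ^+ (n - p)) *
   (q ^ ((m%:Z - 0) * (0 + 1)) * q ^ ((n%:Z - 0) * (0 + 1)) * q ^ (- (n - p)%:Z) *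
    q ^ ((0 - p%:Z) * (2 + m%:Z) + p%:Z ^+ 2 - 0 ^+ 2 + n%:Z)) * A).
    by rewrite /A subn0; ring.
  rewrite !ss !mul1r /Y !qD; congr (_ * q ^ _ * _); lia.
have -> : c * taup N (n - p) * (q ^ (- (n * (m - p))%:Z) * qbin v m (m - p) *
    hwc v m n p p) = c * Y.
  have NZ : N%:Z = m%:Z + n%:Z - 2 * p%:Z by lia.
  have mpZ : (n * (m - p))%:Z = n%:Z * (m%:Z - p%:Z) by rewrite PoszM; congr (_ * _); lia.
  have npZ : (n - p)%:Z = n%:Z - p%:Z by lia.
  rewrite /taup /hwc Nn /Y eA NZ mpZ npZ.
  move: (qbin _ _ _) (qfact v _ * _ / _) ((-1) ^+ _) ((-1) ^+ _) => x y z w.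
  by qmono.
by move=> e; apply: (mulIf Y0); rewrite mul1r.
Qed.
End ZeroWeight.

(** * Matrix coefficients at a lowest weight vector *)

Section LowestVector.
Variables (S : comUnitRingType) (v : qparam S) (A : lmodType S) (a : uaction v A).
Local Notation q := (qv v).
Hypothesis qn : forall n, qint v n.+1 \is a GRing.unit.
Local Notation E := (opE a).
Local Notation F := (opF a).
Local Notation K := (opK a).
Local Notation Ki := (opKi a).

Lemma iter_F r x : iter r F x = qfact v r *: act a (dF v r) x.
Proof.
elim: r => [|r IH]; first by rewrite dFa0 qfact0 scale1r.
by rewrite iterS IH (linZ (opF_lin a)) (F_dF _ qn) scalerA -qfactS.
Qed.
Lemma iter_E r x : iter r E x = qfact v r *: act a (dE v r) x.
Proof.
elim: r => [|r IH]; first by rewrite dEa0 qfact0 scale1r.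
by rewrite iterS IH (linZ (opE_lin a)) (E_dE _ qn) scalerA -qfactS.
Qed.

Variables (c : S) (x : A).
Hypotheses (cu : c \is a GRing.unit) (Kx : K x = c *: x).

Lemma wt_iterE r : K (iter r E x) = (q ^ (2 * r)%:Z * c) *: iter r E x.
Proof.
elim: r => [|r IH]; first by rewrite mul1r.
by rewrite iterS (wt_E IH) mulrA qD; congr (q ^ _ * _ *: _); lia.
Qed.
Lemma wt_iterF r : K (iter r F x) = (q ^ (- (2 * r)%:Z) * c) *: iter r F x.
Proof.
elim: r => [|r IH]; first by rewrite mul1r.
by rewrite iterS (wt_F IH) mulrA qD; congr (q ^ _ * _ *: _); lia.
Qed.

Lemma iter_EKi r : iter r (fun y => E (Ki y)) x =
  (q ^ (- r%:Z * (r%:Z - 1)) * c ^- r) *: iter r E x.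
Proof.
elim: r => [|r IH]; first by rewrite expr0 invr1 !mulr1 scale1r.
rewrite iterS IH (linZ (opKi_lin a)) (linZ (opE_lin a)).
have uc : q ^ (2 * r)%:Z * c \is a GRing.unit by rewrite unitrM qX_unit.
rewrite (wt_Ki uc (wt_iterE r)) (linZ (opE_lin a)) scalerA -iterS.
congr (_ *: _); rewrite invrM ?qX_unit // invr_expz exprS invrM ?unitrX //.
move: c^-1 (c ^- r) => *; qmono.
Qed.
Lemma iter_EK r : iter r (fun y => E (K y)) x =
  (q ^ (r%:Z * (r%:Z - 1)) * c ^+ r) *: iter r E x.
Proof.
elim: r => [|r IH]; first by rewrite expr0 !mulr1 scale1r.
rewrite iterS IH (linZ (opK_lin a)) (linZ (opE_lin a)).
rewrite wt_iterE (linZ (opE_lin a)) scalerA -iterS.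
congr (_ *: _); rewrite exprS; move: (c ^+ r) => *; qmono.
Qed.
Lemma iter_KiF r : iter r (fun y => Ki (F y)) x =
  (q ^ (r%:Z * (r%:Z + 1)) * c ^- r) *: iter r F x.
Proof.
elim: r => [|r IH]; first by rewrite expr0 invr1 !mulr1 scale1r.
rewrite iterS IH (linZ (opF_lin a)) (linZ (opKi_lin a)) -iterS.
have uc : q ^ (- (2 * r.+1)%:Z) * c \is a GRing.unit by rewrite unitrM qX_unit.
rewrite (wt_Ki uc (wt_iterF r.+1)) scalerA.
congr (_ *: _); rewrite invrM ?qX_unit // invr_expz exprS invrM ?unitrX //.
move: c^-1 (c ^- r) => *; qmono.
Qed.
Lemma iter_K r : iter r K x = c ^+ r *: x.
Proof.
elim: r => [|r IH]; first by rewrite scale1r.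
by rewrite iterS IH (linZ (opK_lin a)) Kx scalerA -exprSr.
Qed.
Lemma iter_Ki r : iter r Ki x = c ^- r *: x.
Proof.
elim: r => [|r IH]; first by rewrite expr0 invr1 scale1r.
rewrite iterS IH (linZ (opKi_lin a)) (wt_Ki cu Kx) scalerA exprS.
by rewrite invrM ?unitrX.
Qed.
End LowestVector.

Section ActPow.
Variables (S : comUnitRingType) (v : qparam S) (A : lmodType S) (a : uaction v A).
Lemma act_exp u r x : act a (u ^+ r) x = iter r (act a u) x.
Proof. by elim: r => [|r IH]; rewrite ?act1 // exprS actM IH. Qed.
End ActPow.

Section LowestPairing.
Variables (S : comUnitRingType) (v : qparam S) (A : lmodType S) (a : uaction v A).
Variables (phi : A -> A -> S) (c : S) (z : A).
Local Notation q := (qv v).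
Hypothesis qn : forall n, qint v n.+1 \is a GRing.unit.
Hypothesis pc : pairing a a phi.
Hypotheses (cu : c \is a GRing.unit) (Kz : opK a z = c *: z) (Fz : opF a z = 0).
Local Notation "u # x" := (act a u x) (at level 30, right associativity).
Local Notation f u := (phi z (rho1 u # z)).
Local Notation g u := (phi z (Tminus1 (rho1 u) # z)).
Local Notation ad u := (act (adjoint v) u).

Let zE x : phi z (opE a x) = 0.
Proof. by rewrite (pairEr pc) Kz (linZ (opF_lin a)) Fz scaler0 (pair0l pc) mulr0. Qed.
Let Kiz : opKi a z = c^-1 *: z. Proof. exact: wt_Ki. Qed.

Lemma low_rho_adK u : f (adK u) = f u.
Proof.
have [_ _ rK rKi] := rho1_gens v.
rewrite /adK !rmorphM /= rK rKi !actM actKi actK Kz (linZ (act_lin a _)).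
rewrite -(pairKi pc) Kiz (pairZl pc) (pairZr pc) mulrA mulVr //.
by rewrite mul1r.
Qed.
Lemma low_T_adK u : g (adK u) = g u.
Proof.
have [_ _ rK rKi] := rho1_gens v; have [_ _ tK tKi] := Tminus1_gens v.
rewrite /adK !rmorphM /= rK rKi tK tKi !actM actKi actK Kiz (linZ (act_lin a _)).
rewrite -(pairK pc) Kz (pairZl pc) (pairZr pc) mulrA mulrV //.
by rewrite mul1r.
Qed.

Let rho_adF u x : phi z (rho1 (adF u) # x) = q^-1 * phi z (rho1 u # opE a (opKi a x)).
Proof.
have [_ rF rK _] := rho1_gens v.
rewrite /adF mulrN rmorphB actD actN !rmorphM /= rF rK -!scalerAl -scalerAr.
rewrite !actZ !actM !actE !actKi scaleNr.
have e0 : phi z (- (q^-1 *: opE a (rho1 u # opKi a x))) = 0.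
  by rewrite (pairNr pc) (pairZr pc) zE mulr0 oppr0.
by rewrite (pairDr pc) e0 add0r scaleNr opprK (pairZr pc).
Qed.
Let rho_iter r u x : phi z (rho1 (iter r (@adF S v) u) # x) =
  q ^- r * phi z (rho1 u # iter r (fun y => opE a (opKi a y)) x).
Proof.
elim: r x => [|r IH] x; first by rewrite expr0 invr1 mul1r.
rewrite iterS rho_adF IH mulrA exprS invrM ?unitrX ?qv_unit // [q^-1 * _]mulrC.
by rewrite iterSr.
Qed.
Let T_adF u x : opF a x = 0 -> Tminus1 (rho1 (adF u)) # x =
  q^-1 *: opKi a (opF a (Tminus1 (rho1 u) # opK a x)).
Proof.
move=> Fx; have [_ rF rK _] := rho1_gens v; have [tE _ _ tKi] := Tminus1_gens v.
rewrite /adF mulrN !(rmorphB, rmorphN, rmorphM) /= rF rK !linearZ /= tE tKi.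
rewrite !scaleNr !scalerN !opprK -!scalerAl -scalerAr actD !actN !actZ !actM !actKi !actF !actK.
have FKx : opF a (opK a x) = 0.
  apply: (scalerI_unit (qX_unit v (- 2))).
  by rewrite -K_F Fx (lin0 (opK_lin a)) scaler0.
by rewrite FKx (lin0 (opKi_lin a)) (lin0 (act_lin a _)) scaler0 oppr0 addr0.
Qed.
Let T_iter r u x : opF a x = 0 -> Tminus1 (rho1 (iter r (@adF S v) u)) # x =
  q ^- r *: iter r (fun y => opKi a (opF a y)) (Tminus1 (rho1 u) # iter r (opK a) x).
Proof.
elim: r x => [|r IH] x Fx; first by rewrite expr0 invr1 scale1r.
rewrite iterS T_adF // IH; last first.
  apply: (scalerI_unit (qX_unit v (- 2))).
  by rewrite -K_F Fx (lin0 (opK_lin a)) scaler0.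
rewrite (linZ (opF_lin a)) (linZ (opKi_lin a)) scalerA exprS.
by rewrite invrM ?unitrX ?qv_unit // [q^-1 * _]mulrC -iterSr.
Qed.

Let X r := dE v r * gKi v ^+ r.

(** At each application of ad(F) one of its two terms dies: under [rho1] because [phi z] kills the
    image of E, under T'_-1 o rho1 because F kills [z]. Both sides become multiples of the pairing
    of [z] with F^(r) E^r z; the weight [c] drops out, and the ratio is the eigenvalue of Q found in
    [Q_wzE]. *)
Lemma low_rho_ad r : f (ad (dF v r) (X r)) =
  (-1) ^+ r * q ^ (r%:Z * (r%:Z + 1)) * g (ad (dF v r) (X r)).
Proof.
have -> : ad (dF v r) (X r) = (qfact v r)^-1 *: iter r (@adF S v) (X r).
  rewrite (_ : iter r _ _ = iter r (opF (adjoint v)) (X r)) // (iter_F _ qn).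
  by rewrite scalerA mulVr ?(qfact_unit qn) ?scale1r.
rewrite !linearZ !actZ !(pairZr pc) rho_iter (T_iter _ _ Fz) (pairZr pc).
have [_ _ _ rKi] := rho1_gens v; have [_ tF tK _] := Tminus1_gens v.
have fX x : rho1 (X r) # x = (- q) ^+ r *: dF v r # iter r (opK a) x.
  rewrite /X rmorphM rmorphXn actM /= rKi rho1_dE actZ act_exp.
  by rewrite (eq_iter (@actK _ _ _ a)).
have gX x : Tminus1 (rho1 (X r)) # x = ((qfact v r)^-1 * q ^+ r) *:
    iter r (fun y => opE a (opK a y)) (iter r (opKi a) x).
  have -> : rho1 (X r) = ((- q) ^+ r * (qfact v r)^-1) *: (gF v ^+ r * gK v ^+ r).
    rewrite /X (rmorphM (@rho1 S v)) (rmorphXn (@rho1 S v)) /= rKi rho1_dE /dF.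
    by rewrite scalerA scalerAl.
  rewrite linearZ_LR (rmorphM (@Tminus1 S v)) !(rmorphXn (@Tminus1 S v)) /= tF tK.
  rewrite actZ actM !act_exp (eq_iter (@actKi _ _ _ a)).
  have -> y : iter r (act a (- (gE v * gK v))) y =
      (-1) ^+ r *: iter r (fun y => opE a (opK a y)) y.
    elim: (r) y => [|k IH] y; first by rewrite scale1r.
    rewrite !iterS IH (linZ (act_lin a _)) actN actM actE actK exprS mulN1r.
    by rewrite scalerN scaleNr.
  rewrite scalerA; congr (_ *: _); rewrite [(- q) ^+ r]exprNn.
  transitivity ((qfact v r)^-1 * (q ^+ r) * ((-1) ^+ r * (-1) ^+ r)); first by ring.
  by rewrite -exprD addnn -mul2n exprM sqrrN !expr1n mulr1.
have iKK y : iter r (opKi a) (iter r (opK a) y) = y.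
  by elim: (r) y => [//|k IH] y; rewrite iterS iterSr IH opKiK.
have lKF : linear (iter r (fun y => opKi a (opF a y)) : A -> A).
  by elim: (r) => [|k IH] d x y //=; rewrite IH (opF_lin a) (opKi_lin a).
have uc : q ^ (2 * r)%:Z * c \is a GRing.unit by rewrite unitrM qX_unit.
rewrite fX gX iKK (iter_EKi cu Kz) (iter_EK cu Kz) !(linZ lKF).
rewrite (iter_KiF uc (wt_iterE cu Kz r)) (iter_F _ qn).
have -> d : iter r (opK a) (d *: iter r (opE a) z) =
    (d * (q ^ (2 * r)%:Z * c) ^+ r) *: iter r (opE a) z.
  rewrite (iter_K (c := q ^ (2 * r)%:Z * c)).
    by rewrite scalerA mulrC.
  by rewrite (linZ (opK_lin a)) (wt_iterE cu Kz) scalerC.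
rewrite (linZ (act_lin a _)) !(pairZr pc).
have [cV qV'] : c ^+ r * c ^- r = 1 /\ qfact v r * (qfact v r)^-1 = 1.
  by rewrite !mulrV ?unitrX // (qfact_unit qn).
move: (phi _ _) => p.
have qe d : (q ^ d * c) ^+ r = q ^ (d * r%:Z) * c ^+ r.
  by rewrite exprMn [(q ^ d) ^+ r]exprnP exprz_exp.
rewrite !qe invrM ?qX_unit ?unitrX // invr_expz [(- q) ^+ r]exprNn qXN qX.
move: ((-1) ^+ r) (c ^+ r) (c ^- r) cV (qfact v r) (qfact v r)^-1 qV'.
move=> s c1 c2 cc f1 f2 ff.
transitivity (f2 * s * p * (c1 * c2) * q ^ (r%:Z * (r%:Z + 1))).
  by qmono.
transitivity (f2 * s * p * (c1 * c2) * (f1 * f2) * q ^ (r%:Z * (r%:Z + 1))); last by qmono.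
by rewrite ff mulr1.
Qed.
End LowestPairing.

(** * Inversion of the series with coefficients [cL] and [cJ] *)

Lemma tri_add i j :
  ((i + j) * (i + j).-1)./2 = ((i * i.-1)./2 + (j * j.-1)./2 + i * j)%N.
Proof.
elim: j => [|j IH]; first by rewrite !addn0 muln0 addn0.
rewrite addnS !succnK !tri_half IH; lia.
Qed.
Lemma tri2 i : ((i * i.-1)./2 * 2 = i * i.-1)%N.
Proof. by elim: i => // i; rewrite succnK tri_half; case: i => // i; lia. Qed.

Lemma sum_antidiag (V : nmodType) (G : nat -> nat -> V) N :
  (forall i j, (N <= i + j)%N -> G i j = 0) ->
  \sum_(i < N) \sum_(j < N) G i j = \sum_(k < N) \sum_(i < k.+1) G i (k - i)%N.
Proof.
move=> GN.
have -> : \sum_(i < N) \sum_(j < N) G i j =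
    \sum_(i < N) \sum_(k < N) if (i <= k)%N then G i (k - i)%N else 0.
  apply: eq_bigr => i _; rewrite -(big_mkord xpredT (G i)).
  rewrite -(big_mkord xpredT (fun k => if (i <= k)%N then G i (k - i)%N else 0)).
  rewrite [RHS](big_cat_nat (n := i)) ?(ltnW (ltn_ord i)) //=.
  have -> : \sum_(0 <= k < i) (if (i <= k)%N then G i (k - i)%N else 0) = 0.
    by rewrite big_nat big1 // => k /andP[_ ki]; rewrite leqNgt ki.
  rewrite add0r.
  rewrite -{2}[nat_of_ord i]add0n big_addn.
  rewrite (big_cat_nat (n := (N - i)%N)) ?leq_subr //=.
  have -> : \sum_(N - i <= j < N) G i j = 0.
    by rewrite big_nat big1 // => j /andP[j1 j2]; rewrite GN //; lia.
  rewrite addr0.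
  by apply: eq_bigr => j _; rewrite leq_addl addnK.
rewrite exchange_big; apply: eq_bigr => -[k kN] _ /=.
rewrite -(big_mkord xpredT (fun i => if (i <= k)%N then G i (k - i)%N else 0)).
rewrite (big_cat_nat (n := k.+1)) //=.
have -> : \sum_(k.+1 <= i < N) (if (i <= k)%N then G i (k - i)%N else 0) = 0.
  by rewrite big_nat big1 // => i /andP[ki _]; rewrite leqNgt ki.
rewrite addr0.
by rewrite big_mkord; apply: eq_bigr => i _; rewrite -ltnS ltn_ord.
Qed.

Section QuasiR.
Variables (S : comUnitRingType) (v : qparam S).
Local Notation q := (qv v).
Hypothesis qn : forall n, qint v n.+1 \is a GRing.unit.
Local Notation qbin := (qbin v).

(** Gauss's binomial formula: [s n] is the product of the factors 1 - q^(2i) for i < n, and the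
    factor at i = 0 vanishes. *)
Lemma gauss_eq0 n : \sum_(i < n.+2) (-1) ^+ i * q ^ (i%:Z * n%:Z) * qbin n.+1 i = 0.
Proof.
have q0 z : q ^ (0%N%:Z * z) = 1 by rewrite mul0r.
pose s n := \sum_(i < n.+1) (-1) ^+ i * q ^ (i%:Z * (n%:Z - 1)) * qbin n i.
have sS k : s k.+1 = (1 - q ^ (2 * k%:Z)) * s k.
  rewrite mulrBl mul1r {1}/s big_ord_recl /= qbin0 // (q0 (k.+1%:Z - 1)) !mulr1.
  pose A i := (-1) ^+ i * q ^ (i%:Z * (k%:Z - 1)) * qbin k i.
  transitivity (1 + \sum_(i < k.+1) (A i.+1 - q ^ (2 * k%:Z) * A i)).
    congr (_ + _); apply: eq_bigr => i _; rewrite /bump /= add1n qbinS // /A exprS.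
    move: ((-1) ^+ i) (qbin _ _) (qbin _ _) => e x y.
    rewrite mulrDr !mulN1r !mulNr; congr (- _ - _); qmono.
  rewrite sumrB -mulr_sumr addrA; congr (_ - _).
  rewrite /s [in RHS]big_ord_recl /A /= qbin0 // q0 !mulr1; congr (_ + _).
  by rewrite big_ord_recr /= [qbin k k.+1]qbin_gt // mulr0 addr0.
have sn : s n.+1 = 0.
  elim: n => [|n IH]; rewrite sS; last by rewrite IH mulr0.
  by rewrite (_ : 2 * 0%N%:Z = 0) // subrr mul0r.
rewrite -[RHS]sn; apply: eq_bigr => i _; congr (_ * q ^ (_ * _) * _); lia.
Qed.

Lemma qbrace_fact n : qbrace v n = (q - q^-1) ^+ n * qfact v n.
Proof.
elim: n => [|n IH]; first by rewrite qbrace0 qfact0 mulr1.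
by rewrite qbraceS IH qB_qint qfactS exprS; move: (qfact v n) (qint v _) => *; ring.
Qed.

Lemma cLJ n i : (i <= n)%N -> cL v (n - i) * cJ v i * (- q) ^+ i * qbin n i =
  (q - q^-1) ^+ n * qfact v n * q ^ (n%:Z - (n * n.-1)./2%:Z) *
  ((-1) ^+ i * q ^ (i%:Z * (n%:Z - 1))).
Proof.
move=> ni; have [j ->] : exists j, n = (i + j)%N by exists (n - i)%N; rewrite subnKC.
have := qbinM qn (leq_addr j i); rewrite addKn => <-.
rewrite /cL /cJ !qbrace_fact [(- q) ^+ i]exprNn exprD !qXN !qX tri_add.
have : (i * i.-1)%:Z = i%:Z * (i%:Z - 1) by case: (i) => //= k; lia.
have := tri2 i; move: (_./2) (_./2) => t1 t2.
move: (_ ^+ i) (_ ^+ j) (qbin _ _) (qfact v _) (qfact v _) ((-1) ^+ _) => * .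
by qmono.
Qed.

(* [cL] and [cJ] are the coefficients of a quasi R-matrix and of its inverse. *)
Lemma cLJ_sum n : \sum_(i < n.+1) cL v (n - i) * cJ v i * (- q) ^+ i * qbin n i ^+ 2 =
  (n == 0)%:R.
Proof.
case: n => [|n].
  by rewrite big_ord_recl big_ord0 /= subn0 cL0 cJ0 qbin0 // expr0 expr1n !mulr1 addr0.
transitivity ((q - q^-1) ^+ n.+1 * qfact v n.+1 *
    q ^ (n.+1%:Z - (n.+1 * n)./2%:Z) *
    \sum_(i < n.+2) (-1) ^+ i * q ^ (i%:Z * n%:Z) * qbin n.+1 i).
  rewrite mulr_sumr; apply: eq_bigr => i _.
  rewrite expr2 [LHS]mulrA cLJ; last by rewrite -ltnS.
  rewrite -[LHS]mulrA; congr (_ * (_ * q ^ (_ * _) * _)); lia.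
by rewrite gauss_eq0 mulr0.
Qed.

Lemma qbin_mul k i j :
  qbin (k + j) j * qbin (k + j + i) i = qbin (k + (i + j)) (i + j) * qbin (i + j) i.
Proof.
have fu := qfact_unit qn.
have e1 := qbinM qn (leq_addl k j); rewrite addnK in e1.
have e2 := qbinM qn (leq_addl (k + j) i); rewrite addnK in e2.
have e3 := qbinM qn (leq_addl k (i + j)); rewrite addnK in e3.
have e4 := qbinM qn (leq_addr j i); rewrite addKn in e4.
rewrite (_ : k + j + i = k + (i + j))%N in e2 *; last by lia.
apply: (mulIr (fu j)); apply: (mulIr (fu k)); apply: (mulIr (fu i)).
transitivity (qbin (k + (i + j)) i * (qfact v i * (qbin (k + j) j * (qfact v j * qfact v k)))).
  ring.
rewrite e1 e2 -e3 -e4; ring.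
Qed.
End QuasiR.

(** * Comparison of functionals on F_m (x) F_n^rho1 through Q *)

Section BraidL.
Variables (F : fieldType) (v : qparam F).
Local Notation q := (qv v).
Hypothesis qn : forall n, qint v n.+1 \is a GRing.unit.
Variables m n : nat.
Local Notation Fm := (Fmod v m).
Local Notation Fn := (Fmod v n).
Local Notation W := {ffun 'I_n.+1 -> 'cV[F]_m.+1}.
Local Notation aW := (FFmod v m n).
Local Notation u2 i j := (ubas2 F m n i j).
Local Notation t := (@braidFm F v m).
Local Notation t' := (@braidFm F v n).
Local Notation Q := (@braidW F v m n).

Let lt : linear t := @braidFm_lin _ v m.
Let lt' : linear t' := @braidFm_lin _ v n.
Let lid (B : lmodType F) : linear (id : B -> B). Proof. by []. Qed.
Let ltt : linear (tmap t t' : W -> W). Proof. exact: tmap_lin. Qed.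
Let lt1 : linear (tmap t id : W -> W). Proof. exact: tmap_lin. Qed.

Let u2_0 i j : (m < i)%N || (n < j)%N -> u2 i j = 0.
Proof. by case/orP=> ?; [rewrite u2_gtl|rewrite u2_gtr]. Qed.

(** Sum_j [cL_j] F^(j) u_k (x) F^(j) u_l, with the divided powers evaluated on the basis: what L
    feeds to [beta] at a lowest weight vector. *)
Definition Lu2 N k l : W :=
  \sum_(j < N) (cL v j * qbin v (k + j) j * qbin v (l + j) j) *: u2 (k + j) (l + j).

(** E^(i) acts on F_n^rho1 as (-q)^i F^(i), so Q is [t (x) t'] after Sum_i [cJ_i] (-q)^i F^(i) (x)
    F^(i); by [cLJ_sum] this series undoes the one in [Lu2]. *)
Lemma braidW_Lu2 N k l : (n < N)%N -> (k <= m)%N -> (l <= n)%N ->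
  Q (Lu2 N k l) = (tau v m k * tau v n l) *: u2 (m - k) (n - l).
Proof.
move=> nN km ln; have lQ := @braidW_lin _ v m n.
have QE i j : Q (u2 i j) = tmap t t' (\sum_(a < N)
    (cJ v a * (- q) ^+ a * qbin v (i + a) a * qbin v (j + a) a) *: u2 (i + a) (j + a)).
  pose f a := (cJ v a * (- q) ^+ a * qbin v (i + a) a * qbin v (j + a) a) *:
     u2 (i + a) (j + a).
  have fz a : (n < a)%N -> f a = 0.
    by move=> na; rewrite /f u2_0 ?scaler0 //; apply/orP; right; lia.
  have -> : \sum_(a < N) f a = \sum_(a < n.+2) f a.
    rewrite -(fsum_nat (f := f) (N := N)); last by move=> a Na; apply: fz; lia.
    by apply: fsum_nat => a na; apply: fz; lia.
  rewrite /braidW braid_pure // (lin_sum lt1) (lin_sum ltt); apply: eq_bigr => a _.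
  rewrite (linZ lt1) (linZ ltt) !tmap_pure // act_twist_dE !act_dF_u // scalerA.
  rewrite (linZ lt) (linZ lt') !tpureZl !tpureZr !scalerA; congr (_ *: _).
  by move: (cJ v a) ((- q) ^+ a) (qbin _ _ _) (qbin _ _ _) => *; ring.
rewrite /Lu2 (lin_sum lQ).
pose G i j := (cL v j * cJ v i * (- q) ^+ i *
  (qbin v (k + (i + j)) (i + j) * qbin v (i + j) i) *
  (qbin v (l + (i + j)) (i + j) * qbin v (i + j) i)) *:
   u2 (k + (i + j)) (l + (i + j)).
transitivity (tmap t t' (\sum_(i < N) \sum_(j < N) G i j)).
  rewrite [X in _ = tmap _ _ X]exchange_big [RHS](lin_sum ltt).
  apply: eq_bigr => j _.
  rewrite (linZ lQ) QE -(linZ ltt); congr (tmap _ _ _); rewrite scaler_sumr.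
  apply: eq_bigr => i _; rewrite scalerA /G -!qbin_mul //.
  have -> : (k + (i + j) = k + j + i)%N by lia.
  have -> : (l + (i + j) = l + j + i)%N by lia.
  congr (_ *: _); move: (cJ v i) (cL v j) ((- q) ^+ i) => x y w.
  by move: (qbin _ _ _) (qbin _ _ _) (qbin _ _ _) (qbin _ _ _) => *; ring.
rewrite sum_antidiag => [|i j ij]; last first.
  by rewrite /G u2_0 ?scaler0 //; apply/orP; right; lia.
have -> : \sum_(a < N) \sum_(i < a.+1) G i (a - i)%N =
    \sum_(a < N) (qbin v (k + a) a * qbin v (l + a) a * (nat_of_ord a == 0%N)%:R) *: u2 (k + a) (l + a).
  apply: eq_bigr => a _; rewrite -(cLJ_sum qn) mulr_sumr scaler_suml.
  apply: eq_bigr => i _; have ia : (i <= a)%N by rewrite -ltnS.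
  rewrite /G subnKC //; congr (_ *: _).
  move: (cL _ _) (cJ _ _) ((- q) ^+ _) => x y w.
  by move: (qbin _ _ _) (qbin _ _ _) (qbin _ _ _) => *; ring.
case: N nN {QE G} => // N _; rewrite big_ord_recl big1 ?addr0 => [|i _]; last first.
  by rewrite mulr0 scale0r.
rewrite !addn0 !qbin0 // !mul1r scale1r tmap_pure // !braidFm_u // tpureZl tpureZr.
by rewrite scalerA.
Qed.

Variable s : nat.
Hypothesis mns : (m + n = 2 * s)%N.

(** K-invariant functionals vanish off the zero weight space; Q preserves that space and has there
    the basis of eigenvectors [wz p]. *)
Lemma braidW_equal (f g : W -> fps F) :
  (forall c x y, f (c *: x + y) = fpsC c * f x + f y) ->
  (forall c x y, g (c *: x + y) = fpsC c * g x + g y) ->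
  (forall w, f (opK aW w) = f w) -> (forall w, g (opK aW w) = g w) ->
  (forall p, (p <= minn m n)%N -> f (wz v m n s p) =
    fpsC ((-1) ^+ (s - p) * q ^ ((s - p)%:Z * ((s - p)%:Z + 1))) * g (wz v m n s p)) ->
  forall w, f w = g (Q w).
Proof.
move=> fl gl fK gK fg; have lQ := @braidW_lin _ v m n.
have lin_f (h : W -> fps F) : (forall c x y, h (c *: x + y) = fpsC c * h x + h y) ->
   [/\ h 0 = 0, forall x y, h (x + y) = h x + h y &
     forall c x, h (c *: x) = fpsC c * h x].
  move=> hl; have h0 : h 0 = 0.
    have := hl 1 0 0; rewrite scaler0 addr0 rmorph1 mul1r => /esym/eqP.
    by rewrite -subr_eq0 addrK => /eqP.
  split=> // [x y|c x]; first by have := hl 1 x y; rewrite scale1r rmorph1 mul1r.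
  by have := hl c x 0; rewrite h0 !addr0.
have [f0 fD fZ] := lin_f f fl; have [g0 gD gZ] := lin_f g gl.
(* For [e] nonzero, q^e - 1 is a nonzero constant and R has no zero divisors. *)
have kill (h : W -> fps F) w e : (forall c x, h (c *: x) = fpsC c * h x) ->
    (forall w, h (opK aW w) = h w) -> e != 0 -> opK aW w = q ^ e *: w -> h w = 0.
  move=> hZ hK e0 Kw; have := hK w; rewrite Kw hZ => /eqP.
  rewrite -subr_eq0 -{2}[h w]mul1r -mulrBl => /eqP z; apply: fps_mulf_eq0 z _.
  have -> : fpsC (q ^ e) - 1 = fpsC (q ^ e - 1) :> fps F by rewrite rmorphB rmorph1.
  apply/eqP => /(congr1 (fun x => fcoef x 0)) /= /eqP.
  by rewrite subr_eq0; apply/negP; exact: qX_neq1.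
apply: W_ind => [x y ex ey||c i j im jn].
- by rewrite fD (linD lQ) gD ex ey.
- by rewrite (lin0 lQ) f0 g0.
rewrite (linZ lQ) fZ gZ; congr (_ * _); have := K_u2 v m n i j.
set e := (_ - _ - _); have [-> KW|e0 KW] := eqVneq e 0; last first.
  rewrite (kill _ _ _ fZ fK e0 KW).
  rewrite (kill g (Q (u2 i j)) (- e)) ?oppr_eq0 //.
  rewrite -(braidWK qn) (wt_Ki (qX_unit v e) KW) (linZ lQ).
  by rewrite invr_expz.
rewrite scale1r in KW; have [c' ->] := W0_span qn mns KW.
rewrite (lin_sum lQ) (big_morph f fD f0) (big_morph g gD g0); apply: eq_bigr => p _.
have pd : (p <= minn m n)%N by rewrite -ltnS.
by rewrite (linZ lQ) fZ gZ fg // (Q_wzE qn mns pd) gZ.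
Qed.
End BraidL.

(** * Base change from k(v) to R *)

Section BaseChangeTheory.
Variables (F : fieldType) (v : qparam F).
Local Notation vR := (qparamR v).
Local Notation bc := (@bc F v).
Hypothesis qn : forall n, qint v n.+1 \is a GRing.unit.

Lemma bcD : {morph bc : x y / x + y}. Proof. exact: UhomD (bc_rels v). Qed.
Lemma bcM : {morph bc : x y / x * y}. Proof. exact: UhomM (bc_rels v). Qed.
Lemma bcZ c x : bc (c *: x) = fpsC c *: bc x.
Proof. by rewrite /Defs.bc (UhomZ (bc_rels v)) -scalerAl mul1r. Qed.
Lemma bc1 : bc 1 = 1.
Proof. by case: (Uhom_monoid (bc_rels v)). Qed.
Lemma bcX x n : bc (x ^+ n) = bc x ^+ n.
Proof. by elim: n => [|n IH]; rewrite ?bc1 // !exprS bcM IH. Qed.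
Lemma bcB x y : bc (x - y) = bc x - bc y.
Proof. exact: Uhom_zmod (bc_rels v) x y. Qed.
Lemma bc_gens : [/\ bc (gE v) = gE vR, bc (gF v) = gF vR, bc (gK v) = gK vR &
  bc (gKi v) = gKi vR].
Proof. exact: Uhom_gens (bc_rels v). Qed.

Lemma fpsCM x y : fpsC (x * y) = fpsC x * fpsC y :> fps F.
Proof. exact: rmorphM. Qed.
Lemma fpsCXz x z : x \is a GRing.unit -> fpsC (x ^ z) = fpsC x ^ z :> fps F.
Proof.
move=> xu; case: z => n; first by rewrite rmorphXn.
by rewrite !NegzE -!exprnN rmorphV ?unitrX // rmorphXn.
Qed.
Lemma qR z : qv vR ^ z = fpsC (qv v ^ z).
Proof. by rewrite fpsCXz ?qv_unit. Qed.
Lemma qintR n : qint vR n = fpsC (qint v n).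
Proof.
by rewrite /qint rmorphM rmorphV ?qvB_unit // !rmorphB rmorphV ?unitrX ?qv_unit //
  !rmorphXn rmorphV ?qv_unit.
Qed.
Lemma qnR n : qint vR n.+1 \is a GRing.unit.
Proof. by rewrite qintR rmorph_unit. Qed.
Lemma qfactR n : qfact vR n = fpsC (qfact v n).
Proof. by rewrite /qfact rmorph_prod; apply: eq_bigr => i _; exact: qintR. Qed.
Lemma qbraceR n : qbrace vR n = fpsC (qbrace v n).
Proof.
rewrite /qbrace rmorph_prod; apply: eq_bigr => i _.
by rewrite rmorphB rmorphV ?unitrX ?qv_unit // rmorphXn.
Qed.
Lemma cLR j : cL vR j = fpsC (cL v j).
Proof. by rewrite /cL qbraceR !rmorphM rmorphV ?unitrX ?qv_unit // !rmorphXn. Qed.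
Lemma cJR j : cJ vR j = fpsC (cJ v j).
Proof. by rewrite /cJ qbraceR !rmorphM !rmorphXn. Qed.
Lemma qbinR k j : qbin vR k j = fpsC (qbin v k j).
Proof.
rewrite /qbin; case: leqP => // _.
by rewrite rmorphM rmorphV ?unitrM ?(qfact_unit qn) // rmorphM !qfactR.
Qed.
Lemma tauR m k : tau vR m k = fpsC (tau v m k).
Proof. by rewrite /tau qR rmorphM; congr (_ * _); rewrite rmorphXn rmorphN1. Qed.

Lemma bc_dF n : bc (dF v n) = dF vR n.
Proof.
have [_ bF _ _] := bc_gens.
by rewrite /dF bcZ bcX bF rmorphV ?(qfact_unit qn) // qfactR.
Qed.
Lemma bc_dE n : bc (dE v n) = dE vR n.
Proof.
have [bE _ _ _] := bc_gens.
by rewrite /dE bcZ bcX bE rmorphV ?(qfact_unit qn) // qfactR.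
Qed.
Lemma bc_ad u y : bc (act (adjoint v) u y) = act (adjoint vR) (bc u) (bc y).
Proof.
have [bE bF bK bKi] := bc_gens.
elim/gen_ind: u y.
- move=> y; rewrite actE bE actE /opE /= /adE !mulrN bcB !bcM bE bK bKi //.
- move=> y; rewrite actF bF actF /opF /= /adF !mulrN bcB !bcM bF bK //.
- by move=> y; rewrite actK bK actK /opK /= /adK !bcM bK bKi.
- by move=> y; rewrite actKi bKi actKi /opKi /= /adKi !bcM bK bKi.
- by move=> c y; rewrite actC !bcZ bc1 actC.
- by move=> x y IHx IHy w; rewrite actD !bcD IHx IHy actD.
- by move=> x y IHx IHy w; rewrite actM bcM IHx IHy actM.
Qed.

Variables m n : nat.
Local Notation u2 i j := (ubas2 F m n i j).
Local Notation u2R i j := (ubas2 (fps F) m n i j).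
Local Notation W := {ffun 'I_n.+1 -> 'cV[F]_m.+1}.

Lemma extR_u2 b i j : linear b -> extR b (u2R i j) = bc (b (u2 i j)).
Proof.
move=> lb; have b0 : bc (b 0) = 0 by rewrite (lin0 lb) -[0](subrr 1) bcB subrr.
rewrite /extR; have [im|mi] := leqP i m; last first.
  rewrite [u2 i j]u2_gtl // b0 big1 // => k _; rewrite big1 // => l _.
  by rewrite /ubas2 ubas_gt // tpure0l ffunE mxE scale0r.
have [jn|nj] := leqP j n; last first.
  rewrite [u2 i j]u2_gtr // b0 big1 // => k _; rewrite big1 // => l _.
  by rewrite /ubas2 (@ubas_gt _ n) // tpure0r ffunE mxE scale0r.
rewrite (bigD1 (inord i)) //= (bigD1 (inord j)) //= !inordK // big1 => [|l lj].
  rewrite big1 => [|k ki]; last first.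
    rewrite big1 // => l _; rewrite /ubas2 !ffunE /ubas im jn !mxE.
    by rewrite (negPf ki) mulr0 scale0r.
  by rewrite !addr0 /ubas2 !ffunE /ubas im jn !mxE !eqxx mulr1 scale1r.
rewrite /ubas2 !ffunE /ubas im jn !mxE (negPf lj) mul0r.
by rewrite scale0r.
Qed.

Lemma extR_lin b : linear (@extR F v m n b).
Proof.
move=> c x y; rewrite /extR scaler_sumr -big_split; apply: eq_bigr => i _ /=.
rewrite scaler_sumr -big_split; apply: eq_bigr => j _ /=.
by rewrite !ffunE !mxE scalerDl scalerA.
Qed.

Lemma W_extR (B : lmodType (fps F)) (f g : {ffun 'I_n.+1 -> 'cV[fps F]_m.+1} -> B) :
  linear f -> linear g ->
  (forall i j, (i <= m)%N -> (j <= n)%N -> f (u2R i j) = g (u2R i j)) -> f =1 g.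
Proof.
move=> lf lg fg; apply: tens_ext => // x e.
rewrite (cV_sum e) (lin_sum (tpure_linr x)) (lin_sum lf) (lin_sum lg).
apply: eq_bigr => j _; rewrite tpureZr (linZ lf) (linZ lg); congr (_ *: _).
rewrite (cV_sum x) (lin_sum (tpure_linl _)) (lin_sum lf) (lin_sum lg).
apply: eq_bigr => i _; rewrite tpureZl (linZ lf) (linZ lg); congr (_ *: _).
by rewrite -!ubas_delta; apply: fg; rewrite -ltnS.
Qed.

Definition iV k (x : 'cV[F]_k) : 'cV[fps F]_k := map_mx (@fpsC F) x.
Definition iW (w : W) : {ffun 'I_n.+1 -> 'cV[fps F]_m.+1} := [ffun j => iV (w j)].

Lemma iVD k : {morph @iV k : x y / x + y}.
Proof. by move=> x y; apply/matrixP => i j; rewrite !mxE rmorphD. Qed.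
Lemma iVZ k c (x : 'cV[F]_k) : iV (c *: x) = fpsC c *: iV x.
Proof. by apply/matrixP => i j; rewrite !mxE rmorphM. Qed.
Lemma iV0 k : iV (0 : 'cV[F]_k) = 0.
Proof. by apply/matrixP => i j; rewrite !mxE rmorph0. Qed.
Lemma iV_ubas k i : iV (@ubas F k i) = ubas k i.
Proof.
rewrite /ubas; case: leqP => // _; last exact: iV0.
by apply/matrixP => a b; rewrite !mxE rmorph_nat.
Qed.
Lemma iV_linext k (g : nat -> 'cV[F]_k.+1) g' x : (forall i, iV (g i) = g' i) ->
  iV (linext g x) = linext g' (iV x).
Proof.
move=> gg; rewrite /linext (big_morph _ (@iVD _) (@iV0 _)); apply: eq_bigr => i _.
by rewrite iVZ gg mxE.
Qed.
Lemma iV_E k x : iV (opE (Fmod v k) x) = opE (Fmod vR k) (iV x).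
Proof.
by apply: iV_linext => -[|i]; rewrite ?iV0 // iVZ iV_ubas qintR.
Qed.
Lemma iV_F k x : iV (opF (Fmod v k) x) = opF (Fmod vR k) (iV x).
Proof. by apply: iV_linext => i; rewrite iVZ iV_ubas qintR. Qed.
Lemma iV_K k x : iV (opK (Fmod v k) x) = opK (Fmod vR k) (iV x).
Proof. by apply: iV_linext => i; rewrite iVZ iV_ubas qR. Qed.
Lemma iV_Ki k x : iV (opKi (Fmod v k) x) = opKi (Fmod vR k) (iV x).
Proof. by apply: iV_linext => i; rewrite iVZ iV_ubas qR. Qed.

Lemma iWD : {morph iW : x y / x + y}.
Proof. by move=> x y; apply/ffunP => j; rewrite !ffunE iVD. Qed.
Lemma iWZ c w : iW (c *: w) = fpsC c *: iW w.
Proof. by apply/ffunP => j; rewrite !ffunE iVZ. Qed.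
Lemma iW0 : iW 0 = 0.
Proof. by apply/ffunP => j; rewrite !ffunE iV0. Qed.
Lemma iW_pure x e : iW (tpure x e) = tpure (iV x) (iV e).
Proof. by apply/ffunP => j; rewrite !ffunE iVZ mxE. Qed.
Lemma iW_u2 i j : iW (u2 i j) = u2R i j.
Proof. by rewrite /ubas2 iW_pure !iV_ubas. Qed.

Let iW_ind (f : W -> W) (g : {ffun 'I_n.+1 -> 'cV[fps F]_m.+1} -> _) :
  linear f -> linear g -> (forall x e, iW (f (tpure x e)) = g (tpure (iV x) (iV e))) ->
  forall w, iW (f w) = g (iW w).
Proof.
move=> lf lg fg; apply: tens_ind => [x y ex ey||x e].
- by rewrite (linD lf) !iWD (linD lg) ex ey.
- by rewrite (lin0 lf) iW0 (lin0 lg).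
by rewrite fg iW_pure.
Qed.
Lemma iW_E w : iW (opE (FFmod v m n) w) = opE (FFmod vR m n) (iW w).
Proof.
apply: (iW_ind (opE_lin _) (opE_lin _)) => x e.
rewrite !tensE_pure iWD !iW_pure iV_E iV_K !twistRE iVZ iV_F.
by rewrite rmorphN.
Qed.
Lemma iW_F w : iW (opF (FFmod v m n) w) = opF (FFmod vR m n) (iW w).
Proof.
apply: (iW_ind (opF_lin _) (opF_lin _)) => x e.
rewrite !tensF_pure iWD !iW_pure iV_F !twistRF !twistRKi iVZ iV_E iV_K.
by rewrite rmorphN rmorphV ?qv_unit.
Qed.
Lemma iW_K w : iW (opK (FFmod v m n) w) = opK (FFmod vR m n) (iW w).
Proof.
apply: (iW_ind (opK_lin _) (opK_lin _)) => x e.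
by rewrite !tensK_pure iW_pure iV_K !twistRK iV_Ki.
Qed.

Lemma extR_iW b w : linear b -> extR b (iW w) = bc (b w).
Proof.
move=> lb; have leR := @extR_lin b; elim/W_ind: w => [x y ex ey||c i j im jn].
- by rewrite iWD (linD leR) (linD lb) bcD ex ey.
- by rewrite iW0 (lin0 leR) (lin0 lb) -[0 in RHS](subrr 1) bcB subrr.
by rewrite iWZ (linZ leR) (linZ lb) bcZ iW_u2 extR_u2.
Qed.

Lemma extR_uhom b : uhom (FFmod v m n) (adjoint v) b ->
  uhom (FFmod vR m n) (adjoint vR) (extR b).
Proof.
move=> [lb hb]; have leR := @extR_lin b; have [bE bF bK _] := bc_gens.
apply: uhom_gen => //; apply: W_extR.
- exact: lin_comp leR (opE_lin _).
- exact: lin_comp (opE_lin _) leR.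
- by move=> i j _ _; rewrite -iW_u2 -iW_E !extR_iW // -!actE hb bc_ad bE.
- exact: lin_comp leR (opF_lin _).
- exact: lin_comp (opF_lin _) leR.
- by move=> i j _ _; rewrite -iW_u2 -iW_F !extR_iW // -!actF hb bc_ad bF.
- exact: lin_comp leR (opK_lin _).
- exact: lin_comp (opK_lin _) leR.
- by move=> i j _ _; rewrite -iW_u2 -iW_K !extR_iW // -!actK hb bc_ad bK.
Qed.
End BaseChangeTheory.

(** * The identity for beta at a lowest weight vector *)

Section LowestBeta.
Variables (F : fieldType) (v : qparam F).
Local Notation vR := (qparamR v).
Local Notation R := (fps F).
Hypothesis qn : forall n, qint v n.+1 \is a GRing.unit.
Variables (P : lmodType R) (a : uaction vR P) (phi : P -> P -> R) (c : R) (z : P).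
Hypothesis pc : pairing a a phi.
Hypotheses (cu : c \is a GRing.unit) (Kz : opK a z = c *: z) (Fz : opF a z = 0).
Variables m n : nat.
Local Notation W := {ffun 'I_n.+1 -> 'cV[F]_m.+1}.
Local Notation u2 i j := (ubas2 F m n i j).
Local Notation "u # x" := (act a u x) (at level 30, right associativity).

Let qRn := qnR qn.

(** [f] and [g] are K-invariant, and [b] sends [wz p] to 0 or to ad(F^(r)) (E^(r) K^-r); so
    [low_rho_ad] supplies the eigenvalue condition of [braidW_equal], whose conclusion is then read
    at [Lu2]. *)
Lemma low_is_beta r b N k l : brange m n r -> is_beta v m n r b ->
  (n < N)%N -> (k <= m)%N -> (l <= n)%N ->
  \sum_(j < N) cL vR j * (qbin vR (k + j) j * qbin vR (l + j) j) *
     phi z (rho1 (bc (b (u2 (k + j) (l + j)))) # z) =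
  tau vR m k * tau vR n l *
     phi z (Tminus1 (rho1 (bc (b (u2 (m - k) (n - l))))) # z).
Proof.
move=> /and3P[mn2 _ _] [[lb hb] bu] nN km ln.
pose f (w : W) := phi z (rho1 (bc (b w)) # z).
pose g (w : W) := phi z (Tminus1 (rho1 (bc (b w))) # z).
have fl d x y : f (d *: x + y) = fpsC d * f x + f y.
  by rewrite /f lb bcD bcZ linearP actD actZ (pairDr pc) (pairZr pc).
have gl d x y : g (d *: x + y) = fpsC d * g x + g y.
  by rewrite /g lb bcD bcZ !linearP actD actZ (pairDr pc) (pairZr pc).
have [_ _ bK bKi] := bc_gens v.
have bKw w : bc (b (opK (FFmod v m n) w)) = adK (bc (b w)).
  by rewrite -actK hb actK /opK /= /adK !bcM bK bKi.
have fK w : f (opK (FFmod v m n) w) = f w.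
  by rewrite /f bKw (low_rho_adK pc cu Kz).
have gK w : g (opK (FFmod v m n) w) = g w.
  by rewrite /g bKw (low_T_adK pc cu Kz).
have [s mns] : exists s, (m + n = 2 * s)%N.
  by exists ((m + n)./2); move: mn2; lia.
have fg p : (p <= minn m n)%N -> f (wz v m n s p) =
    fpsC ((-1) ^+ (s - p) * qv v ^ ((s - p)%:Z * ((s - p)%:Z + 1))) * g (wz v m n s p).
  move=> pd; rewrite /f /g /wz /chain hb bu // bc_ad (bc_dF qn).
  have [rp|] := eqVneq; last first.
    have b0 : bc (0 : Uq v) = 0 by rewrite -[0](subrr 1) bcB subrr.
    rewrite b0 (lin0 (act_lin (adjoint vR) _)) !linear0.
    by rewrite -(scale0r 1) actC scale0r (pair0r pc) mulr0.
  have -> : r = (s - p)%N by move: pd; rewrite leq_min; lia.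
  rewrite bcM (bc_dE qn) bcX bKi (low_rho_ad qRn pc cu Kz Fz) qR fpsCM.
  have e : fpsC ((-1) ^+ (s - p)) = (-1) ^+ (s - p) :> R by rewrite rmorphXn rmorphN1.
  by rewrite e.
have e := braidW_equal qn mns fl gl fK gK fg (Lu2 v m n N k l).
rewrite (braidW_Lu2 qn nN km ln) in e.
have f0 : f 0 = 0.
  have := fl 1 0 0; rewrite scaler0 addr0 rmorph1 mul1r => /esym/eqP.
  by rewrite -subr_eq0 addrK => /eqP.
have fD x y : f (x + y) = f x + f y by have := fl 1 x y; rewrite scale1r rmorph1 mul1r.
have fZ d x : f (d *: x) = fpsC d * f x by have := fl d x 0; rewrite f0 !addr0.
have g0 : g 0 = 0.
  have := gl 1 0 0; rewrite scaler0 addr0 rmorph1 mul1r => /esym/eqP.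
  by rewrite -subr_eq0 addrK => /eqP.
have gZ d x : g (d *: x) = fpsC d * g x by have := gl d x 0; rewrite g0 !addr0.
rewrite gZ fpsCM -!tauR in e; rewrite -/(g _) -e /Lu2 (big_morph f fD f0).
apply: eq_bigr => j _; rewrite fZ cLR !(qbinR qn) -!fpsCM.
by rewrite mulrA.
Qed.

Lemma low_betaR (b : nat -> W -> Uq v) (r : nat -> R) N k l :
  (forall i, brange m n i -> is_beta v m n i (b i)) ->
  (n < N)%N -> (k <= m)%N -> (l <= n)%N ->
  \sum_(j < N) cL vR j *
     phi z (rho1 (betaR b r (tpure (act (Fmod vR m) (dF vR j) (ubas m k))
                                   (act (Fmod vR n) (dF vR j) (ubas n l)))) # z) =
  phi z (Tminus1 (rho1 (betaR b r (tpure (@braidFm _ vR m (ubas m k))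
    (@braidFm _ vR n (ubas n l))))) # z).
Proof.
move=> hb nN km ln.
have rs (I : finType) (Pr : pred I) (u : I -> Uq vR) w :
    (\sum_(i | Pr i) u i) # w = \sum_(i | Pr i) u i # w.
  apply: (big_morph (fun u => u # w) (fun u u' => actD a u u' w)).
  by rewrite -(scale0r 1) actC scale0r.
rewrite /betaR !raddf_sum /= rs (pair_sumr pc).
have -> : \sum_(j < N) cL vR j * phi z (rho1 (\sum_(i < (m + n).+1 | brange m n i)
      r i *: extR (b i) (tpure (act (Fmod vR m) (dF vR j) (ubas m k))
         (act (Fmod vR n) (dF vR j) (ubas n l)))) # z) =
    \sum_(i < (m + n).+1 | brange m n i) \sum_(j < N) r i *
      (cL vR j * (qbin vR (k + j) j * qbin vR (l + j) j) *
       phi z (rho1 (bc (b i (u2 (k + j) (l + j)))) # z)).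
  rewrite exchange_big; apply: eq_bigr => j _ /=.
  rewrite raddf_sum rs (pair_sumr pc) mulr_sumr /=; apply: eq_bigr => i bi.
  have [[lb _] _] := hb i bi.
  rewrite !act_dF_u // tpureZl tpureZr scalerA (linZ (@extR_lin _ _ _ _ (b i))).
  rewrite -/(ubas2 R m n (k + j) (l + j)) extR_u2 // !linearZ !actZ !(pairZr pc).
  move: (cL _ _) (qbin _ _ _) (qbin _ _ _) (phi _ _) => *; ring.
apply: eq_bigr => i bi; have [[lb _] _] := hb i bi.
rewrite !braidFm_u // tpureZl tpureZr scalerA (linZ (@extR_lin _ _ _ _ (b i))).
rewrite -/(ubas2 R m n (m - k) (n - l)) extR_u2 // !linearZ !actZ !(pairZr pc).
by rewrite -mulr_sumr (low_is_beta bi (hb i bi) nN km ln).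
Qed.
End LowestBeta.

(** * The Verma module M in coordinates *)

Section QT.
Variables (F : fieldType) (v : qparam F).
Local Notation vR := (qparamR v).
Local Notation R := (fps F).
Local Notation T := (fpsT F).
Local Notation q := (qv vR).
Local Notation h := ((q - q^-1)^-1).
Hypothesis qn : forall n, qint v n.+1 \is a GRing.unit.

Lemma qTE l : qT v l = h * (q ^ l * T - q ^ (- l) * T^-1).
Proof. by rewrite /qT mulrC. Qed.

Lemma qiR z : qi vR z = fpsC (qi v z).
Proof.
rewrite /qi !qR fpsCM; congr (_ * _); last by rewrite rmorphB.
by rewrite rmorphV ?qvB_unit // rmorphB rmorphV ?qv_unit.
Qed.
Lemma qiR_unit z : z != 0 -> qi vR z \is a GRing.unit.
Proof. by move=> z0; rewrite qiR rmorph_unit // unitfE qi_neq0. Qed.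

Lemma T_coef0 : fcoef T^-1 0 = 1.
Proof.
have := congr1 (fun f => fcoef f 0) (mulVr (fpsT_unit F)).
by rewrite /= big_ord_recl big_ord0 /= mulr1 addr0.
Qed.

Lemma qT_unit l : l != 0 -> qT v l \is a GRing.unit.
Proof.
move=> l0; rewrite qTE unitrM h_unit /=; apply: fps_unit0.
rewrite !qR fcoefD fcoefN !fcoefCM T_coef0 !mulr1.
have := qi_neq0 qn l0; rewrite /qi mulf_eq0 negb_or => /andP[_].
by [].
Qed.

(** At [l = 0] the value vanishes at T = 1 and is not a unit. It is nonzero because T^2 is not 1, as
    its coefficient on (T - 1)^2 shows. *)
Lemma qT_neq0 l : qT v l != 0.
Proof.
have [->|/qT_unit] := eqVneq l 0; last first.
  by apply: contraTneq => ->; rewrite unitr0.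
rewrite qTE; apply/negP => /eqP e0.
have : T * T - 1 = 0.
  rewrite -(mulrV (fpsT_unit F)) -mulrBr; have := congr1 ( *%R (h^-1)) e0.
  rewrite mulr0 mulrA mulVr ?h_unit // mul1r expr0z !mul1r => ->.
  by rewrite mulr0.
move=> /(congr1 (fun f => fcoef f 2)); rewrite fcoefD fcoefN fcoef0 fcoefM.
rewrite !big_ord_recl big_ord0 /= oppr0 !addr0 !mul0r !mulr0 mul1r add0r addr0.
by move/eqP; rewrite oner_eq0.
Qed.

Lemma fps_regular (f g : R) : f != 0 -> f * g = 0 -> g = 0.
Proof. by move=> f0 fg; apply: fps_mulf_eq0 fg f0. Qed.
Lemma fps_mulf_neq0 (f g : R) : f != 0 -> g != 0 -> f * g != 0.
Proof. by move=> f0; apply: contraNneq => /(fps_regular f0) ->. Qed.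

(* F^i x0 has weight [wtz i], and E F^i x0 = [ez i] F^(i - 1) x0, for i in Z. *)
Definition wtz (i : int) : R := T * q ^ (- 1 - 2 * i).
Definition ez (i : int) : R := qi vR i * qT v (- i).

Lemma wtz_unit i : wtz i \is a GRing.unit.
Proof. by rewrite unitrM fpsT_unit qX_unit. Qed.
Lemma wtzV i : (wtz i)^-1 = T^-1 * q ^ (1 + 2 * i).
Proof. rewrite /wtz invrM ?qX_unit ?fpsT_unit // invr_expz mulrC; congr (_ * q ^ _); lia. Qed.
Lemma ez0 : ez 0 = 0.
Proof. by rewrite /ez qi0 mul0r. Qed.
Lemma ez_neq0 i : i != 0 -> ez i != 0.
Proof.
move=> i0; apply: fps_mulf_neq0 (qT_neq0 _).
by apply: contraTneq (qiR_unit i0) => ->; rewrite unitr0.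
Qed.
Lemma ez_unit i : i != 0 -> ez i \is a GRing.unit.
Proof. by move=> i0; rewrite unitrM qiR_unit // qT_unit // oppr_eq0. Qed.
Lemma ezS i : ez (i + 1) = ez i + h * (wtz i - (wtz i)^-1).
Proof.
rewrite wtzV /ez !qTE /wtz /qi; have hh := hB vR.
move: T (T^-1) => T'' T'.
have -> : h * (T'' * q ^ (-1 - 2 * i) - T' * q ^ (1 + 2 * i)) =
  h * h * ((q ^ 1 - q ^ (- 1)) * (T'' * q ^ (-1 - 2 * i) - T' * q ^ (1 + 2 * i))).
  have -> : q ^ 1 - q ^ (-1) = q - q^-1 by [].
  move: (q ^ _) (q ^ _) hh; move: (q - q^-1) h => y x b a e.
  transitivity (x * (x * y) * (T'' * a - T' * b)); last by ring.
  by rewrite e mulr1.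
have e2 (a b c d : int) : h * (q ^ a - q ^ b) * (h * (q ^ c * T'' - q ^ d * T')) =
   h * h * (q ^ (a + c) * T'' - q ^ (a + d) * T' - (q ^ (b + c) * T'' - q ^ (b + d) * T')).
  rewrite -!qD; move: h (q ^ _) (q ^ _) (q ^ _) (q ^ _) => *; ring.
rewrite !e2 -mulrDr; congr (_ * _).
have -> : (q ^ 1 - q ^ (- 1)) * (T'' * q ^ (-1 - 2 * i) - T' * q ^ (1 + 2 * i)) =
   q ^ (- (2 * i)) * T'' - q ^ (2 + 2 * i) * T' - (q ^ (- 2 - 2 * i) * T'' - q ^ (2 * i) * T').
  have -> : q ^ (- (2 * i)) = q ^ 1 * q ^ (-1 - 2 * i) by rewrite qD; congr (q ^ _); lia.
  have -> : q ^ (2 + 2 * i) = q ^ 1 * q ^ (1 + 2 * i) by rewrite qD; congr (q ^ _); lia.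
  have -> : q ^ (- 2 - 2 * i) = q ^ (-1) * q ^ (-1 - 2 * i) by rewrite qD; congr (q ^ _); lia.
  have -> : q ^ (2 * i) = q ^ (-1) * q ^ (1 + 2 * i) by rewrite qD; congr (q ^ _); lia.
  move: (q ^ 1) (q ^ (-1)) (q ^ _) (q ^ _) => *; ring.
rewrite (_ : i + 1 - (i + 1) = 0) ?subrr; last by lia.
have -> : - (i + 1) + - (i + 1) = - 2 - 2 * i by lia.
have -> : i + 1 + - - (i + 1) = 2 + 2 * i by lia.
have -> : i + - - i = 2 * i by lia.
have -> : - i + - i = - (2 * i) by lia.
by move: (q ^ _) (q ^ _) (q ^ _) (q ^ _) (q ^ 0) => *; ring.
Qed.
End QT.

Section PolyVerma.
Variables (F : fieldType) (v : qparam F).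
Local Notation vR := (qparamR v).
Local Notation R := (fps F).
Local Notation q := (qv vR).
Implicit Types p : {poly R}.

(** A model of the Verma module on polynomials, where X^i stands for F^i x0; the universal property
    of M maps M to it and so provides coordinates. *)
Definition pE p := \poly_(i < size p) (ez v i.+1%:Z * p`_i.+1).
Definition pF p := 'X * p.
Definition pK p := \poly_(i < size p) (wtz v i%:Z * p`_i).
Definition pKi p := \poly_(i < size p) ((wtz v i%:Z)^-1 * p`_i).

Lemma coef_pE p i : (pE p)`_i = ez v i.+1%:Z * p`_i.+1.
Proof.
rewrite coef_poly; case: ltnP => // pi; rewrite nth_default ?mulr0 //.
exact: leq_trans pi _.
Qed.
Lemma coef_pF p i : (pF p)`_i = if i is j.+1 then p`_j else 0.
Proof. by rewrite coefXM; case: i. Qed.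
Lemma coef_pK p i : (pK p)`_i = wtz v i%:Z * p`_i.
Proof. by rewrite coef_poly; case: ltnP => // pi; rewrite nth_default ?mulr0. Qed.
Lemma coef_pKi p i : (pKi p)`_i = (wtz v i%:Z)^-1 * p`_i.
Proof. by rewrite coef_poly; case: ltnP => // pi; rewrite nth_default ?mulr0. Qed.

Let coefs := (coef_pE, coef_pF, coef_pK, coef_pKi, coefD, coefZ, coefN, coefB).
Fact pE_lin : linear pE.
Proof. by move=> c x y; apply/polyP => i; rewrite !coefs mulrDr mulrCA. Qed.
Fact pF_lin : linear pF.
Proof. by move=> c x y; rewrite /pF mulrDr scalerAr. Qed.
Fact pK_lin : linear pK.
Proof. by move=> c x y; apply/polyP => i; rewrite !coefs mulrDr mulrCA. Qed.
Fact pKi_lin : linear pKi.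
Proof. by move=> c x y; apply/polyP => i; rewrite !coefs mulrDr mulrCA. Qed.
Fact pKKi p : pK (pKi p) = p.
Proof. by apply/polyP => i; rewrite !coefs mulrA mulrV ?wtz_unit // mul1r. Qed.
Fact pKiK p : pKi (pK p) = p.
Proof. by apply/polyP => i; rewrite !coefs mulrA mulVr ?wtz_unit // mul1r. Qed.
Let wtzD i j : wtz v i * (wtz v j)^-1 = q ^ (2 * (j - i)).
Proof.
rewrite wtzV /wtz mulrACA mulrV ?fpsT_unit // mul1r qD; congr (q ^ _); lia.
Qed.
Fact pKE p : pK (pE (pKi p)) = q ^+ 2 *: pE p.
Proof.
apply/polyP => i; rewrite !coefs [ez _ _ * (_ * _)]mulrCA [LHS]mulrA wtzD.
by rewrite qX; congr (q ^ _ * _); lia.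
Qed.
Fact pKF p : pK (pF (pKi p)) = q ^- 2 *: pF p.
Proof.
apply/polyP => -[|i]; rewrite !coefs ?mulr0 // [LHS]mulrA wtzD qXN.
by congr (q ^ _ * _); lia.
Qed.
Fact pEF p : pE (pF p) - pF (pE p) = (q - q^-1)^-1 *: (pK p - pKi p).
Proof.
have e i c : (q - q^-1)^-1 * (wtz v i * c - (wtz v i)^-1 * c) =
    (ez v (i + 1) - ez v i) * c.
  by rewrite -mulrBl mulrA ezS [ez v i + _]addrC addrK.
apply/polyP => -[|i]; rewrite !coefs e; first by rewrite ez0 !subr0.
by rewrite -mulrBl; congr ((ez v _ - _) * _); lia.
Qed.
Definition poly_verma : uaction vR {poly R} :=
  UAction pE_lin pF_lin pK_lin pKi_lin pKKi pKiK pKE pKF pEF.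
End PolyVerma.

Section VermaBasis.
Variables (F : fieldType) (v : qparam F).
Local Notation vR := (qparamR v).
Local Notation R := (fps F).
Local Notation q := (qv vR).
Variables (A : lmodType R) (a : uaction vR A).

(** Map to the polynomial model by the universal property and come back by [g]; uniqueness among
    endomorphisms fixing [x0] makes the composite the identity. *)
Lemma verma_coord : verma a (fpsT F * q^-1) ->
  exists (x0 : A) (f : A -> {poly R}), [/\ opE a x0 = 0, opK a x0 = wtz v 0 *: x0,
    uhom a (poly_verma v) f, f x0 = 1 &
    forall x, x = \sum_(i < size (f x)) (f x)`_i *: iter i (opF a) x0].
Proof.
case=> x0 [Ex0 Kx0 univ]; exists x0.
have Kx0' : opK a x0 = wtz v 0 *: x0.
  by rewrite Kx0 /wtz mulr0 subr0.
have E1 : opE (poly_verma v) 1 = 0.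
  by apply/polyP => i; rewrite coef_pE coef1 coef0 mulr0.
have K1 : opK (poly_verma v) 1 = (fpsT F * q^-1) *: (1 : {poly R}).
  apply/polyP => i; rewrite coef_pK coefZ coef1.
  by case: i => [|i]; rewrite ?mulr0 // /wtz mulr0 subr0.
have [f [[hf f1] _]] := univ _ (poly_verma v) 1 E1 K1.
exists f; split => //.
have Kz i : opK a (iter i (opF a) x0) = wtz v i%:Z *: iter i (opF a) x0.
  elim: i => [|i IH]; first exact: Kx0'.
  rewrite iterS (wt_F IH) /wtz mulrCA qD; congr (_ * q ^ _ *: _); lia.
have Ez i : opE a (iter i.+1 (opF a) x0) = ez v i.+1%:Z *: iter i (opF a) x0.
  elim: i => [|i IH]; rewrite iterS E_F.
    rewrite Ex0 (lin0 (opF_lin a)) add0r Kx0' (wt_Ki (wtz_unit v 0) Kx0').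
    by rewrite -scalerBl scalerA (_ : 1%N%:Z = 0 + 1) // ezS ez0 add0r.
  rewrite IH (linZ (opF_lin a)) (wt_Ki (wtz_unit v _) (Kz i.+1)) Kz -iterS.
  rewrite -scalerBl scalerA -scalerDl -ezS; congr (ez v _ *: _); lia.
pose g (p : {poly R}) := \sum_(i < size p) p`_i *: iter i (opF a) x0.
have gN N (p : {poly R}) : (size p <= N)%N -> g p = \sum_(i < N) p`_i *: iter i (opF a) x0.
  move=> pN; rewrite /g -(subnKC pN) big_split_ord /= [X in _ + X]big1 ?addr0 // => i _.
  by rewrite nth_default ?scale0r // leq_addr.
have gl : linear g.
  move=> c p p'; pose N := maxn (size (c *: p + p')) (maxn (size p) (size p')).
  rewrite !(gN N) ?leq_max ?leqnn ?orbT // scaler_sumr -big_split.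
  by apply: eq_bigr => i _ /=; rewrite coefD coefZ scalerDl scalerA.
have gh : uhom (poly_verma v) a g.
  apply: uhom_gen => // p.
  - rewrite (gN (size p)) ?size_poly // (gN (size p).+1) // (lin_sum (opE_lin a)).
    rewrite [RHS]big_ord_recl (linZ (opE_lin a)) Ex0 scaler0 add0r.
    by apply: eq_bigr => i _; rewrite coef_pE (linZ (opE_lin a)) Ez scalerA mulrC.
  - rewrite (gN (size p).+1); last first.
      apply/leq_sizeP => j pj; rewrite coef_pF; case: j pj => // j pj.
      by rewrite nth_default.
    rewrite big_ord_recl coef_pF scale0r add0r (gN (size p)) // (lin_sum (opF_lin a)).
    by apply: eq_bigr => i _; rewrite coef_pF (linZ (opF_lin a)).
  rewrite (gN (size p)) ?size_poly // (gN (size p)) // (lin_sum (opK_lin a)).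
  by apply: eq_bigr => i _; rewrite coef_pK (linZ (opK_lin a)) Kz scalerA mulrC.
have [id' [_ uid]] := univ _ a x0 Ex0 Kx0.
have e1 : id' = (fun x => g (f x)).
  apply: uid; split; last first.
    by rewrite f1 (gN 1%N) ?size_poly1 // big_ord_recl big_ord0 coef1 scale1r addr0.
  by split; [exact: lin_comp gl hf.1 | move=> u x; rewrite hf.2 gh.2].
have e2 : id' = id by apply: uid.
by move=> x; have /(congr1 (fun h => h x)) := e1; rewrite e2.
Qed.
End VermaBasis.

(** * Coordinates on M_F, and the lift of a form on M *)

Section Localization.
Variables (F : fieldType) (v : qparam F).
Local Notation vR := (qparamR v).
Local Notation R := (fps F).
Local Notation q := (qv vR).
Hypothesis qn : forall n, qint v n.+1 \is a GRing.unit.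
Variables (M : locdata v) (x0 : lbase M) (f : lbase M -> {poly R}).
Variable Fi : lloc M -> lloc M.
Local Notation aB := (abase M).
Local Notation aL := (aloc M).
Local Notation j := (@linj _ _ M).

Record verma_loc : Prop := VermaLoc {
  vl_E0 : opE aB x0 = 0;
  vl_K0 : opK aB x0 = wtz v 0 *: x0;
  vl_f : uhom aB (poly_verma v) f;
  vl_f0 : f x0 = 1;
  vl_sum : forall x, x = \sum_(i < size (f x)) (f x)`_i *: iter i (opF aB) x0;
  vl_j : uhom aB aL j;
  vl_inj : injective j;
  vl_FK : cancel (opF aL) Fi;
  vl_KF : cancel Fi (opF aL);
  vl_mem : forall y, exists n x, iter n (opF aL) y = j x
}.
Hypothesis H : verma_loc.

Let fl : linear f. Proof. by case: (vl_f H). Qed.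
Let fF x : f (opF aB x) = 'X * f x.
Proof. by rewrite -actF (vl_f H).2 actF. Qed.
Let fE x : f (opE aB x) = pE v (f x).
Proof. by rewrite -actE (vl_f H).2 actE. Qed.
Let fK x : f (opK aB x) = pK v (f x).
Proof. by rewrite -actK (vl_f H).2 actK. Qed.
Lemma linj_lin : linear j. Proof. by case: (vl_j H). Qed.
Let jl := linj_lin.
Lemma linjE x : j (opE aB x) = opE aL (j x).
Proof. by rewrite -!actE (vl_j H).2. Qed.
Lemma linjF x : j (opF aB x) = opF aL (j x).
Proof. by rewrite -!actF (vl_j H).2. Qed.
Lemma linjK x : j (opK aB x) = opK aL (j x).
Proof. by rewrite -!actK (vl_j H).2. Qed.
Lemma linjKi x : j (opKi aB x) = opKi aL (j x).
Proof. by rewrite -!actKi (vl_j H).2. Qed.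
Lemma linjF_iter n x : j (iter n (opF aB) x) = iter n (opF aL) (j x).
Proof. by elim: n => // n IH; rewrite !iterS linjF IH. Qed.
Lemma f_inj x y : (forall i, (f x)`_i = (f y)`_i) -> x = y.
Proof. by move=> /polyP e; rewrite [x](vl_sum H) [y](vl_sum H) e. Qed.
Let f_iter n x i : (f (iter n (opF aB) x))`_(n + i) = (f x)`_i.
Proof. by elim: n => // n IH; rewrite iterS fF coefXM. Qed.
Let f_iter0 n x i : (i < n)%N -> (f (iter n (opF aB) x))`_i = 0.
Proof.
elim: n i => // n IH [|i] ni; rewrite iterS fF coefXM //.
exact: IH.
Qed.
Lemma Finv_lin : linear Fi.
Proof.
move=> c x y; apply: (can_inj (vl_FK H)); rewrite (opF_lin aL) !(vl_KF H) //.
Qed.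
Let Fl n : linear (iter n (opF aL)).
Proof. by elim: n => [|n IH] c x y //=; rewrite IH (opF_lin aL). Qed.

(** The coefficient of F^i x0 in [y], for any integer [i]: a power of F pushes [y] into M, and the
    index is shifted accordingly. By [czE] the power chosen does not matter; a negative shifted
    index gives 0. *)
Definition cz (y : lloc M) (i : int) : R :=
  xget 0 [set r | exists n x, iter n (opF aL) y = j x /\
    r = if i + n%:Z is Posz k then (f x)`_k else 0]%classic.

Lemma czE n x y i : iter n (opF aL) y = j x ->
  cz y i = if i + n%:Z is Posz k then (f x)`_k else 0.
Proof.
move=> yx; rewrite /cz; case: xgetP => [r _ [n' [x' [yx' ->]]]|]; last first.
  by move=> no; exfalso; apply: (no _); exists n, x; split; first exact: yx.
have key n1 n2 x1 x2 : (n1 <= n2)%N -> iter n1 (opF aL) y = j x1 ->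
    iter n2 (opF aL) y = j x2 -> (if i + n2%:Z is Posz k then (f x2)`_k else 0) =
    (if i + n1%:Z is Posz k then (f x1)`_k else 0).
  move=> n12 y1 y2; have -> : x2 = iter (n2 - n1) (opF aB) x1.
    by apply: (vl_inj H); rewrite linjF_iter -y1 -iterD subnK // y2.
  have : i + n2%:Z = i + n1%:Z + (n2 - n1)%:Z by lia.
  case: (i + n1%:Z) => [k|k] ->.
    by rewrite -PoszD addnC f_iter.
  case e: (Negz k + _) => [k'|//]; rewrite f_iter0 //; lia.
by have [le|/ltnW le] := leqP n n'; [rewrite (key n n' x x')|rewrite -(key n' n x' x)].
Qed.

Lemma cz_lin i : linear (cz^~ i : lloc M -> R^o).
Proof.
move=> c y y'; have [n [x yx]] := vl_mem H y; have [n' [x' yx']] := vl_mem H y'.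
have ex : iter (n + n') (opF aL) y = j (iter n' (opF aB) x).
  by rewrite addnC iterD yx linjF_iter.
have ex' : iter (n + n') (opF aL) y' = j (iter n (opF aB) x').
  by rewrite iterD yx' linjF_iter.
have e : iter (n + n') (opF aL) (c *: y + y') =
    j (c *: iter n' (opF aB) x + iter n (opF aB) x').
  by rewrite Fl ex ex' jl.
rewrite (czE _ e) (czE _ ex) (czE _ ex'); case: (i + _) => k; last first.
  by rewrite scaler0 addr0.
by rewrite fl coefD coefZ.
Qed.
Lemma czD y y' i : cz (y + y') i = cz y i + cz y' i. Proof. exact: linD (cz_lin i) _ _. Qed.
Lemma czB y y' i : cz (y - y') i = cz y i - cz y' i. Proof. exact: linB (cz_lin i) _ _. Qed.
Lemma czZ c y i : cz (c *: y) i = c * cz y i. Proof. exact: linZ (cz_lin i) _ _. Qed.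
Lemma cz0 i : cz 0 i = 0. Proof. exact: lin0 (cz_lin i). Qed.
Lemma cz_sum (I : Type) (r : seq I) (P : pred I) (g : I -> lloc M) i :
  cz (\sum_(k <- r | P k) g k) i = \sum_(k <- r | P k) cz (g k) i.
Proof. exact: (lin_sum (cz_lin i)). Qed.

Lemma cz_linj x k : cz (j x) (Posz k) = (f x)`_k.
Proof. by rewrite (@czE 0 x) // addr0. Qed.
Lemma cz_linjN x k : cz (j x) (Negz k) = 0.
Proof. by rewrite (@czE 0 x) // addr0. Qed.

Lemma cz_F y i : cz (opF aL y) i = cz y (i - 1).
Proof.
have [n [x yx]] := vl_mem H y.
have e : iter n (opF aL) (opF aL y) = j (opF aB x) by rewrite linjF -yx -iterSr.
have e' : iter n.+1 (opF aL) y = j (opF aB x) by rewrite iterSr.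
rewrite (czE _ e) (czE _ e'); have -> // : i + n%:Z = i - 1 + n.+1%:Z; lia.
Qed.
Lemma cz_Fi y i : cz (Fi y) i = cz y (i + 1).
Proof. by rewrite -[y in RHS](vl_KF H) cz_F addrK. Qed.

Let K_iterF n y : iter n (opF aL) (opK aL y) = q ^ (2 * n)%:Z *: opK aL (iter n (opF aL) y).
Proof.
elim: n => [|n IH]; first by rewrite scale1r.
rewrite !iterS IH (linZ (opF_lin aL)) K_F scalerA qD; congr (q ^ _ *: _); lia.
Qed.

Lemma cz_K y i : cz (opK aL y) i = wtz v i * cz y i.
Proof.
have [n [x yx]] := vl_mem H y.
have e : iter n (opF aL) (opK aL y) = j (q ^ (2 * n)%:Z *: opK aB x).
  by rewrite K_iterF yx (linZ jl) linjK.
rewrite (czE _ e) (czE _ yx); case en : (i + _) => [k|k]; last by rewrite mulr0.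
rewrite (linZ fl) coefZ fK coef_pK mulrA; congr (_ * _).
rewrite /wtz mulrCA qD; congr (_ * q ^ _); lia.
Qed.
Lemma cz_Ki y i : cz (opKi aL y) i = (wtz v i)^-1 * cz y i.
Proof. by rewrite -[y in RHS](opKKi aL) cz_K mulKr ?wtz_unit. Qed.

(** Induction on the power of F that pushes [y] into M; passing from F y to y uses the commutator of
    E and F, that is the recursion [ezS]. *)
Lemma cz_E y i : cz (opE aL y) i = ez v (i + 1) * cz y (i + 1).
Proof.
have [n [x yx]] := vl_mem H y; elim: n y x i yx => [|n IH] y x i yx.
  rewrite (yx : y = j x) -linjE; case: i => k.
    by rewrite cz_linj fE coef_pE (_ : Posz k + 1 = k.+1%:Z) ?cz_linj //; lia.
  rewrite cz_linjN; case: k => [|k]; first by rewrite (_ : Negz 0 + 1 = 0) ?ez0 ?mul0r //; lia.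
  by rewrite (_ : Negz k.+1 + 1 = Negz k) ?cz_linjN ?mulr0 //; lia.
have := IH (opF aL y) x (i + 1); rewrite -iterSr => /(_ yx).
rewrite E_F czD cz_F cz_F addrK czZ czB cz_K cz_Ki -mulrBl mulrA ezS addrK.
by rewrite mulrDl => /addIr.
Qed.

Lemma cz_inj y y' : (forall i, cz y i = cz y' i) -> y = y'.
Proof.
move=> e; apply/eqP; rewrite -subr_eq0; apply/eqP.
have [n [x yx]] := vl_mem H (y - y').
have x_0 : x = 0.
  apply: f_inj => i; rewrite (lin0 fl) coef0; have := czE (i%:Z - n%:Z) yx.
  by rewrite subrK czB e subrr.
rewrite x_0 (lin0 jl) in yx; elim: n yx => // n IH; rewrite iterS => e0; apply: IH.
by apply: (can_inj (vl_FK H)); rewrite e0 (lin0 (opF_lin aL)).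
Qed.

Lemma cz_mem y : (forall k, cz y (Negz k) = 0) -> exists x, y = j x.
Proof.
have [n [x yx]] := vl_mem H y; elim: n y x yx => [|n IH] y x yx y0; first by exists x.
have yx' : iter n (opF aL) (opF aL y) = j x by rewrite -iterSr.
have [k|x1 Fy] := IH _ _ yx'.
  by rewrite cz_F (_ : Negz k - 1 = Negz k.+1) //; lia.
have f0 : (f x1)`_0 = 0 by rewrite -cz_linj -Fy cz_F; exact: y0 0%N.
have [x2 x12] : exists x2, x1 = opF aB x2.
  have := vl_sum H x1; case: (size (f x1)) => [|N].
    by rewrite big_ord0 => ->; exists 0; rewrite (lin0 (opF_lin aB)).
  rewrite big_ord_recl f0 scale0r add0r => ->.
  exists (\sum_(i < N) (f x1)`_i.+1 *: iter i (opF aB) x0).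
  rewrite (lin_sum (opF_lin aB)); apply: eq_bigr => i _.
  by rewrite (linZ (opF_lin aB)).
by exists x2; apply: (can_inj (vl_FK H)); rewrite Fy x12 linjF.
Qed.

Definition zz (i : int) : lloc M :=
  match i with Posz n => iter n (opF aL) (j x0) | Negz n => iter n.+1 Fi (j x0) end.
Arguments zz : simpl never.

Lemma F_zz i : opF aL (zz i) = zz (i + 1).
Proof.
case: i => [n|[|n]]; first by rewrite (_ : Posz n + 1 = n.+1) //; lia.
  by rewrite (_ : Negz 0 + 1 = 0); [exact: (vl_KF H)|lia].
by rewrite (_ : Negz n.+1 + 1 = Negz n); [exact: (vl_KF H)|lia].
Qed.
Lemma Fi_zz i : Fi (zz i) = zz (i - 1).
Proof. by rewrite -{1}[i](subrK 1) -F_zz (vl_FK H). Qed.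
Lemma cz_zz i k : cz (zz i) k = (i == k)%:R.
Proof.
have c0 l : cz (zz 0) l = (0 == l)%:R.
  case: l => l; last by rewrite cz_linjN.
  by rewrite cz_linj (vl_f0 H) coef1; case: l.
have cp n l : cz (iter n (opF aL) (j x0)) l = (n%:Z == l)%:R.
  by elim: n l => [|n IH] l; rewrite ?c0 // iterS cz_F IH; congr (_%:R); lia.
have cn n l : cz (iter n Fi (j x0)) l = (- n%:Z == l)%:R.
  by elim: n l => [|n IH] l; rewrite ?c0 // iterS cz_Fi IH; congr (_%:R); lia.
by case: i => n; rewrite /zz ?cp // cn NegzE.
Qed.
Lemma K_zz i : opK aL (zz i) = wtz v i *: zz i.
Proof.
apply: cz_inj => k; rewrite cz_K czZ cz_zz.
by have [->|] := eqVneq i k; rewrite ?mulr0.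
Qed.
Lemma E_zz i : opE aL (zz i) = ez v i *: zz (i - 1).
Proof.
apply: cz_inj => k; rewrite cz_E czZ !cz_zz subr_eq.
by have [->|] := eqVneq i (k + 1); rewrite ?mulr0.
Qed.

Lemma cz_fin y : exists N, forall k, (N <= k)%N -> cz y (Negz k) = 0.
Proof.
have [n [x yx]] := vl_mem H y; exists n => k nk; rewrite (czE _ yx).
by case e: (Negz k + _) => [l|] //; lia.
Qed.

Lemma zz_span y : exists N x,
  y = j x + \sum_(k < N) cz y (Negz k) *: zz (Negz k).
Proof.
have [N yN] := cz_fin y; exists N.
have [x e] : exists x, y - \sum_(k < N) cz y (Negz k) *: zz (Negz k) = j x.
  apply: cz_mem => k; rewrite czB cz_sum; have [kN|Nk] := ltnP k N.
    rewrite (bigD1 (Ordinal kN)) //= big1 => [|i ik].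
      by rewrite addr0 czZ cz_zz eqxx mulr1 subrr.
    rewrite czZ cz_zz (_ : Negz i == Negz k = false) ?mulr0 //.
    by apply: contraNF ik => /eqP[ik]; apply/eqP/val_inj.
  rewrite yN // big1 ?subr0 // => i _; rewrite czZ cz_zz.
  rewrite (_ : Negz i == Negz k = false) ?mulr0 //.
  by apply/negP => /eqP[ik]; have := ltn_ord i; lia.
by exists x; rewrite -e subrK.
Qed.


Section FormLift.
Variable phi : lbase M -> lbase M -> R.
Hypothesis pc : pairing aB aB phi.
Local Notation z := (zz (Negz 0)).

Lemma phi_x0 y : phi x0 y = (f y)`_0 * phi x0 x0.
Proof.
rewrite {1}[y](vl_sum H) (pair_sumr pc).
have F0 w : phi x0 (opF aB w) = 0.
  rewrite (pairFr pc) (wt_Ki (wtz_unit v 0) (vl_K0 H)) (linZ (opE_lin aB)) (vl_E0 H).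
  by rewrite scaler0 (pair0l pc) mulr0.
case e: (size (f y)) => [|n].
  by rewrite big_ord0 nth_default ?mul0r // e.
rewrite big_ord_recl (pairZr pc) big1 ?addr0 // => i _.
by rewrite (pairZr pc) F0 mulr0.
Qed.

(** The value of the lift on F^-(k+1) x0 paired with itself: the normalization prescribes it at
    [k = 0], and invariance under E forces the rest. *)
Fixpoint ph (k : nat) : R := if k is k'.+1 then
  q * wtz v (Negz k') * (ez v (Negz k'))^-1 * ph k' else phi x0 x0.

Let phS k : ez v (Negz k) * ph k.+1 = q * wtz v (Negz k) * ph k.
Proof.
have eu : ez v (Negz k) * (ez v (Negz k))^-1 = 1 by rewrite mulrV // ez_unit.
rewrite /=; move: (ez _ _) (ez _ _)^-1 (wtz _ _) (ph k) eu => e e' w p ee.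
transitivity (q * w * p * (e * e')); first by ring.
by rewrite ee mulr1.
Qed.

Definition phiF (y y' : lloc M) : R := \sum_(k \in [set: nat]%classic)
  ph k * (cz y (Negz k) * cz y' (Negz k)).

Lemma phiFE N y y' :
  (forall k, (N <= k)%N -> cz y (Negz k) * cz y' (Negz k) = 0) ->
  phiF y y' = \sum_(k < N) ph k * (cz y (Negz k) * cz y' (Negz k)).
Proof. by move=> yN; rewrite /phiF (fsum_nat (N := N)) // => k /yN ->; rewrite mulr0. Qed.

Lemma phiF_pairing : pairing aL aL phiF.
Proof.
have N1 k : Negz k.+1 + 1 = Negz k by lia.
have N2 k : Negz k - 1 = Negz k.+1 by lia.
split=> [y' c x x'|x c y y'|x y|x y|x y].
- have [N xN] := cz_fin x; have [N' xN'] := cz_fin x'.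
  rewrite !(phiFE (N := maxn N N')) => [|k|k|k]; rewrite ?geq_max; last first.
  + by move=> /andP[? ?]; rewrite czD czZ xN ?xN' // mulr0 addr0 mul0r.
  + by move=> /andP[? ?]; rewrite xN // mul0r.
  + by move=> /andP[? ?]; rewrite xN' // mul0r.
  rewrite mulr_sumr -big_split; apply: eq_bigr => k _ /=.
  by rewrite czD czZ; move: (cz _ _) (cz _ _) (cz _ _) (ph k) => *; ring.
- have [N xN] := cz_fin x.
  rewrite !(phiFE (N := N)) => [|k kN|k kN|k kN]; rewrite ?xN ?mul0r //.
  rewrite mulr_sumr -big_split; apply: eq_bigr => k _ /=.
  by rewrite czD czZ; move: (cz _ _) (cz _ _) (cz _ _) (ph k) => *; ring.
- have [N xN] := cz_fin x.
  rewrite (phiFE (N := N.+1)) => [|[|k] kN]; last 2 first.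
  + by [].
  + by rewrite cz_E N1 xN // mulr0 mul0r.
  rewrite (phiFE (N := N)) => [|k kN]; last by rewrite xN ?mul0r.
  rewrite big_ord_recl cz_E (_ : Negz 0 + 1 = 0) // ez0 !mul0r mulr0 add0r mulr_sumr.
  apply: eq_bigr => k _; rewrite lift0 cz_E N1 cz_K cz_F N2.
  transitivity (ez v (Negz k) * ph k.+1 * (cz x (Negz k) * cz y (Negz k.+1))).
    by move: (ph _) (cz _ _) (cz _ _) (ez _ _) => *; ring.
  by rewrite phS; move: (ph _) (cz _ _) (cz _ _) (wtz _ _) => *; ring.
- have [N xN] := cz_fin x; have [N' yN] := cz_fin y.
  rewrite (phiFE (N := N)) => [|k kN]; last by rewrite cz_F N2 xN ?mul0r // ltnW.
  rewrite (phiFE (N := N.+1)) => [|k kN]; last by rewrite xN ?mul0r // ltnW.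
  rewrite big_ord_recl cz_Ki cz_E (_ : Negz 0 + 1 = 0) // ez0 !mul0r !mulr0 add0r.
  rewrite mulr_sumr; apply: eq_bigr => k _; rewrite lift0 cz_F N2 cz_Ki cz_E N1.
  transitivity (q * (wtz v (Negz k.+1))^-1 * (ez v (Negz k) * ph k.+1) *
    (cz x (Negz k.+1) * cz y (Negz k))); last first.
    by move: (ph _) (cz _ _) (cz _ _) (ez _ _) (wtz _ _)^-1 => *; ring.
  rewrite phS; have e : q * (wtz v (Negz k.+1))^-1 * (q * wtz v (Negz k)) = 1.
    rewrite wtzV /wtz [q]q1 -[1]mulr1 -(mulrV (fpsT_unit F)).
    by move: (fpsT F)^-1 (fpsT F) => t t'; qmono.
  by rewrite [q * _ * (_ * ph k)]mulrA e mul1r.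
have [N xN] := cz_fin x.
rewrite !(phiFE (N := N)) => [|k kN|k kN]; rewrite ?cz_K ?xN ?mulr0 ?mul0r //.
apply: eq_bigr => k _; rewrite !cz_K.
by move: (ph _) (cz _ _) (cz _ _) (wtz _ _) => *; ring.
Qed.

Lemma phiF_linjl x y : phiF (j x) y = 0.
Proof. by rewrite (phiFE (N := 0)) ?big_ord0 // => k _; rewrite cz_linjN mul0r. Qed.
Lemma phiF_linjr x y : phiF x (j y) = 0.
Proof. by rewrite (phiFE (N := 0)) ?big_ord0 // => k _; rewrite cz_linjN mulr0. Qed.
Lemma phiF_zz : phiF z z = phi x0 x0.
Proof.
rewrite (phiFE (N := 1)) => [|[|k] _] //; last by rewrite !cz_zz mul0r.
by rewrite big_ord_recl big_ord0 !cz_zz eqxx mulr1 addr0 mulr1.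
Qed.

(** Since [ez] vanishes only at 0, the singular vectors of M are the multiples of [x0]; so the
    normalization is only at stake for [l = 0], where it is [phiF_zz]. *)
Lemma phiF_lift : is_lift phi phiF.
Proof.
have pF := phiF_pairing.
split; [split| | |].
- by move=> *; rewrite (pair_linl pF).
- by move=> *; rewrite (pair_linr pF).
- by move=> u x y; rewrite (pair_act pF).
- exact: phiF_linjl.
- exact: phiF_linjr.
have hw (l : int) x x' : opK aB x = (fpsT F * q ^ (l - 1)) *: x -> opE aB x = 0 ->
    opF aL x' = j x ->
    [/\ x = (f x)`_0 *: x0, x' = (f x)`_0 *: z & l != 0 -> (f x)`_0 = 0].
  move=> Kx Ex Fx.
  have fx i : (f x)`_i.+1 = 0.
    have : (f (opE aB x))`_i = 0 by rewrite Ex (lin0 fl) coef0.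
    by rewrite fE coef_pE; apply: fps_regular; exact: ez_neq0.
  have x0E : x = (f x)`_0 *: x0.
    apply: f_inj => i; rewrite (linZ fl) coefZ (vl_f0 H) coef1.
    by case: i => [|i]; rewrite ?mulr1 // fx mulr0.
  split=> // [|l0].
    apply: (can_inj (vl_FK H)); rewrite Fx {1}x0E (linZ jl) (linZ (opF_lin aL)).
    by rewrite F_zz (_ : Negz 0 + 1 = 0).
  have : (f (opK aB x))`_0 = wtz v 0 * (f x)`_0 by rewrite fK coef_pK.
  rewrite Kx (linZ fl) coefZ => /eqP; rewrite -subr_eq0 -mulrBl => /eqP; apply: fps_regular.
  rewrite /wtz -mulrBr; apply: fps_mulf_neq0.
    by apply: contraTneq (fpsT_unit F) => ->; rewrite unitr0.
  have -> : q ^ (l - 1) - q ^ (- 1 - 2 * 0%N%:Z) = q ^ (-1) * (q ^ l - 1).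
    by rewrite mulrBr qD mulr1; congr (q ^ _ - q ^ _); lia.
  apply: fps_mulf_neq0; first by apply: contraTneq (qX_unit vR (- 1)) => ->; rewrite unitr0.
  rewrite qR; apply: contraNneq (qX_neq1 qn l0) => /eqP.
  rewrite subr_eq0 => /eqP/(congr1 (fun g => fcoef g 0)) /= ->.
  by [].
move=> l x y x' y' Kx Ky Ex Ey Fx Fy.
have [xE x'E xl] := hw l x x' Kx Ex Fx; have [yE y'E _] := hw l y y' Ky Ey Fy.
have [->|l0] := eqVneq l 0.
  rewrite expr0z mul1r; congr (_ * _); rewrite {1}xE {1}yE x'E y'E.
  rewrite !(pairZl pF) !(pairZr pF) !(pairZl pc) !(pairZr pc) phiF_zz.
  by [].
by rewrite xE x'E xl // !scale0r (pair0l pF) (pair0l pc) !mulr0.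
Qed.
End FormLift.
End Localization.

(** * Negative powers of F, singular vectors, uniqueness of lifts *)

Section InverseOfF.
Variables (S : comUnitRingType) (v : qparam S) (A : lmodType S) (a : uaction v A).
Local Notation q := (qv v).
Variable Fi : A -> A.
Hypotheses (FK : cancel (opF a) Fi) (KF : cancel Fi (opF a)).

Lemma inv_lin : linear Fi.
Proof. by move=> c x y; apply: (can_inj FK); rewrite (opF_lin a) !KF. Qed.

Lemma iter_inv_lin k : linear (iter k Fi).
Proof. by elim: k => [|k IH] c x y //=; rewrite IH inv_lin. Qed.

Lemma K_iterFi k x : opK a (iter k Fi x) = q ^ (2 * k)%:Z *: iter k Fi (opK a x).
Proof.
elim: k => [|k IH]; first by rewrite scale1r.
apply: (can_inj FK); rewrite -[opF a _]scale1r -(qNK v 2) -scalerA.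
rewrite -[q ^ (- 2) *: _]scale1r (linZ (opF_lin a)) !iterS KF.
rewrite scale1r -K_F KF IH scalerA qD; congr (q ^ _ *: _); lia.
Qed.
Lemma Ki_iterFi k x : opKi a (iter k Fi x) = q ^ (- (2 * k)%:Z) *: iter k Fi (opKi a x).
Proof.
have lF : linear (iter k Fi) by elim: (k) => [|i IH] c y z //=; rewrite IH inv_lin.
have := K_iterFi k (opKi a x); rewrite opKKi => /(congr1 (opKi a)); rewrite opKiK => ->.
by rewrite (linZ (opKi_lin a)) scalerA qKN scale1r.
Qed.

(** The commutator formula of E with F^n, continued to n = -k. *)
Lemma E_iterFi k x : opE a (iter k Fi x) = iter k Fi (opE a x) -
  qint v k *: iter k.+1 Fi ((q - q^-1)^-1 *: (q ^ k.+1%:Z *: opK a x - q ^ (- k.+1%:Z) *: opKi a x)).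
Proof.
have lF i : linear (iter i Fi) by elim: (i) => [|i' IH] c y z //=; rewrite IH inv_lin.
elim: k => [|k IH]; first by rewrite qint0 scale0r subr0.
have e : opF a (opE a (iter k.+1 Fi x)) = opE a (iter k Fi x) -
    (q - q^-1)^-1 *: (opK a (iter k.+1 Fi x) - opKi a (iter k.+1 Fi x)).
  by rewrite -[iter k Fi x]KF E_F addrK.
apply: (can_inj FK); rewrite e IH (linB (opF_lin a)) (linZ (opF_lin a)) !iterS !KF.
rewrite -!iterS -addrA -opprD; congr (_ - _).
rewrite K_iterFi Ki_iterFi !(linZ (lF _)) !(linB (lF _)) !(linZ (lF _)).
move: (iter k.+1 Fi (opK a x)) (iter k.+1 Fi (opKi a x)) => X Y.
rewrite !scalerBr !scalerA addrACA -scalerDl -opprD -scalerDl; congr (_ *: _ - _ *: _).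
  rewrite (qintS' v k); move: (_^-1) (qint v k) => h x1.
  by rewrite !mulrDl; congr (_ + _); qmono.
rewrite (qintS v k); move: (_^-1) (qint v k) => h x1.
by rewrite !mulrDl; congr (_ + _); qmono.
Qed.
End InverseOfF.

Section HighestWeightVector.
Variables (F : fieldType) (v : qparam F).
Local Notation vR := (qparamR v).
Local Notation R := (fps F).
Local Notation T := (fpsT F).
Local Notation q := (qv vR).
Hypothesis qn : forall n, qint v n.+1 \is a GRing.unit.
Variables (A : lmodType R) (a : uaction vR A).
Local Notation qTl l := (T * q ^ l).

Lemma wtT_unit l : qTl l \is a GRing.unit.
Proof. by rewrite unitrM fpsT_unit qX_unit. Qed.
Lemma wtT_inv l : (qTl l)^-1 = T^-1 * q ^ (- l).
Proof. by rewrite invrM ?qX_unit ?fpsT_unit // invr_expz mulrC. Qed.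
Lemma wtT_br l k x : opK a x = qTl l *: x ->
  (q - q^-1)^-1 *: (q ^ k *: opK a x - q ^ (- k) *: opKi a x) = qT v (l + k) *: x.
Proof.
move=> Kx; rewrite (wt_Ki (wtT_unit l) Kx) Kx !scalerA -scalerBl scalerA qTE wtT_inv.
congr (_ * (_ - _) *: _); first by rewrite mulrCA qD mulrC addrC.
by rewrite mulrCA qD mulrC; congr (q ^ _ * _); lia.
Qed.

(** If E^(k+2) kills [w], then E^(k+1) kills [c w - F E w]; iterating gives a singular vector. All
    corrections lie in the image of F, and the factor of [w] stays nonzero, though it may fail to be
    a unit. *)
Lemma hw_exists k l w : opK a w = qTl l *: w -> act a (dE vR k.+1) w = 0 ->
  exists N b, [/\ N != 0, opE a (N *: w + opF a b) = 0 &
    opK a (N *: w + opF a b) = qTl l *: (N *: w + opF a b)].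
Proof.
have qRn := qnR qn; elim: k w => [|k IH] w Kw Ew.
  exists 1, 0; rewrite (lin0 (opF_lin a)) addr0 scale1r; split=> //.
    exact: oner_neq0.
  by have := E_dE a qRn 0 w; rewrite dEa0 Ew scaler0.
(* Because E^(k+2) w = 0, the operator E^(k+1) sends F E w to [c] times E^(k+1) w. *)
pose c := qint vR k.+1 * qT v (l + 2 + k%:Z).
have KE : opK a (opE a w) = qTl (l + 2) *: opE a w.
  by rewrite (wt_E Kw) mulrCA qD addrC.
have KFE : opK a (opF a (opE a w)) = qTl l *: opF a (opE a w).
  by rewrite (wt_F KE) mulrCA qD; congr (_ * q ^ _ *: _); lia.
pose w1 := c *: w - opF a (opE a w).
have Kw1 : opK a w1 = qTl l *: w1.
  by rewrite /w1 (linB (opK_lin a)) (linZ (opK_lin a)) KFE Kw scalerBr scalerC.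
have Ew1 : act a (dE vR k.+1) w1 = 0.
  rewrite /w1 (linB (act_lin a _)) (linZ (act_lin a _)) (dE_F _ qRn).
  have -> : act a (dE vR k.+1) (opE a w) = 0 by rewrite (dE_E _ qRn) Ew scaler0.
  rewrite (lin0 (opF_lin a)) add0r -(linZ (act_lin a (dE vR k))) (wtT_br _ KE).
  by rewrite (linZ (act_lin a _)) (dE_E _ qRn) scalerA /c mulrC subrr.
have [N [b [N0 EN KN]]] := IH w1 Kw1 Ew1.
have e : N *: w1 + opF a b = (N * c) *: w + opF a (b - N *: opE a w).
  by rewrite /w1 scalerBr scalerA (linB (opF_lin a)) (linZ (opF_lin a)) -addrA; congr (_ + _); exact: addrC.
exists (N * c), (b - N *: opE a w); rewrite -e; split=> //.
apply: fps_mulf_neq0 => //; apply: fps_mulf_neq0; last exact: qT_neq0.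
by apply: contraTneq (qRn k) => ->; rewrite unitr0.
Qed.
End HighestWeightVector.

Section LiftUniqueness.
Variables (F : fieldType) (v : qparam F).
Local Notation vR := (qparamR v).
Local Notation R := (fps F).
Local Notation T := (fpsT F).
Local Notation q := (qv vR).
Hypothesis qn : forall n, qint v n.+1 \is a GRing.unit.
Local Notation qTl l := (T * q ^ l).

(* [A_F] is spanned by the vectors F^i t_k (i in Z), and E t_k is a multiple of
   t_(k-1). *)
Record loc_span (X : locdata v) (Fi : lloc X -> lloc X) (t : nat -> lbase X)
    (lam : nat -> int) : Prop := LocSpan {
  ls_j : uhom (abase X) (aloc X) (@linj _ _ X);
  ls_FK : cancel (opF (aloc X)) Fi;
  ls_KF : cancel Fi (opF (aloc X));
  ls_mem : forall y, exists n x, iter n (opF (aloc X)) y = linj x;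
  ls_K : forall k, opK (abase X) (t k) = qTl (lam k) *: t k;
  ls_E0 : opE (abase X) (t 0%N) = 0;
  ls_ES : forall k, exists c, opE (abase X) (t k.+1) = c *: t k;
  ls_span : forall xi : lloc X -> R, linear (xi : _ -> R^o) ->
    (forall k i, xi (iter i (opF (aloc X)) (linj (t k))) = 0) ->
    (forall k i, xi (iter i Fi (linj (t k))) = 0) -> forall y, xi y = 0
}.

Section OneSide.
Variables (X : locdata v) (Fi : lloc X -> lloc X) (t : nat -> lbase X).
Variable lam : nat -> int.
Hypothesis H : loc_span Fi t lam.
Local Notation aB := (abase X).
Local Notation aL := (aloc X).
Local Notation j := (@linj _ _ X).

Lemma ls_jl : linear j. Proof. by case: (ls_j H). Qed.
Lemma ls_jE x : j (opE aB x) = opE aL (j x).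
Proof. by rewrite -!actE (ls_j H).2. Qed.
Lemma ls_jF x : j (opF aB x) = opF aL (j x).
Proof. by rewrite -!actF (ls_j H).2. Qed.
Lemma ls_jK x : j (opK aB x) = opK aL (j x).
Proof. by rewrite -!actK (ls_j H).2. Qed.

Lemma ls_iterF i x : iter i (opF aL) (j x) = j (iter i (opF aB) x).
Proof. by elim: i => // i IH; rewrite !iterS IH ls_jF. Qed.

Lemma ls_dE k : act aB (dE vR k.+1) (t k) = 0.
Proof.
have qRn := qnR qn; elim: k => [|k IH].
  by apply: (scalerI_unit (qRn 0%N)); rewrite -(dE_E _ qRn) dEa0 (ls_E0 H) scaler0.
have [c Et] := ls_ES H k.
apply: (scalerI_unit (qRn k.+1)).
by rewrite -(dE_E _ qRn) Et (linZ (act_lin aB _)) IH !scaler0.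
Qed.

(** Modulo F^-(i+1) E t_k, the vector E F^-(i+1) t_k is a nonzero multiple of F^-(i+2) t_k, and E
    t_k is a multiple of t_(k-1). So on negative powers of F, a functional killing the image of E is
    determined by its values at the F^-1 t_k. *)
Lemma ls_vanish (xi : lloc X -> R) : linear (xi : _ -> R^o) ->
  (forall x, xi (j x) = 0) -> (forall y, xi (opE aL y) = 0) ->
  (forall k, xi (Fi (j (t k))) = 0) -> forall y, xi y = 0.
Proof.
move=> lxi xij xiE xit; apply: (ls_span H lxi) => k i.
  by rewrite ls_iterF.
case: i => [|i]; first exact: xij.
elim: k i => [|k IH] [|i]; rewrite ?xit //.
all: have KF := ls_KF H; have FK := ls_FK H; have lF := iter_inv_lin FK KF.
all: have key l : xi (iter i.+1 Fi (opE aL (j (t l)))) = 0 ->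
  xi (iter i.+2 Fi (j (t l))) = 0 by
  [move=> e; have := xiE (iter i.+1 Fi (j (t l))); rewrite (E_iterFi FK KF);
   rewrite (linB lxi) e sub0r (linZ lxi) (wtT_br (l := lam l));
   [rewrite (linZ (lF _)) (linZ lxi) => /eqP; rewrite oppr_eq0 => /eqP e2;
    apply: (fps_regular (qT_neq0 qn (lam l + i.+2%:Z)));
    apply: (mulrI (qnR qn i)); rewrite mulr0
   |rewrite -ls_jK (ls_K H) (linZ ls_jl)]].
  by apply: key; rewrite -ls_jE (ls_E0 H) (lin0 ls_jl) (lin0 (lF _)) (lin0 lxi).
have [c Et] := ls_ES H k; apply: key; rewrite -ls_jE Et (linZ ls_jl) (linZ (lF _)).
by rewrite (linZ lxi) IH scaler0.
Qed.
End OneSide.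

Variables (X Y : locdata v) (Fx : lloc X -> lloc X) (Fy : lloc Y -> lloc Y).
Variables (t : nat -> lbase X) (u : nat -> lbase Y) (lam mu : nat -> int).
Hypotheses (HX : loc_span Fx t lam) (HY : loc_span Fy u mu).

Lemma invariant_is_pairing (A B : lmodType R) (a : uaction vR A) (b : uaction vR B)
  chi : invariant_pairing a b chi -> pairing a b chi.
Proof.
have [vE vF vK vKi] := varrho_gens vR.
case=> cl cr ci; have crZ x c y : chi x (c *: y) = c * chi x y.
  exact: (linZ ((cr^~ x) : linear (chi x : _ -> R^o))).
split=> // x y.
- by rewrite -actE ci vE actZ actM actK actF crZ.
- by rewrite -actF ci vF actZ actM actKi actE crZ.
- by rewrite -actK ci vK actK.
Qed.

(** The difference D of two lifts is invariant, vanishes when one argument comes from the base, and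
    vanishes on F^-1 of singular vectors by the normalization. [hw_exists] makes t_k singular modulo
    the image of F, which gives D = 0 on the F^-1 t_k; [ls_vanish] propagates this in the second
    argument, then in the first. *)
Lemma lift_uniq (chi : lbase X -> lbase Y -> R) L1 L2 :
  is_lift chi L1 -> is_lift chi L2 -> L1 = L2.
Proof.
case=> i1 l1 r1 n1 [i2 l2 r2 n2].
have p1 := invariant_is_pairing i1; have p2 := invariant_is_pairing i2.
pose D x y := L1 x y - L2 x y.
have Dl y : linear (D^~ y : _ -> R^o).
  by move=> c x x'; rewrite /D (pair_linl p1) (pair_linl p2) scalerBr opprD addrACA.
have Dr x : linear (D x : _ -> R^o).
  by move=> c y y'; rewrite /D (pair_linr p1) (pair_linr p2) scalerBr opprD addrACA.
have DE x y : D (opE (aloc X) x) y = q * D x (opK (aloc Y) (opF (aloc Y) y)).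
  by rewrite /D (pairE p1) (pairE p2) mulrBr.
have DEr x y : D x (opE (aloc Y) y) = q ^ (- 1) * D (opF (aloc X) (opK (aloc X) x)) y.
  by rewrite /D (pairEr p1) (pairEr p2) mulrBr.
have DK x y : D (opK (aloc X) x) y = D x (opK (aloc Y) y).
  by rewrite /D (pairK p1) (pairK p2).
have Djl x y : D (linj x) y = 0 by rewrite /D l1 l2 subrr.
have Djr x y : D x (linj y) = 0 by rewrite /D r1 r2 subrr.
have KFt (Z : locdata v) Fz w nu (HZ : @loc_span Z Fz w nu) k :
    opK (aloc Z) (Fz (linj (w k))) = qTl (nu k + 2) *: Fz (linj (w k)).
  have -> : opK (aloc Z) (Fz (linj (w k))) =
      q ^ (2 * 1)%:Z *: Fz (opK (aloc Z) (linj (w k))).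
    exact: (K_iterFi (ls_FK HZ) (ls_KF HZ) 1 (linj (w k))).
  rewrite -(ls_jK HZ) (ls_K HZ) (linZ (ls_jl HZ)).
  rewrite (linZ (inv_lin (ls_FK HZ) (ls_KF HZ))) scalerA mulrCA qD.
  by congr (_ * q ^ _ *: _); lia.
have Dt k l : D (Fx (linj (t k))) (Fy (linj (u l))) = 0.
  (* Vectors of different weights are orthogonal, by invariance under K. *)
  have [e|ne] := eqVneq (lam k) (mu l); last first.
    have := DK (Fx (linj (t k))) (Fy (linj (u l))).
    rewrite (KFt _ _ _ _ HX) (KFt _ _ _ _ HY) (linZ (Dl _)) (linZ (Dr _)) => /eqP.
    rewrite -subr_eq0 -mulrBl => /eqP; apply: fps_regular; rewrite -mulrBr.
    apply: fps_mulf_neq0; first by apply: contraTneq (fpsT_unit F) => ->; rewrite unitr0.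
    have -> : q ^ (lam k + 2) - q ^ (mu l + 2) = q ^ (mu l + 2) * (q ^ (lam k - mu l) - 1).
      by rewrite mulrBr qD mulr1; congr (q ^ _ - _); lia.
    apply: fps_mulf_neq0.
      by apply: contraTneq (qX_unit vR (mu l + 2)) => ->; rewrite unitr0.
    rewrite qR; have z0 : lam k - mu l != 0 by rewrite subr_eq0.
    apply: contraNneq (qX_neq1 qn z0) => /eqP.
    by rewrite subr_eq0 => /eqP/(congr1 (fun g => fcoef g 0)) /= ->.
  have [N [b [N0 EN KN]]] := hw_exists qn (ls_K HX k) (ls_dE HX k).
  have [N' [b' [N0' EN' KN']]] := hw_exists qn (ls_K HY l) (ls_dE HY l).
  have FFi (Z : locdata v) Fz w nu (HZ : @loc_span Z Fz w nu) i c y :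
      opF (aloc Z) (c *: Fz (linj (w i)) + linj y) =
      linj (c *: w i + opF (abase Z) y).
    by rewrite (opF_lin (aloc Z)) (ls_KF HZ) (ls_jl HZ) (ls_jF HZ).
  have e1 : lam k = (lam k + 1) - 1 by rewrite addrK.
  rewrite -e e1 in KN'; rewrite e1 in KN.
  have a1 := n1 _ _ _ _ _ KN KN' EN EN' (FFi _ _ _ _ HX k N b) (FFi _ _ _ _ HY l N' b').
  have a2 := n2 _ _ _ _ _ KN KN' EN EN' (FFi _ _ _ _ HX k N b) (FFi _ _ _ _ HY l N' b').
  have : qT v (lam k + 1) * D (N *: Fx (linj (t k)) + linj b)
      (N' *: Fy (linj (u l)) + linj b') = 0.
    by rewrite /D mulrBr a1 a2 subrr.
  move=> /(fps_regular (qT_neq0 qn _)); rewrite Dl Djl (Dr _) Djr !addr0.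
  by move=> /(fps_regular N0)/(fps_regular N0').
have Dxt k y : D (Fx (linj (t k))) y = 0.
  move: y; apply: (ls_vanish HY (Dr _)) => [y|y|l]; rewrite ?Djr ?Dt //.
  rewrite DEr (KFt _ _ _ _ HX) (linZ (opF_lin (aloc X))) (ls_KF HX).
  by rewrite -(linZ (ls_jl HX)) Djl mulr0.
have D0 x y : D x y = 0.
  (* Induction on the power of F that pushes [y] into the base: invariance turns E in the first
     argument into K F in the second, where F y needs one power fewer. *)
  have [n [y' yn]] := ls_mem HY y; elim: n y yn x => [|n IH] y yn.
    by move=> x; rewrite (yn : y = linj y') Djr.
  apply: (ls_vanish HX (Dl y)) => [x|x|k]; rewrite ?Djl ?Dxt //.
  rewrite DE -DK IH ?mulr0 //.
  by rewrite -iterSr.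
apply/funext => x; apply/funext => y; apply/eqP.
by rewrite -subr_eq0; apply/eqP; exact: D0.
Qed.

Lemma lift_eq (chi : lbase X -> lbase Y -> R) L : is_lift chi L -> Defs.lift chi = L.
Proof.
move=> hL; rewrite /Defs.lift; case: xgetP => [L' _ hL'|/(_ L) []//].
exact: lift_uniq hL' hL.
Qed.

Lemma chi_piE (chi : lbase X -> lbase Y -> R) L x y : is_lift chi L ->
  (forall x', lproj x' = 0 :> lquo X -> exists z, x' = linj z) ->
  (forall y', lproj y' = 0 :> lquo Y -> exists z, y' = linj z) ->
  linear (@lproj _ _ X) -> linear (@lproj _ _ Y) ->
  chi_pi chi (lproj x) (lproj y) = L x y.
Proof.
move=> hL kX kY lX lY; rewrite /chi_pi (lift_eq hL).
case: xgetP => [r _ [x' [y' [ex ey ->]]]|]; last first.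
  by move=> /(_ (L x y)) []; exists x, y.
case: hL => hi hl hr _; have p := invariant_is_pairing hi.
have [|w ew] := kX (x' - x); first by rewrite (linB lX) ex subrr.
have [|w' ew'] := kY (y' - y); first by rewrite (linB lY) ey subrr.
rewrite -[x'](subrK x) -[y'](subrK y) ew ew' (pairDl p) hl add0r (pairDr p) hr.
by rewrite add0r.
Qed.
End LiftUniqueness.

(** * The localization of M (x) F_n *)

Section TensorLocalization.
Variables (S : comUnitRingType) (v : qparam S).
Local Notation q := (qv v).
Hypothesis qn : forall n, qint v n.+1 \is a GRing.unit.
Variables (A : lmodType S) (a : uaction v A) (Fi : A -> A) (n : nat).
Hypotheses (FK : cancel (opF a) Fi) (KF : cancel Fi (opF a)).
Local Notation En := (Fmod v n).
Local Notation Fe := (opF En).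
Local Notation Ke := (opK En).
Local Notation tF := (opF (tens a En)).

Let lFi k : linear (iter k Fi).
Proof. by elim: k => [|k IH] c x y //=; rewrite IH (inv_lin FK KF). Qed.

Lemma F_iterK k e : Fe (iter k Ke e) = q ^ (2 * k)%:Z *: iter k Ke (Fe e).
Proof.
elim: k => [|k IH]; first by rewrite scale1r.
apply: (scalerI_unit (qX_unit v (- 2))); rewrite !iterS -K_F IH (linZ (opK_lin En)).
by rewrite scalerA qD; congr (q ^ _ *: _); lia.
Qed.
Lemma Ki_iterF k e : opKi En (iter k Fe e) = q ^ (2 * k)%:Z *: iter k Fe (opKi En e).
Proof.
elim: k => [|k IH]; first by rewrite scale1r.
by rewrite !iterS Ki_F IH (linZ (opF_lin En)) scalerA qD; congr (q ^ _ *: _); lia.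
Qed.
Lemma iterF_nil e : iter n.+1 Fe e = 0.
Proof.
rewrite (iter_F _ qn); elim/cV_ind: e => [x y ex ey||c k kn].
- by rewrite (linD (act_lin _ _)) scalerDr ex ey addr0.
- by rewrite (lin0 (act_lin _ _)) scaler0.
by rewrite (linZ (act_lin _ _)) act_dF_u // ubas_gt ?scaler0 // addnS ltnS leq_addl.
Qed.

Definition KF_pow k e := iter k.+1 Ke (iter k Fe e).
Lemma KF_pow_lin k : linear (KF_pow k).
Proof.
have lF i : linear (iter i Fe) by elim: i => [|i IH] c x y //=; rewrite IH (opF_lin En).
have lK i : linear (iter i Ke) by elim: i => [|i IH] c x y //=; rewrite IH (opK_lin En).
by move=> c x y; rewrite /KF_pow lF lK.
Qed.

(* The inverse of [F (x) K^-1 + 1 (x) F], as a geometric series. *)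
Definition tFinv (w : {ffun 'I_n.+1 -> A}) : {ffun 'I_n.+1 -> A} :=
  \sum_(k < n.+1) ((-1) ^+ k * q ^ (k%:Z * (k%:Z + 1))) *:
    tmap (iter k.+1 Fi) (KF_pow k) w.

Lemma tFinv_lin : linear tFinv.
Proof.
apply: lin_bigsum => k; apply: lin_scale; apply: tmap_lin; exact: lFi.
Qed.
Lemma tFinv_pure x e : tFinv (tpure x e) =
  \sum_(k < n.+1) ((-1) ^+ k * q ^ (k%:Z * (k%:Z + 1))) *:
    tpure (iter k.+1 Fi x) (KF_pow k e).
Proof.
by apply: eq_bigr => k _; rewrite tmap_pure //; exact: KF_pow_lin.
Qed.

Let telescope (f : nat -> {ffun 'I_n.+1 -> A}) : f n.+1 = 0 ->
  \sum_(k < n.+1) (f k - f k.+1) = f 0%N.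
Proof.
move=> fn; transitivity (- (f n.+1 - f 0%N)); last by rewrite fn sub0r opprK.
rewrite -(telescope_sumr f (leq0n n.+1)) -sumrN big_mkord.
by apply: eq_bigr => k _; rewrite opprB.
Qed.

Lemma tFinvK : cancel tFinv tF.
Proof.
apply: tens_ext => //; first exact: lin_comp (opF_lin _) tFinv_lin.
move=> x e; rewrite tFinv_pure (lin_sum (opF_lin _)).
pose f k := ((-1) ^+ k * q ^ (k%:Z * (k%:Z + 1))) *: tpure (iter k Fi x) (iter k Ke (iter k Fe e)).
rewrite -[RHS]/(tpure (iter 0 Fi x) (iter 0 Ke (iter 0 Fe e))) -[RHS]scale1r.
have -> : 1 *: tpure (iter 0 Fi x) (iter 0 Ke (iter 0 Fe e)) = f 0%N.
  by rewrite /f mulr1.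
have lK i : linear (iter i Ke) by elim: i => [|i IH] c ? ? //=; rewrite IH (opK_lin En).
rewrite -telescope; last by rewrite /f iterF_nil (lin0 (lK _)) tpure0r scaler0.
apply: eq_bigr => k _; rewrite (linZ (opF_lin _)) tensF_pure iterS KF.
rewrite /KF_pow F_iterK [iter k.+1 Ke (iter k Fe e)]iterS opKiK tpureZr scalerDr; congr (_ + _).
rewrite scalerA /f -scaleNr -iterS; congr (_ *: _); rewrite exprS mulN1r mulNr opprK.
by move: ((-1) ^+ k) => s; qmono.
Qed.

Lemma tF_K : cancel tF tFinv.
Proof.
apply: tens_ext => //; first exact: lin_comp tFinv_lin (opF_lin _).
move=> x e; rewrite tensF_pure (linD tFinv_lin) !tFinv_pure -big_split.
pose f k := ((-1) ^+ k * q ^ (k%:Z * (k%:Z - 1))) *: tpure (iter k Fi x) (iter k Ke (iter k Fe e)).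
rewrite -[RHS]/(tpure (iter 0 Fi x) (iter 0 Ke (iter 0 Fe e))) -[RHS]scale1r.
have -> : 1 *: tpure (iter 0 Fi x) (iter 0 Ke (iter 0 Fe e)) = f 0%N.
  by rewrite /f mulr1.
have lK i : linear (iter i Ke) by elim: i => [|i IH] c ? ? //=; rewrite IH (opK_lin En).
rewrite -telescope; last by rewrite /f iterF_nil (lin0 (lK _)) tpure0r scaler0.
apply: eq_bigr => k _ /=; congr (_ + _).
  have -> : KF_pow k (opKi En e) = q ^ (- (2 * k)%:Z) *: iter k Ke (iter k Fe e).
    apply: (scalerI_unit (qX_unit v (2 * k)%:Z)); rewrite scalerA qNK scale1r.
    by rewrite /KF_pow -(linZ (lK _)) -Ki_iterF iterSr opKKi.
  rewrite -iterS iterSr FK tpureZr scalerA; congr (_ *: _).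
  by move: ((-1) ^+ k) => s; qmono.
rewrite /f -scaleNr -iterS /KF_pow -iterSr; congr (_ *: _).
by rewrite exprS mulN1r mulNr opprK; congr (_ * q ^ _); lia.
Qed.
End TensorLocalization.

Section LocSpanInstances.
Variables (F : fieldType) (v : qparam F).
Local Notation vR := (qparamR v).
Local Notation R := (fps F).
Local Notation T := (fpsT F).
Local Notation q := (qv vR).
Hypothesis qn : forall n, qint v n.+1 \is a GRing.unit.
Variables (M : locdata v) (x0 : lbase M) (f : lbase M -> {poly R}).
Variable Fi : lloc M -> lloc M.
Hypothesis H : verma_loc x0 f Fi.
Local Notation aB := (abase M).
Local Notation aL := (aloc M).
Local Notation j := (@linj _ _ M).

Let KF := vl_KF H.
Let FK := vl_FK H.
Let jl := linj_lin H.

Lemma wtz0 : wtz v 0 = T * q ^ (- 1).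
Proof. by rewrite /wtz mulr0 subr0. Qed.

Lemma loc_span_verma :
  loc_span Fi (fun k => if k is 0 then x0 else 0) (fun=> -1).
Proof.
split; rewrite ?(vl_j H) //; try by case: H.
- by case=> [|k]; rewrite ?(vl_K0 H) ?wtz0 // (lin0 (opK_lin aB)) scaler0.
- by move=> k; exists 0; rewrite (lin0 (opE_lin aB)) scale0r.
move=> xi lxi xF xFi y; have [N [x ->]] := zz_span H y.
rewrite (linD lxi) {1}[x](vl_sum H) (lin_sum jl) !(lin_sum lxi) !big1 ?addr0 //.
  by move=> i _; rewrite (linZ lxi) (xFi 0%N i.+1) scaler0.
by move=> i _; rewrite (linZ jl) (linZ lxi) (linjF_iter H) (xF 0%N i) scaler0.
Qed.

Variable n : nat.
Local Notation X := (tens_loc M n).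
Local Notation En := (Fmod vR n).
Local Notation u k := (@ubas R n k).
Local Notation jt := (@linj _ _ X).
Local Notation tF := (opF (aloc X)).
Local Notation Gi := (@tFinv R vR (lloc M) Fi n).

Let qRn := qnR qn.

Lemma jt_lin : linear jt.
Proof. by move=> c x y; apply/ffunP => i; rewrite !ffunE jl. Qed.
Lemma jt_pure x e : jt (tpure x e) = tpure (j x) e.
Proof. by apply/ffunP => i; rewrite !ffunE (linZ jl). Qed.

Lemma jt_uhom : uhom (abase X) (aloc X) jt.
Proof.
apply: uhom_gen; first exact: jt_lin.
- apply: tens_ext; [exact: lin_comp jt_lin (opE_lin _)|exact: lin_comp (opE_lin _) jt_lin|].
  by move=> x e; rewrite tensE_pure (linD jt_lin) !jt_pure tensE_pure (linjE H) (linjK H).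
- apply: tens_ext; [exact: lin_comp jt_lin (opF_lin _)|exact: lin_comp (opF_lin _) jt_lin|].
  by move=> x e; rewrite tensF_pure (linD jt_lin) !jt_pure tensF_pure (linjF H).
apply: tens_ext; [exact: lin_comp jt_lin (opK_lin _)|exact: lin_comp (opK_lin _) jt_lin|].
by move=> x e; rewrite tensK_pure !jt_pure tensK_pure (linjK H).
Qed.

(** The x0 (x) u_k generate the localization under F and its inverse: F (y (x) u_k) is a unit
    multiple of F y (x) u_k plus a multiple of y (x) u_(k+1), so descending induction on [k] reaches
    every [y]. *)
Lemma tloc_ind (P : {ffun 'I_n.+1 -> lloc M} -> Prop) :
  (forall x y, P x -> P y -> P (x + y)) -> (forall c x, P x -> P (c *: x)) ->
  (forall k, P (tpure (j x0) (u k))) -> (forall w, P w -> P (tF w)) ->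
  (forall w, P (tF w) -> P w) -> forall w, P w.
Proof.
move=> PD PZ Pt PF PF'.
have P0 : P 0 by rewrite -(scale0r (tpure (j x0) (u 0%N))); apply/PZ/Pt.
have PN x : P x -> P (- x) by move=> Px; rewrite -scaleN1r; apply: PZ.
have Psum (I : Type) (r : seq I) (Q : pred I) (g : I -> _) :
    (forall i, P (g i)) -> P (\sum_(i <- r | Q i) g i).
  by move=> Pg; elim/big_ind: _.
have Fu y k : tF (tpure y (u k)) =
    q ^ ((2 * k)%:Z - n%:Z) *: tpure (opF aL y) (u k) + qint vR k.+1 *: tpure y (u k.+1).
  by rewrite tensF_pure opKiu opFu !tpureZr.
have key d k y : (n < k + d)%N -> P (tpure y (u k)).
  elim: d k y => [|d IH] k y nk.
    by rewrite ubas_gt ?tpure0r // -[k]addn0.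
  have IH' y' : P (tpure y' (u k.+1)) by apply: IH; rewrite addSnnS.
  have up y' : P (tpure y' (u k)) -> P (tpure (opF aL y') (u k)).
    move=> Py; have <- : q ^ (n%:Z - (2 * k)%:Z) *: (tF (tpure y' (u k)) -
        qint vR k.+1 *: tpure y' (u k.+1)) = tpure (opF aL y') (u k).
      rewrite Fu addrK scalerA qD (_ : _ + _ = 0) ?scale1r //; lia.
    by apply/PZ/PD; [exact: PF|apply/PN/PZ].
  have Pj x : P (tpure (j x) (u k)).
    rewrite [x](vl_sum H) (lin_sum jl) (lin_sum (tpure_linl _)); apply: Psum => i.
    rewrite (linZ jl) tpureZl; apply: PZ; rewrite (linjF_iter H).
    by elim: (nat_of_ord i) => [|l Pl]; [exact: Pt | rewrite iterS; exact: up].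
  have [N [x yx]] := vl_mem H y; elim: N y yx => [|N IHN] y yx.
    by rewrite (yx : y = j x).
  apply: PF'; rewrite Fu; apply: PD; apply: PZ => //.
  by apply: IHN; rewrite -iterSr.
apply: tens_ind => // y e; rewrite (cV_sum e) (lin_sum (tpure_linr _)).
by apply: Psum => i; rewrite tpureZr -ubas_delta; apply/PZ/(key n.+1); rewrite addnS ltnS leq_addl.
Qed.

Lemma loc_span_tens : loc_span (X := X) Gi (fun k => tpure x0 (u k))
  (fun k => n%:Z - (2 * k)%:Z - 1).
Proof.
have tFK := tF_K qRn FK KF (n := n); have tKF := tFinvK qRn FK KF (n := n).
split=> //.
- exact: jt_uhom.
- apply: tloc_ind => [x y [a [x' ex]] [b [y' ey]]|c x [a [x' ex]]|k|w [a [x' ex]]|w [a [x' ex]]].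
  + have lF i : linear (iter i tF) by elim: i => [|i IH] c ? ? //=; rewrite IH (opF_lin _).
    have jF i w : jt (iter i (opF (abase X)) w) = iter i tF (jt w).
      by elim: i => // i IH; rewrite !iterS -IH -actF jt_uhom.2 actF.
    exists (a + b)%N, (iter b (opF (abase X)) x' + iter a (opF (abase X)) y').
    rewrite (linD (lF _)) (linD jt_lin) !jF -ex -ey.
    by rewrite -!iterD [in iter (b + a) _ _]addnC.
  + have lF i : linear (iter i tF) by elim: i => [|i IH] d ? ? //=; rewrite IH (opF_lin _).
    by exists a, (c *: x'); rewrite (linZ (lF _)) ex (linZ jt_lin).
  + by exists 0%N, (tpure x0 (u k)); rewrite jt_pure.
  + exists a, (opF (abase X) x'); rewrite -iterSr iterS ex -actF.
    by rewrite -[in RHS]actF jt_uhom.2.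
  by exists a.+1, x'; rewrite iterSr.
- move=> k; rewrite tensK_pure (vl_K0 H) opKu tpureZl tpureZr scalerA wtz0.
  by rewrite -mulrA qD; congr (_ * q ^ _ *: _); lia.
- by rewrite tensE_pure (vl_E0 H) tpure0l opE0 tpure0r addr0.
- move=> k; rewrite tensE_pure (vl_E0 H) tpure0l add0r (vl_K0 H) tpureZl.
  have [kn|nk] := ltnP k n; last first.
    by exists 0; rewrite (@ubas_gt _ n k.+1) // (lin0 (opE_lin _)) tpure0r scaler0 scale0r.
  by exists (wtz v 0 * qint vR (n - k)); rewrite opES // tpureZr scalerA.
move=> xi lxi xF xFi y.
suff [_ /(_ 0%N)] : (forall i, xi (iter i tF y) = 0) /\ (forall i, xi (iter i Gi y) = 0) by [].
move: y; apply: tloc_ind => [x y [x1 x2] [y1 y2]|c x [x1 x2]|k|w [w1 w2]|w [w1 w2]].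
- have lF i : linear (iter i tF) by elim: i => [|i IH] c ? ? //=; rewrite IH (opF_lin _).
  have lG i : linear (iter i Gi) by elim: i => [|i IH] c ? ? //=; rewrite IH (tFinv_lin FK KF).
  by split=> i; rewrite ?(linD (lF _)) ?(linD (lG _)) (linD lxi) ?x1 ?x2 ?y1 ?y2 addr0.
- have lF i : linear (iter i tF) by elim: i => [|i IH] d ? ? //=; rewrite IH (opF_lin _).
  have lG i : linear (iter i Gi) by elim: i => [|i IH] d ? ? //=; rewrite IH (tFinv_lin FK KF).
  by split=> i; rewrite ?(linZ (lF _)) ?(linZ (lG _)) (linZ lxi) ?x1 ?x2 scaler0.
- by rewrite -jt_pure; split=> i; [exact: xF|exact: xFi].
- split=> [i|[|i]]; first by rewrite -iterSr.
    exact: (w1 1%N).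
  by rewrite iterSr tFK.
split=> [[|i]|i]; last by have := w2 i.+1; rewrite iterSr tFK.
  by have := w2 1%N; rewrite /= tFK.
by rewrite iterSr.
Qed.
End LocSpanInstances.

(** * The lift of chi_{beta,phi} *)

Section LiftOperator.
Variables (S : comUnitRingType) (v : qparam S).
Local Notation q := (qv v).
Local Notation h := ((q - q^-1)^-1).
Hypothesis qn : forall n, qint v n.+1 \is a GRing.unit.
Variables (A : lmodType S) (a : uaction v A) (Fi : A -> A) (n : nat).
Hypotheses (FK : cancel (opF a) Fi) (KF : cancel Fi (opF a)).
Local Notation En := (Fmod v n).
Local Notation Fe := (opF En).
Local Notation Ke := (opK En).
Local Notation tE := (opE (tens a En)).

(** The operator [K; k]; on a vector of weight T v^l it is multiplication by [T; l + k], see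
    [wtT_br]. *)
Definition qbr k (B : lmodType S) (b : uaction v B) (x : B) : B :=
  h *: (q ^ k *: opK b x - q ^ (- k) *: opKi b x).

Lemma qbr_lin k (B : lmodType S) (b : uaction v B) : linear (qbr k b).
Proof.
apply: lin_scale => c x y; rewrite (opK_lin b) (opKi_lin b) !scalerDr opprD addrACA.
by rewrite scalerN; congr (_ - _ + _); exact: scalerC.
Qed.

Let lFi k : linear (iter k Fi). Proof. exact: iter_inv_lin FK KF k. Qed.
Let lFe i : linear (iter i Fe).
Proof. by elim: i => [|i IH] c x y //=; rewrite IH (opF_lin En). Qed.
Let lKe i : linear (iter i Ke).
Proof. by elim: i => [|i IH] c x y //=; rewrite IH (opK_lin En). Qed.

Lemma E_iterK k e : opE En (iter k Ke e) = q ^ (- (2 * k)%:Z) *: iter k Ke (opE En e).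
Proof.
elim: k => [|k IH]; first by rewrite scale1r.
apply: (scalerI_unit (qX_unit v 2)); rewrite !iterS -K_E IH (linZ (opK_lin En)).
by rewrite scalerA qD; congr (q ^ _ *: _); lia.
Qed.
Lemma E_iterF k e : opE En (iter k.+1 Fe e) = iter k.+1 Fe (opE En e) +
  qint v k.+1 *: iter k Fe (qbr (- k%:Z) En e).
Proof.
rewrite !(iter_F _ qn) (linZ (opE_lin En)) (E_dF _ qn) scalerDr; congr (_ + _).
rewrite /qbr !(linZ (act_lin En _)) !scalerA opprK; congr (_ *: _).
by rewrite qfactS; move: h (qfact v k) (qint v k.+1) => *; ring.
Qed.
Lemma KF_pow_Ki k e : iter k Ke (iter k Fe e) = q ^ (2 * k)%:Z *: KF_pow v k (opKi En e).
Proof. by rewrite /KF_pow -(linZ (lKe _)) -Ki_iterF iterSr opKKi. Qed.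

Let gm k : S := - ((-1) ^+ k * q ^ (k%:Z * k%:Z)).

(** It has the shape of a q-logarithm of 1 + F^-1 (x) K F, that is, formally, of the difference
    between log F on the tensor product and log F on A. *)
Definition liftop (w : {ffun 'I_n.+1 -> A}) : {ffun 'I_n.+1 -> A} :=
  \sum_(i < n.+1) (gm i.+1 * (qint v i.+1)^-1) *:
    tmap (iter i.+1 Fi) (fun e => iter i.+1 Ke (iter i.+1 Fe e)) w.

Lemma liftop_lin : linear liftop.
Proof. apply: lin_bigsum => k; apply: lin_scale; apply: tmap_lin; exact: lFi. Qed.

Let lKK i : linear (fun e => iter i Ke (iter i Fe e)).
Proof. exact: lin_comp (lKe i) (lFe i). Qed.

(** Formally the commutator of E with log F is F^-1 [K; 1]; the identity compares this on the tensor
    product with the same on A. In the series, contributions of consecutive indices regroup into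
    [tFinv]. *)
Lemma liftop_E w : tE (liftop w) - liftop (tE w) + tmap (fun y => Fi (qbr 1 a y)) id w =
  tFinv v Fi (qbr 1 (tens a En) w).
Proof.
have lB : linear (fun y => Fi (qbr 1 a y)).
  exact: lin_comp (inv_lin FK KF) (qbr_lin 1 a).
have lid : linear (id : 'cV[S]_n.+1 -> _) by [].
move: w; apply: tens_ext.
- apply: lin_add; last exact: tmap_lin.
  apply: lin_add; first exact: lin_comp (opE_lin _) liftop_lin.
  exact: lin_opp (lin_comp liftop_lin (opE_lin _)).
- exact: lin_comp (tFinv_lin FK KF) (qbr_lin 1 _).
move=> x e; rewrite tmap_pure // tensE_pure (linD liftop_lin).
have lp x' e' : liftop (tpure x' e') = \sum_(i < n.+1) (gm i.+1 * (qint v i.+1)^-1) *: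
    tpure (iter i.+1 Fi x') (iter i.+1 Ke (iter i.+1 Fe e')).
  by apply: eq_bigr => i _; rewrite tmap_pure.
pose At i := - (gm i *: tpure (iter i.+1 Fi (qbr i.+1%:Z a x)) (iter i Ke (iter i Fe e))).
pose Bt i := gm i.+1 *: tpure (iter i.+1 Fi (opK a x))
  (iter i.+1 Ke (iter i Fe (qbr (- i%:Z) En e))).
transitivity (\sum_(i < n.+1) (At i.+1 + Bt i) + At 0%N).
  congr (_ + _); last first.
    by rewrite /At /gm mul1r /= -scaleNr opprK mulr0 expr0z scale1r.
  rewrite !lp -big_split (lin_sum (opE_lin _)) -sumrB; apply: eq_bigr => i _.
  rewrite (linZ (opE_lin _)) tensE_pure /= -scalerDr -scalerBr -!iterS.
  rewrite (E_iterFi FK KF) (K_iterFi FK KF) E_iterK E_iterF.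
  rewrite tpureBl !tpureZl [tpure _ (q ^ _ *: _)]tpureZr scalerA qNK scale1r.
  rewrite (linD (lKe _)) (linZ (lKe _)) tpureDr tpureZr -/(qbr i.+2%:Z a x).
  set X1 := tpure _ _; set X2 := tpure _ _; set X3 := tpure _ _; set X4 := tpure _ _.
  have -> : X1 - qint v i.+1 *: X2 + (X3 + qint v i.+1 *: X4) - (X1 + X3) =
      qint v i.+1 *: (X4 - X2).
    rewrite scalerBr; move: (_ *: X4) (_ *: X2) => y4 y2.
    by rewrite addrACA [X in X - _]addrC addrK addrC.
  rewrite scalerA -mulrA mulVr ?qn // mulr1 /At /Bt scalerBr addrC.
  by [].
have An : At n.+1 = 0.
  by rewrite /At iterF_nil // (lin0 (lKe _)) tpure0r scaler0 oppr0.
transitivity (\sum_(i < n.+1) (At i + Bt i)).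
  rewrite !big_split /= addrAC; congr (_ + _).
  transitivity (\sum_(i < n.+2) At i); last by rewrite big_ord_recr /= An addr0.
  by rewrite [RHS]big_ord_recl addrC; congr (_ + _); apply: eq_bigr => i _; rewrite lift0.
have lG := @tFinv_lin _ v _ a Fi n FK KF; have pG := @tFinv_pure _ v _ a Fi n FK KF.
move: (tFinv v Fi) lG pG => G lG pG.
rewrite /qbr tensK_pure tensKi_pure (linZ lG) (linB lG) (linZ lG (q ^ 1)).
rewrite (linZ lG (q ^ (-1))) !pG.
rewrite [q ^ 1 *: _]scaler_sumr [q ^ (-1) *: _]scaler_sumr -sumrB [RHS]scaler_sumr.
apply: eq_bigr => -[i iN] _; rewrite /At /Bt /= -!iterS KF_pow_Ki.
have lp2 := @KF_pow_lin _ v n i.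
have -> : iter i.+1 Ke (iter i Fe (qbr (- i%:Z) En e)) =
    h *: (q ^ (- i%:Z) *: KF_pow v i (opK En e) - q ^ i%:Z *: KF_pow v i (opKi En e)).
  by rewrite -[LHS]/(KF_pow v i _) /qbr (linZ lp2) (linB lp2) !(linZ lp2) opprK.
rewrite /qbr !(linZ (lFi _)) (linB (lFi _)) !(linZ (lFi _)).
rewrite !tpureZl !tpureZr tpureBl tpureBr !tpureZl !tpureZr.
set X1 := tpure _ _; set X2 := tpure _ _; set X3 := tpure _ _.
have comb (B : lmodType S) (y1 y2 y3 : B) (c1 c2 c3 c4 c5 c6 : S) :
    c1 + c4 = 0 -> c2 = - c6 -> c3 = c5 ->
    - (c1 *: y1 - c2 *: y2) + (c3 *: y3 - c4 *: y1) = c5 *: y3 - c6 *: y2.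
  move=> /eqP; rewrite addr_eq0 => /eqP -> -> ->.
  by rewrite !scaleNr opprK opprD opprK addrC addrA subrK.
rewrite !scalerBr !scalerA; apply: comb; rewrite /gm ?exprS; move: ((-1) ^+ i) h => s c.
- rewrite mulN1r !mulNr opprK; apply/eqP; rewrite addrC subr_eq0; apply/eqP.
  by qmono.
- by rewrite !mulNr; congr (- _); qmono.
by rewrite mulN1r mulNr opprK; qmono.
Qed.
End LiftOperator.

Section BetaLift.
Variables (F : fieldType) (v : qparam F).
Local Notation vR := (qparamR v).
Local Notation R := (fps F).
Local Notation T := (fpsT F).
Local Notation q := (qv vR).
Local Notation h := ((q - q^-1)^-1).
Hypothesis qn : forall n, qint v n.+1 \is a GRing.unit.
Variables (M : locdata v) (x0 : lbase M) (f : lbase M -> {poly R}).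
Variable Fi : lloc M -> lloc M.
Hypothesis H : verma_loc x0 f Fi.
Local Notation aB := (abase M).
Local Notation aL := (aloc M).
Local Notation aQ := (aquo M).
Local Notation j := (@linj _ _ M).
Local Notation pr := (@lproj _ _ M).
Hypothesis hpr : uhom aL aQ pr.
Hypothesis pr_surj : forall z, exists y, pr y = z :> lquo M.
Hypothesis pr_ker : forall y : lloc M, pr y = 0 <-> exists x, y = j x.
Variable phi : lbase M -> lbase M -> R.
Hypothesis pc : pairing aB aB phi.
Local Notation z := (zz x0 Fi (Negz 0)).
Local Notation phF := (phiF x0 f phi).

Let KF := vl_KF H.
Let FK := vl_FK H.
Let jl := linj_lin H.
Let fl : linear f. Proof. by case: (vl_f H). Qed.
Let qRn := qnR qn.
Let prl : linear pr. Proof. by case: hpr. Qed.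
Let pF := phiF_pairing qn H phi.

Lemma prE y : pr (opE aL y) = opE aQ (pr y). Proof. by rewrite -!actE hpr.2. Qed.
Lemma prF y : pr (opF aL y) = opF aQ (pr y). Proof. by rewrite -!actF hpr.2. Qed.
Lemma prK y : pr (opK aL y) = opK aQ (pr y). Proof. by rewrite -!actK hpr.2. Qed.
Lemma prKi y : pr (opKi aL y) = opKi aQ (pr y). Proof. by rewrite -!actKi hpr.2. Qed.
Lemma pr_j x : pr (j x) = 0. Proof. by apply/pr_ker; exists x. Qed.

Lemma low_F : opF aQ (pr z) = 0.
Proof. by rewrite -prF (F_zz H) (_ : Negz 0 + 1 = 0) // (pr_j x0). Qed.
Lemma low_K : opK aQ (pr z) = (T * q) *: pr z.
Proof.
rewrite -prK (K_zz H) (linZ prl) /wtz (_ : - 1 - 2 * Negz 0 = 1) //.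
Qed.

Definition sec (p : lquo M) : lloc M := xget 0 [set y | pr y = p]%classic.
Lemma secK p : pr (sec p) = p.
Proof.
rewrite /sec; case: xgetP => // no.
by have [y yp] := pr_surj p; case: (no y).
Qed.
Definition phiQ (x : lloc M) (p : lquo M) : R := phF x (sec p).
Lemma phiQE x y : phiQ x (pr y) = phF x y.
Proof.
have /pr_ker[w e] : pr (sec (pr y) - y) = 0 by rewrite (linB prl) secK subrr.
by rewrite /phiQ -[sec _](subrK y) e (pairDr pF) (phiF_linjr H) add0r.
Qed.
Lemma phiQ_pairing : pairing aL aQ phiQ.
Proof.
split=> [p c x x'|x c p p'|x p|x p|x p].
- by rewrite /phiQ (pair_linl pF).
- rewrite -(secK p) -(secK p') -prl !phiQE (pair_linr pF) //.
- by rewrite -(secK p) -prF -prK !phiQE (pairE pF).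
- by rewrite -(secK p) -prE -prKi !phiQE (pairF pF).
by rewrite -(secK p) -prK !phiQE (pairK pF).
Qed.
Let pQ := phiQ_pairing.

(* An extension of A by A_pi for A = M, which is not split: E x0 = T z. *)
Local Notation N' := (lbase M * lquo M)%type.
Definition extE (w : N') : N' := (opE aB w.1, opE aQ w.2 + (T * (f w.1)`_0) *: pr z).
Definition extF (w : N') : N' := (opF aB w.1, opF aQ w.2).
Definition extK (w : N') : N' := (opK aB w.1, opK aQ w.2).
Definition extKi (w : N') : N' := (opKi aB w.1, opKi aQ w.2).

Let pair_eq (w w' : N') : w.1 = w'.1 -> w.2 = w'.2 -> w = w'.
Proof. by case: w w' => [? ?] [? ?] /= -> ->. Qed.
Let c0F x : (f (opF aB x))`_0 = 0.
Proof. by rewrite -actF (vl_f H).2 actF coefXM. Qed.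
Let c0K x : (f (opK aB x))`_0 = wtz v 0 * (f x)`_0.
Proof. by rewrite -actK (vl_f H).2 actK coef_pK. Qed.
Let c0Ki x : (f (opKi aB x))`_0 = (wtz v 0)^-1 * (f x)`_0.
Proof. by rewrite -actKi (vl_f H).2 actKi coef_pKi. Qed.

Fact extE_lin : linear extE.
Proof.
move=> c x y; apply: pair_eq => /=; first exact: opE_lin.
rewrite (opE_lin aQ) fl coefD coefZ mulrDr scalerDl scalerDr addrACA; congr (_ + (_ + _)).
by rewrite scalerA mulrCA.
Qed.
Fact extF_lin : linear extF.
Proof. by move=> c x y; apply: pair_eq => /=; exact: opF_lin. Qed.
Fact extK_lin : linear extK.
Proof. by move=> c x y; apply: pair_eq => /=; exact: opK_lin. Qed.
Fact extKi_lin : linear extKi.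
Proof. by move=> c x y; apply: pair_eq => /=; exact: opKi_lin. Qed.
Fact extKKi w : extK (extKi w) = w.
Proof. by apply: pair_eq; rewrite /= opKKi. Qed.
Fact extKiK w : extKi (extK w) = w.
Proof. by apply: pair_eq; rewrite /= opKiK. Qed.
Fact extKE w : extK (extE (extKi w)) = q ^+ 2 *: extE w.
Proof.
apply: pair_eq; first exact: opKE.
rewrite /extK /extE /extKi /= (linD (opK_lin aQ)) opKE scalerDr (linZ (opK_lin aQ)) low_K.
congr (_ + _); rewrite !scalerA c0Ki wtzV mulr0 addr0; congr (_ *: _).
have := mulrV (fpsT_unit F); move: (fpsT F) (fpsT F)^-1 ((f w.1)`_0) => t t' c tt.
have -> : fpsC (qv v) ^+ 2 = q ^ 2 by [].
rewrite [X in _ * (t * X)](q1 vR).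
transitivity (t * t' * (q ^ 2 * (t * c))); first by qmono.
by rewrite tt mul1r.
Qed.
Fact extKF w : extK (extF (extKi w)) = q ^- 2 *: extF w.
Proof. by apply: pair_eq; rewrite /= opKF. Qed.
Fact extEF w : extE (extF w) - extF (extE w) = h *: (extK w - extKi w).
Proof.
apply: pair_eq; first exact: opEF.
rewrite /extF /extE /= c0F mulr0 scale0r addr0 (linD (opF_lin aQ)) (linZ (opF_lin aQ)).
by rewrite low_F scaler0 addr0 opEF.
Qed.
Definition ext_act : uaction vR N' :=
  UAction extE_lin extF_lin extK_lin extKi_lin extKKi extKiK extKE extKF extEF.

Lemma ext_act1 u w : (act ext_act u w).1 = act aB u w.1.
Proof.
elim/gen_ind: u w => [w|w|w|w|c w|u u' e e' w|u u' e e' w].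
- by rewrite !actE. - by rewrite !actF. - by rewrite !actK. - by rewrite !actKi.
- by rewrite !actC. - by rewrite !actD /= e e'.
by rewrite !actM e e'.
Qed.
Lemma ext_act2 u p : act ext_act u (0, p) = (0, act aQ u p).
Proof.
elim/gen_ind: u p => [p|p|p|p|c p|u u' e e' p|u u' e e' p].
- rewrite !actE; apply: pair_eq; first exact: lin0 (opE_lin aB).
  by rewrite /opE /= (lin0 fl) coef0 mulr0 scale0r addr0.
- by rewrite !actF; apply: pair_eq => //; exact: lin0 (opF_lin aB).
- by rewrite !actK; apply: pair_eq => //; exact: lin0 (opK_lin aB).
- by rewrite !actKi; apply: pair_eq => //; exact: lin0 (opKi_lin aB).
- by rewrite !actC; apply: pair_eq => //; exact: scaler0.
- by rewrite !actD e e'; apply: pair_eq => //; exact: addr0.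
by rewrite !actM e' e.
Qed.

(* The projection of M_F on M along the span of the F^i x0, i < 0. *)
Definition ppos (y : lloc M) : lbase M :=
  xget 0 [set x | forall k, (f x)`_k = cz f y (Posz k)]%classic.
Lemma pposE y k : (f (ppos y))`_k = cz f y (Posz k).
Proof.
rewrite /ppos; case: xgetP => [x _|]; first exact.
have [N [x e]] := zz_span H y.
case/(_ x) => l; rewrite {1}e (czD H) (cz_sum H) (cz_linj H) big1 ?addr0 // => i _.
by rewrite (czZ H) (cz_zz H) mulr0.
Qed.
Lemma ppos_j x : ppos (j x) = x.
Proof. by apply: (f_inj H) => i; rewrite pposE (cz_linj H). Qed.

Definition phihat (x : lloc M) (w : N') : R := phi (ppos x) w.1 + phiQ x w.2.

(** [ppos] commutes with E and K, but its failure to commute with F is the coefficient of F^-1 x0;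
    the term added in [extE] compensates exactly for it. *)
Lemma phihat_pairing : pairing aL ext_act phihat.
Proof.
have fE x : f (opE aB x) = pE v (f x) by rewrite -actE (vl_f H).2 actE.
have fF x : f (opF aB x) = 'X * f x by rewrite -actF (vl_f H).2 actF.
have fK x : f (opK aB x) = pK v (f x) by rewrite -actK (vl_f H).2 actK.
have pl c x y : ppos (c *: x + y) = c *: ppos x + ppos y.
  apply: (f_inj H) => i; rewrite fl coefD coefZ !pposE (czD H) (czZ H) //.
have pE' x : ppos (opE aL x) = opE aB (ppos x).
  apply: (f_inj H) => i; rewrite fE coef_pE !pposE (cz_E H).
  by have -> : i%:Z + 1 = i.+1%:Z by lia.
have pK' x : ppos (opK aL x) = opK aB (ppos x).
  by apply: (f_inj H) => i; rewrite fK coef_pK !pposE (cz_K H).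
have pF' x : ppos (opF aL x) = cz f x (Negz 0) *: x0 + opF aB (ppos x).
  apply: (f_inj H) => i; rewrite fl coefD coefZ (vl_f0 H) coef1 fF coefXM pposE (cz_F H).
  case: i => [|i] /=; first by rewrite mulr1 addr0; congr (cz _ _ _).
  by rewrite mulr0 add0r pposE; congr (cz _ _ _); lia.
split=> [w c x x'|x c w w'|x w|x w|x w]; rewrite /phihat.
- by rewrite pl (pair_linl pc) (pair_linl pQ) mulrDr addrACA.
- by rewrite (pair_linr pc) (pair_linr pQ) mulrDr addrACA.
- by rewrite pE' (pairE pc) (pairE pQ) mulrDr.
- have -> : opKi ext_act (opE ext_act w) = (opKi aB (opE aB w.1),
      opKi aQ (opE aQ w.2 + (T * (f w.1)`_0) *: pr z)) by [].
  have phz : phF x z = cz f x (Negz 0) * phi x0 x0.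
    rewrite (@phiFE _ _ M x0 f phi 1 x z) => [|[|k] _] //; last by rewrite (cz_zz H) mulr0.
    by rewrite big_ord_recl big_ord0 (cz_zz H) eqxx mulr1 addr0 mulrC.
  (* The weight of z contributes (T q)^-1, which cancels the factor T of the extension against the
     factor q of invariance. *)
  have key : q * phiQ x (opKi aQ ((T * (f w.1)`_0) *: pr z)) =
      cz f x (Negz 0) * phi x0 w.1.
    have Tu : T * q \is a GRing.unit by rewrite unitrM fpsT_unit qv_unit.
    rewrite (linZ (opKi_lin aQ)) (wt_Ki Tu low_K) !(pairZr pQ) phiQE phz (phi_x0 H pc w.1).
    have := mulrV Tu; move: (T * q)^-1 => t' tt.
    move: (f w.1)`_0 (cz _ _ _) (phi _ _) => a b c.
    transitivity (T * q * t' * (b * (a * c))); last by rewrite tt mul1r.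
    by ring.
  rewrite /fst /snd (linD (opKi_lin aQ)) (pairDr pQ) !mulrDr key.
  by rewrite pF' (pair_linl pc) (pairF pc) (pairF pQ) addrA addrC -!addrA.
by rewrite pK' (pairK pc) (pairK pQ).
Qed.

Section ProjTens.
Variable n : nat.
Local Notation En := (Fmod vR n).
Local Notation X := (tens_loc M n).
Local Notation jt := (@linj _ _ X).
Local Notation prt := (@lproj _ _ X).

Lemma prt_lin : linear prt.
Proof. by move=> c x y; apply/ffunP => i; rewrite !ffunE prl. Qed.
Lemma prt_pure x e : prt (tpure x e) = tpure (pr x) e.
Proof. by apply/ffunP => i; rewrite !ffunE (linZ prl). Qed.
Lemma prt_uhom : uhom (aloc X) (aquo X) prt.
Proof.
apply: uhom_gen; first exact: prt_lin.
- apply: tens_ext; [exact: lin_comp prt_lin (opE_lin _)|exact: lin_comp (opE_lin _) prt_lin|].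
  by move=> x e; rewrite tensE_pure (linD prt_lin) !prt_pure tensE_pure prE prK.
- apply: tens_ext; [exact: lin_comp prt_lin (opF_lin _)|exact: lin_comp (opF_lin _) prt_lin|].
  by move=> x e; rewrite tensF_pure (linD prt_lin) !prt_pure tensF_pure prF.
apply: tens_ext; [exact: lin_comp prt_lin (opK_lin _)|exact: lin_comp (opK_lin _) prt_lin|].
by move=> x e; rewrite tensK_pure !prt_pure tensK_pure prK.
Qed.
Lemma prt_surj z : exists y, prt y = z.
Proof.
by exists [ffun i => sec (z i)]; apply/ffunP => i; rewrite !ffunE secK.
Qed.
Lemma prt_ker y : prt y = 0 -> exists x, y = jt x.
Proof.
move=> y0; have e i : exists x, y i = j x.
  by apply/pr_ker; have /ffunP/(_ i) := y0; rewrite !ffunE.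
exists [ffun i => sval (cid (e i))]; apply/ffunP => i; rewrite !ffunE.
exact: svalP (cid (e i)).
Qed.
End ProjTens.

Lemma tmap_idr (B C : lmodType R) d (g : B -> C) (w : {ffun 'I_d -> B}) i :
  tmap g id w i = g (w i).
Proof.
rewrite /tmap sum_ffunE (bigD1 i) //= big1 => [|k ki].
  by rewrite !ffunE !mxE !eqxx scale1r addr0.
by rewrite !ffunE !mxE eq_sym (negPf ki) scale0r.
Qed.

Lemma pr_Fi_qbr x : pr (Fi (qbr 1 aL (j x))) = (qT v 0 * (f x)`_0) *: pr z.
Proof.
apply/eqP; rewrite -subr_eq0 -(linZ prl) -(linB prl); apply/eqP/pr_ker.
apply: (cz_mem H) => k; rewrite (czB H) (czZ H) (cz_zz H) (cz_Fi H) /qbr.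
rewrite (czZ H) (czB H) !(czZ H) (cz_K H) (cz_Ki H); case: k => [|k].
  rewrite eqxx mulr1 (_ : Negz 0 + 1 = Posz 0) // (cz_linj H) wtzV /wtz qTE.
  rewrite mulr0 addr0 subr0; apply/eqP; rewrite subr_eq0; apply/eqP.
  rewrite expr0z; move: T (T^-1) (f x)`_0 => t t' c.
  transitivity (h * (q ^ 1 * q ^ (-1) * t - q ^ (-1) * q ^ 1 * t') * c); first by ring.
  by rewrite !qD.
rewrite (_ : Negz k.+1 + 1 = Negz k) ?(cz_linjN H) ?mulr0 ?subrr ?mulr0 ?subr0 //.
by lia.
Qed.

Variables m n : nat.
Variable beta : {ffun 'I_n.+1 -> 'cV[R]_m.+1} -> Uq vR.
Hypothesis hb : uhom (FFmod vR m n) (adjoint vR) beta.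
Local Notation Em := (Fmod vR m).
Local Notation En := (Fmod vR n).
Local Notation X := (tens_loc M m).
Local Notation Y := (tens_loc M n).
Local Notation tN := (tens ext_act En).

Let p1 (w : {ffun 'I_n.+1 -> N'}) : lbase Y := [ffun i => (w i).1].
Let p2 (w : {ffun 'I_n.+1 -> N'}) : lquo Y := [ffun i => (w i).2].
Let dl (y : lbase Y) : lquo Y := [ffun i => (T * (f (y i))`_0) *: pr z].
Let p1_lin : linear p1. Proof. by move=> c x y; apply/ffunP => i; rewrite !ffunE. Qed.
Let p2_lin : linear p2. Proof. by move=> c x y; apply/ffunP => i; rewrite !ffunE. Qed.
Let dl_lin : linear dl.
Proof.
move=> c x y; apply/ffunP => i; rewrite !ffunE fl coefD coefZ scalerA -scalerDl.
by congr (_ *: _); ring.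
Qed.
Let p1_pure x e : p1 (tpure x e) = tpure x.1 e.
Proof. by apply/ffunP => i; rewrite !ffunE. Qed.
Let p2_pure x e : p2 (tpure x e) = tpure x.2 e.
Proof. by apply/ffunP => i; rewrite !ffunE. Qed.
Let p1E w : p1 (opE tN w) = opE (abase Y) (p1 w).
Proof.
move: w; apply: tens_ext; [exact: lin_comp p1_lin (opE_lin _)|exact: lin_comp (opE_lin _) p1_lin|].
by move=> x e; rewrite tensE_pure (linD p1_lin) !p1_pure tensE_pure.
Qed.
Let p2E w : p2 (opE tN w) = opE (aquo Y) (p2 w) + dl (p1 w).
Proof.
move: w; apply: tens_ext.
- exact: lin_comp p2_lin (opE_lin _).
- by apply: lin_add; [exact: lin_comp (opE_lin _) p2_lin|exact: lin_comp dl_lin p1_lin].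
move=> x e; rewrite tensE_pure (linD p2_lin) !p2_pure tensE_pure p1_pure.
rewrite [(opE ext_act x).2]/= [(opK ext_act x).2]/= tpureDl addrAC; congr (_ + _ + _).
apply/ffunP => i; rewrite !ffunE (linZ fl) coefZ !scalerA; congr (_ *: _); ring.
Qed.
Let p1Ki w : p1 (opKi tN w) = opKi (abase Y) (p1 w).
Proof.
move: w; apply: tens_ext; [exact: lin_comp p1_lin (opKi_lin _)|exact: lin_comp (opKi_lin _) p1_lin|].
by move=> x e; rewrite tensKi_pure !p1_pure tensKi_pure.
Qed.
Let p2Ki w : p2 (opKi tN w) = opKi (aquo Y) (p2 w).
Proof.
move: w; apply: tens_ext; [exact: lin_comp p2_lin (opKi_lin _)|exact: lin_comp (opKi_lin _) p2_lin|].
by move=> x e; rewrite tensKi_pure !p2_pure tensKi_pure.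
Qed.

Let phihat_j x w : phihat (j x) w = phi x w.1.
Proof. by rewrite /phihat ppos_j /phiQ (phiF_linjl H) addr0. Qed.

(** Only the normalization needs an idea. One finds [bt] in N' (x) F_n lying over [T; 0] y, with E
    bt equal to T [T; l] times the class of y' = F^-1 y. Since x = F x', the value [T; 0] chi(x, y)
    is the pairing of F x' with [bt]; moving F across makes it the required multiple of chi_F(x',
    y'). *)
Lemma beta_lift : is_lift (X := X) (Y := Y) (pair_beta aB phi beta) (pair_beta aL phF beta).
Proof.
have pcF := pair_beta_pairing pF hb.
have tFK := tF_K qRn FK KF (n := n).
split.
- by split=> [*|*|*]; rewrite ?(pair_linl pcF) ?(pair_linr pcF) ?(pair_act pcF).
- move=> x y; rewrite /pair_beta big1 // => i _; rewrite big1 // => k _.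
  by rewrite ffunE (phiF_linjl H).
- move=> x y; rewrite /pair_beta big1 // => i _; rewrite big1 // => k _.
  by rewrite ffunE -(vl_j H).2 (phiF_linjr H).
move=> l x y x' y' Kx Ky Ex Ey Fx Fy.
have jh := jt_uhom H n; have jtl : linear (@linj _ _ Y) := jt_lin H (n := n).
have y'E : y' = tFinv vR Fi (linj y : lloc Y) by rewrite -Fy tFK.
have Kj : opK (aloc Y) (linj y) = (T * q ^ (l - 1)) *: linj y.
  by rewrite -actK -jh.2 actK Ky (linZ jtl).
have Ej : opE (aloc Y) (linj y) = 0 by rewrite -actE -jh.2 actE Ey (lin0 jtl).
have Ky' : opKi (aloc Y) y' = (T * q ^ (l + 1))^-1 *: y'.
  apply: wt_Ki; first exact: wtT_unit.
  have e := K_iterFi tFK (tFinvK qRn FK KF (n := n)) 1 (linj y : lloc Y).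
  rewrite y'E -[LHS]/(opK (aloc Y) (iter 1 _ _)) e Kj.
  rewrite (linZ (iter_inv_lin tFK (tFinvK qRn FK KF (n := n)) 1)) scalerA mulrCA qD.
  by congr (_ * q ^ _ *: _); lia.
pose L := liftop vR Fi (linj y : lloc Y).
have LE : opE (aloc Y) L + tmap (fun y => Fi (qbr 1 aL y)) id (linj y : lloc Y) =
    qT v l *: y'.
  have := liftop_E qRn FK KF (linj y : lloc Y).
  rewrite Ej (lin0 (liftop_lin FK KF)) subr0 => ->.
  by rewrite /qbr (wtT_br 1 Kj) subrK (linZ (tFinv_lin FK KF)) -y'E.
(* The second component is chosen so that its image under E and the extension term of [T; 0] y add
   up, by [LE], to a multiple of the class of y'. *)
pose bt : {ffun 'I_n.+1 -> N'} := [ffun i => (qT v 0 *: y i, T *: pr (L i))].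
have bt1 : p1 bt = qT v 0 *: y by apply/ffunP => i; rewrite !ffunE.
have bt2 : p2 bt = T *: lproj (L : lloc Y) by apply/ffunP => i; rewrite !ffunE.
have prh := prt_uhom n; have prtl := prt_lin (n := n).
have E1 : p1 (opE tN bt) = 0 by rewrite p1E bt1 (linZ (opE_lin _)) Ey scaler0.
have E2 : p2 (opE tN bt) = (T * qT v l) *: lproj (y' : lloc Y).
  rewrite p2E bt1 bt2 (linZ (opE_lin _)) -actE -prh.2 actE.
  rewrite -[RHS]scalerA -(linZ prtl (qT v l)) -LE [X in _ = _ *: X](linD prtl) [RHS]scalerDr; congr (_ + _).
  apply/ffunP => i; rewrite !ffunE tmap_idr ffunE pr_Fi_qbr (linZ fl) coefZ scalerA.
  by [].
pose w := opKi tN (opE tN bt).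
have w1 : p1 w = 0 by rewrite p1Ki E1 (lin0 (opKi_lin _)).
have w2 : p2 w = lproj ((qT v l * q ^ (- (l + 1))) *: y' : lloc Y).
  rewrite p2Ki E2 (linZ (opKi_lin _)) -actKi -prh.2 actKi Ky' !(linZ prtl) scalerA.
  rewrite wtT_inv; congr (_ *: _); have := mulrV (fpsT_unit F).
  move: (fpsT F) (fpsT F)^-1 => t t' tt.
  transitivity (t * t' * (qT v l * q ^ (- (l + 1)))); first by ring.
  by rewrite tt mul1r.
have phat := pair_beta_pairing phihat_pairing hb.
have e1 : pair_beta ext_act phihat beta (linj x : lloc X) bt =
    qT v 0 * pair_beta aB phi beta x y.
  have pcB := pair_beta_pairing pc hb.
  rewrite -(pairZr pcB) -bt1 /pair_beta; apply: eq_bigr => i _; apply: eq_bigr => k _.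
  by rewrite [linj x i]ffunE [p1 bt k]ffunE phihat_j ext_act1.
have e2 : pair_beta ext_act phihat beta x' w =
    qT v l * q ^ (- (l + 1)) * pair_beta aL phF beta x' y'.
  rewrite -(pairZr pcF) /pair_beta; apply: eq_bigr => i _; apply: eq_bigr => k _.
  have -> : w k = (0, pr (((qT v l * q ^ (- (l + 1))) *: y') k)).
    apply: pair_eq => /=; first by have /ffunP/(_ k) := w1; rewrite !ffunE.
    by have /ffunP/(_ k) := w2; rewrite !ffunE.
  by rewrite ext_act2 /phihat (pair0r pc) add0r -hpr.2 phiQE.
have : q ^ l * (q * pair_beta ext_act phihat beta x' w) =
    q ^ l * (qT v 0 * pair_beta aB phi beta x y).
  by rewrite -e1 -Fx (pairF phat).
rewrite e2 => e; rewrite -[RHS]mulrA -e.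
rewrite [X in _ * (X * _)](q1 vR); move: (pair_beta _ _ _ _ _) (qT v l) => c d.
by qmono.
Qed.
End BetaLift.

(** * Modules generated by a lowest weight vector, and their pairings *)

Section DividedNil.
Variables (S : comUnitRingType) (v : qparam S).
Local Notation q := (qv v).
Hypothesis qn : forall n, qint v n.+1 \is a GRing.unit.
Variables (A : lmodType S) (a : uaction v A).

Definition dFnil (x : A) := exists N, forall j, (N <= j)%N -> act a (dF v j) x = 0.

Lemma dFnilD x y : dFnil x -> dFnil y -> dFnil (x + y).
Proof.
move=> [N xN] [N' yN]; exists (maxn N N') => j; rewrite geq_max => /andP[j1 j2].
by rewrite (linD (act_lin a _)) xN // yN // addr0.
Qed.
Lemma dFnilZ c x : dFnil x -> dFnil (c *: x).
Proof. by move=> [N xN]; exists N => j /xN; rewrite (linZ (act_lin a _)) => ->; rewrite scaler0. Qed.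
Lemma dFnilE x : dFnil x -> dFnil (opE a x).
Proof.
move=> [N xN]; exists N.+1 => -[//|j] jN.
have := E_dF a qn j x; rewrite (linB (act_lin a (dF v j))).
rewrite !(linZ (act_lin a (dF v j))) xN ?(lin0 (opE_lin a)) ?leqW //.
have -> : act a (dF v j) (opK a x) = 0.
  by apply: (scalerI_unit (qX_unit v (- (2 * j)%:Z))); rewrite -K_dF // xN // (lin0 (opK_lin a)) scaler0.
have -> : act a (dF v j) (opKi a x) = 0.
  by apply: (scalerI_unit (qX_unit v (2 * j)%:Z)); rewrite -Ki_dF // xN // (lin0 (opKi_lin a)) scaler0.
by rewrite !scaler0 subrr scaler0 addr0.
Qed.

Lemma Fmod_dF0 n j e : (n < j)%N -> act (Fmod v n) (dF v j) e = 0.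
Proof.
move=> nj; elim/cV_ind: e => [x y ex ey||c k kn].
- by rewrite (linD (act_lin _ _)) ex ey addr0.
- exact: lin0 (act_lin _ _).
by rewrite (linZ (act_lin _ _)) act_dF_u // ubas_gt ?scaler0 // (leq_trans nj) ?leq_addl.
Qed.

Lemma low_dF z j : opF a z = 0 -> act a (dF v j.+1) z = 0.
Proof. by move=> Fz; apply: (scalerI_unit (qn j)); rewrite -dF_F // Fz (lin0 (act_lin a _)) scaler0. Qed.

Lemma low_tens_dF n z j e : opF a z = 0 ->
  act (tens a (Fmod v n)) (dF v j) (tpure z e) = tpure z (act (Fmod v n) (dF v j) e).
Proof.
move=> Fz; elim: j => [|j IH]; first by rewrite !dFa0.
apply: (scalerI_unit (qn j)); rewrite -F_dF // IH tensF_pure Fz tpure0l add0r.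
by rewrite F_dF // tpureZr.
Qed.
End DividedNil.

Section Pullback.
Variables (S : comUnitRingType) (v : qparam S).
Variables (A B A' B' : lmodType S) (a : uaction v A) (b : uaction v B).
Variables (a' : uaction v A') (b' : uaction v B').

Lemma pairing_pullback chi (f : A -> A') (g : B -> B') : pairing a' b' chi ->
  linear f -> linear g ->
  (forall x, f (opE a x) = opE a' (f x)) -> (forall x, f (opF a x) = opF a' (f x)) ->
  (forall x, f (opK a x) = opK a' (f x)) ->
  (forall x, g (opE b x) = opE b' (g x)) -> (forall x, g (opF b x) = opF b' (g x)) ->
  (forall x, g (opK b x) = opK b' (g x)) ->
  pairing a b (fun x y => chi (f x) (g y)).
Proof.
move=> pc lf lg fE fF fK gE gF gK.
have gKi x : g (opKi b x) = opKi b' (g x) by rewrite -{2}[x](opKKi b) gK opKiK.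
split=> [y c x x'|x c y y'|x y|x y|x y].
- by rewrite lf (pair_linl pc).
- by rewrite lg (pair_linr pc).
- by rewrite fE (pairE pc) gK gF.
- by rewrite fF (pairF pc) gKi gE.
by rewrite fK (pairK pc) gK.
Qed.

Lemma pairing_sub (c1 c2 : A -> B -> S) : pairing a b c1 -> pairing a b c2 ->
  pairing a b (fun x y => c1 x y - c2 x y).
Proof.
move=> p1 p2; split=> [y c x x'|x c y y'|x y|x y|x y].
- by rewrite (pair_linl p1) (pair_linl p2) mulrBr opprD addrACA.
- by rewrite (pair_linr p1) (pair_linr p2) mulrBr opprD addrACA.
- by rewrite (pairE p1) (pairE p2) mulrBr.
- by rewrite (pairF p1) (pairF p2) mulrBr.
by rewrite (pairK p1) (pairK p2).
Qed.
End Pullback.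

(* Modules generated under E by a vector z killed by F, and their products with
   F_m. *)
Section LowGenerated.
Variables (S : comUnitRingType) (v : qparam S).
Local Notation q := (qv v).
Hypothesis qn : forall n, qint v n.+1 \is a GRing.unit.
Variables (A : lmodType S) (a : uaction v A) (z : A) (c : S).
Hypotheses (cu : c \is a GRing.unit) (Fz : opF a z = 0) (Kz : opK a z = c *: z).
Hypothesis gen : forall P : A -> Prop, (forall x y, P x -> P y -> P (x + y)) ->
  (forall d x, P x -> P (d *: x)) -> P z -> (forall x, P x -> P (opE a x)) ->
  forall x, P x.
Local Notation TT n := (tens a (Fmod v n)).
Local Notation TW n := (twist (@Tminus1 S v) (TT n)).
Local Notation u n k := (@ubas S n k).

(** Induction on [k]: E (x (x) u_k) is E x (x) u_k plus a term in u_(k-1), so E x (x) u_k is reached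
    from smaller indices. *)
Lemma low_tens_ind n (P : {ffun 'I_n.+1 -> A} -> Prop) :
  (forall x y, P x -> P y -> P (x + y)) -> (forall d x, P x -> P (d *: x)) ->
  (forall k, P (tpure z (u n k))) -> (forall x, P x -> P (opE (TT n) x)) ->
  forall w, P w.
Proof.
move=> PD PZ Pu PE.
have key k x : P (tpure x (u n k)).
  elim: k x => [|k IH].
    apply: gen => [x y|d x||x Px]; rewrite ?tpureDl ?tpureZl; [exact: PD|exact: PZ|exact: Pu|].
    by have := PE _ Px; rewrite tensE_pure opE0 tpure0r addr0.
  apply: gen => [x y|d x||x Px]; rewrite ?tpureDl ?tpureZl; [exact: PD|exact: PZ|exact: Pu|].
  have -> : tpure (opE a x) (u n k.+1) = opE (TT n) (tpure x (u n k.+1)) +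
      (-1) *: tpure (opK a x) (opE (Fmod v n) (u n k.+1)).
    by rewrite tensE_pure scaleN1r addrK.
  apply: (PD); first exact: PE; apply: (PZ).
  have [kn|nk] := ltnP k n; first by rewrite opES // tpureZr; exact/PZ/IH.
  rewrite (@ubas_gt _ n k.+1) // (lin0 (opE_lin _)) -(scale0r (u n k)) tpureZr.
  exact/PZ/IH.
move=> w; rewrite [w]tpure_sum; elim/big_ind: _ => [||i _].
- by rewrite -(scale0r (tpure z (u n 0))); exact/PZ/Pu.
- exact: PD.
by rewrite -ubas_delta; exact: key.
Qed.

Lemma low_Fnil : Fnil a.
Proof.
apply: gen => [x y|d x||x]; [exact: dFnilD|exact: dFnilZ| |exact: dFnilE].
by exists 1%N => -[//|j] _; exact: low_dF.
Qed.
Lemma low_tens_Fnil n : Fnil (TT n).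
Proof.
apply: low_tens_ind => [x y|d x|k|x]; [exact: dFnilD|exact: dFnilZ| |exact: dFnilE].
by exists n.+1 => j nj; rewrite low_tens_dF // Fmod_dF0 // tpure0r.
Qed.

(** Invariance under the T'_-1-twist turns E in one argument into F in the other, and F maps z (x)
    u_l to a multiple of z (x) u_(l+1). So the difference vanishes by induction on the first
    argument, then on the second. *)
Lemma low_pairing_eq m n c1 c2 : pairing (TW m) (TW n) c1 -> pairing (TW m) (TW n) c2 ->
  (forall k l, c1 (tpure z (u m k)) (tpure z (u n l)) =
               c2 (tpure z (u m k)) (tpure z (u n l))) ->
  forall x y, c1 x y = c2 x y.
Proof.
move=> p1 p2 e12; have pD := pairing_sub p1 p2; pose D x y := c1 x y - c2 x y.
rewrite -/D in pD.
have D1 x y : D (opE (TT m) (opK (TT m) x)) y = q * D x (opF (TT n) y).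
  have := pairF pD x y; rewrite twistTF twistTKi twistTE (linN (opK_lin _)) opKKi.
  by rewrite (pairNl pD) (pairNr pD) mulrN => /oppr_inj.
have D2 x y : D (opKi (TT m) (opF (TT m) x)) y =
    q * D x (opKi (TT n) (opE (TT n) (opK (TT n) y))).
  have := pairE pD x y; rewrite twistTE twistTK twistTF (linN (opKi_lin _)).
  by rewrite (pairNl pD) (pairNr pD) mulrN => /oppr_inj.
have D3 x y : D (opKi (TT m) x) y = D x (opKi (TT n) y).
  by have := pairK pD x y; rewrite !twistTK.
have Kiz : opKi a z = c^-1 *: z by exact: wt_Ki.
have s1 x l : D x (tpure z (u n l)) = 0.
  move: x l; apply: low_tens_ind => [x y Dx Dy l|d x Dx l|k l|x Dx l].
  - by rewrite (pairDl pD) Dx Dy addr0.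
  - by rewrite (pairZl pD) Dx mulr0.
  - by rewrite /D e12 subrr.
  rewrite -[x](opKKi (TT m)) D1 tensF_pure Fz tpure0l add0r opFu tpureZr.
  rewrite (pairZr pD) D3 tensKi_pure Kiz opKiu tpureZl tpureZr !(pairZr pD) Dx.
  by rewrite !mulr0.
have s2 y : forall x, D x y = 0.
  move: y; apply: low_tens_ind => [y y' Dy Dy' x|d y Dy x|k x|y Dy x].
  - by rewrite (pairDr pD) Dy Dy' addr0.
  - by rewrite (pairZr pD) Dy mulr0.
  - exact: s1.
  have := D2 x y; rewrite Dy Ki_E opKiK (pairZr pD) => e.
  have qu : q * q ^ (-2) \is a GRing.unit by rewrite unitrM qv_unit qX_unit.
  by apply: (mulrI qu); rewrite -mulrA -e mulr0.
by move=> x y; apply/eqP; rewrite -subr_eq0; apply/eqP; exact: s2.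
Qed.

(* [braid] is surjective. *)
Lemma braid_surj n w : exists w', braid a (Fmod v n) (@braidFm S v n) n.+1 w' = w.
Proof.
have lB := @braid_lin _ _ _ _ a (Fmod v n) (@braidFm S v n) n.+1.
pose im w := exists w', braid a (Fmod v n) (@braidFm S v n) n.+1 w' = w.
have iD x y : im x -> im y -> im (x + y).
  by move=> [x' <-] [y' <-]; exists (x' + y'); rewrite (linD lB).
have iZ d x : im x -> im (d *: x) by move=> [x' <-]; exists (d *: x'); rewrite (linZ lB).
have i0 : im 0 by exists 0; rewrite (lin0 lB).
have iS (I : Type) (r : seq I) (P : pred I) (f : I -> _) :
  (forall i, im (f i)) -> im (\sum_(i <- r | P i) f i) by move=> fi; elim/big_ind: _.
have key k x : (k <= n)%N -> im (tpure x (braidFm v (u n k))).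
  elim/ltn_ind: k x => k IH x kn.
  (* Triangularity: the term of index 0 is the wanted vector, and the other terms only involve u_i
     with i < k. *)
  have -> : tpure x (braidFm v (u n k)) =
      braid a (Fmod v n) (@braidFm S v n) n.+1 (tpure x (u n k)) +
      (-1) *: \sum_(j < n.+1) cJ v j.+1 *: tpure (act a (dF v j.+1) x)
        (braidFm v (act (Fmod v n) (dE v j.+1) (u n k))).
    rewrite braid_pure; last exact: braidFm_lin.
    by rewrite big_ord_recl cJ0 dFa0 dEa0 scale1r scaleN1r addrK.
  apply: iD; first by exists (tpure x (u n k)).
  apply/iZ/iS => j; apply: (iZ); have [jk|kj] := ltnP j k; last first.
    by rewrite act_dE_u0 // (lin0 (@braidFm_lin S v n)) tpure0r.
  rewrite act_dE_u // (linZ (@braidFm_lin S v n)) tpureZr; apply/iZ/IH; lia.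
rewrite -[w]/(id w) -/(im (id w)) [id w]tpure_sum; apply: iS => i.
have ti : tau v n (n - i) \is a GRing.unit by rewrite unitrM unitrX ?unitrN1 // qX_unit.
have ilt : (i <= n)%N by rewrite -ltnS.
have -> : tpure (w i) (delta_mx i 0) =
    (tau v n (n - i))^-1 *: tpure (w i) (braidFm v (u n (n - i))).
  rewrite braidFm_u ?leq_subr // subKn // tpureZr scalerA mulVr // scale1r.
  by rewrite ubas_delta.
by apply/iZ/key; rewrite leq_subr.
Qed.
End LowGenerated.

(** * The identity for L on M_pi *)

Section BaseChangeTwists.
Variables (F : fieldType) (v : qparam F).
Local Notation vR := (qparamR v).

Let Uq_ind2 (f g : Uq v -> Uq vR) :
  (forall x y, f (x + y) = f x + f y) -> (forall x y, g (x + y) = g x + g y) ->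
  (forall x y, f (x * y) = f x * f y) -> (forall x y, g (x * y) = g x * g y) ->
  (forall c, f c%:A = g c%:A) -> f (gE v) = g (gE v) -> f (gF v) = g (gF v) ->
  f (gK v) = g (gK v) -> f (gKi v) = g (gKi v) -> f =1 g.
Proof.
move=> fD gD fM gM fC fE fF fK fKi; apply: gen_ind => // x y ex ey.
  by rewrite fD gD ex ey.
by rewrite fM gM ex ey.
Qed.

Lemma bc_rho1 (u : Uq v) : rho1 (bc u) = bc (rho1 u).
Proof.
have [bE bF bK bKi] := bc_gens v; have [rE rF rK rKi] := rho1_gens v.
have [rE' rF' rK' rKi'] := rho1_gens vR.
move: u; apply: Uq_ind2 => [x y|x y|x y|x y|c||||].
- by rewrite bcD rmorphD.
- by rewrite rmorphD bcD.
- by rewrite bcM rmorphM.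
- by rewrite rmorphM bcM.
- by rewrite linearZ_LR !bcZ linearZ_LR rmorph1 bc1 rmorph1.
- by rewrite bE rE' rE bcZ bF rmorphN.
- by rewrite bF rF' rF bcZ bE rmorphN rmorphV ?qv_unit.
- by rewrite bK rK' rK bKi.
by rewrite bKi rKi' rKi bK.
Qed.

Lemma bc_Tminus1 (u : Uq v) : Tminus1 (bc u) = bc (Tminus1 u).
Proof.
have [bE bF bK bKi] := bc_gens v; have [rE rF rK rKi] := Tminus1_gens v.
have [rE' rF' rK' rKi'] := Tminus1_gens vR.
have bN x : bc (- x) = - bc x by rewrite -scaleN1r bcZ rmorphN1 scaleN1r.
move: u; apply: Uq_ind2 => [x y|x y|x y|x y|c||||].
- by rewrite bcD rmorphD.
- by rewrite rmorphD bcD.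
- by rewrite bcM rmorphM.
- by rewrite rmorphM bcM.
- by rewrite linearZ_LR !bcZ linearZ_LR rmorph1 bc1 rmorph1.
- by rewrite bE rE' rE bN bcM bKi bF.
- by rewrite bF rF' rF bN bcM bE bK.
- by rewrite bK rK' rK bKi.
by rewrite bKi rKi' rKi bK.
Qed.
End BaseChangeTwists.

Section Star.
Variables (F : fieldType) (v : qparam F).
Local Notation vR := (qparamR v).
Local Notation R := (fps F).
Local Notation T := (fpsT F).
Local Notation q := (qv vR).
Hypothesis qn : forall n, qint v n.+1 \is a GRing.unit.
Variables (M : locdata v) (x0 : lbase M) (f : lbase M -> {poly R}).
Variable Fi : lloc M -> lloc M.
Hypothesis H : verma_loc x0 f Fi.
Local Notation aB := (abase M).
Local Notation aL := (aloc M).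
Local Notation aQ := (aquo M).
Local Notation j := (@linj _ _ M).
Local Notation pr := (@lproj _ _ M).
Hypothesis hpr : uhom aL aQ pr.
Hypothesis pr_surj : forall z, exists y, pr y = z :> lquo M.
Hypothesis pr_ker : forall y : lloc M, pr y = 0 <-> exists x, y = j x.
Variable phi : lbase M -> lbase M -> R.
Hypothesis pc : pairing aB aB phi.
Local Notation z := (pr (zz x0 Fi (Negz 0))).
Local Notation phF := (phiF x0 f phi).
Local Notation phQ := (chi_pi phi).
Let qRn := qnR qn.
Let prl : linear pr. Proof. by case: hpr. Qed.
Let pF := phiF_pairing qn H phi.
Let Fz : opF aQ z = 0. Proof. exact: low_F H hpr pr_ker. Qed.
Let Kz : opK aQ z = (T * q) *: z. Proof. exact: low_K H hpr. Qed.
Let cu : T * q \is a GRing.unit. Proof. by rewrite unitrM fpsT_unit qv_unit. Qed.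

Lemma phQE x y : phQ (pr x) (pr y) = phF x y.
Proof.
apply: (chi_piE qn (loc_span_verma H) (loc_span_verma H) _ _ (phiF_lift qn H pc)) => //.
- by move=> x' /pr_ker.
- by move=> x' /pr_ker.
Qed.

Lemma phQ_pairing : pairing aQ aQ phQ.
Proof.
have prE y : pr (opE aL y) = opE aQ (pr y) by rewrite -!actE hpr.2.
have prF y : pr (opF aL y) = opF aQ (pr y) by rewrite -!actF hpr.2.
have prK y : pr (opK aL y) = opK aQ (pr y) by rewrite -!actK hpr.2.
have prKi y : pr (opKi aL y) = opKi aQ (pr y) by rewrite -!actKi hpr.2.
split=> [y c x x'|x c y y'|x y|x y|x y].
- have [[{}x <-] [[{}x' <-] [{}y <-]]] := (pr_surj x, (pr_surj x', pr_surj y)).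
  by rewrite -prl !phQE (pair_linl pF).
- have [[{}x <-] [[{}y' <-] [{}y <-]]] := (pr_surj x, (pr_surj y', pr_surj y)).
  by rewrite -prl !phQE (pair_linr pF).
- have [[{}x <-] [{}y <-]] := (pr_surj x, pr_surj y).
  by rewrite -prE -prF -prK !phQE (pairE pF).
- have [[{}x <-] [{}y <-]] := (pr_surj x, pr_surj y).
  by rewrite -prE -prF -prKi !phQE (pairF pF).
have [[{}x <-] [{}y <-]] := (pr_surj x, pr_surj y).
by rewrite -!prK !phQE (pairK pF).
Qed.
Let pQ := phQ_pairing.

(** E sends the class of F^i x0 to that of F^(i-1) x0 times [ez v i], which is a unit for negative
    [i]. *)
Lemma quo_gen (P : lquo M -> Prop) : (forall x y, P x -> P y -> P (x + y)) ->
  (forall d x, P x -> P (d *: x)) -> P z -> (forall x, P x -> P (opE aQ x)) ->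
  forall x, P x.
Proof.
move=> PD PZ Pz PE p; have [y <-] := pr_surj p.
have P0 : P 0 by rewrite -(scale0r z); exact: PZ.
have [N [x ->]] := zz_span H y.
have -> : pr (j x + \sum_(k < N) cz f y (Negz k) *: zz x0 Fi (Negz k)) =
    \sum_(k < N) cz f y (Negz k) *: pr (zz x0 Fi (Negz k)).
  rewrite (linD prl) (_ : pr (j x) = 0) ?add0r; last by apply/pr_ker; exists x.
  by rewrite (lin_sum prl); apply: eq_bigr => k _; rewrite (linZ prl).
elim/big_ind: _ => // k _; apply: (PZ); elim: (nat_of_ord k) => // i Pi.
have eu : ez v (Negz i) \is a GRing.unit by apply: ez_unit.
have <- : (ez v (Negz i))^-1 *: opE aQ (pr (zz x0 Fi (Negz i))) = pr (zz x0 Fi (Negz i.+1)).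
  rewrite -actE -hpr.2 actE (E_zz H) (linZ prl) scalerA mulVr // scale1r.
  by rewrite (_ : Negz i - 1 = Negz i.+1) //; lia.
by apply/PZ/PE.
Qed.

Variables m n : nat.
Local Notation W := {ffun 'I_n.+1 -> 'cV[F]_m.+1}.
Variables (b : nat -> W -> Uq v) (r : nat -> R).
Hypothesis hb : forall i, brange m n i -> is_beta v m n i (b i).
Local Notation Em := (Fmod vR m).
Local Notation En := (Fmod vR n).
Local Notation X := (tens_loc M m).
Local Notation Y := (tens_loc M n).
Local Notation beta := (betaR b r).

Lemma betaR_uhom : uhom (FFmod vR m n) (adjoint vR) beta.
Proof.
have hk k : brange m n k -> uhom (FFmod vR m n) (adjoint vR) (extR (b k)).
  by move=> /hb[h _]; exact: extR_uhom.
split=> [c x y|u x].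
  rewrite /betaR scaler_sumr -big_split; apply: eq_bigr => k bk /=.
  by rewrite (hk k bk).1 scalerDr !scalerA mulrC.
rewrite /betaR (lin_sum (act_lin _ u)); apply: eq_bigr => k bk.
by rewrite (hk k bk).2 (linZ (act_lin _ u)).
Qed.

(** By uniqueness the lift is [pair_beta] over [phiF]; on the quotient [phiF] becomes [phQ]. *)
Lemma chi_pi_beta x y :
  chi_pi (X := X) (Y := Y) (pair_beta aB phi beta) x y = pair_beta aQ phQ beta x y.
Proof.
have sX := prt_surj pr_surj (n := m); have sY := prt_surj pr_surj (n := n).
have [x' <-] := sX x; have [y' <-] := sY y.
rewrite (chi_piE qn (loc_span_tens qn H m) (loc_span_tens qn H n) _ _
  (beta_lift qn H hpr pr_surj pr_ker pc betaR_uhom)).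
- rewrite /pair_beta; apply: eq_bigr => i _; apply: eq_bigr => k _.
  by rewrite !ffunE -hpr.2 phQE.
- exact: prt_ker pr_ker _.
- exact: prt_ker pr_ker _.
- exact: prt_lin hpr _.
exact: prt_lin hpr _.
Qed.

Local Notation aT := (twist (@Tminus1 R vR) aQ).
Local Notation phT := (pairL aQ aQ phQ).
Local Notation J k := (braid aQ (Fmod vR k) (@braidFm R vR k) k.+1).

Let nilQ : Fnil aQ. Proof. exact: (low_Fnil qRn Fz (@quo_gen)). Qed.

Let J_lin k : linear (J k).
Proof. exact: braid_lin. Qed.
Let nilE k i y : (k.+1 <= i)%N -> act (Fmod vR k) (dE vR i) y = 0.
Proof. by move=> ki; apply: Fmod_dE0. Qed.
Let JT k : let TW := twist (@Tminus1 R vR) (tens aQ (Fmod vR k)) in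
  let T' := tens aT (Fmod vR k) in
  [/\ forall w, J k (opE TW w) = opE T' (J k w), forall w, J k (opF TW w) = opF T' (J k w) &
      forall w, J k (opK TW w) = opK T' (J k w)].
Proof.
have lt := @braidFm_lin R vR k.
have tE := @braidFm_E _ vR k; have tF := @braidFm_F _ vR k.
have tK := @braidFm_K _ vR k.
split=> w.
- by rewrite twistTE (linN (@J_lin k)) (braid_opF aQ qRn lt tF tK (@nilE k)) opprK.
- by rewrite twistTF (linN (@J_lin k)) (braid_opE aQ qRn lt tE tK (@nilE k)) opprK.
by rewrite twistTK (braid_opK aQ qRn lt tK).
Qed.

(** Both sides are invariant for the T'_-1-twists, so they need only agree on the z (x) u_k. There J
    is 1 (x) T''_1, and L(phi_pi) keeps only its term of index 0 because F kills z; what remains is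
    [low_betaR]. *)
Lemma pairL_beta x y : pairL (aquo X) (aquo Y) (pair_beta aQ phQ beta) x y =
  pair_beta aT phT beta (J m x) (J n y).
Proof.
have pT := pairL_pairing qRn pQ nilQ.
have nX : Fnil (tens aQ Em) := low_tens_Fnil qRn Fz (@quo_gen) (n := m).
have p1 := pairL_pairing qRn (pair_beta_pairing pQ betaR_uhom) nX.
have p2 := pair_beta_pairing pT betaR_uhom.
have [mE mF mK] := JT m; have [nE nF nK] := JT n.
have p3 := pairing_pullback p2 (@J_lin m) (@J_lin n) mE mF mK nE nF nK.
apply: (low_pairing_eq cu Fz Kz (@quo_gen) p1 p3) => k l.
have Ju i e : J i (tpure z e) = tpure z (braidFm vR e).
  rewrite braid_pure; last exact: braidFm_lin.
  rewrite big_ord_recl big1 => [|a _].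
    by rewrite cJ0 dFa0 dEa0 scale1r addr0.
  by rewrite [act _ (dF _ _) _](low_dF qRn _ Fz) tpure0l scaler0.
rewrite !Ju (pair_beta_pure pT betaR_uhom) act_twist.
rewrite (@pairLE _ _ _ _ _ _ _ pQ 1%N); last by move=> [//|i] _; exact: low_dF.
rewrite big_ord_recl big_ord0 cL0 !dFa0 mul1r addr0.
have pB := pair_beta_pairing pQ betaR_uhom.
have [km|mk] := leqP k m; last first.
  rewrite ubas_gt // tpure0r (lin0 (@braidFm_lin _ vR m)) (pair0l p1) tpure0l.
  by rewrite (lin0 betaR_uhom.1) !linear0 -(scale0r 1) actC scale0r (pair0r pQ).
have [ln|nl] := leqP l n; last first.
  rewrite (@ubas_gt _ n l) // tpure0r (lin0 (@braidFm_lin _ vR n)) (pair0r p1) tpure0r.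
  by rewrite (lin0 betaR_uhom.1) !linear0 -(scale0r 1) actC scale0r (pair0r pQ).
rewrite (@pairLE _ _ _ _ _ _ _ pB (m + n).+1); last first.
  by move=> i mi; rewrite (low_tens_dF qRn) // Fmod_dF0 ?tpure0r //; lia.
rewrite -(low_betaR qn pQ cu Kz Fz r hb (N := (m + n).+1)) //; last by lia.
apply: eq_bigr => i _; congr (_ * _).
by rewrite !(low_tens_dF qRn) // (pair_beta_pure pQ betaR_uhom).
Qed.
End Star.

(** * Passage from M_pi to M through Psi *)

Section SharpCore.
Variables (F : fieldType) (v : qparam F).
Local Notation vR := (qparamR v).
Local Notation R := (fps F).
Hypothesis qn : forall n, qint v n.+1 \is a GRing.unit.
Variables (M : locdata v) (Psi : lquo M -> lbase M).
Hypothesis HPsi : twisted_iso Psi.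
Local Notation aB := (abase M).
Local Notation aQ := (aquo M).
Local Notation J k := (braid aQ (Fmod vR k) (@braidFm R vR k) k.+1).

Let PD x y : Psi (x + y) = Psi x + Psi y. Proof. by case: HPsi. Qed.
Let P0 : Psi 0 = 0. Proof. by apply: (addrI (Psi 0)); rewrite -PD !addr0. Qed.
Let PZ c x : Psi (c *: x) = fps_s c *: Psi x.
Proof. by case: HPsi => _ _ pz _; rewrite -{1}(fps_sK c) pz. Qed.
Let Psum (I : Type) (s : seq I) (P : pred I) (g : I -> lquo M) :
  Psi (\sum_(i <- s | P i) g i) = \sum_(i <- s | P i) Psi (g i).
Proof. by apply: (big_morph Psi PD P0). Qed.

Lemma T1_braidFm m (e : 'cV[R]_m.+1) : T1 vR e = braidFm vR e.
Proof.
rewrite /T1 /braidFm /linext; apply: eq_bigr => k _.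
have km : (k <= m)%N by rewrite -ltnS.
by rewrite (T1wt_u (qnR qn) km).
Qed.

(** The matrix entries of J come from k(v), whose elements [s] fixes. *)
Lemma braidFm_dE_const m j (i l : 'I_m.+1) :
  let c := cJ vR j * braidFm vR (act (Fmod vR m) (dE vR j) (ubas m i)) l 0 in
  fps_s c = c.
Proof.
have im : (i <= m)%N by rewrite -ltnS.
rewrite /=; have [ij|ji] := leqP j i; last first.
  by rewrite (act_dE_u0 (qnR qn)) // (lin0 (@braidFm_lin _ vR m)) mxE mulr0 fps_s0.
rewrite (act_dE_u (qnR qn)) // (linZ (@braidFm_lin _ vR m)) braidFm_u; last by lia.
rewrite !mxE /ubas ifT; last by lia.
rewrite cJR (qbinR qn) (tauR v m (i - j)) mxE !fps_sM !fps_sC.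
by case: (_ && _); rewrite ?fps_s1 ?fps_s0.
Qed.

(* The coefficients are constant in T, so the semilinearity of Psi is invisible here. *)
Lemma PsibarE m (x : {ffun 'I_m.+1 -> lquo M}) :
  Psibar Psi x = [ffun l => Psi (J m x l)].
Proof.
apply/ffunP => l; rewrite ffunE /Psibar /braid !sum_ffunE.
have -> : Psi (\sum_(j < m.+2) (cJ vR j *: tmap (act aQ (dF vR j))
      (fun y => braidFm vR (act (Fmod vR m) (dE vR j) y)) x) l) =
    \sum_(j < m.+2) \sum_(i < m.+1)
      (cJ vR j * braidFm vR (act (Fmod vR m) (dE vR j) (ubas m i)) l 0) *:
        Psi (act aQ (dF vR j) (x i)).
  rewrite Psum; apply: eq_bigr => j _; rewrite ffunE /tmap sum_ffunE scaler_sumr Psum.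
  apply: eq_bigr => i _; rewrite ffunE scalerA PZ -ubas_delta.
  by rewrite braidFm_dE_const.
rewrite exchange_big; apply: eq_bigr => i _.
rewrite (fsum_nat (N := m.+2)) => [|j mj]; last first.
  rewrite (Fmod_dE0 (qnR qn)); last by lia.
  by rewrite T1_braidFm (lin0 (@braidFm_lin _ vR m)) tpure0r scaler0.
rewrite sum_ffunE; apply: eq_bigr => j _.
by rewrite !ffunE scalerA T1_braidFm.
Qed.

Hypothesis HM : verma aB (fpsT F * (qv vR)^-1).
Hypothesis Hloc : is_localization M.

Let loc_ex : exists (x0 : lbase M) f Fi, verma_loc x0 f Fi.
Proof.
have [x0 [f [Ex0 Kx0 hf f0 fs]]] := verma_coord HM.
case: Hloc => [[hj jinj] [Fi FK KF] jmem _ _].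
by exists x0, f, Fi.
Qed.
Let hpr : uhom (aloc M) aQ (@lproj _ _ M). Proof. by case: Hloc => ? ? ? []. Qed.
Let pr_surj z : exists y, lproj y = z :> lquo M.
Proof. by case: Hloc => ? ? ? [_ h] _; exact: h. Qed.
Let pr_ker (y : lloc M) : lproj y = 0 <-> exists x, y = linj x.
Proof. by case: Hloc. Qed.

Lemma Psibar_invK m (y : {ffun 'I_m.+1 -> lbase M}) : Psibar Psi (Psibar_inv Psi y) = y.
Proof.
have [x0 [f [Fi H]]] := loc_ex.
have cu : fpsT F * qv vR \is a GRing.unit by rewrite unitrM fpsT_unit qv_unit.
case: HPsi => [[P' PK KP] _ _ _].
have [w Jw] := braid_surj (qnR qn) aQ cu [ffun l => P' (y l)].
(* [braid_surj] and the bijectivity of Psi give a preimage, so [xget] does not return its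
   default. *)
rewrite /Psibar_inv; case: xgetP => // /(_ w) []; rewrite /= PsibarE.
by apply/ffunP => l; rewrite ffunE Jw ffunE KP.
Qed.

Variables m n : nat.
Variable b : nat -> {ffun 'I_n.+1 -> 'cV[F]_m.+1} -> Uq v.
Hypothesis hb : forall r, brange m n r -> is_beta v m n r (b r).
Variable r : nat -> R.

(** The source of s beta: elements of U pass through Psi at the price of T'_-1, and the scalars
    [r k] at the price of [s]. *)
Lemma betaR_Psi (i j : nat) x :
  act aB (rho1 (betaR b (fun k => fps_s (r k)) (ubas2 R m n i j))) (Psi x) =
  Psi (act aQ (Tminus1 (rho1 (betaR b r (ubas2 R m n i j)))) x).
Proof.
have aS (A : lmodType R) (a : uaction vR A) (I : Type) (s : seq I) (P : pred I)
    (g : I -> Uq vR) z :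
    act a (\sum_(k <- s | P k) g k) z = \sum_(k <- s | P k) act a (g k) z.
  apply: (big_morph (fun u => act a u z)) => [u w|]; first exact: actD.
  by rewrite -(scale0r 1) actC scale0r.
rewrite /betaR !linear_sum !aS Psum; apply: eq_bigr => k bk.
have [[bl _] _] := hb bk.
rewrite (extR_u2 i j bl) !linearZ_LR !actZ PZ; congr (_ *: _).
by rewrite /= !bc_rho1 bc_Tminus1; case: HPsi => _ _ _ ->.
Qed.

Variable phi : lbase M -> lbase M -> R.
Hypothesis Hphi : invariant_pairing aB aB phi.
Hypothesis Hcomp : forall x y, sL phi x y = phi (Psi x) (Psi y).

(** With both arguments written as images of Psibar, the claim is [s] applied to [pairL_beta], where
    [Hcomp] turns s o L(phi_pi) into phi on the images of Psi. *)
Lemma sharp_chi_beta :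
  sharp Psi (chi_beta aB (betaR b r) phi) =
  chi_beta aB (betaR b (fun i => fps_s (r i))) phi.
Proof.
have [x0 [f [Fi H]]] := loc_ex; have pc := invariant_is_pairing Hphi.
apply: funext => x; apply: funext => y.
rewrite -[in RHS](Psibar_invK x) -[in RHS](Psibar_invK y) /sharp.
move: (Psibar_inv Psi x) (Psibar_inv Psi y) => w z.
have sLE X Y chi a c :
    sL (X := X) (Y := Y) chi a c = fps_s (pairL (aquo X) (aquo Y) (chi_pi chi) a c).
  by [].
have chiE : chi_pi (X := tens_loc M m) (Y := tens_loc M n) (chi_beta aB (betaR b r) phi) =
    pair_beta aQ (chi_pi phi) (betaR b r).
  apply: funext => w'; apply: funext => z'.
  exact: (chi_pi_beta qn H hpr pr_surj pr_ker pc r hb).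
rewrite sLE chiE.
rewrite (pairL_beta qn H hpr pr_surj pr_ker pc r hb) /pair_beta !PsibarE fps_s_sum.
apply: eq_bigr => i _; rewrite fps_s_sum; apply: eq_bigr => j _.
by rewrite !ffunE act_twist betaR_Psi -Hcomp.
Qed.
End SharpCore.

Lemma expr_eq_inv (K : fieldType) (x : K) n : x != 0 -> x ^+ n = x ^- n -> x ^+ (n + n) = 1.
Proof. by move=> x0 e; rewrite exprD {1}e mulVf // expf_neq0. Qed.

(** [v] is an indeterminate, so no positive power of it is 1. *)
Lemma qint_vq (k : fieldType) n : qint (vq k) n.+1 \is a GRing.unit.
Proof.
have x0 : qv (vq k) != 0 by rewrite -unitfE qv_unit.
rewrite /qint unitrM unitrV qvB_unit andbT unitfE subr_eq0; apply/eqP.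
move/(expr_eq_inv x0); rewrite /= -tofracXn -tofrac1 => /eqP.
rewrite tofrac_eq => /eqP /(congr1 (fun p : {poly k} => size p)).
by rewrite size_polyXn size_poly1.
Qed.

Theorem theorem1p2 (k : fieldType) (char0 : [pchar k] =i pred0)
  (M : locdata (vq k))
  (HM : verma (abase M) (fpsT _ * (qv (qparamR (vq k)))^-1))
  (Hloc : is_localization M)
  (Psi : lquo M -> lbase M) (HPsi : twisted_iso Psi)
  (m n : nat)
  (b : nat -> {ffun 'I_n.+1 -> 'cV[{fraction {poly k}}]_m.+1} -> Uq (vq k))
  (Hb : forall r : nat, brange m n r -> is_beta (vq k) m n r (b r))
  (r : nat -> fps {fraction {poly k}})
  (phi : lbase M -> lbase M -> fps {fraction {poly k}})
  (Hphi : invariant_pairing (abase M) (abase M) phi)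
  (Hcomp : forall x y : lquo M, sL phi x y = phi (Psi x) (Psi y)) :
  sharp Psi (chi_beta (abase M) (betaR b r) phi) =
  chi_beta (abase M) (betaR b (fun i => fps_s (r i))) phi.
Proof. exact: (sharp_chi_beta (@qint_vq k) HPsi HM Hloc Hb r Hphi Hcomp). Qed.
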